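(* Let $\alpha>0$, $\beta>0$, $L>0$, $0<T<\infty$, $\Omega=(0,L)^2$. Suppose that the unique $\Omega$-periodic solution $\Phi$ of the MPFC equation $$\beta\,\partial_{tt}\Phi+\partial_t\Phi=\Delta\left(\Phi^3+\alpha\Phi+2\Delta\Phi+\Delta^2\Phi\right)$$ with $\partial_t\Phi(\cdot,\cdot,0)\equiv 0$ satisfies $$\Phi\in H^4(0,T;L^2(\Omega))\cap L^\infty(0,T;H^8(\Omega))\cap W^{2,\infty}(0,T;H^2(\Omega))\cap H^2(0,T;H^6(\Omega)).$$ Let $N$ be an even positive integer, $h=L/N$, $s>0$. Let $\phi^k,\psi^k$ ($k\ge 1$) be the periodic grid functions produced by the second-order convex splitting scheme stated in the context, with $\phi^0_{i,j}=\Phi(p_i,p_j,0)$, $\phi^{-1}_{i,j}=\phi^0_{i,j}$ and $\psi^0_{i,j}=0$. Define the error $$e^k_{i,j}:=\Phi(p_i,p_j,ks)-\phi^k_{i,j}.$$ Then there is a constant $C>0$, independent of $h$ and $s$, such that, provided $s$ is sufficiently small, $$\|e^k\|_2+\|\nabla_h(\Delta_h e^k)\|_2\le C\,(s^2+h^2)$$ for all $k\ge1$ with $ks\le T$.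
   Context: Grid: $p_i=(i-\tfrac12)h$, $h=L/N$. A periodic grid function is a function $\phi_{i,j}$ of $(i,j)\in\mathbb{Z}^2$ that is $N$-periodic in $i$ and in $j$; $\phi_{i,j}$ represents a value at the cell center $(p_i,p_j)$. Difference operators: $D_x\phi_{i+1/2,j}=(\phi_{i+1,j}-\phi_{i,j})/h$, $D_y\phi_{i,j+1/2}=(\phi_{i,j+1}-\phi_{i,j})/h$, $\Delta_h\phi_{i,j}=(\phi_{i+1,j}+\phi_{i-1,j}+\phi_{i,j+1}+\phi_{i,j-1}-4\phi_{i,j})/h^2$. Norms: $\|\phi\|_2^2=h^2\sum_{i,j=1}^N|\phi_{i,j}|^2$ and $\|\nabla_h\phi\|_2^2=h^2\sum_{i,j=1}^N\left(|D_x\phi_{i+1/2,j}|^2+|D_y\phi_{i,j+1/2}|^2\right)$. Scheme: given periodic grid functions $\phi^{k-1},\phi^k,\psi^k$, find periodic grid functions $\phi^{k+1},\psi^{k+1},\mu^{k+1/2}$ such that $$\beta(\psi^{k+1}-\psi^k)=s\Delta_h\mu^{k+1/2}-s\psi^{k+1/2},$$ $$\mu^{k+1/2}=\chi(\phi^{k+1},\phi^k)+\alpha\phi^{k+1/2}+2\Delta_h\hat\phi^{k+1/2}+\Delta_h^2\phi^{k+1/2},$$ $$\phi^{k+1}-\phi^k=s\psi^{k+1/2},$$ where $\phi^{k+1/2}=\frac{\phi^{k+1}+\phi^k}{2}$, $\psi^{k+1/2}=\frac{\psi^{k+1}+\psi^k}{2}$, $\hat\phi^{k+1/2}=\frac{3\phi^k-\phi^{k-1}}{2}$,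 and $\chi(\phi,\psi)=\frac{\phi^2+\psi^2}{2}\cdot\frac{\phi+\psi}{2}$ (pointwise). The scheme is uniquely solvable for every $s>0$. Sobolev spaces $H^r(\Omega)$ are those of $\Omega$-periodic functions. *)

(* Defs.v *)
From HB Require Import structures.
From mathcomp Require Import all_boot all_order all_algebra.
From mathcomp Require Import all_classical all_reals all_analysis.

Set Implicit Arguments.
Unset Strict Implicit.
Unset Printing Implicit Defensive.

Import Order.TTheory GRing.Theory Num.Theory.
Import numFieldNormedType.Exports.

Local Open Scope classical_set_scope.
Local Open Scope ring_scope.

(* Periodic Sobolev spaces on the square (0,L)^2.  An L-periodic function is
   seen, up to null sets, through its restriction to (0,L)^2; periodicity
   enters through the test functions, which are smooth and L-periodic on the
   whole plane. *)

Section Space.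
Variable R : realType.
Implicit Types (L : R) (f g theta : R -> R -> R).

Definition leb2 := (@lebesgue_measure R \x @lebesgue_measure R)%E.

Definition itv0 L : set R := `]0, L[.

Definition square L : set (R * R) := itv0 L `*` itv0 L.

Definition dx f : R -> R -> R := fun x y => derive1 (fun x' => f x' y) x.
Definition dy f : R -> R -> R := fun x y => derive1 (f x) y.
Definition laplacian f : R -> R -> R :=
  fun x y => dx (dx f) x y + dy (dy f) x y.

Fixpoint Cn (n : nat) f : Prop :=
  continuous (fun p : R * R => f p.1 p.2) /\
  if n is m.+1 then
    [/\ forall x y, derivable (fun x' => f x' y) x 1,
        forall x y, derivable (f x) y 1,
        Cn m (dx f) & Cn m (dy f)]
  else True.

Definition periodic_fun L f : Prop :=
  forall x y, f (x + L) y = f x y /\ f x (y + L) = f x y.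

Definition periodic_test L theta : Prop :=
  periodic_fun L theta /\ forall n, Cn n theta.

Definition sqL2 L f : \bar R :=
  \int[leb2]_(p in square L) (((f p.1 p.2) ^+ 2)%:E).

Definition in_L2 L f : Prop :=
  measurable_fun (square L) (fun p : R * R => f p.1 p.2) /\
  (sqL2 L f < +oo)%E.

Definition dotL2 L f g : R :=
  (\int[leb2]_(p in square L) (f p.1 p.2 * g p.1 p.2))%R.

Definition weak_dxy L (a b : nat) f g : Prop :=
  [/\ in_L2 L f, in_L2 L g &
      forall theta, periodic_test L theta ->
        dotL2 L f (iter a dx (iter b dy theta)) =
        (-1) ^+ (a + b) * dotL2 L g theta].

Definition weak_laplacian L f g : Prop :=
  [/\ in_L2 L f, in_L2 L g &
      forall theta, periodic_test L theta ->
        dotL2 L f (laplacian theta) = dotL2 L g theta].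

End Space.

(* Functions of (x, y, t), seen as functions of t in (0,T) with values in a
   space of functions of (x, y).  Because the periodic Sobolev spaces H^r are
   separable Hilbert spaces, strong measurability in t amounts to having
   jointly measurable representatives of the weak space derivatives, and
   Bochner integrals can be computed pointwise in (x, y). *)

Section SpaceTime.
Variable R : realType.
Implicit Types (L T : R) (u v : R -> R -> R -> R).

Definition cylinder L T : set (R * R * R) := square L `*` itv0 T.

Definition jointly_measurable L T u : Prop :=
  measurable_fun (cylinder L T) (fun p : R * R * R => u p.1.1 p.1.2 p.2).

Definition slice u (t : R) : R -> R -> R := fun x y => u x y t.

(* These two predicates are applied to the square of a norm: [in_L2t T n]
   says that the norm is in L^2(0,T), [in_Linft T n] that it is essentially
   bounded. *)
Definition in_L2t T (n : R -> \bar R) : Prop :=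
  (\int[@lebesgue_measure R]_(t in itv0 T) n t < +oo)%E.
Definition in_Linft T (n : R -> \bar R) : Prop :=
  exists M : R, {ae @lebesgue_measure R,
    forall t, 0 < t < T -> (n t <= M%:E)%E}.

(* u belongs to L^p(0,T; H^r), with [Lp] one of the two predicates above;
   [g a b] is the weak derivative of order a in x and b in y of u. *)
Definition Lp_Hr (Lp : R -> (R -> \bar R) -> Prop) L T (r : nat) u : Prop :=
  jointly_measurable L T u /\
  exists g : nat -> nat -> R -> R -> R -> R,
    [/\ forall a b, (a + b <= r)%N -> jointly_measurable L T (g a b),
        {ae @lebesgue_measure R, forall t, 0 < t < T ->
          forall a b, (a + b <= r)%N ->
            weak_dxy L a b (slice u t) (slice (g a b) t)} &
        Lp T (fun t => \sum_(a < r.+1) \sum_(b < r.+1 | (a + b <= r)%N)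
                          sqL2 L (slice (g a b) t))%E].

Definition time_test T (eta : R -> R) : Prop :=
  (forall n t, derivable (derive1n n eta) t 1) /\
  exists a b : R, [/\ 0 < a, b < T &
    forall t, ~~ (a <= t <= b) -> eta t = 0].

Definition weak_dt L T (j : nat) u v : Prop :=
  [/\ jointly_measurable L T u, jointly_measurable L T v,
      {ae @leb2 R, forall p, square L p ->
        (@lebesgue_measure R).-integrable (@itv0 R T) (EFin \o u p.1 p.2) /\
        (@lebesgue_measure R).-integrable (@itv0 R T) (EFin \o v p.1 p.2)} &
      forall eta, time_test T eta ->
        {ae @leb2 R, forall p, square L p ->
          (\int[@lebesgue_measure R]_(t in itv0 T)
              (u p.1 p.2 t * derive1n j eta t))%R =
          (-1) ^+ j * (\int[@lebesgue_measure R]_(t in itv0 T)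
              (v p.1 p.2 t * eta t))%R}].

(* u belongs to W^{m,p}(0,T; H^r). *)
Definition Wmp_Hr (Lp : R -> (R -> \bar R) -> Prop) L T (m r : nat) u : Prop :=
  Lp_Hr Lp L T r u /\
  forall j, (0 < j <= m)%N -> exists2 v, weak_dt L T j u v & Lp_Hr Lp L T r v.

Definition mpfc_regularity L T u : Prop :=
  [/\ Wmp_Hr in_L2t L T 4 0 u,
      Wmp_Hr in_Linft L T 0 8 u,
      Wmp_Hr in_Linft L T 2 2 u &
      Wmp_Hr in_L2t L T 2 6 u].

(* The equation holds in L^2 for almost every t, all derivatives being weak.
   Point values and the initial velocity refer to the continuous
   representative on R^2 x [0,T]. *)
Definition mpfc_solution (alpha beta L T : R) u : Prop :=
  [/\ forall t, 0 <= t <= T -> periodic_fun L (slice u t),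
      {within [set p : R * R * R | 0 <= p.2 <= T],
        continuous (fun p : R * R * R => u p.1.1 p.1.2 p.2)},
      forall x y, (u x y t - u x y 0) / t @[t --> 0^'+] --> (0 : R) &
      exists ut utt, [/\ weak_dt L T 1 u ut, weak_dt L T 2 u utt &
        {ae @lebesgue_measure R, forall t, 0 < t < T ->
          exists lap1 lap2 : R -> R -> R,
          [/\ weak_laplacian L (slice u t) lap1,
              weak_laplacian L lap1 lap2 &
              weak_laplacian L
                (fun x y => u x y t ^+ 3 + alpha * u x y t
                            + 2 * lap1 x y + lap2 x y)
                (fun x y => beta * utt x y t + ut x y t)]}]].

End SpaceTime.

Section Grid.
Variable R : realType.

(* The value of a grid function at (i, j) sits at the cell center
   (p_i, p_j). *)
Definition grid := int -> int -> R.
Implicit Types (phi psi mu : grid) (h s : R) (i j : int).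

Definition center h i : R := (i%:~R - 2^-1) * h.

Definition periodic_grid (N : nat) phi : Prop :=
  forall i j, phi (i + N%:Z) j = phi i j /\ phi i (j + N%:Z) = phi i j.

(* [gDx h phi i j] is D_x phi at (i+1/2, j), [gDy h phi i j] is D_y phi at
   (i, j+1/2). *)
Definition gDx h phi : grid := fun i j => (phi (i + 1) j - phi i j) / h.
Definition gDy h phi : grid := fun i j => (phi i (j + 1) - phi i j) / h.

Definition glap h phi : grid := fun i j =>
  (phi (i + 1) j + phi (i - 1) j + phi i (j + 1) + phi i (j - 1)
   - 4 * phi i j) / h ^+ 2.

Definition grid_norm (N : nat) h phi : R :=
  Num.sqrt (h ^+ 2 * \sum_(1 <= i < N.+1) \sum_(1 <= j < N.+1)
    `|phi i%:Z j%:Z| ^+ 2).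

Definition grid_gradnorm (N : nat) h phi : R :=
  Num.sqrt (h ^+ 2 * \sum_(1 <= i < N.+1) \sum_(1 <= j < N.+1)
    (`|gDx h phi i%:Z j%:Z| ^+ 2 + `|gDy h phi i%:Z j%:Z| ^+ 2)).

Definition gmid phi psi : grid := fun i j => (phi i j + psi i j) / 2.

Definition gchi phi psi : grid := fun i j =>
  (phi i j ^+ 2 + psi i j ^+ 2) / 2 * ((phi i j + psi i j) / 2).

Definition gextrap phi phi_prev : grid :=
  fun i j => (3 * phi i j - phi_prev i j) / 2.

Definition scheme_step (alpha beta s h : R)
    (phi_prev phi psi phi_next psi_next mu : grid) : Prop :=
  forall i j,
  [/\ beta * (psi_next i j - psi i j) =
        s * glap h mu i j - s * gmid psi_next psi i j,
      mu i j = gchi phi_next phi i j + alpha * gmid phi_next phi i j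
               + 2 * glap h (gextrap phi phi_prev) i j
               + glap h (glap h (gmid phi_next phi)) i j &
      phi_next i j - phi i j = s * gmid psi_next psi i j].

(* The predecessor of step 0 is phi^{-1} = phi^0, which is what [k.-1]
   yields for k = 0. *)
Definition scheme_sequence (alpha beta s h : R) (N : nat) (phi0 : grid)
    (phi psi : nat -> grid) : Prop :=
  [/\ forall i j, phi 0 i j = phi0 i j,
      forall i j, psi 0 i j = 0,
      forall k, periodic_grid N (phi k) /\ periodic_grid N (psi k) &
      forall k, exists2 mu, periodic_grid N mu &
        scheme_step alpha beta s h
          (phi k.-1) (phi k) (psi k) (phi k.+1) (psi k.+1) mu].

Definition sample (h : R) (u : R -> R -> R -> R) (t : R) : grid :=
  fun i j => u (center h i) (center h j) t.

End Grid.

(* Main.v *)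
(* Phi is expanded in the real orthogonal basis cas(om m x) cas(om n y),
   cas = cos + sin.  Testing the weak formulation with these functions turns
   the equation and the regularity hypotheses into ordinary differential
   equations and weighted square-summability bounds for the coefficients; an
   integrability bound on a further time derivative becomes a Holder-1/2 bound
   by a monotone function, whose increments telescope in time.

   On the grid the truncation of Phi to frequencies below N/6 is compared with
   the scheme: its cube then has frequencies below N/2, so that Parseval's
   identity is exact on the grid and bounds all consistency errors.  The
   residual of phi^{k+1} - phi^k = s psi^{k+1/2} is only of order s^2 without
   a spare factor s, hence it is summed by parts in the energy estimate.  The
   nonlinearity is controlled in the algebra norm |f|^2 + |Lap_h f|^2, in which
   the numerical solution stays bounded by the convex splitting energy law
   (with psi^k = Lap_h q^k), and discrete Gronwall concludes. *)

Require Import Defs.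
From HB Require Import structures.
From mathcomp Require Import all_boot all_order all_algebra.
From mathcomp Require Import all_classical all_reals all_analysis.
From mathcomp Require Import measurable_realfun.
From mathcomp Require Import ring lra zify.

Set Implicit Arguments.
Unset Strict Implicit.
Unset Printing Implicit Defensive.

Import Order.TTheory GRing.Theory Num.Theory.
Import numFieldNormedType.Exports.

Local Open Scope classical_set_scope.
Local Open Scope ring_scope.

(** The third and fourth time derivatives of Phi are only square integrable in space, so the
    remainders of Taylor expansions in time have no values at cell centers. This is why the scheme
    is compared with a truncated series, coefficient by coefficient. The H^8 bound makes the
    discarded tail of size h^6 in the sup norm; each discrete Laplacian costs at most a factor
    h^(-2), so that two of them still leave the required h^2. The cube is handled in the same
    spirit: its coefficients are compared with those of the cube of the truncation by Bessel's
    inequality, from a sup bound alone, and their decay is read off the equation instead of a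
    product rule. Two energies occur because they serve different ends. The convex splitting energy
    contains the quartic term and yields only boundedness of phi^k; the error is measured by a
    quadratic energy, one derivative stronger, in which the nonlinearity is a Lipschitz
    perturbation. *)

(** * The real trigonometric basis *)

Section Cas.
Variable R : realType.
Implicit Types (x y L : R) (m n : int).

Definition cas x := cos x + sin x.

Lemma cas_mul x y :
  cas x * cas y = 2^-1 * (cas (x - y) + cas (- (x - y)) + cas (x + y) - cas (- (x + y))).
Proof.
by rewrite /cas !cosN !sinN cosB sinB cosD sinD; field.
Qed.

(** Sum-to-product formula: it makes each [e1 L m] an eigenfunction of the second central
    difference, as used in [gA_tpoly]. *)
Lemma casDB x y : cas (x + y) + cas (x - y) = 2 * cos y * cas x.
Proof. by rewrite /cas cosB sinB cosD sinD; ring. Qed.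

Lemma sqr_cas_le2 x : cas x ^+ 2 <= 2.
Proof.
rewrite /cas; have := cos2Dsin2 x; have := sqr_ge0 (cos x - sin x).
by rewrite sqrrB sqrrD; lra.
Qed.

Lemma abs_cas_le x : `|cas x| <= 2.
Proof.
have := sqr_cas_le2 x; rewrite -real_normK ?num_real// => h.
rewrite leNgt; apply/negP => h2.
have : 2 * 2 <= `|cas x| ^+ 2 by rewrite expr2 ler_pM// ltW.
by lra.
Qed.

(** Differentiation reflects the argument, so a first derivative turns frequency m into -m, and only
    second derivatives act diagonally on the basis. *)
Lemma is_derive_cas x : is_derive x 1 (@cas) (cas (- x)).
Proof.
have -> : cas (- x) = - sin x + cos x by rewrite /cas cosN sinN addrC.
by rewrite /cas; apply: is_deriveD.
Qed.

Definition om L : R := 2 * pi / L.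

Definition e1 L m x := cas (om L * m%:~R * x).

Lemma e10 L x : e1 L 0 x = 1.
Proof. by rewrite /e1 mulr0 mul0r /cas cos0 sin0 addr0. Qed.

(** All four frequencies on the right are at most |m| + |n|, so products respect the degree although
    the basis is real. *)
Lemma e1_mul L m n x : e1 L m x * e1 L n x =
  2^-1 * (e1 L (m - n) x + e1 L (n - m) x + e1 L (m + n) x - e1 L (- (m + n)) x).
Proof.
rewrite /e1 cas_mul; congr (_ * (cas _ + cas _ + cas _ - cas _)).
all: by rewrite ?rmorphB ?rmorphN ?rmorphD /=; ring.
Qed.

Lemma abs_e1_le L m x : `|e1 L m x| <= 2. Proof. exact: abs_cas_le. Qed.

Lemma is_derive_e1 L m x : is_derive x 1 (e1 L m) (om L * m%:~R * e1 L (- m) x).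
Proof.
have -> : om L * m%:~R * e1 L (- m) x = cas (- (om L * m%:~R * x)) * (om L * m%:~R).
  by rewrite /e1 mulrC; congr (cas _ * _); rewrite rmorphN/=; ring.
apply: (@is_derive1_comp _ cas (fun y => om L * m%:~R * y)).
  exact: is_derive_cas.
by apply: is_derive_eq; rewrite /GRing.scale/= mulr1.
Qed.

Lemma continuous_e1 L m : continuous (e1 L m).
Proof.
move=> x; apply: differentiable_continuous; apply/derivable1_diffP.
exact: (ex_derive (is_derive := is_derive_e1 L m x)).
Qed.

Lemma e1D L m x : 0 < L -> e1 L m (x + L) = e1 L m x.
Proof.
move=> L0; rewrite /e1.
have -> : om L * m%:~R * (x + L) = om L * m%:~R * x + (pi *+ 2) *~ m.
  by rewrite /om mulrDr -mulr_natl -mulrzr; congr (_ + _); field; rewrite gt_eqF.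
move: (om L * _ * _) => z.
have P k : cas (z + pi *+ 2 *+ k) = cas z.
  by rewrite /cas (periodicn (@cosD2pi R)) (periodicn (@sinD2pi R)).
have P' k y : cas (y + pi *+ 2 *+ k) = cas y.
  by rewrite /cas (periodicn (@cosD2pi R)) (periodicn (@sinD2pi R)).
case: m => k; first by rewrite -pmulrn.
by rewrite NegzE mulrNz -pmulrn -[RHS]addr0 -(P' k.+1) addrNK addr0.
Qed.

Definition bas L m n : R -> R -> R := fun x y => e1 L m x * e1 L n y.

Lemma dx_bas k L m n : dx (fun x y => k * bas L m n x y) =
  (fun x y => (k * (om L * m%:~R)) * bas L (- m) n x y).
Proof.
apply/funext => x; apply/funext => y; rewrite /dx /bas derive1E.
have -> : (fun x' => k * (e1 L m x' * e1 L n y)) = (k * e1 L n y) \*: e1 L m.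
  by apply/funext => z; rewrite /= /GRing.scale/=; ring.
have h := @is_deriveZ _ _ _ (e1 L m) (k * e1 L n y) x 1 _ (is_derive_e1 L m x).
by rewrite (derive_val (is_derive := h)) /GRing.scale/=; ring.
Qed.

Lemma dy_bas k L m n : dy (fun x y => k * bas L m n x y) =
  (fun x y => (k * (om L * n%:~R)) * bas L m (- n) x y).
Proof.
apply/funext => x; apply/funext => y; rewrite /dy /bas derive1E.
have -> : (fun y' => k * (e1 L m x * e1 L n y')) = (k * e1 L m x) \*: e1 L n.
  by apply/funext => z; rewrite /= /GRing.scale/=; ring.
have h := @is_deriveZ _ _ _ (e1 L n) (k * e1 L m x) y 1 _ (is_derive_e1 L n y).
by rewrite (derive_val (is_derive := h)) /GRing.scale/=; ring.
Qed.

Lemma continuous_bas L m n : continuous (fun p : R * R => bas L m n p.1 p.2).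
Proof.
move=> p; apply: cvgM; (apply: continuous_comp; last exact: continuous_e1).
- exact: cvg_fst.
- exact: cvg_snd.
Qed.

Lemma Cn_bas N k L m n : Cn N (fun x y => k * bas L m n x y).
Proof.
have c k' m' n' : continuous (fun p : R * R => k' * bas L m' n' p.1 p.2).
  by move=> p; apply: cvgM; [exact: cvg_cst|exact: continuous_bas].
elim: N k m n => [|N IH] k m n /=; split => //; split.
- move=> x y; have -> : (fun x' => k * bas L m n x' y) = (k * e1 L n y) \*: e1 L m.
    by apply/funext => z; rewrite /= /GRing.scale/= /bas; ring.
  by apply: derivableZ; exact: (ex_derive (is_derive := is_derive_e1 L m x)).
- move=> x y; have -> : (fun y' => k * bas L m n x y') = (k * e1 L m x) \*: e1 L n.
    by apply/funext => z; rewrite /= /GRing.scale/= /bas; ring.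
  by apply: derivableZ; exact: (ex_derive (is_derive := is_derive_e1 L n y)).
- by rewrite dx_bas; exact: IH.
- by rewrite dy_bas; exact: IH.
Qed.

Lemma periodic_test_bas k L m n : 0 < L ->
  periodic_test L (fun x y => k * bas L m n x y).
Proof.
move=> L0; split=> [x y|N]; last exact: Cn_bas.
by rewrite /bas !e1D.
Qed.

Lemma bas1 L m n : bas L m n = (fun x y => 1 * bas L m n x y).
Proof. by apply/funext => x; apply/funext => y; rewrite mul1r. Qed.

(** Eigenvalue of minus the Laplacian on [bas L m n], see [laplacian_bas]. *)
Definition lam L m n : R := om L ^+ 2 * (m%:~R ^+ 2 + n%:~R ^+ 2).

Lemma dx2_bas k L m n : dx (dx (fun x y => k * bas L m n x y)) =
  (fun x y => (- (om L * m%:~R) ^+ 2 * k) * bas L m n x y).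
Proof.
rewrite !dx_bas opprK; apply/funext => x; apply/funext => y.
by rewrite rmorphN/=; ring.
Qed.

Lemma dy2_bas k L m n : dy (dy (fun x y => k * bas L m n x y)) =
  (fun x y => (- (om L * n%:~R) ^+ 2 * k) * bas L m n x y).
Proof.
rewrite !dy_bas opprK; apply/funext => x; apply/funext => y.
by rewrite rmorphN/=; ring.
Qed.

Lemma iter_dx_bas p k L m n : iter p.*2 (@dx R) (fun x y => k * bas L m n x y) =
  (fun x y => ((- (om L * m%:~R) ^+ 2) ^+ p * k) * bas L m n x y).
Proof.
elim: p k => [|p IH] k /=.
  by apply/funext => x; apply/funext => y; rewrite expr0 mul1r.
by rewrite IH dx2_bas; apply/funext => x; apply/funext => y; rewrite (exprS _ p) !mulrA.
Qed.

Lemma iter_dy_bas p k L m n : iter p.*2 (@dy R) (fun x y => k * bas L m n x y) =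
  (fun x y => ((- (om L * n%:~R) ^+ 2) ^+ p * k) * bas L m n x y).
Proof.
elim: p k => [|p IH] k /=.
  by apply/funext => x; apply/funext => y; rewrite expr0 mul1r.
by rewrite IH dy2_bas; apply/funext => x; apply/funext => y; rewrite (exprS _ p) !mulrA.
Qed.

Lemma laplacian_bas L m n :
  laplacian (bas L m n) = (fun x y => - lam L m n * bas L m n x y).
Proof.
apply/funext => x; apply/funext => y.
by rewrite /laplacian bas1 dx2_bas dy2_bas /lam; ring.
Qed.

Lemma abs_bas_le L m n x y : `|bas L m n x y| <= 4.
Proof.
rewrite /bas normrM; have -> : (4 : R) = 2 * 2 by ring.
by rewrite ler_pM ?abs_e1_le.
Qed.

End Cas.

(** * Square-integrable functions and Bessel's inequality *)

Section L2.
Context d (T : measurableType d) (R : realType) (mu : {measure set T -> \bar R}).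
Variables (D : set T) (mD : measurable D).
Implicit Types f g : T -> R.

Definition L2on f := measurable_fun D f /\ (\int[mu]_(x in D) (f x ^+ 2)%:E < +oo)%E.

Definition ip f g := (\int[mu]_(x in D) (f x * g x))%R.

Lemma L2on_sqr_int f : L2on f -> mu.-integrable D (EFin \o (fun x => f x ^+ 2)).
Proof.
move=> [mf lf]; apply/integrableP; split.
  by apply/measurable_EFinP; exact: measurable_funX.
by under eq_integral do rewrite /= ger0_norm ?sqr_ge0//.
Qed.

Lemma L2on_mul_int f g : L2on f -> L2on g -> mu.-integrable D (EFin \o (fun x => f x * g x)).
Proof.
move=> Lf Lg; have [mf _] := Lf; have [mg _] := Lg.
have h := integrableD mD (L2on_sqr_int Lf) (L2on_sqr_int Lg).
apply: le_integrable h => //.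
  by apply/measurable_EFinP; exact: measurable_funM.
move=> x Dx /=; rewrite lee_fin normrM [leRHS]ger0_norm ?addr_ge0 ?sqr_ge0//.
have := sqr_ge0 (`|f x| - `|g x|); rewrite sqrrB !real_normK ?num_real//.
by have := sqr_ge0 (f x); have := sqr_ge0 (g x); lra.
Qed.

Lemma L2onD f g : L2on f -> L2on g -> L2on (fun x => f x + g x).
Proof.
move=> Lf Lg; have [mf _] := Lf; have [mg _] := Lg.
split; first exact: measurable_funD.
have h := integrableD mD (L2on_sqr_int Lf) (L2on_sqr_int Lg).
have := integrableZl mD 2 h => /integrableP[_]; apply: le_lt_trans.
apply: ge0_le_integral => //.
- by move=> x _; rewrite lee_fin sqr_ge0.
- by apply/measurable_EFinP; apply: measurable_funX; exact: measurable_funD.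
- have /integrableP[h1 _] := integrableZl mD 2 h.
  exact: measurableT_comp.
move=> x Dx /=; rewrite lee_fin ger0_norm; last first.
  by rewrite mulr_ge0// addr_ge0 ?sqr_ge0.
by have := sqr_ge0 (f x - g x); rewrite sqrrB sqrrD; lra.
Qed.

Lemma L2onZ k f : L2on f -> L2on (fun x => k * f x).
Proof.
move=> Lf; have [mf _] := Lf.
split; first exact: measurable_funM.
have := integrableZl mD (k ^+ 2) (L2on_sqr_int Lf) => /integrableP[_]; apply: le_lt_trans.
apply: ge0_le_integral => //.
- by move=> x _; rewrite lee_fin sqr_ge0.
- by apply/measurable_EFinP; apply: measurable_funX; exact: measurable_funM.
- have /integrableP[h1 _] := integrableZl mD (k ^+ 2) (L2on_sqr_int Lf).
  exact: measurableT_comp.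
by move=> x Dx /=; rewrite lee_fin exprMn ler_norm.
Qed.

Lemma L2onN f : L2on f -> L2on (fun x => - f x).
Proof.
by move=> /(L2onZ (-1)); congr L2on; apply/funext => x; rewrite mulN1r.
Qed.

Lemma L2onB f g : L2on f -> L2on g -> L2on (fun x => f x - g x).
Proof. by move=> Lf /L2onN Lg; exact: L2onD. Qed.

Lemma bounded_L2on f M : (mu D < +oo)%E -> measurable_fun D f ->
  (forall x, D x -> `|f x| <= M) -> L2on f.
Proof.
move=> muD mf fM; split=> //.
apply: (@le_lt_trans _ _ (\int[mu]_(x in D) (M ^+ 2)%:E)%E).
  apply: ge0_le_integral => //.
  - by move=> x _; rewrite lee_fin sqr_ge0.
  - by apply/measurable_EFinP; exact: measurable_funX.
  - by move=> x Dx; rewrite lee_fin -real_normK ?num_real// lerXn2r ?nnegrE// ?fM// (le_trans _ (fM _ Dx)).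
by rewrite integral_cst// lte_mul_pinfty// ?lee_fin ?sqr_ge0.
Qed.

Lemma L2on_int f : (mu D < +oo)%E -> L2on f -> mu.-integrable D (EFin \o f).
Proof.
move=> muD Lf.
have L1 : L2on (fun=> 1 : R) by apply: (@bounded_L2on _ 1) => // x _; rewrite normr1.
by have := L2on_mul_int Lf L1; congr (_.-integrable _ _); apply/funext => x /=; rewrite mulr1.
Qed.

Lemma ipC f g : ip f g = ip g f.
Proof. by apply: eq_Rintegral => x _; rewrite mulrC. Qed.

Lemma ipDl f g h : L2on f -> L2on g -> L2on h ->
  ip (fun x => f x + g x) h = ip f h + ip g h.
Proof.
move=> Lf Lg Lh; rewrite /ip -RintegralD//; try exact: L2on_mul_int.
by apply: eq_Rintegral => x _; rewrite mulrDl.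
Qed.

Lemma ipZl k f h : L2on f -> L2on h -> ip (fun x => k * f x) h = k * ip f h.
Proof.
move=> Lf Lh; rewrite /ip -RintegralZl//; last exact: L2on_mul_int.
by apply: eq_Rintegral => x _; rewrite mulrA.
Qed.

Lemma ipBl f g h : L2on f -> L2on g -> L2on h ->
  ip (fun x => f x - g x) h = ip f h - ip g h.
Proof.
move=> Lf Lg Lh; rewrite /ip -RintegralB//; try exact: L2on_mul_int.
by apply: eq_Rintegral => x _; rewrite mulrBl.
Qed.

Lemma ip_ge0 f : 0 <= ip f f.
Proof. by apply: Rintegral_ge0 => x _; rewrite -expr2 sqr_ge0. Qed.

Lemma ip_sqrE f : L2on f -> (ip f f)%:E = (\int[mu]_(x in D) (f x ^+ 2)%:E)%E.
Proof.
move=> Lf; rewrite /ip /Rintegral fineK; last first.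
  exact: (integrable_fin_num mD (L2on_mul_int Lf Lf)).
by apply: eq_integral => x _; rewrite expr2.
Qed.

Section sums.
Variables (I : eqType) (e : I -> T -> R) (kappa : R).
Hypothesis Le : forall i, L2on (e i).

Lemma L2on_sum (s : seq I) (a : I -> R) : (mu D < +oo)%E ->
  L2on (fun x => \sum_(i <- s) a i * e i x).
Proof.
move=> muD; elim: s => [|i s IH].
  have -> : (fun x => \sum_(i <- [::]) a i * e i x) = cst 0.
    by apply/funext => x; rewrite big_nil.
  by apply: (@bounded_L2on _ 0) => // x _; rewrite normr0.
have -> : (fun x => \sum_(j <- i :: s) a j * e j x) =
   (fun x => (a i * e i x) + \sum_(j <- s) a j * e j x).
  by apply/funext => x; rewrite big_cons.
by apply: L2onD => //; exact: L2onZ.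
Qed.

Lemma ip_suml (s : seq I) (a : I -> R) g : (mu D < +oo)%E -> L2on g ->
  ip (fun x => \sum_(i <- s) a i * e i x) g = \sum_(i <- s) a i * ip (e i) g.
Proof.
move=> muD Lg; elim: s => [|i s IH].
  rewrite big_nil /ip -[RHS](@Rintegral_set0 _ _ _ mu (fun=> 0)) Rintegral_set0.
  rewrite (_ : (fun x => _) = cst 0) ?Rintegral_cst ?mul0r//.
  by apply/funext => x; rewrite big_nil mul0r.
have -> : (fun x => \sum_(j <- i :: s) a j * e j x) =
   (fun x => (a i * e i x) + \sum_(j <- s) a j * e j x).
  by apply/funext => x; rewrite big_cons.
by rewrite ipDl ?ipZl ?IH ?big_cons//; [exact: L2onZ|exact: L2on_sum].
Qed.

(** Expands 0 <= |f - S|^2, where S is the partial sum with the Fourier coefficients of f. The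
    common squared norm [kappa] of the family will be L^2. *)
Lemma bessel (s : seq I) f : (mu D < +oo)%E -> 0 < kappa ->
  (forall i j, ip (e i) (e j) = kappa *+ (i == j)) -> uniq s -> L2on f ->
  \sum_(i <- s) (kappa^-1 * ip f (e i)) ^+ 2 <= kappa^-1 * ip f f.
Proof.
move=> muD k0 orth us Lf; pose a i := kappa^-1 * ip f (e i).
pose S x := \sum_(i <- s) a i * e i x.
have LS : L2on S by exact: L2on_sum.
have aE i : ip f (e i) = kappa * a i by rewrite /a mulVKf// gt_eqF.
have fS : ip f S = kappa * \sum_(i <- s) a i ^+ 2.
  rewrite ipC ip_suml// mulr_sumr; apply: eq_bigr => i _.
  by rewrite ipC aE; ring.
have SS : ip S S = kappa * \sum_(i <- s) a i ^+ 2.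
  rewrite ip_suml// mulr_sumr !big_seq; apply: eq_bigr => i si.
  rewrite ipC ip_suml// (bigD1_seq i)//= big1 ?addr0 => [|j ji].
    by rewrite orth eqxx mulr1n; ring.
  by rewrite orth (negbTE ji) mulr0n mulr0.
have := ip_ge0 (fun x => f x - S x).
rewrite ipBl ?[ip f _]ipC ?[ip S _]ipC ?ipBl//; try exact: L2onB.
rewrite fS [ip S f]ipC fS SS => h.
rewrite -(ler_pM2l k0) mulVKf ?gt_eqF//; first by lra.
Qed.

End sums.
End L2.

(** * Tonelli and Fubini on rectangles *)

Section FubiniRect.
Context d1 d2 (T1 : measurableType d1) (T2 : measurableType d2) (R : realType).
Variables (m1 : {sigma_finite_measure set T1 -> \bar R}).
Variables (m2 : {sigma_finite_measure set T2 -> \bar R}).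
Variables (A : set T1) (B : set T2) (mA : measurable A) (mB : measurable B).
Implicit Types f : T1 * T2 -> R.

Let mAB : measurable (A `*` B). Proof. exact: measurableX. Qed.

(** Extension by zero commutes with taking sections, which reduces integrals over a rectangle to
    integrals over the full product. *)
Let patchE f x y : ((fun p => (f p)%:E) \_ (A `*` B)) (x, y) =
  (((fun x => ((fun y => (f (x, y))%:E) \_ B) y) \_ A) x)%E.
Proof.
rewrite /patch in_setX; case: (x \in A) => //=.
Qed.

Lemma patch_setX_l f x : A x ->
  (fun y => ((fun p => (f p)%:E) \_ (A `*` B)) (x, y)) = (fun y => (f (x, y))%:E) \_ B.
Proof. by move=> Ax; apply/funext => y; rewrite patchE {1}/patch mem_set. Qed.

Lemma patch_setX_r f y : B y ->
  (fun x => ((fun p => (f p)%:E) \_ (A `*` B)) (x, y)) = (fun x => (f (x, y))%:E) \_ A.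
Proof.
by move=> By; apply/funext => x; rewrite /patch in_setX (mem_set By) andbT.
Qed.

Lemma measurable_sec_l f x : measurable_fun (A `*` B) f -> A x ->
  measurable_fun B (fun y => f (x, y)).
Proof.
move=> mf Ax; apply: (measurable_comp mAB _ mf) => //.
  by move=> _ [y By <-].
by apply: measurable_funTS; exact: pair1_measurable.
Qed.

Lemma measurable_sec_r f y : measurable_fun (A `*` B) f -> B y ->
  measurable_fun A (fun x => f (x, y)).
Proof.
move=> mf By; apply: (measurable_comp mAB _ mf) => //.
  by move=> _ [x Ax <-].
by apply: measurable_funTS; exact: pair2_measurable.
Qed.

Section ge0.
Variable f : T1 * T2 -> R.
Hypothesis mf : measurable_fun (A `*` B) f.

Let mF : measurable_fun setT ((fun p => `|f p|%:E) \_ (A `*` B)).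
Proof.
apply/(measurable_restrictT _ mAB).
by apply/measurable_EFinP; exact: measurableT_comp.
Qed.

Let F0 p : (0 <= ((fun p => `|f p|%:E) \_ (A `*` B)) p)%E.
Proof. by rewrite /patch; case: ifP. Qed.

Lemma tonelli_rect_l :
  (\int[(m1 \x m2)%E]_(p in A `*` B) `|f p|%:E = \int[m1]_(x in A) \int[m2]_(y in B) `|f (x, y)|%:E)%E.
Proof.
rewrite integral_mkcond fubini_tonelli1// [RHS]integral_mkcond.
apply: eq_integral => x _; rewrite /fubini_F [in RHS]/patch; case: ifPn => xA.
  by rewrite (patch_setX_l (fun p => `|f p|)) -?integral_mkcond//; exact: set_mem.
by apply: integral0_eq => y _; rewrite patchE {1}/patch (negbTE xA).
Qed.

Lemma tonelli_rect_r :
  (\int[(m1 \x m2)%E]_(p in A `*` B) `|f p|%:E = \int[m2]_(y in B) \int[m1]_(x in A) `|f (x, y)|%:E)%E.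
Proof.
rewrite integral_mkcond fubini_tonelli2// [RHS]integral_mkcond.
apply: eq_integral => y _; rewrite /fubini_G [in RHS]/patch; case: ifPn => yB.
  by rewrite (patch_setX_r (fun p => `|f p|)) -?integral_mkcond//; exact: set_mem.
by apply: integral0_eq => x _; rewrite /patch in_setX (negbTE yB) andbF.
Qed.

Lemma measurable_tonelli_l :
  measurable_fun A (fun x => \int[m2]_(y in B) `|f (x, y)|%:E)%E.
Proof.
have := measurable_fun_fubini_tonelli_F (m2 := m2) _ mF F0.
move=> /(measurable_funS measurableT (@subsetT _ A)); apply: eq_measurable_fun => x /set_mem Ax.
by rewrite /fubini_F (patch_setX_l (fun p => `|f p|))// -integral_mkcond.
Qed.

Lemma measurable_tonelli_r :
  measurable_fun B (fun y => \int[m1]_(x in A) `|f (x, y)|%:E)%E.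
Proof.
have := measurable_fun_fubini_tonelli_G (m1 := m1) _ mF F0.
move=> /(measurable_funS measurableT (@subsetT _ B)); apply: eq_measurable_fun => y /set_mem By.
by rewrite /fubini_G (patch_setX_r (fun p => `|f p|))// -integral_mkcond.
Qed.

End ge0.

Section int.
Variable f : T1 * T2 -> R.
Hypothesis fi : ((m1 \x m2)%E).-integrable (A `*` B) (EFin \o f).

Let Fi : ((m1 \x m2)%E).-integrable setT ((fun p => (f p)%:E) \_ (A `*` B)).
Proof. by apply/integrable_restrict => //; rewrite setTI. Qed.

Lemma ae_integrable_l : {ae m1, forall x, A x -> m2.-integrable B (fun y => (f (x, y))%:E)}.
Proof.
have := ae_integrable1 Fi; apply: filterS => x h Ax.
by move: h; rewrite patch_setX_l// => /integrable_restrict; rewrite setTI; exact.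
Qed.

Lemma ae_integrable_r : {ae m2, forall y, B y -> m1.-integrable A (fun x => (f (x, y))%:E)}.
Proof.
have := ae_integrable2 Fi; apply: filterS => y h By.
by move: h; rewrite patch_setX_r// => /integrable_restrict; rewrite setTI; exact.
Qed.

Lemma fubini_rect_l :
  (\int[m1 \x m2]_(p in A `*` B) (f p)%:E = \int[m1]_(x in A) \int[m2]_(y in B) (f (x, y))%:E)%E.
Proof.
rewrite integral_mkcond -integral12_prod_meas1// [RHS]integral_mkcond.
apply: eq_integral => x _; rewrite /fubini_F [in RHS]/patch; case: ifPn => xA.
  by rewrite patch_setX_l -?integral_mkcond//; exact: set_mem.
by apply: integral0_eq => y _; rewrite patchE {1}/patch (negbTE xA).
Qed.

Lemma fubini_rect_r :
  (\int[m1 \x m2]_(p in A `*` B) (f p)%:E = \int[m2]_(y in B) \int[m1]_(x in A) (f (x, y))%:E)%E.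
Proof.
rewrite integral_mkcond -integral21_prod_meas1// [RHS]integral_mkcond.
apply: eq_integral => y _; rewrite /fubini_G [in RHS]/patch; case: ifPn => yB.
  by rewrite patch_setX_r -?integral_mkcond//; exact: set_mem.
by apply: integral0_eq => x _; rewrite /patch in_setX (negbTE yB) andbF.
Qed.

Lemma integrable_fubini_l :
  m1.-integrable A (fun x => \int[m2]_(y in B) (f (x, y))%:E)%E.
Proof.
have := integrable_fubini_F Fi => /(integrableS measurableT mA (@subsetT _ _)).
apply: eq_integrable => // x /set_mem Ax.
by rewrite /fubini_F patch_setX_l// -integral_mkcond.
Qed.

Lemma integrable_fubini_r :
  m2.-integrable B (fun y => \int[m1]_(x in A) (f (x, y))%:E)%E.
Proof.
have mf := measurable_int _ fi; have mf' : measurable_fun (A `*` B) f by exact/measurable_EFinP.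
have mG : measurable_fun B (fun y => \int[m1]_(x in A) (f (x, y))%:E)%E.
  have := measurable_fubini_G Fi => /(measurable_funS measurableT (@subsetT _ B)).
  apply: eq_measurable_fun => y /set_mem By.
  by rewrite /fubini_G patch_setX_r// -integral_mkcond.
apply/integrableP; split => //.
move: (fi) => /integrableP[_]; rewrite tonelli_rect_r//; apply: le_lt_trans.
apply: ge0_le_integral => //.
- exact: measurableT_comp.
- exact: measurable_tonelli_r.
move=> y By; apply: le_abse_integral => //.
exact/measurable_EFinP/(measurable_sec_r mf').
Qed.

End int.
End FubiniRect.

Section RFubini.
Context d1 d2 (T1 : measurableType d1) (T2 : measurableType d2) (R : realType).
Variables (m1 : {sigma_finite_measure set T1 -> \bar R}).
Variables (m2 : {sigma_finite_measure set T2 -> \bar R}).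
Variables (A : set T1) (B : set T2) (mA : measurable A) (mB : measurable B).
Variable f : T1 * T2 -> R.
Hypothesis fi : ((m1 \x m2)%E).-integrable (A `*` B) (EFin \o f).

Lemma Rfubini_int_l : m1.-integrable A (EFin \o (fun x => \int[m2]_(y in B) f (x, y))%R).
Proof.
have h := integrable_fubini_l mA mB fi.
have mfine : measurable_fun A (EFin \o (fun x => \int[m2]_(y in B) f (x, y))%R).
  by apply/measurable_EFinP; apply: measurableT_comp => //; exact: measurable_int h.
apply/integrableP; split => //; move: h => /integrableP[mh]; apply: le_lt_trans.
apply: ge0_le_integral => //; try exact: measurableT_comp.
(* [fine] sends an infinite inner integral to 0, which can only decrease its absolute value. *)
by move=> x _ /=; rewrite /Rintegral; case: (\int[m2]_(y in B) _)%E => //= *; rewrite normr0 ?leey.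
Qed.

Lemma Rfubini_int_r : m2.-integrable B (EFin \o (fun y => \int[m1]_(x in A) f (x, y))%R).
Proof.
have h := integrable_fubini_r mA mB fi.
have mfine : measurable_fun B (EFin \o (fun y => \int[m1]_(x in A) f (x, y))%R).
  by apply/measurable_EFinP; apply: measurableT_comp => //; exact: measurable_int h.
apply/integrableP; split => //; move: h => /integrableP[mh]; apply: le_lt_trans.
apply: ge0_le_integral => //; try exact: measurableT_comp.
by move=> x _ /=; rewrite /Rintegral; case: (\int[m1]_(x in A) _)%E => //= *; rewrite normr0 ?leey.
Qed.

Lemma Rfubini_l : (\int[(m1 \x m2)%E]_(p in A `*` B) f p)%R =
  (\int[m1]_(x in A) \int[m2]_(y in B) f (x, y))%R.
Proof.
rewrite {1}/Rintegral (fubini_rect_l mA mB fi) [in RHS]/Rintegral; congr fine.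
apply: ae_eq_integral => //.
- exact: measurable_int (integrable_fubini_l mA mB fi).
- exact: measurable_int Rfubini_int_l.
have := ae_integrable_l mA mB fi; apply: filterS => x h Ax.
by rewrite /Rintegral fineK//; apply: integrable_fin_num => //; exact: h.
Qed.

Lemma Rfubini_r : (\int[(m1 \x m2)%E]_(p in A `*` B) f p)%R =
  (\int[m2]_(y in B) \int[m1]_(x in A) f (x, y))%R.
Proof.
rewrite {1}/Rintegral (fubini_rect_r mA mB fi) [in RHS]/Rintegral; congr fine.
apply: ae_eq_integral => //.
- exact: measurable_int (integrable_fubini_r mA mB fi).
- exact: measurable_int Rfubini_int_r.
have := ae_integrable_r mA mB fi; apply: filterS => x h Ax.
by rewrite /Rintegral fineK//; apply: integrable_fin_num => //; exact: h.
Qed.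

End RFubini.

(** * Lebesgue differentiation and dominated convergence *)

Section Primitive.
Variable R : realType.
Notation mu := (@lebesgue_measure R).
Implicit Types (a b x : R) (f : R -> R).

(** By Lebesgue differentiation the primitive of f extended by zero has derivative f at almost every
    point, while near each point of (a, b) this primitive is constant. *)
Lemma ae0_of_primitive a b f :
  mu.-integrable `]a, b[ (EFin \o f) ->
  (forall x, a < x < b -> (\int[mu]_(t in `]a, x[) f t)%R = 0) ->
  {ae mu, forall x, a < x < b -> f x = 0}.
Proof.
move=> fi f0; pose g := f \_ `]a, b[.
have gi : mu.-integrable setT (EFin \o g).
  rewrite /g -restrict_EFin; apply/integrable_restrict => //; by rewrite setTI.
have gi' (A : set R) : measurable A -> mu.-integrable A (EFin \o g).
  by move=> mA; apply: (integrableS _ _ _ gi).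
have gl : locally_integrable setT g.
  by have := integrable_locally (@measurableT _ _) gi; rewrite patch_setT.
have := FTC1 (a := BLeft a) (fun y => gi' _ (measurable_itv _)) gl.
apply: (@filterS _ _ (ae_filter_ringOfSetsType mu)) => x /= h /andP[ax xb].
have {h} [|dF Fx] := h; first by rewrite lte_fin.
have gx : g x = f x by rewrite /g patchE mem_set//= in_itv/= ax xb.
rewrite -gx -Fx derive1E.
pose F0 : R -> R := fun=> 0.
rewrite (@near_eq_derive _ _ _ _ F0) ?derive_cst//.
near=> y.
have ay : a < y by near: y; exact: lt_nbhsr.
have yb : y < b by near: y; exact: lt_nbhsl.
rewrite /F0 -[RHS](f0 y) ?ay//.
rewrite -Rintegral_itv_bndo_bndc; last exact: gi'.
rewrite -Rintegral_itv_obnd_cbnd; last exact: gi'.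
apply: eq_Rintegral => t; rewrite inE/= in_itv/= => /andP[at_ ty].
by rewrite /g patchE mem_set//= in_itv/= at_ (lt_trans ty).
Unshelve. all: by end_near. Qed.

End Primitive.

Lemma Rdominated_cvg d (T : measurableType d) (R : realType) (mu : {measure set T -> \bar R})
    (D : set T) (f_ : nat -> T -> R) (f g : T -> R) :
  measurable D -> (forall n, measurable_fun D (f_ n)) ->
  (forall x, D x -> f_ n x @[n --> \oo] --> f x) ->
  mu.-integrable D (EFin \o g) ->
  (forall n x, D x -> `|f_ n x| <= g x) ->
  (\int[mu]_(x in D) f_ n x)%R @[n --> \oo] --> (\int[mu]_(x in D) f x)%R.
Proof.
move=> mD mf cf ig fg.
have mF : measurable_fun D f by exact: (measurable_fun_cvg mf).
have fi : mu.-integrable D (EFin \o f).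
  apply: le_integrable ig => //; first exact/measurable_EFinP.
  move=> x Dx /=; rewrite lee_fin (le_trans _ (ler_norm _))//.
  have h : `|f_ n x| @[n --> \oo] --> `|f x| by apply: cvg_norm; exact: cf.
  rewrite -(cvg_lim _ h)//; apply: limr_le; first exact: cvgP h.
  by apply: nearW => n; exact: fg.
apply: fine_cvg; rewrite /= fineK; last exact: integrable_fin_num.
apply: (@dominated_cvg _ _ _ mu D mD (fun n => EFin \o f_ n) (EFin \o f) (EFin \o g)) => //.
- by move=> n; exact/measurable_EFinP.
- by move=> x Dx; apply: cvg_EFin; [exact: nearW|exact: cf].
Qed.

(** * Spans graded by degree *)

Section Span.
Variables (R : comNzRingType) (T I : Type) (e : I -> T -> R) (deg : I -> nat).
Implicit Types f g : T -> R.

(** Polynomials of degree at most D in an abstract family. The same closure under powers serves the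
    approximate step functions of one variable and the cube of a truncated series in two. *)
Definition sp D f := exists2 s : seq (R * I),
  all (fun p => deg p.2 <= D)%N s & forall x, f x = \sum_(p <- s) p.1 * e p.2 x.

Lemma spS D1 D2 f : (D1 <= D2)%N -> sp D1 f -> sp D2 f.
Proof.
by move=> h [s sD fE]; exists s => //; apply: sub_all sD => p /= /leq_trans; apply.
Qed.

Lemma sp_e i : sp (deg i) (e i).
Proof. by exists [:: (1, i)] => [|x]; rewrite /= ?leqnn// big_seq1 mul1r. Qed.

Lemma spD D f g : sp D f -> sp D g -> sp D (fun x => f x + g x).
Proof.
move=> [s sD fE] [t tD gE]; exists (s ++ t); first by rewrite all_cat sD.
by move=> x; rewrite big_cat fE gE.
Qed.

Lemma spZ D k f : sp D f -> sp D (fun x => k * f x).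
Proof.
move=> [s sD fE]; exists [seq (k * p.1, p.2) | p <- s]; first by rewrite all_map.
move=> x; rewrite big_map fE mulr_sumr; apply: eq_bigr => p _.
by rewrite /= mulrA.
Qed.

Lemma sp0 D : sp D (fun=> 0).
Proof. by exists [::] => // x; rewrite big_nil. Qed.

Hypothesis eM : forall i j, sp (deg i + deg j) (fun x => e i x * e j x).

Lemma spM D1 D2 f g : sp D1 f -> sp D2 g -> sp (D1 + D2) (fun x => f x * g x).
Proof.
move=> [s sD fE] [t tD gE].
have -> : (fun x => f x * g x) = (fun x => \sum_(p <- s) \sum_(q <- t) p.1 * q.1 * (e p.2 x * e q.2 x)).
  apply/funext => x; rewrite fE gE mulr_suml; apply: eq_bigr => p _.
  by rewrite mulr_sumr; apply: eq_bigr => q _; ring.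
elim: s sD {fE} => [|p s IH] /=.
  by move=> _; under eq_fun do rewrite big_nil; exact: sp0.
move=> /andP[pD sD]; under eq_fun do rewrite big_cons.
apply: spD; last exact: IH.
elim: t tD {gE IH} => [|q t IH] /=.
  by move=> _; under eq_fun do rewrite big_nil; exact: sp0.
move=> /andP[qD tD]; under eq_fun do rewrite big_cons.
apply: spD; last exact: IH.
by apply: spZ; apply: spS (eM _ _); rewrite leq_add.
Qed.

Lemma spX D n f i0 : deg i0 = 0%N -> (forall x, e i0 x = 1) ->
  sp D f -> sp (n * D) (fun x => f x ^+ n).
Proof.
move=> d0 e0 fD; elim: n => [|n IH].
  have -> : (fun x => f x ^+ 0) = e i0 by apply/funext => x; rewrite expr0 e0.
  by rewrite mul0n -d0; exact: sp_e.
under eq_fun do rewrite exprS.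
by rewrite mulSn; exact: spM.
Qed.

End Span.

Section Trig1.
Variables (R : realType) (L : R).

Lemma e1_spM m n : sp (e1 L) absz (`|m|%N + `|n|%N) (fun x => e1 L m x * e1 L n x).
Proof.
under eq_fun do rewrite e1_mul.
exists [:: (2^-1, m - n); (2^-1, n - m); (2^-1, m + n); (- 2^-1, - (m + n))].
  by rewrite /=; lia.
by move=> x; rewrite !big_cons big_nil/=; ring.
Qed.

Lemma sp_cos c : sp (e1 L) absz 1 (fun x => cos (om L * x - c)).
Proof.
exists [:: ((cos c + sin c) / 2, 1); ((cos c - sin c) / 2, -1)] => // x.
rewrite !big_cons big_nil/= /e1 /cas cosB mulr1 rmorphN/= mulrN1 mulNr cosN sinN.
by field.
Qed.

End Trig1.

(** * Polynomials approximating a step *)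

Section Approx.
Variable R : realType.
Implicit Types t : R.

(** A polynomial known from elementary proofs of the Stone-Weierstrass theorem. On [0, 1] it stays
    in [0, 1]; it tends to 1 below 1/2 and to 0 above, because Bernoulli's inequality compares it
    with 1 - (2 t)^n and with (2 t)^(-n). *)
Definition stp n t : R := (1 - t ^+ n) ^+ (2 ^ n).

Lemma stp_bound n t : 0 <= t <= 1 -> 0 <= stp n t <= 1.
Proof.
move=> /andP[t0 t1]; have h : 0 <= 1 - t ^+ n <= 1.
  by rewrite subr_ge0 exprn_ile1//= gerBl exprn_ge0.
by move: h => /andP[h0 h1]; rewrite exprn_ge0//= exprn_ile1.
Qed.

Lemma bernoulli_ge (a : R) k : 0 <= a <= 1 -> 1 - a *+ k <= (1 - a) ^+ k.
Proof.
move=> /andP[a0 a1]; elim: k => [|k IH]; first by rewrite mulr0n subr0 expr0.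
rewrite exprS; apply: (@le_trans _ _ ((1 - a) * (1 - a *+ k))); last first.
  by rewrite ler_wpM2l// subr_ge0.
rewrite mulrS mulrBr mulr1 mulrBl mul1r opprB.
have : 0 <= a * (a *+ k) by rewrite mulr_ge0// mulrn_wge0.
by move: (a *+ k) => b; lra.
Qed.

Lemma bernoulli_le (a : R) k : 0 <= a <= 1 -> (1 - a) ^+ k * (1 + a *+ k) <= 1.
Proof.
move=> /andP[a0 a1]; elim: k => [|k IH]; first by rewrite mulr0n addr0 expr0 mulr1.
have h0 : 0 <= (1 - a) ^+ k by rewrite exprn_ge0// subr_ge0.
apply: le_trans IH; rewrite exprSr -mulrA ler_wpM2l// mulrS.
have : 0 <= a *+ k by rewrite mulrn_wge0.
move: (a *+ k) => b b0; have : 0 <= a * a by rewrite mulr_ge0.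
have : 0 <= a * b by rewrite mulr_ge0.
by lra.
Qed.

Lemma stp_lt t : 0 <= t < 2^-1 -> stp n t @[n --> \oo] --> (1 : R).
Proof.
move=> /andP[t0 t2].
have c : 1 - (2 * t) ^+ n @[n --> \oo] --> (1 : R).
  rewrite -[X in _ --> X]subr0; apply: cvgB; first exact: cvg_cst.
  by apply: cvg_expr; rewrite ger0_norm; [|rewrite mulr_ge0]; lra.
apply: (squeeze_cvgr _ c (cvg_cst (1 : R))).
apply: nearW => n; have t1 : t <= 1 by lra.
have /andP[_ ->] := @stp_bound n t (introT andP (conj t0 t1)); rewrite andbT.
rewrite /stp; have := @bernoulli_ge (t ^+ n) (2 ^ n); rewrite exprn_ge0// exprn_ile1// => /(_ isT).
by rewrite exprMn -[in X in X * _]natrX mulr_natl.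
Qed.

Lemma stp_gt t : 2^-1 < t <= 1 -> stp n t @[n --> \oo] --> (0 : R).
Proof.
move=> /andP[t2 t1]; have t0 : 0 <= t by lra.
have c : ((2 * t)^-1) ^+ n @[n --> \oo] --> (0 : R).
  apply: cvg_expr; rewrite ger0_norm ?invr_ge0 ?mulr_ge0//.
  by rewrite invf_lt1; lra.
apply: (squeeze_cvgr _ (cvg_cst (0 : R)) c).
apply: nearW => n; have /andP[-> _] := @stp_bound n t (introT andP (conj t0 t1)).
rewrite /= /stp; have := @bernoulli_le (t ^+ n) (2 ^ n); rewrite exprn_ge0// exprn_ile1// => /(_ isT).
have -> : t ^+ n *+ 2 ^ n = (2 * t) ^+ n by rewrite exprMn -[in RHS]natrX mulr_natl.
have /andP[s0 _] := @stp_bound n t (introT andP (conj t0 t1)).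
have p0 : 0 < (2 * t) ^+ n by rewrite exprn_gt0//; lra.
move=> h; rewrite exprVn -[leRHS]mul1r ler_pdivlMr//; apply: le_trans h.
by rewrite ler_wpM2l//; lra.
Qed.

End Approx.

(** * Completeness of the basis on an interval *)

Section Complete1.
Variables (R : realType) (L : R) (L0 : 0 < L).
Notation mu := (@lebesgue_measure R).

Lemma integrable_mul_bounded d (T : measurableType d) (m : {measure set T -> \bar R})
    (D : set T) (f g : T -> R) (M : R) : measurable D ->
  m.-integrable D (EFin \o f) -> measurable_fun D g -> (forall x, D x -> `|g x| <= M) ->
  m.-integrable D (EFin \o (fun x => f x * g x)).
Proof.
move=> mD fi mg gM; have mf : measurable_fun D f.
  by apply/measurable_EFinP; exact: measurable_int fi.
have := integrableZl mD M fi; apply: le_integrable => //.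
  by apply/measurable_EFinP; exact: measurable_funM.
move=> x Dx /=; rewrite lee_fin !normrM mulrC ler_wpM2r//.
by rewrite (le_trans (gM _ Dx))// ler_norm.
Qed.

Lemma measurable_e1 D m : measurable D -> measurable_fun D (e1 L m).
Proof.
move=> mD; apply: (measurable_funS measurableT) => //.
by apply: continuous_measurable_fun; exact: continuous_e1.
Qed.

Lemma sp_e1_continuous D f : sp (e1 L) absz D f -> continuous f.
Proof.
move=> [s _ fE] x; have -> : f = (fun x => \sum_(p <- s) p.1 * e1 L p.2 x) by apply/funext.
elim: s {fE} => [|p s IH].
  by under eq_fun do rewrite big_nil; exact: cvg_cst.
under eq_fun do rewrite big_cons; apply: cvgD; last exact: IH.
by apply: cvgM; [exact: cvg_cst|exact: continuous_e1].
Qed.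

Lemma orth_sp (h f : R -> R) D : mu.-integrable `]0, L[ (EFin \o h) ->
  (forall m, (\int[mu]_(x in `]0%R, L[) (h x * e1 L m x))%R = 0) ->
  sp (e1 L) absz D f -> (\int[mu]_(x in `]0%R, L[) (h x * f x))%R = 0.
Proof.
move=> hi h0 [s _ fE].
have Ei m : mu.-integrable `]0, L[ (EFin \o (fun x => h x * e1 L m x)).
  by apply: (@integrable_mul_bounded _ _ _ _ _ _ 2) => //; [exact: measurable_e1|move=> *; exact: abs_e1_le].
have -> : (\int[mu]_(x in `]0%R, L[) (h x * f x))%R =
  (\int[mu]_(x in `]0%R, L[) (\sum_(p <- s) p.1 * (h x * e1 L p.2 x)))%R.
  apply: eq_Rintegral => x _; rewrite fE mulr_sumr; apply: eq_bigr => p _.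
  by rewrite mulrCA.
suff [] : (\int[mu]_(x in `]0%R, L[) (\sum_(p <- s) p.1 * (h x * e1 L p.2 x)))%R = 0 /\
  mu.-integrable `]0, L[ (EFin \o (fun x => \sum_(p <- s) p.1 * (h x * e1 L p.2 x))) by [].
elim: s {fE} => [|p s [IH1 IH2]].
  have -> : (fun x : R => \sum_(p <- [::] : seq (R * int)) p.1 * (h x * e1 L p.2 x)) = cst 0.
    by apply/funext => x; rewrite big_nil.
  split; first by rewrite Rintegral_cst// mul0r.
  by apply: eq_integrable (integrable0 _ _) => // x _.
have -> : (fun x => \sum_(q <- p :: s) q.1 * (h x * e1 L q.2 x)) =
  (fun x => p.1 * (h x * e1 L p.2 x) + \sum_(q <- s) q.1 * (h x * e1 L q.2 x)).
  by apply/funext => x; rewrite big_cons.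
have Zi : mu.-integrable `]0, L[ (EFin \o (fun x => p.1 * (h x * e1 L p.2 x))).
  exact: (integrableZl _ p.1 (Ei p.2)).
split; last by apply: (integrableD _ Zi IH2); exact: measurable_itv.
by rewrite RintegralD// IH1 RintegralZl// h0 mulr0 addr0.
Qed.

(** A trigonometric polynomial of degree 1 in y that separates the two sides of x: by [arcE] it is
    below 1/2 on (0, x) and above on (x, L), since sin (pi (x - y) / L) changes sign at x. *)
Definition arc x y : R := 2^-1 - (cos (om L * y - om L * x / 2) - cos (om L * x / 2)) / 4.

Lemma arcE x y : arc x y = 2^-1 - sin (pi * y / L) * sin (pi * (x - y) / L) / 2.
Proof.
rewrite /arc.
have -> : om L * y - om L * x / 2 = pi * y / L - pi * (x - y) / L.
  by rewrite /om; field; rewrite gt_eqF.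
have -> : om L * x / 2 = pi * y / L + pi * (x - y) / L.
  by rewrite /om; field; rewrite gt_eqF.
by rewrite cosB cosD; field.
Qed.

Lemma arc_bound x y : 0 <= arc x y <= 1.
Proof.
rewrite /arc; have := cos_le1 (om L * y - om L * x / 2); have := cos_geN1 (om L * y - om L * x / 2).
have := cos_le1 (om L * x / 2); have := cos_geN1 (om L * x / 2); lra.
Qed.

Lemma sinpi_gt0 y : 0 < y < L -> 0 < sin (pi * y / L).
Proof.
move=> /andP[y0 yL]; have p0 := pi_gt0 R; apply: sin_gt0_pi; apply/andP; split.
  by rewrite divr_gt0 ?mulr_gt0.
by rewrite ltr_pdivrMr// ltr_pM2l.
Qed.

Lemma arc_lt x y : 0 < y < x -> x < L -> arc x y < 2^-1.
Proof.
move=> /andP[y0 yx] xL; rewrite arcE gtrBl divr_gt0// mulr_gt0//; apply: sinpi_gt0.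
  by rewrite y0 (lt_trans yx).
by apply/andP; split; lra.
Qed.

Lemma arc_gt x y : 0 < x < y -> y < L -> 2^-1 < arc x y.
Proof.
move=> /andP[x0 xy] yL; rewrite arcE ltrBrDr gtrDl pmulr_llt0// nmulr_llt0; last first.
  have -> : pi * (x - y) / L = - (pi * (y - x) / L) by field; rewrite gt_eqF.
  by rewrite sinN oppr_lt0; apply: sinpi_gt0; apply/andP; split; lra.
by apply: sinpi_gt0; apply/andP; split; lra.
Qed.

Lemma sp_arc x : sp (e1 L) absz 1 (arc x).
Proof.
rewrite /arc.
have -> : (fun y => 2^-1 - (cos (om L * y - om L * x / 2) - cos (om L * x / 2)) / 4) =
 (fun y => - 4^-1 * cos (om L * y - om L * x / 2) + (2^-1 + cos (om L * x / 2) / 4) * e1 L 0 y).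
  by apply/funext => y; rewrite e10; field.
apply: spD; apply: spZ; first exact: sp_cos.
exact: (spS (D1 := 0)) (sp_e _ _ _).
Qed.

Lemma sp_stp_arc n x : exists D, sp (e1 L) absz D (fun y => stp n (arc x y)).
Proof.
have eM := @e1_spM R L; have e0 := @e10 R L.
exists (2 ^ n * (n * 1))%N; apply: (@spX _ _ _ _ _ eM _ _ _ 0) => //.
have -> : (fun y => 1 - arc x y ^+ n) = (fun y => e1 L 0 y + (- 1) * arc x y ^+ n).
  by apply/funext => y; rewrite e10 mulN1r.
apply: spD; first exact: (spS (D1 := 0)) (sp_e _ _ _).
by apply: spZ; apply: (@spX _ _ _ _ _ eM _ _ _ 0) => //; exact: sp_arc.
Qed.

(** The polynomials [stp n (arc x y)] stay in [0, 1] and converge to the indicator of (0, x) away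
    from the point x. They are orthogonal to h, so by dominated convergence the primitive of h
    vanishes. *)
Lemma complete1 (h : R -> R) : mu.-integrable `]0, L[ (EFin \o h) ->
  (forall m, (\int[mu]_(x in `]0%R, L[) (h x * e1 L m x))%R = 0) ->
  {ae mu, forall x, 0 < x < L -> h x = 0}.
Proof.
move=> hi h0; apply: ae0_of_primitive => // x /andP[x0 xL].
have hi' (A : set R) : measurable A -> A `<=` `]0, L[ -> mu.-integrable A (EFin \o h).
  by move=> mA sA; apply: (integrableS _ _ _ hi).
have mstp n (A : set R) : measurable A -> measurable_fun A (fun y => stp n (arc x y)).
  have [D /sp_e1_continuous c] := sp_stp_arc n x.
  by move=> mA; apply: (measurable_funS measurableT) => //; exact: continuous_measurable_fun.
have bstp n y : `|stp n (arc x y)| <= 1.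
  by have /andP[s0 s1] := stp_bound n (arc_bound x y); rewrite ger0_norm.
have key (A : set R) (c : R) : measurable A -> A `<=` `]0, L[ ->
    (forall y, A y -> stp n (arc x y) @[n --> \oo] --> c) ->
    (\int[mu]_(y in A) (h y * stp n (arc x y)))%R @[n --> \oo] --> (\int[mu]_(y in A) (h y * c))%R.
  move=> mA sA cA; have hA := hi' A mA sA.
  have mh : measurable_fun A h by apply/measurable_EFinP; exact: measurable_int hA.
  apply: (@Rdominated_cvg _ _ _ mu A _ _ (fun y => `|h y|)) => //.
  - by move=> n; apply: measurable_funM => //; exact: mstp.
  - by move=> y Ay; apply: cvgM; [exact: cvg_cst|exact: cA].
  - exact: (integrable_norm hA).
  - by move=> n y Ay; rewrite normrM -[leRHS]mulr1 ler_wpM2l.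
have s1 : (`]0, x[ : set R) `<=` `]0, L[.
  by move=> y /=; rewrite !in_itv/= => /andP[-> yx]/=; exact: lt_trans xL.
have s2 : (`]x, L[ : set R) `<=` `]0, L[.
  by move=> y /=; rewrite !in_itv/= => /andP[xy ->]; rewrite (lt_trans x0 xy).
have c1 := key [set` `]0, x[] 1 (measurable_itv _) s1 _.
have c2 := key [set` `]x, L[] 0 (measurable_itv _) s2 _.
have {}c1 : (\int[mu]_(y in `]0%R, x[) (h y * stp n (arc x y)))%R @[n --> \oo] --> (\int[mu]_(y in `]0%R, x[) h y)%R.
  have -> : (\int[mu]_(y in `]0%R, x[) h y)%R = (\int[mu]_(y in `]0%R, x[) (h y * 1))%R.
    by apply: eq_Rintegral => y _; rewrite mulr1.
  apply: c1 => y; rewrite /= in_itv/= => /andP[y0 yx]; apply: stp_lt.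
  by have /andP[-> _] := arc_bound x y; rewrite arc_lt// y0.
have {}c2 : (\int[mu]_(y in `]x, L[) (h y * stp n (arc x y)))%R @[n --> \oo] --> (0 : R).
  have -> : (0 : R) = (\int[mu]_(y in `]x, L[) (h y * 0))%R.
    rewrite -[LHS](mul0r (fine (mu `]x, L[))) -Rintegral_cst//.
    by apply: eq_Rintegral => y _; rewrite mulr0.
  apply: c2 => y; rewrite /= in_itv/= => /andP[xy yL]; apply: stp_gt.
  by have /andP[_ ->] := arc_bound x y; rewrite arc_gt// x0.
pose u n := (\int[mu]_(y in `]0%R, x[) (h y * stp n (arc x y)))%R.
pose v n := (\int[mu]_(y in `]x, L[) (h y * stp n (arc x y)))%R.
have c3 : u n + v n @[n --> \oo] --> (\int[mu]_(y in `]0%R, x[) h y)%R.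
  by rewrite -[X in _ --> X]addr0; exact: cvgD.
have e n : u n + v n = 0.
  have [D spn] := sp_stp_arc n x; rewrite -(orth_sp hi h0 spn).
  have ii (A : set R) : measurable A -> A `<=` `]0, L[ ->
     mu.-integrable A (EFin \o (fun y => h y * stp n (arc x y))).
    move=> mA sA; apply: (@integrable_mul_bounded _ _ _ _ _ _ 1) => //.
    - exact: hi'.
    - exact: mstp.
  rewrite /u /v -(Rintegral_itvB (a := BRight 0) (b := BLeft L) (x := x)) ?bnd_simp//; last 2 first.
    exact: ii.
    by rewrite ltW.
  rewrite -(Rintegral_itv_bndo_bndc (r := x)); first by rewrite addrC subrK.
  exact: ii.
move: c3; under eq_fun do rewrite e.
by move=> /cvg_lim <-//; rewrite lim_cst.
Qed.

End Complete1.

(** * Orthogonality and completeness on the square *)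

(** [leb2] under a name of its own, to which the measure and sigma-finite structures are attached;
    the latter serves to form the product with time. *)
Definition leb2m (R : realType) : set (measurableTypeR R * measurableTypeR R) -> \bar R := @leb2 R.

HB.instance Definition _ (R : realType) := Measure.copy (@leb2m R) (@lebesgue_measure R \x @lebesgue_measure R)%E.

Lemma leb2m_sigma_finite (R : realType) : sigma_finite setT (@leb2m R).
Proof.
have /sigma_finiteP[F [TF ndF Foo]] := sigma_finiteT (@lebesgue_measure R).
exists (fun n => F n `*` F n).
- rewrite -setXTT TF predeqE => -[x y]; split.
    move=> [/= [n _ Fnx] [k _ Gky]]; exists (maxn n k) => //; split.
    + by move: x Fnx; exact/subsetPset/ndF/leq_maxl.
    + by move: y Gky; exact/subsetPset/ndF/leq_maxr.
  by move=> [n _ []/= ? ?]; split; exists n.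
- move=> k; have [mFk Fk] := Foo k.
  split; first exact: measurableX.
  by rewrite /leb2m /leb2 product_measure1E// lte_mul_pinfty// ge0_fin_numE.
Qed.

HB.instance Definition _ (R : realType) :=
  @Measure_isSigmaFinite.Build _ _ _ (@leb2m R) (@leb2m_sigma_finite R).

Lemma sub_ae d (T : measurableType d) (R : realType) (m : {measure set T -> \bar R})
    (P Q : T -> Prop) :
  (forall x, P x -> Q x) -> {ae m, forall x, P x} -> {ae m, forall x, Q x}.
Proof. by move=> PQ; apply: (@filterS _ _ (ae_filter_ringOfSetsType m)). Qed.

Lemma sub_ae2 d (T : measurableType d) (R : realType) (m : {measure set T -> \bar R})
    (P1 P2 Q : T -> Prop) : (forall x, P1 x -> P2 x -> Q x) ->
  {ae m, forall x, P1 x} -> {ae m, forall x, P2 x} -> {ae m, forall x, Q x}.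
Proof. by move=> PQ; apply: (@filterS2 _ _ (ae_filter_ringOfSetsType m)). Qed.

Section Orth.
Variables (R : realType) (L : R) (L0 : 0 < L).
Notation mu := (@lebesgue_measure R).
Notation mu2 := (@leb2m R).

Lemma measurable_itv0 : measurable (itv0 L : set (measurableTypeR R)).
Proof. exact: measurable_itv. Qed.

Let mI := measurable_itv0.

Lemma measurable_square : measurable (square L : set (measurableTypeR R * measurableTypeR R)).
Proof. exact: measurableX. Qed.

Lemma leb_itv0 : mu `]0, L[ = L%:E.
Proof. by rewrite lebesgue_measure_itv/= lte_fin L0 oppr0 adde0. Qed.

Lemma leb2_square : mu2 (square L) = (L ^+ 2)%:E.
Proof.
rewrite /leb2m /leb2 product_measure1E//; try exact: measurable_itv.
by rewrite expr2 EFinM; congr (_ * _)%E; exact: leb_itv0.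
Qed.

Lemma leb2_square_fin : (mu2 (square L) < +oo)%E.
Proof. by rewrite leb2_square ltry. Qed.

Lemma dotL2E f g : dotL2 L f g =
  ip mu2 (square L) (fun p => f p.1 p.2) (fun p => g p.1 p.2).
Proof. by []. Qed.

Lemma sqL2E f : sqL2 L f = (\int[mu2]_(p in square L) ((f p.1 p.2) ^+ 2)%:E)%E.
Proof. by []. Qed.

Lemma measurable_bas D m n : measurable D -> measurable_fun D (fun p : R * R => bas L m n p.1 p.2).
Proof.
move=> mD; apply: (measurable_funS measurableT) => //.
apply: measurable_funM; apply: measurableT_comp => //.
- exact: measurable_e1.
- exact: measurable_e1.
Qed.

Lemma L2on_bas m n : L2on mu2 (square L) (fun p => bas L m n p.1 p.2).
Proof.
apply: (@bounded_L2on _ _ _ _ _ _ _ 4) => //.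
- exact: measurable_square.
- exact: leb2_square_fin.
- by apply: measurable_bas; exact: measurable_square.
- by move=> x _; exact: abs_bas_le.
Qed.

Lemma e1_integrable m : mu.-integrable `]0, L[ (EFin \o e1 L m).
Proof.
apply: L2on_int; first exact: measurable_itv.
  by rewrite [X in (X < _)%E]leb_itv0 ltry.
apply: (@bounded_L2on _ _ _ _ _ _ _ 2); first exact: measurable_itv.
- by rewrite [X in (X < _)%E]leb_itv0 ltry.
- by apply: measurable_e1; exact: measurable_itv.
- by move=> x _; exact: abs_e1_le.
Qed.

(** For m <> 0 the multiple [k * e1 L m] is the derivative of the L-periodic function [e1 L (- m)],
    so its integral over a period is 0. *)
Lemma int_e1 m : (\int[mu]_(x in `]0%R, L[) e1 L m x)%R = L *+ (m == 0).
Proof.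
have [->|m0] := eqVneq m 0.
  rewrite mulr1n.
  transitivity (\int[mu]_(x in `]0%R, L[) cst (1 : R) x)%R.
    by apply: eq_Rintegral => x _; rewrite e10.
  rewrite Rintegral_cst; last exact: measurable_itv.
  by rewrite mul1r; exact: (congr1 fine leb_itv0).
pose k : R := om L * (- m)%:~R.
have k0 : k != 0.
  by rewrite /k mulf_neq0// ?intr_eq0 ?oppr_eq0// /om mulf_neq0 ?invr_eq0 ?gt_eqF// mulr_gt0// pi_gt0.
have fi : mu.-integrable `[0, L] (EFin \o (fun x => k * e1 L m x)).
  apply: continuous_compact_integrable; first exact: segment_compact.
  apply: continuous_subspaceT => x.
  by apply: cvgM; [exact: cvg_cst|exact: continuous_e1].
have E : (\int[mu]_(x in `[0%R, L]) (k * e1 L m x))%R = 0.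
  rewrite /Rintegral (@continuous_FTC2 _ _ (e1 L (- m)) 0 L)//=.
  - by rewrite -[X in e1 L _ X]add0r e1D// subrr.
  - by apply: continuous_subspaceT => x; apply: cvgM; [exact: cvg_cst|exact: continuous_e1].
  - split.
    + by move=> x _; exact: (ex_derive (is_derive := is_derive_e1 L (- m) x)).
    + by apply: cvg_at_right_filter; exact: continuous_e1.
    + by apply: cvg_at_left_filter; exact: continuous_e1.
  - move=> x _; rewrite derive1E (derive_val (is_derive := is_derive_e1 L (- m) x)).
    by rewrite opprK.
rewrite mulr0n; apply/eqP; rewrite -(mulrI_eq0 _ (lregP k0)); apply/eqP.
have sub : (`]0, L[ : set R) `<=` `[0, L] by exact: subset_itv_oo_cc.
rewrite -RintegralZl//; last exact: e1_integrable.
rewrite -[RHS]E -Rintegral_itv_bndo_bndc; last first.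
  by apply: (integrableS _ _ _ fi) => //; exact: subset_itv_co_cc.
rewrite -Rintegral_itv_obnd_cbnd//.
by apply: (integrableS _ _ _ fi) => //; exact: subset_itv_co_cc.
Qed.

Lemma int_e1M m n :
  (\int[mu]_(x in `]0%R, L[) (e1 L m x * e1 L n x))%R = L *+ (m == n).
Proof.
have ii k := e1_integrable k.
have iD f g := @RintegralD _ _ _ mu (itv0 L) f g mI.
have iB f g := @RintegralB _ _ _ mu (itv0 L) f g mI.
have i1 := integrableD mI (ii (m - n)) (ii (n - m)).
have i2 := integrableD mI i1 (ii (m + n)).
have i3 := integrableB mI i2 (ii (- (m + n))).
transitivity (2^-1 * (L *+ (m - n == 0) + L *+ (n - m == 0) + L *+ (m + n == 0) - L *+ (- (m + n) == 0))).
  rewrite -!int_e1 -iD// -iD// -iB// -RintegralZl//.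
  by apply: eq_Rintegral => x _; rewrite e1_mul.
rewrite !subr_eq0 oppr_eq0 (eq_sym n m) addrK.
by case: eqP => _; rewrite ?mulr1n ?mulr0n; field.
Qed.

Lemma e1M_integrable m n : mu.-integrable (itv0 L) (EFin \o (fun x => e1 L m x * e1 L n x)).
Proof.
apply: (@integrable_mul_bounded _ _ _ _ _ _ _ 2) => //.
- exact: e1_integrable.
- exact: measurable_e1.
- by move=> *; exact: abs_e1_le.
Qed.

Lemma ip_bas (i j : int * int) :
  ip mu2 (square L) (fun p => bas L i.1 i.2 p.1 p.2) (fun p => bas L j.1 j.2 p.1 p.2)
  = (L ^+ 2) *+ (i == j).
Proof.
case: i j => [m n] [m' n'] /=.
have fi := L2on_mul_int measurable_square (L2on_bas m n) (L2on_bas m' n').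
rewrite /ip (Rfubini_l (m1 := mu) (m2 := mu) mI mI fi)/=.
transitivity (\int[mu]_(x in itv0 L) ((L *+ (n == n')) * (e1 L m x * e1 L m' x)))%R.
  apply: eq_Rintegral => x _; rewrite -int_e1M mulrC -RintegralZl//.
    by apply: eq_Rintegral => y _; rewrite /bas; ring.
  exact: e1M_integrable.
rewrite RintegralZl//; last exact: e1M_integrable.
by rewrite int_e1M xpair_eqE; case: (m == m'); case: (n == n') => /=; rewrite ?mulr1n ?mulr0n ?mulr0 ?mul0r ?expr2.
Qed.

Lemma ae_forall_int d (T : measurableType d) (m : {measure set T -> \bar R})
    (P : int -> T -> Prop) :
  (forall n, {ae m, forall x, P n x}) -> {ae m, forall x, forall n, P n x}.
Proof.
move=> h; have h1 := ae_foralln (fun n => h (Posz n)).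
have h2 := ae_foralln (fun n => h (Negz n)).
by apply: filterS2 h1 h2 => x p q [n|n]; [exact: p|exact: q].
Qed.

(** The partial integrals [H n] have vanishing coefficients, so for almost every x all of them
    vanish at once, n being countable. Then [complete1] applies to almost every section of h, and
    Tonelli assembles the sections. *)
Lemma complete2 (h : R * R -> R) : mu2.-integrable (square L) (EFin \o h) ->
  (forall m n, (\int[mu2]_(p in square L) (h p * bas L m n p.1 p.2))%R = 0) ->
  {ae mu2, forall p, square L p -> h p = 0}.
Proof.
move=> hi h0.
have mh : measurable_fun (square L) h by apply/measurable_EFinP; exact: measurable_int hi.
have mh' : measurable_fun (itv0 L `*` itv0 L) h by [].
have hn n : mu2.-integrable (square L) (EFin \o (fun p => h p * e1 L n p.2)).
  apply: (@integrable_mul_bounded _ _ _ _ _ _ _ 2) => //.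
  - exact: measurable_square.
  - by apply: (measurable_funS measurableT) => //; apply: measurableT_comp => //; exact: measurable_e1.
  - by move=> p _; exact: abs_e1_le.
pose H n x := (\int[mu]_(y in itv0 L) (h (x, y) * e1 L n y))%R.
have Hi n : mu.-integrable (itv0 L) (EFin \o H n).
  exact: (Rfubini_int_l (m1 := mu) (m2 := mu) mI mI (hn n)).
have HE m n : (\int[mu]_(x in itv0 L) (H n x * e1 L m x))%R = 0.
  rewrite -(h0 m n).
  have gi : mu2.-integrable (square L) (EFin \o (fun p => h p * bas L m n p.1 p.2)).
    apply: (@integrable_mul_bounded _ _ _ _ _ _ _ 4) => //.
    - exact: measurable_square.
    - by apply: measurable_bas; exact: measurable_square.
    - by move=> p _; exact: abs_bas_le.
  rewrite (Rfubini_l (m1 := mu) (m2 := mu) mI mI gi).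
  have := ae_integrable_l (m1 := mu) (m2 := mu) mI mI (hn n) => ae1.
  rewrite /Rintegral; congr fine; apply: ae_eq_integral => //.
  - apply/measurable_EFinP; apply: measurable_funM; last exact: measurable_e1.
    by apply/measurable_EFinP; exact: measurable_int (Hi n).
  - exact: measurable_int (Rfubini_int_l (m1 := mu) (m2 := mu) mI mI gi).
  move: ae1; apply: filterS => x ix xI; congr EFin.
  have {}ix := ix xI; rewrite mulrC -[LHS]RintegralZl//.
  by rewrite /Rintegral/=; congr fine; apply: eq_integral => y _ /=; rewrite /bas; congr EFin; ring.
have H0 n : {ae mu, forall x, 0 < x < L -> H n x = 0}.
  by apply: complete1 => // m; exact: HE.
have {}H0 := ae_forall_int H0.
have ae1 := ae_integrable_l (m1 := mu) (m2 := mu) mI mI hi.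
have ae2 : {ae mu, forall x, itv0 L x -> (\int[mu]_(y in itv0 L) `|h (x, y)|%:E)%E = 0%E}.
  apply: filterS2 ae1 H0 => x ix h0x xI.
  have {}ix := ix xI; have h0y := complete1 L0 ix (h0x^~ xI).
  have mix : measurable_fun (itv0 L) (fun y => (h (x, y))%:E) by exact: measurable_int ix.
  have := (ae_eq_integral_abs mu mI mix).2; apply.
  by apply: sub_ae h0y => y hy yI; rewrite /= hy.
have I0 : (\int[mu2]_(p in square L) `|h p|%:E = 0)%E.
  rewrite (tonelli_rect_l mu mu mI mI mh').
  rewrite (ae_eq_integral (cst 0%E)) ?integral0//.
  by apply: measurable_tonelli_l.
have mhE : measurable_fun (square L) (EFin \o h) by exact: measurable_int hi.
have := (ae_eq_integral_abs mu2 measurable_square mhE).1 I0.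
by apply: filterS => p hp sp; have [] := hp sp.
Qed.

End Orth.

(** * Fourier coefficients and weak derivatives *)

Section Modes.
Variables (R : realType) (L : R) (L0 : 0 < L).
Notation mu := (@lebesgue_measure R).
Notation mu2 := (@leb2m R).
Implicit Types (f g : R -> R -> R) (m n : int) (s : seq (int * int)).

(** One normalization serves all frequencies: every [bas L m n], the constant included, has squared
    norm L^2. *)
Definition mode f m n : R := L ^- 2 * dotL2 L f (bas L m n).

Definition wt m n : R := 1 + m%:~R ^+ 2 + n%:~R ^+ 2.

Lemma wt_ge1 m n : 1 <= wt m n.
Proof. by rewrite /wt -addrA lerDl addr_ge0// sqr_ge0. Qed.

Lemma in_L2P f : in_L2 L f -> L2on mu2 (square L) (fun p => f p.1 p.2).
Proof. by []. Qed.

Lemma sqL2_ge0 f : (0 <= sqL2 L f)%E.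
Proof. by rewrite sqL2E; apply: integral_ge0 => q _; rewrite lee_fin sqr_ge0. Qed.

Lemma bessel2 f s : in_L2 L f -> uniq s ->
  ((\sum_(i <- s) mode f i.1 i.2 ^+ 2)%:E <= (L ^- 2)%:E * sqL2 L f)%E.
Proof.
move=> Lf us.
have h := bessel (measurable_square L) (fun i : int * int => L2on_bas L0 i.1 i.2)
   (leb2_square_fin L0) (exprn_gt0 2 L0) (ip_bas L0) us Lf.
rewrite sqL2E -(ip_sqrE (measurable_square L) Lf) -EFinM lee_fin.
by apply: le_trans h; rewrite le_eqVlt; apply/orP; left; apply/eqP.
Qed.

Lemma dotL2_basZ f k m n : in_L2 L f ->
  dotL2 L f (fun x y => k * bas L m n x y) = k * dotL2 L f (bas L m n).
Proof.
move=> Lf; rewrite !dotL2E ipC ipZl//; last exact: L2on_bas.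
  by rewrite ipC.
exact: measurable_square.
Qed.

(** The order is even because an odd derivative would exchange m and -m. *)
Lemma mode_dx p f g m n : weak_dxy L p.*2 0 f g ->
  mode g m n = (- (om L * m%:~R) ^+ 2) ^+ p * mode f m n.
Proof.
move=> [Lf Lg h]; have := h _ (periodic_test_bas 1 m n L0).
rewrite /= iter_dx_bas addn0 -signr_odd odd_double expr0 !dotL2_basZ// !mul1r mulr1.
by rewrite /mode => <-; ring.
Qed.

Lemma mode_dy p f g m n : weak_dxy L 0 p.*2 f g ->
  mode g m n = (- (om L * n%:~R) ^+ 2) ^+ p * mode f m n.
Proof.
move=> [Lf Lg h]; have := h _ (periodic_test_bas 1 m n L0).
rewrite /= iter_dy_bas add0n -signr_odd odd_double expr0 !dotL2_basZ// !mul1r mulr1.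
by rewrite /mode => <-; ring.
Qed.

Lemma mode_lap f g m n : weak_laplacian L f g -> mode g m n = - lam L m n * mode f m n.
Proof.
move=> [Lf Lg h]; have := h _ (periodic_test_bas 1 m n L0).
have -> : (fun x y => 1 * bas L m n x y) = bas L m n by rewrite -bas1.
by rewrite laplacian_bas dotL2_basZ// /mode => <-; ring.
Qed.

Lemma modeD f g m n : in_L2 L f -> in_L2 L g ->
  mode (fun x y => f x y + g x y) m n = mode f m n + mode g m n.
Proof.
move=> Lf Lg; rewrite /mode !dotL2E ipDl ?mulrDr//; last exact: L2on_bas.
exact: measurable_square.
Qed.

Lemma modeZ k f m n : in_L2 L f -> mode (fun x y => k * f x y) m n = k * mode f m n.
Proof.
move=> Lf; rewrite /mode !dotL2E ipZl//; last exact: L2on_bas.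
  by rewrite mulrCA.
exact: measurable_square.
Qed.

Lemma mode_ae f g m n : in_L2 L f -> in_L2 L g ->
  {ae mu2, forall p, square L p -> f p.1 p.2 = g p.1 p.2} -> mode f m n = mode g m n.
Proof.
move=> Lf Lg fg; rewrite /mode !dotL2E /ip /Rintegral; congr (_ * fine _).
apply: ae_eq_integral; first exact: measurable_square.
- exact: measurable_int (L2on_mul_int (measurable_square L) Lf (L2on_bas L0 m n)).
- exact: measurable_int (L2on_mul_int (measurable_square L) Lg (L2on_bas L0 m n)).
- by apply: sub_ae fg => p h sp; rewrite /= h.
Qed.

Lemma mode_inj f g : in_L2 L f -> in_L2 L g -> (forall m n, mode f m n = mode g m n) ->
  {ae mu2, forall p, square L p -> f p.1 p.2 = g p.1 p.2}.
Proof.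
move=> Lf0 Lg0 fg; have Lf := in_L2P Lf0; have Lg := in_L2P Lg0; have Lh := L2onB (measurable_square L) Lf Lg.
have := complete2 L0 (L2on_int (measurable_square L) (leb2_square_fin L0) Lh) => H.
have {H} H0 : {ae mu2, forall p, square L p -> f p.1 p.2 - g p.1 p.2 = 0}.
  apply: H => m n.
  transitivity (dotL2 L f (bas L m n) - dotL2 L g (bas L m n)).
    by rewrite !dotL2E -(ipBl (measurable_square L) Lf Lg (L2on_bas L0 m n)).
  have := fg m n; rewrite /mode => /(mulfI _) ->; first by rewrite subrr.
  by rewrite invr_eq0 expf_eq0/= gt_eqF.
by apply: sub_ae H0 => p h sp; apply/eqP; rewrite -subr_eq0 h.
Qed.

Lemma sqL2_ae f g : in_L2 L f -> in_L2 L g ->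
  {ae mu2, forall p, square L p -> f p.1 p.2 = g p.1 p.2} -> sqL2 L f = sqL2 L g.
Proof.
move=> /in_L2P Lf /in_L2P Lg fg; rewrite !sqL2E; apply: ae_eq_integral; first exact: measurable_square.
- by have /integrableP[h _] := L2on_sqr_int Lf; exact: h.
- by have /integrableP[h _] := L2on_sqr_int Lg; exact: h.
- by apply: sub_ae fg => p h sp; rewrite /= h.
Qed.

Lemma weak_dxy0 f g : weak_dxy L 0 0 f g -> {ae mu2, forall p, square L p -> f p.1 p.2 = g p.1 p.2}.
Proof.
move=> h; have [Lf Lg _] := h; apply: mode_inj => // m n.
by rewrite (@mode_dx 0 f g)// expr0 mul1r.
Qed.

Definition cwt p : R := 3 ^+ p.*2 * (1 + (om L) ^- (4 * p)).

Lemma om_gt0 : 0 < om L.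
Proof. by rewrite /om divr_gt0// mulr_gt0// pi_gt0. Qed.

(** The weight is at most 3 times the largest of 1, m^2 and n^2, hence the factor 3^(2 p) in [cwt];
    the negative power of [om L] turns powers of the frequencies into the symbols of the pure
    derivatives of order 2 p. *)
Lemma wt_le p m n : wt m n ^+ p.*2 <= cwt p *
  (1 + ((- (om L * m%:~R) ^+ 2) ^+ p) ^+ 2 + ((- (om L * n%:~R) ^+ 2) ^+ p) ^+ 2).
Proof.
have o0 := om_gt0.
have E (k : int) : ((- (om L * k%:~R) ^+ 2) ^+ p) ^+ 2 = om L ^+ (4 * p) * (k%:~R ^+ 2) ^+ p.*2.
  rewrite -!exprM mulnC exprM sqrrN -!exprM -mul2n mulnA exprMn.
  by [].
rewrite !E /cwt; set a := (m%:~R : R) ^+ 2; set b := (n%:~R : R) ^+ 2.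
have a0 : 0 <= a by rewrite sqr_ge0.
have b0 : 0 <= b by rewrite sqr_ge0.
have S : wt m n ^+ p.*2 <= 3 ^+ p.*2 * (1 + a ^+ p.*2 + b ^+ p.*2).
  rewrite /wt -/a -/b; have [h|h] := leP a b.
  - have [h1|h1] := leP 1 b.
      apply: (@le_trans _ _ ((3 * b) ^+ p.*2)).
        by apply: lerXn2r; rewrite ?nnegrE; lra.
      by rewrite exprMn ler_wpM2l ?exprn_ge0// lerDr addr_ge0// exprn_ge0.
    apply: (@le_trans _ _ ((3 * 1) ^+ p.*2)).
      by apply: lerXn2r; rewrite ?nnegrE; lra.
    by rewrite exprMn expr1n ler_wpM2l ?exprn_ge0// -addrA lerDl addr_ge0// exprn_ge0.
  - have [h1|h1] := leP 1 a.
      apply: (@le_trans _ _ ((3 * a) ^+ p.*2)).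
        by apply: lerXn2r; rewrite ?nnegrE; lra.
      by rewrite exprMn ler_wpM2l ?exprn_ge0// addrAC lerDr addr_ge0// exprn_ge0.
    apply: (@le_trans _ _ ((3 * 1) ^+ p.*2)).
      by apply: lerXn2r; rewrite ?nnegrE; lra.
    by rewrite exprMn expr1n ler_wpM2l ?exprn_ge0// -addrA lerDl addr_ge0// exprn_ge0.
apply: le_trans S _; rewrite -mulrA ler_wpM2l ?exprn_ge0//.
have A0 : 0 <= a ^+ p.*2 by rewrite exprn_ge0.
have B0 : 0 <= b ^+ p.*2 by rewrite exprn_ge0.
have o4 : 0 < om L ^+ (4 * p) by rewrite exprn_gt0.
move: (a ^+ _) (b ^+ _) A0 B0 => A B A0 B0.
have -> : (1 + om L ^- (4 * p)) * (1 + om L ^+ (4 * p) * A + om L ^+ (4 * p) * B) =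
  1 + A + B + (om L ^- (4 * p) + om L ^+ (4 * p) * A + om L ^+ (4 * p) * B).
  by field; rewrite gt_eqF.
by rewrite lerDl !addr_ge0// ?mulr_ge0// ?invr_ge0 ltW.
Qed.

Lemma cwt_ge0 p : 0 <= cwt p.
Proof. by rewrite /cwt mulr_ge0// ?exprn_ge0// addr_ge0// invr_ge0 exprn_ge0// ltW// om_gt0. Qed.

(** By [wt_le], Bessel's inequality for f and its two pure derivatives of order 2 p already bounds
    the full weighted sum. *)
Lemma Hr_bessel p f g0 gx gy s : weak_dxy L 0 0 f g0 -> weak_dxy L p.*2 0 f gx ->
  weak_dxy L 0 p.*2 f gy -> uniq s ->
  ((\sum_(i <- s) wt i.1 i.2 ^+ p.*2 * mode f i.1 i.2 ^+ 2)%:E <=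
     (cwt p * L ^- 2)%:E * (sqL2 L g0 + sqL2 L gx + sqL2 L gy))%E.
Proof.
move=> h0 hx hy us; have [Lf Lg0 _] := h0; have [_ Lgx _] := hx; have [_ Lgy _] := hy.
have b0 := bessel2 Lg0 us; have bx := bessel2 Lgx us; have by_ := bessel2 Lgy us.
move: (sqL2_ge0 g0) (sqL2_ge0 gx) (sqL2_ge0 gy) b0 bx by_.
move: (sqL2 L g0) (sqL2 L gx) (sqL2 L gy) => A B C A0 B0 C0 b0 bx by_.
have i0 : 0 <= L ^- 2 by rewrite invr_ge0 exprn_ge0// ltW.
have H : ((\sum_(i <- s) mode g0 i.1 i.2 ^+ 2)%:E + (\sum_(i <- s) mode gx i.1 i.2 ^+ 2)%:E +
   (\sum_(i <- s) mode gy i.1 i.2 ^+ 2)%:E <= (L ^- 2)%:E * (A + B + C))%E.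
  by rewrite !ge0_muleDr ?adde_ge0// leeD// leeD.
rewrite EFinM -muleA; apply: le_trans (lee_wpmul2l _ H); last by rewrite lee_fin cwt_ge0.
rewrite -!EFinD -EFinM lee_fin -!big_split mulr_sumr/=; apply: ler_sum => i _.
rewrite (mode_dx _ _ hx) (mode_dy _ _ hy) (@mode_dx 0 f g0)// expr0 mul1r.
have M0 := sqr_ge0 (mode f i.1 i.2).
apply: le_trans (ler_wpM2r M0 (wt_le p i.1 i.2)) _.
by rewrite le_eqVlt; apply/orP; left; apply/eqP; ring.
Qed.

End Modes.

(** * Coefficients of time-dependent functions *)

Section SpaceTimeModes.
Variables (R : realType) (L T : R) (L0 : 0 < L) (T0 : 0 < T).
Notation mu := (@lebesgue_measure R).
Notation mu2 := (@leb2m R).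
Notation mu3 := (mu2 \x mu)%E.
Implicit Types (u v : R -> R -> R -> R).

Definition cyl v : measurableTypeR R * measurableTypeR R * measurableTypeR R -> R :=
  fun p => v p.1.1 p.1.2 p.2.

Let mS := @measurable_square R L.
Let mI : measurable (itv0 T : set (measurableTypeR R)). Proof. exact: measurable_itv0. Qed.

Lemma measurable_cylinder :
  measurable (cylinder L T : set (measurableTypeR R * measurableTypeR R * measurableTypeR R)).
Proof. exact: measurableX. Qed.

Lemma leb3_cylinder : (mu3 (cylinder L T) < +oo)%E.
Proof.
have -> : mu3 (cylinder L T) = (mu2 (square L) * mu (itv0 T))%E by exact: product_measure1E.
rewrite [X in (X * _)%E](leb2_square L0) [X in (_ * X)%E](leb_itv0 T0) -EFinM.
exact: ltry.
Qed.

Lemma measurable_sqL2 v : jointly_measurable L T v ->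
  measurable_fun (itv0 T) (fun t => sqL2 L (slice v t)).
Proof.
move=> mv; have mv2 : measurable_fun (square L `*` itv0 T) (fun p => cyl v p ^+ 2).
  exact: (@measurable_funX _ _ _ (square L `*` itv0 T) (cyl v) 2 mv).
have := measurable_tonelli_r mu2 mS mI mv2; apply: eq_measurable_fun => t _.
rewrite sqL2E; apply: eq_integral => p _.
by rewrite ger0_norm ?sqr_ge0.
Qed.

Lemma tonelli_sqL2 v : jointly_measurable L T v ->
  (\int[mu3]_(p in cylinder L T) (cyl v p ^+ 2)%:E =
   \int[mu]_(t in itv0 T) sqL2 L (slice v t))%E.
Proof.
move=> mv; have mv2 : measurable_fun (square L `*` itv0 T) (fun p => cyl v p ^+ 2).
  exact: (@measurable_funX _ _ _ (square L `*` itv0 T) (cyl v) 2 mv).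
have := tonelli_rect_r mu2 mu mS mI mv2 => h.
transitivity (\int[mu3]_(p in square L `*` itv0 T) `|cyl v p ^+ 2|%:E)%E.
  by apply: eq_integral => p _; rewrite ger0_norm ?sqr_ge0.
rewrite h; apply: eq_integral => t _; rewrite sqL2E; apply: eq_integral => p _.
by rewrite ger0_norm ?sqr_ge0.
Qed.

Definition L2cyl v := jointly_measurable L T v /\
  (\int[mu]_(t in itv0 T) sqL2 L (slice v t) < +oo)%E.

Lemma L2cylP v : L2cyl v -> L2on mu3 (cylinder L T) (cyl v).
Proof. by move=> [mv fv]; split => //; rewrite tonelli_sqL2. Qed.

Definition tmode v (i : int * int) t := mode L (slice v t) i.1 i.2.

Lemma L2cyl_bas_int v (eta : R -> R) M i : L2cyl v ->
  measurable_fun (itv0 T) eta -> (forall t, itv0 T t -> `|eta t| <= M) ->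
  mu3.-integrable (square L `*` itv0 T)
    (EFin \o (fun p => cyl v p * (bas L i.1 i.2 p.1.1 p.1.2 * eta p.2))).
Proof.
move=> Lv me eM; apply: (L2on_mul_int measurable_cylinder (L2cylP Lv)).
apply: (@bounded_L2on _ _ _ mu3 _ measurable_cylinder _ (4 * M)); first exact: leb3_cylinder.
  apply: measurable_funM.
    have h : measurable_fun setT (fun p : measurableTypeR R * measurableTypeR R => bas L i.1 i.2 p.1 p.2).
      exact: measurable_bas.
    apply: (measurable_comp measurableT _ h) => //.
    by apply: measurable_funTS; exact: measurable_fst.
  apply: (measurable_comp mI _ me) => //.
    by move=> _ [p [_ pT] <-].
  by apply: measurable_funTS; exact: measurable_snd.
move=> p [_ pT]; rewrite normrM ler_pM// ?abs_bas_le//.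
exact: eM.
Qed.

Lemma tmode_int v i : L2cyl v -> mu.-integrable (itv0 T) (EFin \o tmode v i).
Proof.
move=> Lv; have e1 t : itv0 T t -> `|cst (1 : R) t| <= 1 by rewrite /= normr1.
have gi := L2cyl_bas_int i Lv (measurable_cst _) e1.
have := integrableZl mI (L ^- 2) (Rfubini_int_r mS mI gi).
apply: eq_integrable => // t _; rewrite /= /tmode /mode EFinM; congr (_ * _)%E.
rewrite dotL2E /ip; congr (_%:E); apply: eq_Rintegral => p _.
by rewrite mulr1.
Qed.

Lemma L2cyl_slice_int v (eta : R -> R) M : L2cyl v ->
  measurable_fun (itv0 T) eta -> (forall t, itv0 T t -> `|eta t| <= M) ->
  mu2.-integrable (square L)
    (EFin \o (fun x : R * R => (\int[mu]_(t in itv0 T) (v x.1 x.2 t * eta t))%R)).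
Proof.
move=> Lv me eM; have gi0 := L2cyl_bas_int (0, 0) Lv me eM.
have := Rfubini_int_l mS mI gi0; apply: eq_integrable => // p _; congr EFin.
by apply: eq_Rintegral => t _; rewrite /cyl /bas/= !e10; ring.
Qed.

(** Moves the pairing with a time function inside the space integral, which is where [weak_dt] gives
    information: its identities hold for almost every point of the square. *)
Lemma tmode_fubini v (eta : R -> R) M i : L2cyl v ->
  measurable_fun (itv0 T) eta -> (forall t, itv0 T t -> `|eta t| <= M) ->
  (\int[mu]_(t in itv0 T) (tmode v i t * eta t))%R =
  L ^- 2 * (\int[mu2]_(p in square L) ((\int[mu]_(t in itv0 T) (v p.1 p.2 t * eta t)) * bas L i.1 i.2 p.1 p.2))%R.
Proof.
move=> Lv me eM; have e1 t : itv0 T t -> `|cst (1 : R) t| <= 1 by rewrite /= normr1.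
have gi := L2cyl_bas_int i Lv me eM.
have gi1 := L2cyl_bas_int i Lv (measurable_cst _) e1.
have gi0 := L2cyl_bas_int (0, 0) Lv me eM.
have tei : mu.-integrable (itv0 T) (EFin \o (fun t => tmode v i t * eta t)).
  exact: (integrable_mul_bounded mI (tmode_int i Lv) me eM).
have -> : (\int[mu]_(t in itv0 T) (tmode v i t * eta t))%R =
  (\int[mu]_(t in itv0 T) (L ^- 2 * \int[mu2]_(x in square L) (cyl v (x, t) * (bas L i.1 i.2 x.1 x.2 * eta t))))%R.
  rewrite /Rintegral; congr fine; apply: ae_eq_integral => //.
  - exact: measurable_int tei.
  - exact: measurable_int (integrableZl mI (L ^- 2) (Rfubini_int_r mS mI gi)).
  apply: sub_ae (ae_integrable_r mS mI gi1) => t h tT.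
  rewrite /= /tmode /mode -mulrA; congr ((_ * _)%:E).
  rewrite dotL2E /ip mulrC -RintegralZl//; last first.
    by have := h tT; apply: eq_integrable => // p _; rewrite /= mulr1.
  by apply: eq_Rintegral => p _; rewrite /cyl /slice/=; ring.
rewrite RintegralZl//; last exact: (Rfubini_int_r mS mI gi).
congr (_ * _); rewrite -(Rfubini_r mS mI gi) (Rfubini_l mS mI gi).
have mle := measurable_int _ (L2cyl_slice_int Lv me eM).
rewrite /Rintegral; congr fine; apply: ae_eq_integral => //.
- exact: measurable_int (Rfubini_int_l mS mI gi).
- apply/measurable_EFinP; apply: measurable_funM; last exact: measurable_bas.
  exact/measurable_EFinP.
apply: sub_ae (ae_integrable_l mS mI gi0) => p h sp; congr EFin.
rewrite mulrC -RintegralZl//; last first.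
  by have := h sp; apply: eq_integrable => // t _; rewrite /= /bas !e10 /cyl/=; congr EFin; ring.
by apply: eq_Rintegral => t _; rewrite /cyl/=; ring.
Qed.

Lemma weak_dt_tmode j u v (eta : R -> R) i M : L2cyl u -> L2cyl v -> weak_dt L T j u v ->
  time_test T eta -> measurable_fun (itv0 T) eta -> (forall t, itv0 T t -> `|eta t| <= M) ->
  measurable_fun (itv0 T) (derive1n j eta) ->
  (forall t, itv0 T t -> `|derive1n j eta t| <= M) ->
  (\int[mu]_(t in itv0 T) (tmode u i t * derive1n j eta t))%R =
  (-1) ^+ j * (\int[mu]_(t in itv0 T) (tmode v i t * eta t))%R.
Proof.
move=> Lu Lv [_ _ _ h] te me eM mj jM.
rewrite (tmode_fubini i Lu mj jM) (tmode_fubini i Lv me eM) mulrCA; congr (_ * _).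
have bi w (ze : R -> R) : L2cyl w -> measurable_fun (itv0 T) ze ->
    (forall t, itv0 T t -> `|ze t| <= M) -> mu2.-integrable (square L)
    (EFin \o (fun p : R * R => (\int[mu]_(t in itv0 T) (w p.1 p.2 t * ze t))%R * bas L i.1 i.2 p.1 p.2)).
  move=> Lw mz zM; apply: (integrable_mul_bounded mS (L2cyl_slice_int Lw mz zM) (M := 4)).
    exact: measurable_bas.
  by move=> *; exact: abs_bas_le.
rewrite -RintegralZl//; last exact: bi.
rewrite /Rintegral; congr fine; apply: ae_eq_integral => //.
- exact: measurable_int (bi _ _ Lu mj jM).
- exact: measurable_int (integrableZl mS ((-1) ^+ j) (bi _ _ Lv me eM)).
apply: sub_ae (h _ te) => p hp sp; have := hp sp; rewrite /Rintegral => e.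
by rewrite /= e -mulrA.
Qed.

(** A single null set of times serves all finite sums: at a good time every bound follows from the
    weak derivatives at that time. [nrm] is the squared H^(2 p) norm, and leaving [Lp] abstract
    treats square integrability and essential boundedness together. *)
Lemma Lp_Hr_modes Lp p v : Lp_Hr Lp L T p.*2 v ->
  exists nrm : R -> \bar R, [/\ Lp T nrm, measurable_fun (itv0 T) nrm,
    forall t, (0 <= nrm t)%E &
    {ae mu, forall t, 0 < t < T -> [/\ in_L2 L (slice v t), (sqL2 L (slice v t) <= nrm t)%E &
      forall s, uniq s -> ((\sum_(i <- s) wt R i.1 i.2 ^+ p.*2 * tmode v i t ^+ 2)%:E <=
        (3 * (cwt L p * L ^- 2))%:E * nrm t)%E]}].
Proof.
move=> [mv [g [mg wg Lg]]].
exists (fun t => \sum_(a < p.*2.+1) \sum_(b < p.*2.+1 | (a + b <= p.*2)%N) sqL2 L (slice (g a b) t))%E.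
split => //.
- have mm a b : measurable_fun (itv0 T)
      (fun t => if (a + b <= p.*2)%N then sqL2 L (slice (g a b) t) else 0%E).
    by case ab : (a + b <= p.*2)%N; [exact: measurable_sqL2 (mg _ _ ab)|exact: measurable_cst].
  apply: emeasurable_sum => a; under eq_fun do rewrite big_mkcond.
  by apply: emeasurable_sum => b; apply: mm.
- by move=> t; apply: sume_ge0 => a _; apply: sume_ge0 => b _; exact: sqL2_ge0.
apply: sub_ae wg => t h tT; have {}h := h tT.
have le_n a b : (a <= p.*2)%N -> (b <= p.*2)%N -> (a + b <= p.*2)%N -> (sqL2 L (slice (g a b) t) <=
   \sum_(a < p.*2.+1) \sum_(b < p.*2.+1 | (a + b <= p.*2)%N) sqL2 L (slice (g a b) t))%E.
  move=> ap bp ab; rewrite (bigD1 (Ordinal (ap : (a < p.*2.+1)%N)))//=.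
  rewrite (bigD1 (Ordinal (bp : (b < p.*2.+1)%N)))//= -addeA leeDl//.
  apply: adde_ge0; first by apply: sume_ge0 => *; exact: sqL2_ge0.
  by apply: sume_ge0 => ? _; apply: sume_ge0 => *; exact: sqL2_ge0.
have w0 := h 0%N 0%N isT.
have wx := h p.*2 0%N ltac:(by rewrite addn0).
have wy := h 0%N p.*2 ltac:(by rewrite add0n).
have n0 := le_n 0%N 0%N isT isT isT.
have nx := le_n p.*2 0%N (leqnn _) isT ltac:(by rewrite addn0).
have ny := le_n 0%N p.*2 isT (leqnn _) ltac:(by rewrite add0n).
have [Lv Lg0 _] := w0; split => //.
  by rewrite (sqL2_ae Lv Lg0 (weak_dxy0 L0 w0)).
move=> s us; have := Hr_bessel L0 w0 wx wy us.
move: n0 nx ny (sqL2_ge0 L (slice (g 0%N 0%N) t)); move: (\sum_(a < _) _)%E => n.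
move: (sqL2 L _) (sqL2 L _) (sqL2 L _) => A B C An Bn Cn A0 h1; apply: le_trans h1 _.
have k0 : 0 <= cwt L p * L ^- 2 by rewrite mulr_ge0 ?cwt_ge0// invr_ge0 exprn_ge0// ltW.
have -> : 3 * (cwt L p * L ^- 2) = (cwt L p * L ^- 2) * 3 by rewrite mulrC.
have n00 : (0 <= n)%E by apply: le_trans An.
have H : (C + B + A <= 3%:E * n)%E.
  have -> : (3%:E * n = n + n + n)%E.
    have -> : (3 : R) = 1 + 1 + 1 by ring.
    by rewrite !EFinD !ge0_muleDl ?mul1e ?adde_ge0// ?lee_fin.
  by rewrite leeD// leeD.
have -> : ((cwt L p * L ^- 2 * 3)%:E * n = (cwt L p * L ^- 2)%:E * (3%:E * n))%E.
  by rewrite muleA -EFinM.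
by apply: (lee_wpmul2l _ H); rewrite lee_fin.
Qed.

End SpaceTimeModes.

(** * Rules for derivatives on the line *)

Section RDerive.
Variable R : realType.
Implicit Types (f g : R -> R) (x a b k : R).

Lemma Rderive_ext f g x df : f =1 g -> is_derive x 1 f df -> is_derive x 1 g df.
Proof. by move=> /funext ->. Qed.

Lemma Rderive_eq f x df df' : is_derive x 1 f df -> df = df' -> is_derive x 1 f df'.
Proof. by move=> h <-. Qed.

Lemma RderiveM f g x df dg : is_derive x 1 f df -> is_derive x 1 g dg ->
  is_derive x 1 (fun y => f y * g y) (df * g x + f x * dg).
Proof.
move=> hf hg; have := is_deriveM hf hg => h; apply: is_derive_eq.
by rewrite /GRing.scale/=; ring.
Qed.

Lemma RderiveD f g x df dg : is_derive x 1 f df -> is_derive x 1 g dg ->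
  is_derive x 1 (fun y => f y + g y) (df + dg).
Proof. by move=> hf hg; exact: is_deriveD hf hg. Qed.

Lemma RderiveZ k f x df : is_derive x 1 f df -> is_derive x 1 (fun y => k * f y) (k * df).
Proof. by move=> hf; have := is_deriveZ k hf. Qed.

Lemma RderiveB f g x df dg : is_derive x 1 f df -> is_derive x 1 g dg ->
  is_derive x 1 (fun y => f y - g y) (df - dg).
Proof. by move=> hf hg; exact: is_deriveB hf hg. Qed.

Lemma Rderive_cst k x : is_derive x 1 (fun _ : R => k) 0.
Proof. exact: is_derive_cst. Qed.

Lemma Rderive_id x : is_derive x 1 (fun y : R => y) 1.
Proof. exact: is_derive_id. Qed.

Lemma Rderive_comp f g x df dg : is_derive (g x) 1 f df -> is_derive x 1 g dg ->
  is_derive x 1 (fun y => f (g y)) (df * dg).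
Proof. by move=> hf hg; exact: is_derive1_comp hf hg. Qed.

Lemma RderiveX n f x df : is_derive x 1 f df ->
  is_derive x 1 (fun y => f y ^+ n) (n%:R * f x ^+ n.-1 * df).
Proof.
move=> hf; elim: n => [|n IH].
  by rewrite mul0r mul0r; apply: Rderive_ext (Rderive_cst 1 x) => y; rewrite expr0.
apply: (@Rderive_ext (fun y => f y * f y ^+ n)); first by move=> y; rewrite exprS.
apply: Rderive_eq (RderiveM hf IH) _; case: n {IH} => [|n] /=.
  by rewrite expr0; ring.
by rewrite exprS -[n.+2%:R]natr1; ring.
Qed.

Lemma RderiveV f x df : f x != 0 -> is_derive x 1 f df ->
  is_derive x 1 (fun y => (f y)^-1) (- f x ^- 2 * df).
Proof. by move=> f0 hf; exact: is_deriveV f0 hf. Qed.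

Lemma Rderive_near f g x df : (\forall y \near x, f y = g y) -> is_derive x 1 f df ->
  is_derive x 1 g df.
Proof. exact: near_eq_is_derive. Qed.

Lemma Rderive_continuous f x df : is_derive x 1 f df -> {for x, continuous f}.
Proof.
move=> h; apply: differentiable_continuous; apply/derivable1_diffP.
exact: (ex_derive (is_derive := h)).
Qed.

Lemma Rderive_derivable f x df : is_derive x 1 f df -> derivable f x 1.
Proof. by move=> h; exact: (ex_derive (is_derive := h)). Qed.

Lemma Rderive_val f x df : is_derive x 1 f df -> derive1 f x = df.
Proof. by move=> h; rewrite derive1E (derive_val (is_derive := h)). Qed.

Lemma derivable_Rderive f x : derivable f x 1 -> is_derive x 1 f (derive1 f x).
Proof. by move=> h; rewrite derive1E; exact: DeriveDef. Qed.

Lemma Rderive_sq f C : (forall x, `|f x| <= C * x ^+ 2) -> is_derive (0 : R) 1 f 0.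
Proof.
move=> fC; have f0 : f 0 = 0.
  by have := fC 0; rewrite expr0n/= mulr0 normr_le0 => /eqP.
have h : (h^-1 *: (f (h *: (1 : R) + 0) - f 0)) @[h --> (0 : R)^'] --> (0 : R).
  apply/cvgr0Pnorm_le => e e0.
  have C1 : 0 < `|C| + 1 by rewrite ltr_wpDl.
  near=> h.
  have hn0 : h != 0 by near: h; exact: nbhs_dnbhs_neq.
  have he : `|h| <= e / (`|C| + 1) by near: h; apply: dnbhs0_le; rewrite divr_gt0.
  rewrite f0 subr0 addr0 /GRing.scale/= mulr1 normrM normfV.
  rewrite ler_pdivrMl ?normr_gt0//.
  apply: le_trans (fC h) _; rewrite -real_normK ?num_real// expr2 mulrA mulrC ler_wpM2l//.
  apply: (@le_trans _ _ ((`|C| + 1) * `|h|)).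
    by rewrite ler_wpM2r// (le_trans (ler_norm _))// lerDl.
  by rewrite mulrC -ler_pdivlMr.
apply: DeriveDef; first exact: cvgP h.
exact: (cvg_lim _ h).
Unshelve. all: by end_near. Qed.

End RDerive.

(** * Smooth compactly supported functions *)

Section Bump.
Variable R : realType.
Implicit Types (x t a b k : R) (n i j : nat).

(** The functions x^(-n) exp (-1/x), zero for x <= 0: their span is closed under differentiation and
    contains the classical flat function, the case n = 0. *)
Definition bexp n x : R := if 0 < x then x ^- n * expR (- x^-1) else 0.

Lemma bexp_ge0 n x : 0 <= bexp n x.
Proof.
rewrite /bexp; case: ifP => // x0.
by rewrite mulr_ge0 ?expR_ge0// invr_ge0 exprn_ge0// ltW.
Qed.

Lemma bexp0_le n x : x <= 0 -> bexp n x = 0.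
Proof. by rewrite /bexp ltNge => ->. Qed.

(** One term of the exponential series at 1/x. The bound by x^2 gives derivative 0 at the origin,
    the delicate point of [is_derive_bexp]. *)
Lemma bexp_le n x : bexp n x <= (n.+2)`!%:R * x ^+ 2.
Proof.
have f0 : 0 < (n.+2)`!%:R :> R by rewrite ltr0n fact_gt0.
rewrite /bexp; case: ifP => [x0|_]; last by rewrite mulr_ge0 ?sqr_ge0// ltW.
have y0 : 0 < x^-1 by rewrite invr_gt0.
have h : (x^-1) ^+ n.+2 / (n.+2)`!%:R <= expR x^-1.
  by apply: le_trans (expR_ge1Dxn n.+1 (ltW y0)); rewrite lerDr.
rewrite expRN ler_pdivrMr ?expR_gt0//.
apply: le_trans (ler_wpM2l _ h); last by rewrite mulr_ge0 ?sqr_ge0// ltW.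
rewrite le_eqVlt; apply/orP; left; apply/eqP.
rewrite exprVn -addn2 exprD; field.
by rewrite !expf_eq0/= (gt_eqF x0)/= andbF/= gt_eqF.
Qed.

Lemma is_derive_bexp n x : is_derive x 1 (bexp n) (bexp n.+2 x - n%:R * bexp n.+1 x).
Proof.
have [x0|x0|->] := ltgtP x 0.
- rewrite !bexp0_le ?ltW// mulr0 subrr.
  apply: (Rderive_near _ (Rderive_cst 0 x)).
  by near=> y; rewrite bexp0_le//; apply: ltW; near: y; exact: lt_nbhsl.
- have E : \forall y \near x, (y^-1) ^+ n * expR (- y^-1) = bexp n y.
    by near=> y; rewrite /bexp ifT ?exprVn//; near: y; exact: lt_nbhsr.
  have xn0 : x != 0 by rewrite gt_eqF.
  have dV := RderiveV (f := id) xn0 (Rderive_id x).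
  have dN : is_derive x 1 (fun y => - y^-1) (x ^- 2).
    by apply: Rderive_eq (Rderive_ext _ (RderiveZ (-1) dV)) _ => [y|]; rewrite /=; ring.
  have dE := Rderive_comp (f := expR) (g := fun y => - y^-1) (is_derive_expR (- x^-1)) dN.
  apply: (Rderive_near E); apply: Rderive_eq (RderiveM (RderiveX n dV) dE) _.
  rewrite /bexp x0; case: n {E} => [|n]; first by rewrite !expr0; field.
  by rewrite /= !exprVn !exprS; field; rewrite ?expf_neq0 ?xn0.
- rewrite !bexp0_le// mulr0 subrr; apply: (@Rderive_sq _ _ (n.+2)`!%:R) => y.
  by rewrite ger0_norm ?bexp_ge0// bexp_le.
Unshelve. all: by end_near. Qed.

Definition smooth (f : R -> R) := forall n t, derivable (derive1n n f) t 1.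

(** A class closed under differentiation, by [bump_span_derive], so that membership alone gives
    smoothness. *)
Inductive bump_span k a b : (R -> R) -> Prop :=
| BumpSpan c i j : bump_span k a b (fun t => c * (bexp i (k * (t - a)) * bexp j (k * (b - t))))
| BumpSpanD f g : bump_span k a b f -> bump_span k a b g -> bump_span k a b (fun t => f t + g t).

Lemma bump_span_derive k a b f : bump_span k a b f ->
  exists2 f', bump_span k a b f' & forall t, is_derive t 1 f (f' t).
Proof.
elim => [c i j|f1 g1 _ [f1' Ff1 df1] _ [g1' Fg1 dg1]]; last first.
  by exists (fun t => f1' t + g1' t) => [|t]; [exact: BumpSpanD|exact: RderiveD].
exists (fun t => (c * k * (bexp i.+2 (k * (t - a)) * bexp j (k * (b - t))) +
  (- (c * k * i%:R)) * (bexp i.+1 (k * (t - a)) * bexp j (k * (b - t)))) +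
  ((- (c * k)) * (bexp i (k * (t - a)) * bexp j.+2 (k * (b - t))) +
  (c * k * j%:R) * (bexp i (k * (t - a)) * bexp j.+1 (k * (b - t))))).
  by do 2 apply: BumpSpanD => //; exact: BumpSpan.
move=> t; have d1 : is_derive t 1 (fun t => k * (t - a)) k.
  by apply: Rderive_eq (RderiveZ k (RderiveB (Rderive_id t) (Rderive_cst a t))) _; ring.
have d2 : is_derive t 1 (fun t => k * (b - t)) (- k).
  by apply: Rderive_eq (RderiveZ k (RderiveB (Rderive_cst b t) (Rderive_id t))) _; ring.
have e1 := Rderive_comp (f := bexp i) (g := fun t => k * (t - a)) (is_derive_bexp i _) d1.
have e2 := Rderive_comp (f := bexp j) (g := fun t => k * (b - t)) (is_derive_bexp j _) d2.
by apply: Rderive_eq (RderiveZ c (RderiveM e1 e2)) _; ring.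
Qed.

Lemma bump_span_smooth k a b f : bump_span k a b f -> smooth f.
Proof.
move=> Ff n t; elim: n f Ff => [|n IH] f Ff.
  by rewrite /=; have [f' _ df] := bump_span_derive Ff; exact: Rderive_derivable (df t).
rewrite derive1Sn; apply: IH; have [f' Ff' df] := bump_span_derive Ff.
suff -> : derive1 f = f' by [].
by apply/funext => s; exact: Rderive_val (df s).
Qed.

(** As k grows it tends to the indicator of (a, b) and stays in [0, 1], which suits dominated
    convergence. Integer k and rational end points give a countable family of tests. *)
Definition bump k a b t := bexp 0 (k * (t - a)) * bexp 0 (k * (b - t)).

Lemma smooth_bump k a b : smooth (bump k a b).
Proof.
suff -> : bump k a b = (fun t => 1 * bump k a b t) by apply: bump_span_smooth; exact: BumpSpan.
by apply/funext => t; rewrite mul1r.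
Qed.

Lemma bump_ge0 k a b t : 0 <= bump k a b t.
Proof. by rewrite mulr_ge0 ?bexp_ge0. Qed.

Lemma bump_out k a b t : 0 <= k -> ~~ (a < t < b) -> bump k a b t = 0.
Proof.
move=> k0; rewrite negb_and -!leNgt => /orP[h|h]; rewrite /bump.
  by rewrite (@bexp0_le 0 (k * (t - a))) ?mul0r// mulr_ge0_le0// subr_le0.
by rewrite (@bexp0_le 0 (k * (b - t))) ?mulr0// mulr_ge0_le0// subr_le0.
Qed.

Lemma bexp0E x : 0 < x -> bexp 0 x = expR (- x^-1).
Proof. by rewrite /bexp => ->; rewrite expr0 invr1 mul1r. Qed.

Lemma bump_gt0 k a b t : 0 < k -> a < t < b -> 0 < bump k a b t.
Proof.
move=> k0 /andP[h1 h2]; rewrite /bump !bexp0E ?mulr_gt0 ?subr_gt0//; exact: expR_gt0.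
Qed.

Lemma bexp0_le1 x : bexp 0 x <= 1.
Proof.
have [x0|x0] := ltP 0 x; last by rewrite bexp0_le.
by rewrite bexp0E// -expR0 ler_expR oppr_le0 invr_ge0 ltW.
Qed.

Lemma bump_le1 k a b t : bump k a b t <= 1.
Proof. by rewrite -[leRHS]mulr1 ler_pM ?bexp_ge0 ?bexp0_le1. Qed.

Lemma bexp0_cvg x : 0 < x -> bexp 0 (n.+1%:R * x) @[n --> \oo] --> (1 : R).
Proof.
move=> x0; have -> : (fun n => bexp 0 (n.+1%:R * x)) = (fun n => expR (- x^-1 * n.+1%:R^-1)).
  apply/funext => n; rewrite bexp0E ?mulr_gt0//; congr expR.
  by rewrite invfM mulNr mulrC.
rewrite -[X in _ --> X]expR0; apply: continuous_cvg; first exact: continuous_expR.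
rewrite -[X in _ --> X](mulr0 (- x^-1)); apply: cvgM; first exact: cvg_cst.
exact: cvg_harmonic.
Qed.

Lemma bump_cvg a b t : bump n.+1%:R a b t @[n --> \oo] --> ((a < t < b)%R%:R : R).
Proof.
have [/andP[h1 h2]|h] := boolP (a < t < b).
  rewrite /= -[X in _ --> X](mulr1 1); apply: cvgM; apply: bexp0_cvg; by rewrite subr_gt0.
have -> : (fun n => bump n.+1%:R a b t) = (fun=> 0) by apply/funext => n; rewrite bump_out.
exact: cvg_cst.
Qed.

Lemma time_test_bump T k a b : 0 <= k -> 0 < a -> b < T -> time_test T (bump k a b).
Proof.
move=> k0 a0 bT; split; first exact: smooth_bump.
exists a, b; split => // t h; apply: bump_out => //; apply: contra h.
by move=> /andP[/ltW-> /ltW->].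
Qed.

Lemma smooth_continuous f n : smooth f -> continuous (derive1n n f).
Proof. by move=> sf t; apply: differentiable_continuous; apply/derivable1_diffP; exact: sf. Qed.

End Bump.

(** * Test functions in time and integration by parts *)

Section TimeTests.
Variables (R : realType) (T : R) (T0 : 0 < T).
Notation mu := (@lebesgue_measure R).
Implicit Types (eta f g : R -> R) (t a b : R) (n : nat).

Let mI : measurable (itv0 T : set (measurableTypeR R)). Proof. exact: measurable_itv0. Qed.

Lemma continuous_bounded01 f : continuous f -> exists M, forall t, 0 <= t <= T -> `|f t| <= M.
Proof.
move=> cf; have cT : {within `[0, T], continuous f} by exact: continuous_subspaceT.
have [c1 _ h1] := EVT_max (ltW T0) cT; have [c2 _ h2] := EVT_min (ltW T0) cT.
exists (`|f c1| + `|f c2|) => t tT.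
have tI : t \in `[0, T] by rewrite in_itv.
have := h1 t tI; have := h2 t tI => l2 l1.
have := ler_norm (f c1); have := ler_norm (- f c2); rewrite normrN => n2 n1.
have := normr_ge0 (f c1); have := normr_ge0 (f c2) => p2 p1.
by rewrite ler_norml; apply/andP; split; lra.
Qed.

Lemma continuous_measurable_itv0 f : continuous f -> measurable_fun (itv0 T) f.
Proof.
by move=> cf; apply: (measurable_funS measurableT) => //; exact: continuous_measurable_fun.
Qed.

Lemma continuous_integrable_itv0 f : continuous f -> mu.-integrable (itv0 T) (EFin \o f).
Proof.
move=> cf; have ii : mu.-integrable `[0, T] (EFin \o f).
  by apply: continuous_compact_integrable; [exact: segment_compact|exact: continuous_subspaceT].
by apply: (integrableS _ _ _ ii) => //; exact: subset_itv_oo_cc.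
Qed.

Lemma time_test_smooth eta : time_test T eta -> smooth eta. Proof. by case. Qed.

Lemma time_test_continuous eta n : time_test T eta -> continuous (derive1n n eta).
Proof. by move=> /time_test_smooth/smooth_continuous. Qed.

Lemma derive1_out f a b : (forall t, ~~ (a <= t <= b) -> f t = 0) ->
  forall t, ~~ (a <= t <= b) -> derive1 f t = 0.
Proof.
move=> f0 t h; apply: Rderive_val; apply: (Rderive_near _ (Rderive_cst 0 t)).
move: h; rewrite negb_and -!ltNge => /orP[h|h]; near=> s; rewrite f0// negb_and -!ltNge.
  by rewrite (_ : s < a)//; near: s; exact: lt_nbhsl.
by rewrite (_ : b < s) ?orbT//; near: s; exact: lt_nbhsr.
Unshelve. all: by end_near. Qed.

Lemma derive1n_out n f a b : (forall t, ~~ (a <= t <= b) -> f t = 0) ->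
  forall t, ~~ (a <= t <= b) -> derive1n n f t = 0.
Proof. by move=> f0; elim: n => [|n IH] //=; apply: derive1_out. Qed.

Lemma time_test_derive1 eta : time_test T eta -> time_test T (derive1 eta).
Proof.
move=> [sm [a [b [a0 bT out]]]]; split.
  by move=> n t; rewrite -derive1Sn; exact: sm.
by exists a, b; split => //; exact: derive1_out.
Qed.

Lemma time_test_end eta n t : time_test T eta -> ~~ (0 < t < T) -> derive1n n eta t = 0.
Proof.
move=> [sm [a [b [a0 bT out]]]] h; apply: (@derive1n_out n eta a b out).
apply: contra h => /andP[h1 h2]; apply/andP; split.
  exact: lt_le_trans h1.
exact: le_lt_trans bT.
Qed.

Lemma time_testD eta1 eta2 k : time_test T eta1 -> time_test T eta2 ->
  time_test T (fun t => eta1 t + k * eta2 t).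
Proof.
move=> [sm1 [a1 [b1 [a10 b1T out1]]]] [sm2 [a2 [b2 [a20 b2T out2]]]].
have E n : derive1n n (fun t => eta1 t + k * eta2 t) =
    (fun t => derive1n n eta1 t + k * derive1n n eta2 t).
  elim: n => [//|n IH]; rewrite derive1nS IH; apply/funext => t.
  apply: Rderive_val; apply: RderiveD; first by rewrite derive1nS; apply: derivable_Rderive; exact: sm1.
  by apply: RderiveZ; rewrite derive1nS; apply: derivable_Rderive; exact: sm2.
split.
  move=> n t; rewrite E; apply: (@Rderive_derivable _ _ _ (derive1n n.+1 eta1 t + k * derive1n n.+1 eta2 t)).
  apply: RderiveD; first by rewrite derive1nS; apply: derivable_Rderive; exact: sm1.
  by apply: RderiveZ; rewrite derive1nS; apply: derivable_Rderive; exact: sm2.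
exists (Num.min a1 a2), (Num.max b1 b2); split.
- by rewrite lt_min a10.
- by rewrite gt_max b1T.
move=> t h; rewrite out1 ?out2 ?mulr0 ?addr0//; apply: contra h => /andP[h1 h2].
- by rewrite ge_min h1 orbT/= le_max h2 orbT.
- by rewrite ge_min h1/= le_max h2.
Qed.

Lemma derive1nD n eta1 eta2 k : time_test T eta1 -> time_test T eta2 ->
  forall t, derive1n n (fun t => eta1 t + k * eta2 t) t = derive1n n eta1 t + k * derive1n n eta2 t.
Proof.
move=> [sm1 _] [sm2 _]; elim: n => [//|n IH] t; rewrite derive1nS.
have -> : derive1n n (fun t => eta1 t + k * eta2 t) =
    (fun t => derive1n n eta1 t + k * derive1n n eta2 t) by apply/funext => s; exact: IH.
apply: Rderive_val; apply: RderiveD; first by rewrite derive1nS; apply: derivable_Rderive; exact: sm1.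
by apply: RderiveZ; rewrite derive1nS; apply: derivable_Rderive; exact: sm2.
Qed.

Lemma ftc_itv0 F f : (forall t, 0 <= t <= T -> is_derive t 1 F (f t)) -> continuous f ->
  (\int[mu]_(t in itv0 T) f t)%R = F T - F 0.
Proof.
move=> dF cf.
have ii : mu.-integrable `[0, T] (EFin \o f).
  by apply: continuous_compact_integrable; [exact: segment_compact|exact: continuous_subspaceT].
have -> : (\int[mu]_(t in itv0 T) f t)%R = (\int[mu]_(t in `[0%R, T]) f t)%R.
  rewrite -Rintegral_itv_bndo_bndc; last first.
    by apply: (integrableS _ _ _ ii) => //; exact: subset_itv_co_cc.
  rewrite -Rintegral_itv_obnd_cbnd//.
  by apply: (integrableS _ _ _ ii) => //; exact: subset_itv_oo_cc.
rewrite /Rintegral (@continuous_FTC2 _ _ F 0 T)//=.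
- exact: continuous_subspaceT.
- split.
  + move=> x; rewrite in_itv/= => /andP[x0 xT]; apply: Rderive_derivable; apply: dF.
    by rewrite !ltW.
  + by apply: cvg_at_right_filter; apply: Rderive_continuous; apply: dF; rewrite lexx ltW.
  + by apply: cvg_at_left_filter; apply: Rderive_continuous; apply: dF; rewrite lexx ltW.
- move=> x; rewrite in_itv/= => /andP[x0 xT]; apply: Rderive_val; apply: dF.
  by rewrite !ltW.
Qed.

Lemma ibp_test F f eta : (forall t, 0 <= t <= T -> is_derive t 1 F (f t)) ->
  continuous F -> continuous f -> time_test T eta ->
  (\int[mu]_(t in itv0 T) (F t * derive1 eta t))%R = - (\int[mu]_(t in itv0 T) (f t * eta t))%R.
Proof.
move=> dF cF cf te; have ce := @time_test_continuous _ 0 te; have ce' := @time_test_continuous _ 1 te.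
have cfe : continuous (fun t => f t * eta t) by move=> t; apply: cvgM; [exact: cf|exact: ce].
have cFe : continuous (fun t => F t * derive1 eta t) by move=> t; apply: cvgM; [exact: cF|exact: ce'].
apply/eqP; rewrite -addr_eq0 addrC -RintegralD//; try exact: continuous_integrable_itv0.
have dFe t : 0 <= t <= T -> is_derive t 1 (fun t => F t * eta t) (f t * eta t + F t * derive1 eta t).
  move=> tT; apply: RderiveM; first exact: dF.
  by apply: derivable_Rderive; exact: (@time_test_smooth _ te 0).
have cc : continuous (fun t => f t * eta t + F t * derive1 eta t).
  by move=> t; apply: cvgD; [exact: cfe|exact: cFe].
rewrite (ftc_itv0 dFe cc); have := @time_test_end _ 0 T te; have := @time_test_end _ 0 0 te.
by rewrite /= !ltxx andbF => -> // -> //; rewrite !mulr0 subrr.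
Qed.

End TimeTests.

Lemma RMVT (R : realType) (F f : R -> R) (x y : R) : x < y ->
  (forall z, x <= z <= y -> is_derive z 1 F (f z)) ->
  exists2 z, x < z < y & F y - F x = f z * (y - x).
Proof.
move=> xy dF; have d1 : forall z, z \in `]x, y[ -> is_derive z 1 F (f z).
  by move=> z; rewrite in_itv/= => /andP[xz zy]; apply: dF; rewrite !ltW.
have cF : {within `[x, y], continuous F}.
  apply: derivable_within_continuous => z; rewrite in_itv/= => zxy.
  exact: Rderive_derivable (dF z zxy).
by have [z] := MVT xy d1 cF; rewrite in_itv/= => zxy E; exists z.
Qed.

(** * Functions determined by their tests *)

Section Fundamental.
Variables (R : realType) (T : R) (T0 : 0 < T).
Notation mu := (@lebesgue_measure R).
Implicit Types (eta f g v : R -> R) (t a b : R) (n : nat).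

Let mI : measurable (itv0 T : set (measurableTypeR R)). Proof. exact: measurable_itv0. Qed.

Lemma indic_int f x : 0 < x < T -> mu.-integrable (itv0 T) (EFin \o f) ->
  (\int[mu]_(t in itv0 T) (f t * (t < x)%R%:R))%R = (\int[mu]_(t in `]0%R, x[) f t)%R.
Proof.
move=> /andP[x0 xT] fi.
have -> : `]0, x[%classic = itv0 T `&` `]-oo, x[%classic.
  apply/seteqP; split => t /=; rewrite /itv0 /= !in_itv/=.
    by move=> /andP[-> tx]; rewrite tx (lt_trans tx).
  by move=> [/andP[-> _] ->].
rewrite Rintegral_mkcondr; apply: eq_Rintegral => t _.
rewrite /patch mem_setE in_itv/=.
by case: (t < x); rewrite ?mulr1 ?mulr0.
Qed.

Lemma itv_rat_seq (x : R) : 0 < x -> exists q r : nat -> rat, (forall n, 0 < (ratr (q n) : R) < n.+1%:R^-1) /\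
  (forall n, x - n.+1%:R^-1 < ratr (r n) < x).
Proof.
move=> x0.
have h1 n : exists q : rat, 0 < (ratr q : R) < n.+1%:R^-1.
  have [|q] := @rat_in_itvoo R 0 (n.+1%:R^-1); first by rewrite invr_gt0.
  by rewrite in_itv/= => h; exists q.
have h2 n : exists q : rat, x - n.+1%:R^-1 < ratr q < x.
  have [|q] := @rat_in_itvoo R (x - n.+1%:R^-1) x; first by rewrite gtrBl invr_gt0.
  by rewrite in_itv/= => h; exists q.
have [q hq] := choice h1; have [r hr] := choice h2.
by exists q, r.
Qed.

(** The tests are countably many, so the lemma also applies when the exceptional null set of each
    identity depends on the test. First the slope n goes to infinity, then the rational end points
    tend to 0 and x. *)
Lemma fundamental_rat f : mu.-integrable (itv0 T) (EFin \o f) ->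
  (forall (q r : rat) n, 0 < (ratr q : R) -> ratr r < T ->
     (\int[mu]_(t in itv0 T) (f t * bump n.+1%:R (ratr q) (ratr r) t))%R = 0) ->
  {ae mu, forall t, 0 < t < T -> f t = 0}.
Proof.
move=> fi f0; apply: ae0_of_primitive => // x /andP[x0 xT].
have mf : measurable_fun (itv0 T) f by apply/measurable_EFinP; exact: measurable_int fi.
have step1 (q r : rat) : 0 < (ratr q : R) -> ratr r < T ->
    (\int[mu]_(t in itv0 T) (f t * (ratr q < t < ratr r)%R%:R))%R = 0.
  move=> q0 rT.
  have h : (\int[mu]_(t in itv0 T) (f t * bump n.+1%:R (ratr q) (ratr r) t))%R @[n --> \oo] -->
      (\int[mu]_(t in itv0 T) (f t * (ratr q < t < ratr r)%R%:R))%R.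
    apply: (@Rdominated_cvg _ _ _ mu _ _ _ (fun t => `|f t|)) => //.
    - move=> n; apply: measurable_funM => //; apply: continuous_measurable_itv0 => //.
      have sb : smooth (bump n.+1%:R (ratr q : R) (ratr r)) by apply: smooth_bump.
      by apply: (@smooth_continuous _ _ 0%N sb).
    - by move=> t _; apply: cvgM; [exact: cvg_cst|exact: bump_cvg].
    - exact: (integrable_norm fi).
    - move=> n t _; rewrite normrM -[leRHS]mulr1 ler_wpM2l//.
      by rewrite ger0_norm ?bump_ge0// bump_le1.
  have h0 : (fun n => (\int[mu]_(t in itv0 T) (f t * bump n.+1%:R (ratr q) (ratr r) t))%R) = cst 0.
    by apply/funext => n; rewrite f0.
  by move: h; rewrite h0 => /cvg_lim <-//; rewrite lim_cst.
have [q [r [hq hr]]] := itv_rat_seq x0.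
rewrite -indic_int ?x0//.
have h : (\int[mu]_(t in itv0 T) (f t * (ratr (q n) < t < ratr (r n))%R%:R))%R @[n --> \oo] -->
    (\int[mu]_(t in itv0 T) (f t * (t < x)%R%:R))%R.
  apply: (@Rdominated_cvg _ _ _ mu _ _ _ (fun t => `|f t|)) => //.
  - move=> n; apply: measurable_funM => //.
    have -> : (fun t : R => (ratr (q n) < t < ratr (r n))%R%:R : R) = \1_`]ratr (q n), ratr (r n)[.
      by apply/funext => t; rewrite indicE mem_setE in_itv.
    exact: measurable_indic.
  - move=> t; rewrite /itv0/= in_itv/= => /andP[t0 tT]; apply: cvgM; first exact: cvg_cst.
    have [tx|xt] := ltP t x; last first.
      have -> : (fun n => (ratr (q n) < t < ratr (r n))%R%:R : R) = cst 0; last exact: cvg_cst.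
      apply/funext => n; case: (boolP (_ < _ < _)) => // /andP[_ h].
      by have /andP[_ h2] := hr n; have := lt_trans h h2; rewrite ltNge xt.
    apply: cvg_near_cst; near=> n.
    have /andP[_ h1] := hq n; have /andP[h2 _] := hr n.
    have e1 : n.+1%:R^-1 < t.
      by near: n; apply: (@cvgr_lt R _ _ _ _ _ (@cvg_harmonic R)).
    have e2 : n.+1%:R^-1 < x - t.
      by near: n; apply: (@cvgr_lt R _ _ _ _ _ (@cvg_harmonic R)); rewrite subr_gt0.
    by rewrite (lt_trans h1 e1)/= (_ : t < ratr (r n))//; apply: lt_trans h2; rewrite ltrBrDr addrC -ltrBrDr.
  - exact: (integrable_norm fi).
  - move=> n t _; rewrite normrM -[leRHS]mulr1 ler_wpM2l//.
    by case: (_ < _ < _); rewrite ?normr1 ?normr0.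
have h0 : (fun n => (\int[mu]_(t in itv0 T) (f t * (ratr (q n) < t < ratr (r n))%R%:R))%R) = cst 0.
  apply/funext => n; have /andP[q0 _] := hq n; have /andP[_ rx] := hr n.
  by rewrite step1// (lt_trans rx).
by move: h; rewrite h0 => /cvg_lim <-//; rewrite lim_cst.
Unshelve. all: by end_near. Qed.

Lemma fundamental f : mu.-integrable (itv0 T) (EFin \o f) ->
  (forall eta, time_test T eta -> (\int[mu]_(t in itv0 T) (f t * eta t))%R = 0) ->
  {ae mu, forall t, 0 < t < T -> f t = 0}.
Proof.
move=> fi f0; apply: fundamental_rat => // q r n q0 rT; apply: f0.
exact: time_test_bump.
Qed.

(** A violation at one point persists on a nondegenerate interval inside (0, T), also when the point
    is an end point. *)
Lemma ae_le_continuous f M : continuous f -> {ae mu, forall t, 0 < t < T -> f t <= M} ->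
  forall t, 0 <= t <= T -> f t <= M.
Proof.
move=> cf aef t tT; rewrite leNgt; apply/negP => Mf.
have : \forall s \near t, M < f s by exact: (cvgr_gt _ (cf t) _ Mf).
move=> /nbhs_ballP[e /= e0 he].
have [a [b [ab aT H]]] : exists a b, [/\ a < b, (0 <= a) && (b <= T) & forall s, a < s < b -> M < f s].
  move: tT => /andP[t0 tT].
  exists (Num.max 0 (t - e)), (Num.min T (t + e)); split.
  - rewrite gt_max !lt_min T0/= ltr_wpDl//=; apply/andP; split; lra.
  - by rewrite le_max lexx/= ge_min lexx.
  - move=> s; rewrite gt_max lt_min => /andP[/andP[_ h1] /andP[_ h2]]; apply: he.
    by rewrite /ball/= ltr_norml; apply/andP; split; lra.
have [N [mN N0 sN]] := aef.
have sub : (`]a, b[ : set R) `<=` N.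
  move=> s /=; rewrite in_itv/= => /andP[h1 h2]; apply: sN => /= h3.
  move: aT => /andP[a0 bT].
  have := h3; rewrite (le_lt_trans a0 h1) (lt_le_trans h2 bT) => /(_ isT).
  by rewrite leNgt H// h1.
have : (mu `]a, b[ <= mu N)%E by apply: le_measure; rewrite ?inE//; exact: measurable_itv.
by rewrite [X in (_ <= X)%E]N0 lebesgue_measure_itv/= lte_fin ab -EFinD lee_fin subr_le0 leNgt ab.
Qed.

Lemma ae_eq_continuous f g : continuous f -> continuous g ->
  {ae mu, forall t, 0 < t < T -> f t = g t} -> forall t, 0 <= t <= T -> f t = g t.
Proof.
move=> cf cg fg t tT; apply/eqP; rewrite eq_le; apply/andP; split.
- rewrite -subr_le0; apply: (@ae_le_continuous (fun s => f s - g s)) tT.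
    by move=> s; apply: cvgB; [exact: cf|exact: cg].
  by apply: sub_ae fg => s h sT; rewrite h// subrr.
- rewrite -subr_le0; apply: (@ae_le_continuous (fun s => g s - f s)) tT.
    by move=> s; apply: cvgB; [exact: cg|exact: cf].
  by apply: sub_ae fg => s h sT; rewrite h// subrr.
Qed.

(** Integration starts at -1 so that the derivative exists on both sides of 0, the left end of the
    time interval; freezing the argument at -1/2 keeps F continuous on the whole line. *)
Lemma antiderivative f : continuous f -> exists F, continuous F /\
  forall t, - 2^-1 < t -> is_derive t 1 F (f t).
Proof.
move=> cf; pose G t := (\int[mu]_(s in `[(-1)%R, t]) f s)%R.
have dG t : -1 < t -> is_derive t 1 G (f t).
  move=> t1; have [] := @continuous_FTC1 R f (BLeft (-1)) t (t + 1) _ _ _ (cf t).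
  - by rewrite ltrDl.
  - by apply: continuous_compact_integrable; [exact: segment_compact|exact: continuous_subspaceT].
  - by rewrite lte_fin.
  - by move=> h1 h2; rewrite -h2; apply: derivable_Rderive.
exists (fun t => G (Num.max t (- 2^-1))); split.
  move=> t; apply: (@continuous_comp _ _ _ (fun t => Num.max t (- 2^-1)) G); last first.
    by apply: Rderive_continuous; apply: dG; rewrite lt_max; apply/orP; right; lra.
  by apply: continuous_max; [exact: cvg_id|exact: cvg_cst].
move=> t t2; apply: Rderive_near; last by apply: dG; lra.
near=> s; rewrite max_l//; apply: ltW; near: s; exact: lt_nbhsr.
Unshelve. all: by end_near. Qed.

End Fundamental.

Lemma half_between (R : realType) (T : R) : 0 < T -> 0 <= T / 2 <= T /\ T / 4 < T / 2 < 3 * T / 4.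
Proof. by move=> T0; split; apply/andP; split; lra. Qed.

(** * The du Bois-Reymond lemma *)

Section DuBoisReymond.
Variables (R : realType) (T : R) (T0 : 0 < T).
Notation mu := (@lebesgue_measure R).
Implicit Types (eta f g v : R -> R) (t a b : R) (n : nat).

Let mI : measurable (itv0 T : set (measurableTypeR R)). Proof. exact: measurable_itv0. Qed.

Lemma exists_unit_test : exists2 rho, time_test T rho & (\int[mu]_(t in itv0 T) rho t)%R = 1.
Proof.
pose b := bump 1 (T / 4) (3 * T / 4).
have tb : time_test T b.
  apply: time_test_bump => //; first by rewrite divr_gt0.
  by rewrite ltr_pdivrMr// [3 * T]mulrC ltr_pM2l// ltr_nat.
have cb : continuous b by apply: (@time_test_continuous _ _ _ 0%N tb).
pose I := (\int[mu]_(t in itv0 T) b t)%R.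
have I0 : 0 <= I by apply: Rintegral_ge0 => t _; exact: bump_ge0.
have Ip : I != 0.
  apply/eqP => I00.
  have bi := continuous_integrable_itv0 T cb.
  have : {ae mu, forall t, 0 < t < T -> b t = 0}.
    have := (ae_eq_integral_abs mu mI (measurable_int _ bi)).1 _; move=> H.
    have {H} : ae_eq mu (itv0 T) (EFin \o b) (cst 0%E).
      apply: H; transitivity (\int[mu]_(t in itv0 T) (b t)%:E)%E.
        by apply: eq_integral => t _ /=; rewrite ger0_norm ?bump_ge0.
      have := I00; rewrite /I /Rintegral => h.
      by rewrite -[LHS]fineK ?h// integrable_fin_num.
    by apply: sub_ae => t h tT; have [] := h tT.
  move=> /(@ae_eq_continuous _ _ T0 b (fun=> 0) cb (@cst_continuous _ _ (0 : R))) /(_ (T / 2)) h.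
  have [h1 h2] := half_between T0.
  by have := @bump_gt0 R 1 (T / 4) (3 * T / 4) (T / 2) ltr01 h2; rewrite -/(b (T / 2)) h// ltxx.
(* Shaped as a sum so that [time_testD] covers scaling; the zero test is obtained as b - b. *)
exists (fun t => 0 + I^-1 * b t).
  apply: time_testD => //.
  have tz := @time_testD _ T b b (-1) tb tb.
  by move: tz; congr time_test; apply/funext => t; ring.
rewrite -[RHS](mulVf Ip) -RintegralZl//; last exact: continuous_integrable_itv0.
by apply: eq_Rintegral => t _; rewrite add0r.
Qed.

(** A primitive of eta is constant before the support and returns to the same constant after it,
    because the integral of eta is 0. *)
Lemma test_antiderivative eta : time_test T eta -> (\int[mu]_(t in itv0 T) eta t)%R = 0 ->
  exists2 theta, time_test T theta & derive1 theta = eta.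
Proof.
move=> te I0; have [sm [a [b [a0 bT out]]]] := te.
have ce : continuous eta by apply: (@time_test_continuous _ _ _ 0%N te).
have [F [cF dF]] := antiderivative ce.
pose c := Num.min a (T / 2).
have c0 : 0 < c by rewrite lt_min a0 divr_gt0.
(* F is an antiderivative only to the right of -1/2; cutting at 0 does no harm, as F is constant
   from there up to a. *)
pose th t := if 0 < t then F t - F 0 else 0.
have F0 t : - 2^-1 < t -> t < a -> F t = F 0.
  move=> t1 ta.
  have key x y : - 2^-1 < x -> x < y -> y < a -> F y = F x.
    move=> x1 xy ya.
    have [|z] := @RMVT R F eta x y xy.
    - by move=> z /andP[xz _]; apply: dF; exact: lt_le_trans xz.
    - move=> /andP[xz zy] h; apply/eqP; rewrite -subr_eq0 h out ?mul0r//.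
      by rewrite negb_and -!ltNge (lt_trans zy).
  have [t0|t0|->//] := ltgtP t 0; [symmetry|]; apply: key => //; lra.
have FT t : b < t -> 0 < t -> F t = F 0.
  move=> bt t0.
  have E : F T - F 0 = 0.
    have h s : 0 <= s <= T -> is_derive s 1 F (eta s) by move=> /andP[s0 _]; apply: dF; lra.
    by rewrite -[RHS]I0; symmetry; exact: (ftc_itv0 T0 h ce).
  have key x y : 0 < x -> b < x -> x < y -> F y = F x.
    move=> x1 bx xy.
    have [|z] := @RMVT R F eta x y xy.
    - by move=> z /andP[xz _]; apply: dF; lra.
    - move=> /andP[xz zy] h; apply/eqP; rewrite -subr_eq0 h out ?mul0r//.
      by rewrite negb_and -!ltNge (lt_trans bx)// orbT.
  have {E} E : F T = F 0 by apply/eqP; rewrite -subr_eq0 E.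
  rewrite -E; have [tT|tT|->//] := ltgtP t T; [symmetry|]; apply: key => //.
have dth t : is_derive t 1 th (eta t).
  have [ta|ta] := ltP t c; last first.
    have t0 : 0 < t by exact: lt_le_trans ta.
    apply: Rderive_near; last first.
      by apply: Rderive_eq (RderiveB (dF t _) (Rderive_cst (F 0) t)) (subr0 _); lra.
    by near=> s; rewrite /th ifT//; near: s; exact: lt_nbhsr.
  have ta' : t < a by move: ta; rewrite lt_min => /andP[].
  rewrite out; last by rewrite negb_and -!ltNge ta'.
  apply: (Rderive_near _ (Rderive_cst 0 t)); near=> s.
  rewrite /th; case: ifP => // s0; rewrite F0 ?subrr//; first lra.
  by near: s; exact: lt_nbhsl.
have E : derive1 th = eta by apply/funext => t; exact: Rderive_val (dth t).
exists th => //; split.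
  case=> [|n] t; first by rewrite /=; exact: Rderive_derivable (dth t).
  by rewrite derive1Sn E; exact: sm.
exists a, b; split => // t; rewrite negb_and -!ltNge /th => h; case: ifP => // t0.
by case/orP: h => h; [rewrite F0 ?subrr//; lra|rewrite FT ?subrr].
Unshelve. all: by end_near. Qed.

Lemma ibp_poly n (p : {poly R}) eta : time_test T eta ->
  (\int[mu]_(t in itv0 T) (p.[t] * derive1n n eta t))%R =
  (-1) ^+ n * (\int[mu]_(t in itv0 T) ((derivn n p).[t] * eta t))%R.
Proof.
elim: n p => [|n IH] p te; first by rewrite expr0 mul1r.
have cp (q : {poly R}) : continuous (horner q) by exact: continuous_horner.
have tn k : time_test T (derive1n k eta).
  by elim: k => [//|k IHk]; rewrite derive1nS; exact: time_test_derive1.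
rewrite derive1nS (@ibp_test _ _ T0 (horner p) (horner p^`()))//.
by rewrite IH// derivSn exprS; ring.
Qed.

(** Modulo a multiple of [rho], every test is the derivative of a test, so the pairing of f with
    n-th derivatives of tests is a constant k times their integral. A monomial of degree n pairs in
    the same way, and after subtracting it the induction hypothesis applies. *)
Lemma du_bois_reymond n f : continuous f ->
  (forall eta, time_test T eta -> (\int[mu]_(t in itv0 T) (f t * derive1n n eta t))%R = 0) ->
  exists2 p : {poly R}, (size p <= n)%N & forall t, 0 <= t <= T -> f t = p.[t].
Proof.
elim: n f => [|n IH] f cf f0.
  exists 0; first by rewrite size_poly0.
  move=> t tT; rewrite horner0.
  apply: (@ae_eq_continuous _ _ T0 f (fun=> 0) cf _ _ t tT); first exact: cst_continuous.
  by apply: fundamental => //; exact: continuous_integrable_itv0.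
have [rho tr r1] := exists_unit_test.
pose k := (\int[mu]_(t in itv0 T) (f t * derive1n n rho t))%R.
have ci g : continuous g -> mu.-integrable (itv0 T) (EFin \o g) by exact: continuous_integrable_itv0.
have ct eta m : time_test T eta -> continuous (derive1n m eta) by move=> te; apply: (@time_test_continuous _ _ _ m te).
have step eta : time_test T eta ->
    (\int[mu]_(t in itv0 T) (f t * derive1n n eta t))%R = k * (\int[mu]_(t in itv0 T) eta t)%R.
  move=> te; pose I := (\int[mu]_(t in itv0 T) eta t)%R.
  have tz := @time_testD _ T eta rho (- I) te tr.
  have cE := ct _ 0%N te; have cR := ct _ 0%N tr.
  have z0 : (\int[mu]_(t in itv0 T) (eta t + - I * rho t))%R = 0.
    rewrite RintegralD//; [|exact: ci|by apply: ci => t; apply: cvgM; [exact: cvg_cst|exact: cR]].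
    by rewrite RintegralZl ?r1//; [rewrite mulr1 addrN|exact: ci].
  have [th tth dth] := test_antiderivative tz z0.
  have := f0 th tth; rewrite derive1Sn dth.
  have cfn et : time_test T et -> continuous (fun t => f t * derive1n n et t).
    by move=> tet t; apply: cvgM; [exact: cf|exact: (ct _ n tet)].
  have -> : (\int[mu]_(t in itv0 T) (f t * derive1n n (fun t => eta t + - I * rho t) t))%R =
     (\int[mu]_(t in itv0 T) (f t * derive1n n eta t + (- I) * (f t * derive1n n rho t)))%R.
    by apply: eq_Rintegral => t _; rewrite (@derive1nD _ T n eta rho (- I) te tr t); ring.
  rewrite RintegralD//; [|by apply: ci; exact: cfn|by apply: ci => t; apply: cvgM; [exact: cvg_cst|exact: (cfn _ tr)]].
  rewrite RintegralZl//; last by apply: ci; exact: cfn.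
  by rewrite -/k -/I; lra.
(* Its n-th derivative is (-1)^n k, and n integrations by parts contribute the same sign again. *)
pose q : {poly R} := ((-1) ^+ n * k / n`!%:R) *: 'X^n.
have qn : derivn n q = ((-1) ^+ n * k)%:P.
  rewrite derivnZ derivnXn subnn expr0 ffactnn; apply/polyP => i.
  rewrite coefZ coefMn coef1 coefC; case: eqP => _; last by rewrite mul0rn mulr0.
  by rewrite mulrC mulr_natl -mulrnAr; field; rewrite pnatr_eq0 -lt0n fact_gt0.
have cq : continuous (horner q) by exact: continuous_horner.
have [||p sp fp] := IH (fun t => f t - q.[t]).
- by move=> t; apply: cvgB; [exact: cf|exact: cq].
- move=> eta te; have cn := ct _ n te.
  have -> : (\int[mu]_(t in itv0 T) ((f t - q.[t]) * derive1n n eta t))%R =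
    (\int[mu]_(t in itv0 T) (f t * derive1n n eta t - q.[t] * derive1n n eta t))%R.
    by apply: eq_Rintegral => t _; rewrite mulrBl.
  rewrite RintegralB//; last 2 first.
  + by apply: ci => t; apply: cvgM; [exact: cf|exact: cn].
  + by apply: ci => t; apply: cvgM; [exact: cq|exact: cn].
  rewrite step// ibp_poly// qn; have cE := ct _ 0%N te.
  have -> : (\int[mu]_(t in itv0 T) (((-1) ^+ n * k)%:P.[t] * eta t))%R = (-1) ^+ n * k * (\int[mu]_(t in itv0 T) eta t)%R.
    transitivity (\int[mu]_(t in itv0 T) ((-1) ^+ n * k * eta t))%R.
      by apply: eq_Rintegral => t _; rewrite hornerC.
    by apply: RintegralZl => //; exact: ci.
  rewrite !mulrA -expr2 -exprM mulnC exprM sqrrN expr1n expr1n mul1r.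
  by rewrite subrr.
exists (p + q).
  rewrite (leq_trans (size_polyD _ _))// geq_max (leqW sp)/=.
  by rewrite (leq_trans (size_scale_leq _ _))// size_polyXn.
by move=> t tT; rewrite hornerD -fp// subrK.
Qed.

End DuBoisReymond.

(** Discriminant argument behind the Cauchy-Schwarz inequalities for integrals, finite sums and grid
    functions. *)
Lemma quadratic_ge0 (R : realFieldType) (a b c : R) : 0 <= c ->
  (forall k, 0 <= a - 2 * k * b + k ^+ 2 * c) -> b ^+ 2 <= a * c.
Proof.
move=> c0 h; have [c00|cn] := eqVneq c 0.
  have [->|bn] := eqVneq b 0; first by rewrite c00 expr0n mulr0.
  (* With c = 0 the quadratic is linear in k, and this k gives it the value -1. *)
  have := h ((a + 1) / (2 * b)).
  have -> : a - 2 * ((a + 1) / (2 * b)) * b + ((a + 1) / (2 * b)) ^+ 2 * c = - 1.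
    by rewrite c00; field.
  by rewrite oppr_ge0 ler10.
have cp : 0 < c by rewrite lt_def cn.
have -> : a * c = b ^+ 2 + (a - 2 * (b / c) * b + (b / c) ^+ 2 * c) * c by field.
by rewrite lerDl mulr_ge0.
Qed.

Section CauchySchwarz.
Context d (T : measurableType d) (R : realType) (mu : {measure set T -> \bar R}).
Variables (D : set T) (mD : measurable D).

Lemma cauchy_schwarz f g : L2on mu D f -> L2on mu D g ->
  ip mu D f g ^+ 2 <= ip mu D f f * ip mu D g g.
Proof.
move=> Lf Lg; apply: quadratic_ge0 => [|k]; first exact: ip_ge0.
have Lk := L2onZ mD k Lg; have Lh := L2onB mD Lf Lk.
have := ip_ge0 mu D (fun x => f x - k * g x).
rewrite ipBl// !(ipC _ _ _ (fun x => f x - k * g x)) !ipBl// !ipZl//.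
rewrite (ipC _ _ f (fun x => k * g x)) (ipC _ _ g (fun x => k * g x)) !ipZl// (ipC _ _ g f).
by congr (_ <= _); ring.
Qed.

End CauchySchwarz.

(** * Primitives of square-integrable functions *)

Section Primitive.
Variables (R : realType) (T : R) (T0 : 0 < T).
Notation mu := (@lebesgue_measure R).
Implicit Types (eta f g v : R -> R) (r t : R).

Let mI : measurable (itv0 T : set (measurableTypeR R)). Proof. exact: measurable_itv0. Qed.

(** The cut at t sits in the integrand, so that integrability is always discussed on the fixed
    interval (0, T). *)
Definition prim f t : R := (\int[mu]_(x in itv0 T) (f x * (x <= t)%R%:R))%R.

Let ind r t : measurableTypeR R -> R := fun x => (r < x <= t)%R%:R.

Let indE r t : ind r t = \1_`]r, t].
Proof. by apply/funext => x; rewrite indicE mem_setE in_itv. Qed.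

Let ind01 r t x : `|ind r t x| <= 1.
Proof. by rewrite /ind; case: (_ < _ <= _); rewrite ?normr1 ?normr0. Qed.

Let ind_sq r t x : ind r t x * ind r t x = ind r t x.
Proof. by rewrite /ind; case: (_ < _ <= _); rewrite ?mulr1 ?mulr0. Qed.

Let mind r t : measurable_fun (itv0 T) (ind r t).
Proof. by rewrite indE; exact: measurable_indic. Qed.

Lemma itv0_fin : (mu (itv0 T) < +oo)%E.
Proof. by rewrite [X in (X < _)%E](leb_itv0 T0) ltry. Qed.

Let Lind r t : L2on mu (itv0 T) (ind r t).
Proof. exact: (bounded_L2on mI itv0_fin (mind r t) (fun x _ => ind01 r t x)). Qed.

Let mle t : measurable_fun (itv0 T) (fun x : measurableTypeR R => (x <= t)%R%:R : R).
Proof.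
have -> : (fun x => (x <= t)%R%:R : R) = \1_`]-oo, t].
  by apply/funext => x; rewrite indicE mem_setE in_itv.
exact: measurable_indic.
Qed.

Let le_int f t : mu.-integrable (itv0 T) (EFin \o f) ->
  mu.-integrable (itv0 T) (EFin \o (fun x => f x * (x <= t)%R%:R)).
Proof.
move=> fi; apply: (integrable_mul_bounded (M := 1) mI fi (mle t)) => x _.
by case: (x <= t); rewrite ?normr1 ?normr0.
Qed.

Lemma primB f r t : mu.-integrable (itv0 T) (EFin \o f) -> r <= t ->
  prim f t - prim f r = (\int[mu]_(x in itv0 T) (f x * (r < x <= t)%R%:R))%R.
Proof.
move=> fi rt; rewrite /prim -RintegralB//; [|exact: le_int|exact: le_int].
apply: eq_Rintegral => x _; rewrite -mulrBr; congr (_ * _).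
have [xr|rx] := leP x r; last by rewrite subr0.
by rewrite (le_trans xr rt) subrr.
Qed.

Lemma prim_mono f r t : mu.-integrable (itv0 T) (EFin \o f) -> (forall x, 0 <= f x) -> r <= t ->
  prim f r <= prim f t.
Proof.
move=> fi f0 rt; rewrite -subr_ge0 primB//; apply: Rintegral_ge0 => x _.
by rewrite mulr_ge0.
Qed.

Lemma prim0 f : prim f 0 = 0.
Proof.
transitivity (\int[mu]_(x in itv0 T) (0 * f x))%R.
  apply: eq_Rintegral => x; rewrite inE /itv0/= in_itv/= => /andP[x0 _].
  by rewrite leNgt x0 mulr0 mul0r.
rewrite /Rintegral integral0_eq// => x _; by rewrite mul0r.
Qed.

Lemma primT f : prim f T = (\int[mu]_(x in itv0 T) f x)%R.
Proof.
apply: eq_Rintegral => x.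
by rewrite inE /itv0/= in_itv/= => /andP[_ xT]; rewrite ltW// mulr1.
Qed.

Lemma ind_measure r t : r <= t -> ip mu (itv0 T) (ind r t) (ind r t) <= t - r.
Proof.
move=> rt; rewrite -lee_fin ip_sqrE//.
have -> : (\int[mu]_(x in itv0 T) (ind r t x ^+ 2)%:E = \int[mu]_(x in itv0 T) (\1_`]r, t] x)%:E)%E.
  by apply: eq_integral => x _; rewrite expr2 ind_sq indE.
rewrite integral_indic//; apply: (@le_trans _ _ (mu `]r, t])).
  by apply: le_measure; rewrite ?inE//; apply: measurableI.
by rewrite lebesgue_measure_itv/= lte_fin; case: ltP => // _; rewrite lee_fin subr_ge0.
Qed.

(** Cauchy-Schwarz against the indicator of (r, t], whose square has integral at most t - r. *)
Lemma prim_holder v r t : L2on mu (itv0 T) v -> r <= t ->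
  (prim v t - prim v r) ^+ 2 <=
  (t - r) * (prim (fun x => v x ^+ 2) t - prim (fun x => v x ^+ 2) r).
Proof.
move=> Lv rt; have iv := L2on_int mI itv0_fin Lv; have iv2 := L2on_sqr_int Lv.
have Lvi : L2on mu (itv0 T) (fun x => v x * ind r t x).
  split; first by apply: measurable_funM; [case: Lv|exact: mind].
  have [_ Lf] := Lv; apply: le_lt_trans Lf; apply: ge0_le_integral => //.
  - by move=> x _; rewrite lee_fin sqr_ge0.
  - apply/measurable_EFinP; apply: measurable_funX; apply: measurable_funM; [by case: Lv|exact: mind].
  - by have /integrableP[] := iv2.
  - move=> x _; rewrite lee_fin exprMn -[leRHS]mulr1 ler_wpM2l ?sqr_ge0//.
    by rewrite expr2 ind_sq; apply: le_trans (ler_norm _) _.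
have := cauchy_schwarz mI Lvi (Lind r t); rewrite !primB//.
have -> : ip mu (itv0 T) (fun x => v x * ind r t x) (ind r t) =
    (\int[mu]_(x in itv0 T) (v x * (r < x <= t)%R%:R))%R.
  by apply: eq_Rintegral => x _; rewrite -mulrA ind_sq.
have -> : ip mu (itv0 T) (fun x => v x * ind r t x) (fun x => v x * ind r t x) =
    (\int[mu]_(x in itv0 T) (v x ^+ 2 * (r < x <= t)%R%:R))%R.
  by apply: eq_Rintegral => x _; rewrite mulrACA ind_sq expr2.
move=> h; apply: le_trans h _; rewrite mulrC ler_wpM2r ?ind_measure//.
by apply: Rintegral_ge0 => x _; rewrite mulr_ge0 ?sqr_ge0.
Qed.

Lemma prim_continuous v : L2on mu (itv0 T) v -> continuous (prim v).
Proof.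
move=> Lv t; pose I := (\int[mu]_(x in itv0 T) (v x ^+ 2))%R.
have iv2 := L2on_sqr_int Lv.
have key r s : r <= s -> (prim v s - prim v r) ^+ 2 <= (s - r) * I.
  move=> rs; apply: le_trans (prim_holder Lv rs) _; rewrite ler_wpM2l ?subr_ge0//.
  rewrite primB//; apply: le_Rintegral => //.
  - apply: (integrable_mul_bounded (M := 1) mI iv2 (mind r s)) => x _; exact: ind01.
  - move=> x _; rewrite -[leRHS]mulr1 ler_wpM2l ?sqr_ge0//.
    by case: (_ < _ <= _).
have I0 : 0 <= I by apply: Rintegral_ge0 => x _; rewrite sqr_ge0.
have I1 : 0 < I + 1 by rewrite ltr_pwDr.
have {}key s : (prim v t - prim v s) ^+ 2 <= `|t - s| * (I + 1).
  have [st|ts] := leP s t.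
    by rewrite ger0_norm ?subr_ge0//; apply: le_trans (key _ _ st) _; rewrite ler_wpM2l ?subr_ge0// lerDl.
  rewrite ltr0_norm ?subr_lt0// opprB -sqrrN opprB.
  by apply: le_trans (key _ _ (ltW ts)) _; rewrite ler_wpM2l ?subr_ge0 ?(ltW ts)// lerDl.
apply/cvgrPdist_lt => e e0; near=> s.
rewrite -(@ltr_pXn2r _ 2) ?nnegrE ?(ltW e0)// real_normK ?num_real//.
apply: le_lt_trans (key s) _; rewrite -ltr_pdivlMr//.
near: s; apply/nbhs_ballP; exists (e ^+ 2 / (I + 1)) => //=.
by rewrite divr_gt0// exprn_gt0.
Unshelve. all: by end_near. Qed.

(** v is only square integrable, so its primitive need not be differentiable and the product rule is
    not at hand. Fubini on the triangle x <= t replaces it: integrating the derivative of eta from x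
    to T gives - eta x. *)
Lemma prim_ibp v eta : L2on mu (itv0 T) v -> time_test T eta ->
  (\int[mu]_(t in itv0 T) (prim v t * derive1 eta t))%R = - (\int[mu]_(t in itv0 T) (v t * eta t))%R.
Proof.
move=> Lv te; have iv := L2on_int mI itv0_fin Lv.
have ce := @time_test_continuous _ T _ 0%N te; have ce' := @time_test_continuous _ T _ 1%N te.
have [M eM] := continuous_bounded01 T0 ce'.
have me' := continuous_measurable_itv0 (T := T) ce'.
have ie' := continuous_integrable_itv0 T ce'.
have mv : measurable_fun (itv0 T) v by case: Lv.
pose F (p : measurableTypeR R * measurableTypeR R) : R := v p.1 * ((p.1 <= p.2)%R%:R * derive1 eta p.2).
have mfst : measurable_fun (itv0 T `*` itv0 T) (fun p : measurableTypeR R * measurableTypeR R => v p.1).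
  apply: (measurable_comp mI _ mv); first by move=> _ [p [p1 _] <-].
  by apply: measurable_funTS; exact: measurable_fst.
have iF : (mu \x mu)%E.-integrable (itv0 T `*` itv0 T) (EFin \o F).
  apply: (@integrable_mul_bounded _ _ _ (mu \x mu)%E _ (fun p => v p.1) _ M).
  - exact: measurableX.
  - apply/integrableP; split; first exact/measurable_EFinP.
    have /= -> := tonelli_rect_l mu mu mI mI mfst.
    have -> : (\int[mu]_(x in itv0 T) \int[mu]_(y in itv0 T) `|v x|%:E =
        \int[mu]_(x in itv0 T) (T%:E * `|v x|%:E))%E.
      apply: eq_integral => x _; rewrite integral_cst// muleC; congr (_ * _)%E.
      exact: leb_itv0.
    rewrite ge0_integralZl//; last 2 first.
    + by apply/measurable_EFinP; exact: measurableT_comp.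
    + by rewrite lee_fin ltW.
    by rewrite lte_mul_pinfty ?lee_fin ?(ltW T0)//; have /integrableP[] := iv.
  - apply: measurable_funM.
      apply: (measurableT_comp (f := fun b : bool => b%:R : R)); first by [].
      by apply: measurable_fun_ler; apply: measurable_funTS; [exact: measurable_fst|exact: measurable_snd].
    apply: (measurable_comp mI _ me'); first by move=> _ [p [_ p2] <-].
    by apply: measurable_funTS; exact: measurable_snd.
  - move=> [x y] [/= _]; rewrite /itv0/= in_itv/= => /andP[y0 yT].
    rewrite normrM -[leRHS]mul1r ler_pM//; first by case: (x <= y); rewrite ?normr1 ?normr0.
    by apply: eM; rewrite !ltW.
transitivity (\int[mu]_(t in itv0 T) (\int[mu]_(x in itv0 T) F (x, t)))%R.
  apply: eq_Rintegral => t _; rewrite /prim mulrC -RintegralZl//; last exact: le_int.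
  by apply: eq_Rintegral => x _; rewrite /F/=; ring.
rewrite -(Rfubini_r mI mI iF) (Rfubini_l mI mI iF).
have -> : - (\int[mu]_(t in itv0 T) (v t * eta t))%R = (\int[mu]_(t in itv0 T) ((-1) * (v t * eta t)))%R.
  rewrite RintegralZl ?mulN1r//.
  have [N eN] := continuous_bounded01 T0 ce.
  apply: (integrable_mul_bounded (M := N) mI iv); first exact: continuous_measurable_itv0.
  by move=> x; rewrite /itv0/= in_itv/= => /andP[x0 xT]; apply: eN; rewrite !ltW.
apply: eq_Rintegral => x; rewrite inE /itv0/= in_itv/= => /andP[x0 xT].
have ii : mu.-integrable (itv0 T) (EFin \o (fun y => (x <= y)%R%:R * derive1 eta y)).
  have -> : (fun y => (x <= y)%R%:R * derive1 eta y) = (fun y => derive1 eta y * \1_`[x, +oo[ y).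
    by apply/funext => y; rewrite mulrC indicE mem_setE in_itv/= andbT.
  apply: (integrable_mul_bounded (M := 1) mI ie'); first exact: measurable_indic.
  by move=> y _; rewrite indicE; case: (_ \in _); rewrite ?normr1 ?normr0.
rewrite /F/= RintegralZl// mulrCA; congr (_ * _).
have it : mu.-integrable (itv0 T) (EFin \o (fun y => derive1 eta y * (y < x)%R%:R)).
  have -> : (fun y => derive1 eta y * (y < x)%R%:R) = (fun y => derive1 eta y * \1_`]-oo, x[ y).
    by apply/funext => y; rewrite indicE mem_setE in_itv/=.
  apply: (integrable_mul_bounded (M := 1) mI ie'); first exact: measurable_indic.
  by move=> y _; rewrite indicE; case: (_ \in _); rewrite ?normr1 ?normr0.
have -> : (\int[mu]_(y in itv0 T) ((x <= y)%R%:R * derive1 eta y))%R =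
   (\int[mu]_(y in itv0 T) (derive1 eta y - derive1 eta y * (y < x)%R%:R))%R.
  by apply: eq_Rintegral => y _; rewrite ltNge; case: (x <= y) => /=; rewrite ?mul1r ?mul0r ?mulr1 ?mulr0 ?subr0 ?subrr.
have de t : is_derive t 1 eta (derive1 eta t).
  by apply: derivable_Rderive; case: te => /(_ 0%N t).
rewrite RintegralB// indic_int ?x0//.
have h1 := @ftc_itv0 _ T T0 eta (derive1 eta) (fun t _ => de t) ce'.
have h2 := @ftc_itv0 _ x x0 eta (derive1 eta) (fun t _ => de t) ce'.
rewrite -/(itv0 x) h1 h2.
have /= e0 := @time_test_end _ T _ 0%N 0 te; have /= eT := @time_test_end _ T _ 0%N T te.
by rewrite e0 ?ltxx// eT ?ltxx ?andbF//; ring.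
Qed.

Lemma prim_ftc F f t : (forall x, 0 <= x <= T -> is_derive x 1 F (f x)) -> continuous f ->
  0 <= t <= T -> F t = F 0 + prim f t.
Proof.
move=> dF cf /andP[t0 tT].
have [->|tn] := eqVneq t 0; first by rewrite prim0 addr0.
have tp : 0 < t by rewrite lt_def tn.
have h : F t - F 0 = (\int[mu]_(x in itv0 t) f x)%R.
  by symmetry; apply: ftc_itv0 => // x /andP[x0 xt]; apply: dF; rewrite x0 (le_trans xt tT).
rewrite -[LHS](subrK (F 0)) addrC; congr (_ + _); rewrite h.
have [->|tnT] := eqVneq t T; first by rewrite primT.
have cfi : mu.-integrable (itv0 T) (EFin \o f) by exact: continuous_integrable_itv0.
have tT' : t < T by rewrite lt_neqAle tnT.
have sub : (itv0 t : set (measurableTypeR R)) `<=` itv0 T.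
  by move=> x; rewrite /itv0/= !in_itv/= => /andP[-> xt]/=; exact: lt_trans xt tT'.
rewrite Rintegral_itv_bndo_bndc; last by apply: (integrableS _ _ _ cfi) => //; exact: measurable_itv0.
have -> : `]0, t]%classic = itv0 T `&` `]-oo, t]%classic.
  apply/seteqP; split => x /=; rewrite /itv0 /= !in_itv/=.
    by move=> /andP[-> xt]; rewrite xt (le_lt_trans xt).
  by move=> [/andP[-> _] ->].
rewrite Rintegral_mkcondr; apply: eq_Rintegral => x _.
by rewrite /patch mem_setE in_itv/=; case: (x <= t); rewrite ?mulr1 ?mulr0.
Qed.

End Primitive.

(** * Classical derivatives from a weak fourth derivative *)

Section TimeChain.
Variables (R : realType) (T : R) (T0 : 0 < T).
Notation mu := (@lebesgue_measure R).
Implicit Types (eta f g v c : R -> R) (r t : R) (cs : nat -> R -> R).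

Let mI : measurable (itv0 T : set (measurableTypeR R)). Proof. exact: measurable_itv0. Qed.

Lemma time_test_derive1n n eta : time_test T eta -> time_test T (derive1n n eta).
Proof. by move=> te; elim: n => [//|n IH]; rewrite derive1nS; exact: time_test_derive1. Qed.

Lemma ibp_chain cs n eta : (forall j, continuous (cs j)) ->
  (forall j t, (j < n)%N -> 0 <= t <= T -> is_derive t 1 (cs j) (cs j.+1 t)) -> time_test T eta ->
  (\int[mu]_(t in itv0 T) (cs 0%N t * derive1n n eta t))%R =
  (-1) ^+ n * (\int[mu]_(t in itv0 T) (cs n t * eta t))%R.
Proof.
move=> cc dc te; suff H k : (k <= n)%N ->
    (\int[mu]_(t in itv0 T) (cs 0%N t * derive1n n eta t))%R =
    (-1) ^+ k * (\int[mu]_(t in itv0 T) (cs k t * derive1n (n - k) eta t))%R.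
  by rewrite (H n)// subnn.
elim: k => [_|k IH kn]; first by rewrite expr0 mul1r subn0.
rewrite IH ?(ltnW kn)// exprS -mulrA mulN1r -mulrN; congr (_ * _).
have -> : (n - k = (n - k.+1).+1)%N by lia.
rewrite derive1nS; apply: (@ibp_test _ T T0 (cs k) (cs k.+1)) => //.
- by move=> t tT; exact: dc.
- exact: time_test_derive1n.
Qed.

(** Meant for the regularity classes that bring their own weak derivative of order n: testing
    identifies it with the classical derivative already constructed. *)
Lemma weak_chain cs n w : (forall j, continuous (cs j)) ->
  (forall j t, (j < n)%N -> 0 <= t <= T -> is_derive t 1 (cs j) (cs j.+1 t)) ->
  mu.-integrable (itv0 T) (EFin \o w) ->
  (forall eta, time_test T eta -> (\int[mu]_(t in itv0 T) (cs 0%N t * derive1n n eta t))%R =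
    (-1) ^+ n * (\int[mu]_(t in itv0 T) (w t * eta t))%R) ->
  {ae mu, forall t, 0 < t < T -> w t = cs n t}.
Proof.
move=> cc dc iw h.
have ic : mu.-integrable (itv0 T) (EFin \o cs n) by exact: continuous_integrable_itv0.
have H : {ae mu, forall t, 0 < t < T -> w t - cs n t = 0}.
  apply: fundamental.
    exact: (integrableB mI iw ic).
  move=> eta te; have ce := @time_test_continuous _ T _ 0%N te.
  have [M eM] := continuous_bounded01 T0 ce.
  have me : measurable_fun (itv0 T) eta by exact: continuous_measurable_itv0.
  have bd f : mu.-integrable (itv0 T) (EFin \o f) ->
      mu.-integrable (itv0 T) (EFin \o (fun t => f t * eta t)).
    move=> fi; apply: (integrable_mul_bounded (M := M) mI fi me) => x.
    by rewrite /itv0/= in_itv/= => /andP[x0 xT]; apply: eM; rewrite !ltW.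
  transitivity (\int[mu]_(t in itv0 T) (w t * eta t - cs n t * eta t))%R.
    by apply: eq_Rintegral => t _; rewrite mulrBl.
  rewrite RintegralB//; [|exact: bd|exact: bd].
  have := h _ te; rewrite (ibp_chain cc dc te) => E.
  by apply/eqP; rewrite subr_eq0; apply/eqP; apply: (can_inj (signrMK n)); rewrite E.
by apply: sub_ae H => t h1 tT; apply/eqP; rewrite -subr_eq0 h1.
Qed.

(** Four successive primitives of v give a D with the same weak fourth derivative as c. The
    difference is a polynomial of degree at most 3, whose derivatives correct the intermediate
    primitives. The last member [cs 3] is merely a primitive of v, hence Holder but possibly not
    differentiable everywhere. *)
Lemma time_chain c v : continuous c -> L2on mu (itv0 T) v ->
  (forall eta, time_test T eta -> (\int[mu]_(t in itv0 T) (c t * derive1n 4 eta t))%R =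
    (\int[mu]_(t in itv0 T) (v t * eta t))%R) ->
  exists cs, [/\ forall j, continuous (cs j),
    forall j t, (j < 3)%N -> - 2^-1 < t -> is_derive t 1 (cs j) (cs j.+1 t),
    exists k, cs 3%N = (fun t => prim T v t + k) & forall t, 0 <= t <= T -> c t = cs 0%N t].
Proof.
move=> cc Lv h; have cA := prim_continuous T0 Lv.
have [B [cB dB]] := antiderivative cA; have [C [cC dC]] := antiderivative cB.
have [D [cD dD]] := antiderivative cC.
have [||p sp hp] := @du_bois_reymond _ T T0 4 (fun t => c t - D t).
- by move=> t; apply: cvgB; [exact: cc|exact: cD].
- move=> eta te; have ce n := @time_test_continuous _ T _ n te.
  have ci f : continuous f -> mu.-integrable (itv0 T) (EFin \o f) by exact: continuous_integrable_itv0.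
  transitivity (\int[mu]_(t in itv0 T) (c t * derive1n 4 eta t - D t * derive1n 4 eta t))%R.
    by apply: eq_Rintegral => t _; rewrite mulrBl.
  rewrite RintegralB//; last 2 first.
  + by apply: ci => t; apply: cvgM; [exact: cc|exact: (ce 4%N)].
  + by apply: ci => t; apply: cvgM; [exact: cD|exact: (ce 4%N)].
  have tt n := time_test_derive1n n te.
  have dd f F : (forall t, - 2^-1 < t -> is_derive t 1 F (f t)) ->
      forall t, 0 <= t <= T -> is_derive t 1 F (f t).
    by move=> dF t /andP[t0 _]; apply: dF; lra.
  rewrite h// !derive1nS.
  have -> := @ibp_test _ T T0 D C (derive1n 3 eta) (dd _ _ dD) cD cC (tt 3%N).
  have -> := @ibp_test _ T T0 C B (derive1n 2 eta) (dd _ _ dC) cC cB (tt 2%N).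
  have -> := @ibp_test _ T T0 B (prim T v) (derive1n 1 eta) (dd _ _ dB) cB cA (tt 1%N).
  have -> := @prim_ibp _ T T0 v eta Lv te.
  by rewrite !opprK subrr.
have dp (q : {poly R}) t : is_derive t 1 (horner q) (q^`()).[t] by exact: is_derive_poly.
pose P j : R -> R := match j with 0%N => D | 1%N => C | 2%N => B | _ => prim T v end.
exists (fun j t => P j t + (derivn j p).[t]); split.
- move=> j t; apply: cvgD; last exact: continuous_horner.
  by case: j => [|[|[|j]]]; [exact: cD|exact: cC|exact: cB|exact: cA].
- move=> j t j3 t0; have := dp (derivn j p) t; rewrite -derivnS => dj; apply: (RderiveD _ dj).
  by case: j j3 {dj} => [|[|[|//]]] _ /=; [exact: dD|exact: dC|exact: dB].
- have sp3 : (size (derivn 3 p) <= 1)%N 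
    by apply/leq_sizeP => j j1; rewrite coef_derivn nth_default ?mul0rn//; apply: leq_trans sp _; rewrite (leq_add2l 3 1 j).
  exists (derivn 3 p)`_0; apply/funext => t; congr (_ + _).
  by rewrite {1}(size1_polyC sp3) hornerC.
- by move=> t tT; rewrite /P derivn0 -hp// addrC subrK.
Qed.

End TimeChain.

Section SumCS.
Variables (R : realFieldType) (I : Type).

Lemma sum_cauchy_schwarz (s : seq I) (P : pred I) (a b : I -> R) :
  (\sum_(i <- s | P i) a i * b i) ^+ 2 <=
  (\sum_(i <- s | P i) a i ^+ 2) * (\sum_(i <- s | P i) b i ^+ 2).
Proof.
apply: quadratic_ge0 => [|k]; first by apply: sumr_ge0 => i _; rewrite sqr_ge0.
have -> : \sum_(i <- s | P i) a i ^+ 2 - 2 * k * \sum_(i <- s | P i) a i * b i +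
    k ^+ 2 * \sum_(i <- s | P i) b i ^+ 2 = \sum_(i <- s | P i) (a i - k * b i) ^+ 2.
  by rewrite !mulr_sumr -sumrB -big_split; apply: eq_bigr => i _ /=; ring.
by apply: sumr_ge0 => i _; rewrite sqr_ge0.
Qed.

End SumCS.

(** * Sums over frequency boxes *)

Section Box.
Variable R : realType.

Fixpoint ints (K : nat) : seq int :=
  if K is K'.+1 then Posz K :: - Posz K :: ints K' else [:: 0].

Lemma mem_ints K (m : int) : (m \in ints K) = (`|m| <= K)%N.
Proof.
elim: K => [|K IH]; first by rewrite /= inE; lia.
by rewrite /= !inE IH; lia.
Qed.

Lemma ints_uniq K : uniq (ints K).
Proof.
elim: K => [//|K IH]; rewrite [ints _]/= cons_uniq cons_uniq IH !inE !mem_ints; lia.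
Qed.

Definition box K : seq (int * int) := [seq (m, n) | m <- ints K, n <- ints K].

Lemma mem_box K i : (i \in box K) = (`|i.1| <= K)%N && (`|i.2| <= K)%N.
Proof.
case: i => m n; apply/allpairsP/idP => /= [[[a b] /= [aK bK [-> ->]]]|/andP[mK nK]].
  by rewrite -!mem_ints aK.
by exists (m, n); rewrite !mem_ints.
Qed.

Lemma box_uniq K : uniq (box K).
Proof. by apply: allpairs_uniq; rewrite ?ints_uniq// => -[a b] [c d]. Qed.

Lemma sum_box (f : int -> int -> R) K :
  \sum_(i <- box K) f i.1 i.2 = \sum_(m <- ints K) \sum_(n <- ints K) f m n.
Proof. by rewrite big_allpairs_dep. Qed.

Lemma sum_boxM (f g : int -> R) K :
  \sum_(i <- box K) f i.1 * g i.2 = (\sum_(m <- ints K) f m) * (\sum_(n <- ints K) g n).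
Proof.
rewrite (sum_box (fun m n => f m * g n)) mulr_suml; apply: eq_bigr => m _.
by rewrite mulr_sumr.
Qed.

(** Telescoping: the two terms of modulus k add up to 2 / (1 + k^2), which is at most 4 / k - 4 / (k
    + 1); for K = 0 there is equality. *)
Lemma sum_ints_inv K : \sum_(m <- ints K) (1 + (m%:~R : R) ^+ 2)^-1 <= 5 - 4 / K.+1%:R.
Proof.
elim: K => [|K IH]; first by rewrite big_seq1 expr0n addr0 invr1; lra.
rewrite !big_cons; apply: le_trans (lerD (lexx _) (lerD (lexx _) IH)) _.
rewrite mulrNz sqrrN -![K.+2%:R]natr1 -pmulrn; set k : R := K.+1%:R.
have k0 : 0 < k by rewrite ltr0n.
rewrite -subr_ge0.
have -> : 5 - 4 / (k + 1) - ((1 + k ^+ 2)^-1 + ((1 + k ^+ 2)^-1 + (5 - 4 / k))) =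
   2 * (2 + k ^+ 2 - k) / (k * (k + 1) * (1 + k ^+ 2)).
  by field; rewrite !gt_eqF// ?ltr_wpDr// ?exprn_ge0 ?ltW// ltr_pwDl ?exprn_ge0 ?ltW.
have nn : 0 <= 2 + k ^+ 2 - k.
  by have -> : 2 + k ^+ 2 - k = (k - 2^-1) ^+ 2 + 7 / 4; [field|rewrite addr_ge0 ?sqr_ge0].
apply: divr_ge0; first exact: mulr_ge0.
by apply: mulr_ge0; [apply: mulr_ge0|]; rewrite ?addr_ge0 ?exprn_ge0 ?ler01 ?(ltW k0).
Qed.

Lemma sum_box_wt K : \sum_(i <- box K) (wt R i.1 i.2) ^- 2 <= 25.
Proof.
apply: (@le_trans _ _ (\sum_(i <- box K) (1 + (i.1%:~R : R) ^+ 2)^-1 * (1 + (i.2%:~R : R) ^+ 2)^-1)).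
  apply: ler_sum => i _; rewrite -invfM lef_pV2 ?posrE; last 2 first.
  - by rewrite exprn_gt0// (lt_le_trans ltr01 (wt_ge1 _ _ _)).
  - by rewrite mulr_gt0// ltr_pwDl// sqr_ge0.
  rewrite /wt; have := sqr_ge0 (i.1%:~R : R); have := sqr_ge0 (i.2%:~R : R).
  move: (_ ^+ 2) => a; move: (_ ^+ 2) => b a0 b0; nra.
rewrite (sum_boxM (fun m => (1 + (m%:~R : R) ^+ 2)^-1) (fun m => (1 + (m%:~R : R) ^+ 2)^-1)).
have S5 : \sum_(m <- ints K) (1 + (m%:~R : R) ^+ 2)^-1 <= 5.
  by apply: le_trans (sum_ints_inv K) _; rewrite gerBl divr_ge0.
have S0 : 0 <= \sum_(m <- ints K) (1 + (m%:~R : R) ^+ 2)^-1.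
  by apply: sumr_ge0 => m _; rewrite invr_ge0 addr_ge0// sqr_ge0.
have -> : (25 : R) = 5 * 5 by ring.
by rewrite ler_pM.
Qed.

Lemma wt_tail K i : i \notin box K -> K.+1%:R ^+ 2 <= wt R i.1 i.2.
Proof.
rewrite mem_box negb_and -!ltnNge => h.
have key (m : int) : (K < `|m|)%N -> (K.+1%:R : R) ^+ 2 <= m%:~R ^+ 2.
  move=> Km; rewrite -[m%:~R ^+ 2]real_normK ?num_real// -intr_norm.
  by apply: lerXn2r; rewrite ?nnegrE// -[`|m|%R]abszE -pmulrn ler_nat.
rewrite /wt; have a0 := sqr_ge0 (i.1%:~R : R); have b0 := sqr_ge0 (i.2%:~R : R).
by case/orP: h => /key; lra.
Qed.

(** Cauchy-Schwarz with the factors wt^4 and wt^(-4). Of the square wt^(-8), the part wt^(-2) is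
    summable in two dimensions and wt^(-6) is at most (K + 1)^(-12) outside the box; 5 is the root
    of the bound 25. *)
Lemma sum_box_tail K J (c : int * int -> R) A :
  \sum_(i <- box J) wt R i.1 i.2 ^+ 8 * c i ^+ 2 <= A ->
  \sum_(i <- box J | i \notin box K) `|c i| <= 5 * Num.sqrt A / K.+1%:R ^+ 6.
Proof.
move=> hA; have w0 i : 0 < wt R i.1 i.2 by rewrite (lt_le_trans ltr01 (wt_ge1 _ _ _)).
have A0 : 0 <= A.
  apply: le_trans hA; apply: sumr_ge0 => i _.
  by rewrite mulr_ge0 ?sqr_ge0// exprn_ge0// ltW.
have k0 : 0 < (K.+1%:R : R) by rewrite ltr0n.
rewrite -(@ler_pXn2r _ 2) ?nnegrE ?sumr_ge0 ?divr_ge0 ?mulr_ge0 ?sqrtr_ge0 ?exprn_ge0//.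
have -> : \sum_(i <- box J | i \notin box K) `|c i| =
    \sum_(i <- box J | i \notin box K) (wt R i.1 i.2 ^+ 4 * `|c i|) * wt R i.1 i.2 ^- 4.
  by apply: eq_bigr => i _; rewrite mulrAC divff ?mul1r// expf_neq0// gt_eqF.
apply: le_trans (sum_cauchy_schwarz _ _ _ _) _.
have -> : (5 * Num.sqrt A / K.+1%:R ^+ 6) ^+ 2 = A * (25 * (K.+1%:R ^+ 2) ^- 6).
  rewrite expr_div_n exprMn sqr_sqrtr// -!exprM.
  by move: (K.+1%:R) k0 => k k0; field; rewrite gt_eqF.
apply: ler_pM; rewrite ?sumr_ge0//.
- by move=> i _; rewrite sqr_ge0.
- by move=> i _; rewrite sqr_ge0.
- apply: le_trans hA; rewrite [leRHS](bigID (fun i => i \notin box K))/= -[leLHS]addr0 lerD//.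
    by apply: ler_sum => i _; rewrite exprMn -exprM real_normK ?num_real.
  by apply: sumr_ge0 => i _; rewrite mulr_ge0 ?sqr_ge0// exprn_ge0// ltW.
- apply: (@le_trans _ _ (\sum_(i <- box J | i \notin box K) (wt R i.1 i.2 ^- 2 * (K.+1%:R ^+ 2) ^- 6))).
    apply: ler_sum => i /wt_tail; move: (wt R i.1 i.2) (w0 i) => w wp h.
    have -> : w ^- 4 ^+ 2 = w ^- 2 * w ^- 6 by field; rewrite gt_eqF.
    rewrite ler_wpM2l ?invr_ge0 ?exprn_ge0 ?(ltW wp)// lef_pV2 ?posrE ?exprn_gt0//.
    by rewrite lerXn2r ?nnegrE ?exprn_ge0 ?(ltW wp).
  rewrite -mulr_suml ler_wpM2r ?invr_ge0 ?exprn_ge0//.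
  apply: le_trans (sum_box_wt J); rewrite [leRHS](bigID (fun i => i \notin box K))/= lerDl.
  by apply: sumr_ge0 => i _; rewrite invr_ge0 exprn_ge0// ltW.
Qed.

Lemma sum_boxB (f : int * int -> R) K J : (K <= J)%N ->
  \sum_(i <- box J) f i = \sum_(i <- box K) f i + \sum_(i <- box J | i \notin box K) f i.
Proof.
move=> KJ; rewrite (bigID (fun i => i \in box K))/=; congr (_ + _).
rewrite -big_filter; apply: perm_big; apply: uniq_perm; rewrite ?filter_uniq ?box_uniq//.
move=> i; rewrite mem_filter !mem_box.
by case: (leqP `|i.1| K) => //= h1; case: (leqP `|i.2| K) => //= h2; rewrite !(leq_trans _ KJ).
Qed.

End Box.

(** * Uniform convergence of the Fourier series *)

Section Expansion.
Variables (R : realType) (L : R) (L0 : 0 < L).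
Notation mu := (@lebesgue_measure R).
Notation mu2 := (@leb2m R).
Implicit Types (f : R -> R -> R) (K J : nat).

Let mS := @measurable_square R L.

Lemma periodic_shift f (m n : int) x y : periodic_fun L f ->
  f (x + m%:~R * L) (y + n%:~R * L) = f x y.
Proof.
move=> pf; have key (g : R -> R) : (forall x, g (x + L) = g x) ->
    forall (m : int) x, g (x + m%:~R * L) = g x.
  move=> gL; have posE (k : nat) z : g (z + k%:R * L) = g z.
    by elim: k => [|k IH]; rewrite ?mul0r ?addr0// -natr1 mulrDl mul1r addrA gL.
  move=> [k|k] z; first by rewrite -pmulrn posE.
  by rewrite NegzE mulrNz mulNr -[LHS](posE k.+1) -pmulrn subrK.
rewrite (key (fun x => f x (y + n%:~R * L))); last by move=> z; case: (pf z (y + n%:~R * L)).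
by rewrite (key (f x))// => z; case: (pf x z).
Qed.

Lemma shift_itv x : exists (m : int) (z : R), 0 <= z < L /\ x = z + m%:~R * L.
Proof.
exists (Num.floor (x / L)), (x - (Num.floor (x / L))%:~R * L); split; last by rewrite subrK.
have /andP[h1 h2] := floor_itv (x / L).
rewrite subr_ge0 -ler_pdivlMr// h1/= ltrBlDr.
by move: h2; rewrite ltr_pdivrMr// intrD mulrDl mul1r addrC.
Qed.

(** After a shift by periods the point lies in [0, L)^2. Above and to the right of it a small open
    rectangle stays in the square and has positive area, so a violation cannot hide in a null
    set. *)
Lemma ae_le_square f M : continuous (fun p : R * R => f p.1 p.2) -> periodic_fun L f ->
  {ae mu2, forall p, square L p -> f p.1 p.2 <= M} -> forall x y, f x y <= M.
Proof.
move=> cf pf [N [mN N0 sN]] x0 y0; rewrite leNgt; apply/negP => Mf.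
have [m [x [xL xE]]] := shift_itv x0; have [n [y [yL yE]]] := shift_itv y0.
move: Mf; rewrite xE yE periodic_shift// => Mf.
have : \forall p \near (x, y), M < f p.1 p.2 by exact: (cvgr_gt _ (cf (x, y)) _ Mf).
move=> /nbhs_ballP[e /= e0 he].
pose x1 := Num.min L (x + e); pose y1 := Num.min L (y + e).
move: xL yL => /andP[x00 xL] /andP[y00 yL].
have xx1 : x < x1 by rewrite lt_min xL ltrDl.
have yy1 : y < y1 by rewrite lt_min yL ltrDl.
have ball1 (a b : R) : a < b < Num.min L (a + e) -> ball a e b.
  by move=> /andP[h1]; rewrite lt_min => /andP[_ h2]; rewrite /ball/= ltr_norml; apply/andP; split; lra.
have mX : measurable (`]x, x1[%classic : set (measurableTypeR R)) by exact: measurable_itv.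
have mY : measurable (`]y, y1[%classic : set (measurableTypeR R)) by exact: measurable_itv.
have sub : (`]x, x1[ `*` `]y, y1[ : set (measurableTypeR R * measurableTypeR R)) `<=` N.
  move=> [a b] /=; rewrite !in_itv/= => -[ha hb]; apply: sN => /= h3.
  have sq : square L (a, b).
    move: ha hb; rewrite /x1 /y1 !lt_min /square /itv0 /= !in_itv/=.
    move=> /andP[xa /andP[-> _]] /andP[yb /andP[-> _]].
    by rewrite (le_lt_trans x00 xa) (le_lt_trans y00 yb).
  have := h3 sq; rewrite leNgt => /negP; apply.
  by apply: (he (a, b)); split => /=; exact: ball1.
have : (mu2 (`]x, x1[ `*` `]y, y1[) <= mu2 N)%E.
  by apply: le_measure; rewrite ?inE//; exact: measurableX.
rewrite [X in (_ <= X)%E]N0.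
have -> : mu2 (`]x, x1[ `*` `]y, y1[) = (mu `]x, x1[ * mu `]y, y1[)%E by exact: product_measure1E.
rewrite !lebesgue_measure_itv/= !lte_fin xx1 yy1 -!EFinD -EFinM lee_fin.
by rewrite leNgt mulr_gt0// subr_gt0.
Qed.

Lemma continuous_bas_sum (s : seq (int * int)) (c : int * int -> R) :
  continuous (fun p : R * R => \sum_(i <- s) c i * bas L i.1 i.2 p.1 p.2).
Proof.
elim: s => [|i s IH].
  by under eq_fun do rewrite big_nil; exact: cst_continuous.
under eq_fun do rewrite big_cons.
move=> p; apply: cvgD; last exact: IH.
by apply: cvgM; [exact: cvg_cst|exact: continuous_bas].
Qed.

Lemma periodic_bas_sum (s : seq (int * int)) (c : int * int -> R) :
  periodic_fun L (fun x y => \sum_(i <- s) c i * bas L i.1 i.2 x y).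
Proof. by move=> x y; split; apply: eq_bigr => i _; rewrite /bas e1D. Qed.

(** The partial sums converge uniformly to some g with the coefficients of f, so f = g almost
    everywhere. The remainder bound for g passes to f almost everywhere, and then everywhere because
    f minus a partial sum is continuous and periodic. The factor 20 is 5 from the tail times 4 from
    the bound on [bas]. *)
Lemma mode_expansion f A : continuous (fun p : R * R => f p.1 p.2) -> periodic_fun L f ->
  in_L2 L f -> (forall K, \sum_(i <- box K) wt R i.1 i.2 ^+ 8 * mode L f i.1 i.2 ^+ 2 <= A) ->
  forall K x y, `|f x y - \sum_(i <- box K) mode L f i.1 i.2 * bas L i.1 i.2 x y| <=
    20 * Num.sqrt A / K.+1%:R ^+ 6.
Proof.
move=> cf pf Lf hA; set c := fun i : int * int => mode L f i.1 i.2.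
pose S K (p : R * R) := \sum_(i <- box K) c i * bas L i.1 i.2 p.1 p.2.
pose tau K := 20 * Num.sqrt A / K.+1%:R ^+ 6.
have dS K J p : (K <= J)%N -> `|S J p - S K p| <= tau K.
  move=> KJ; rewrite /S (sum_boxB _ KJ) addrC addKr.
  apply: le_trans (ler_norm_sum _ _ _) _.
  apply: (@le_trans _ _ (\sum_(i <- box J | i \notin box K) `|c i| * 4)).
    by apply: ler_sum => i _; rewrite normrM ler_wpM2l// abs_bas_le.
  rewrite -mulr_suml; have := @sum_box_tail R K J c A (hA J).
  rewrite /tau; move: (\sum_(_ <- _ | _) _) (K.+1%:R ^+ 6) => a b h.
  have -> : 20 * Num.sqrt A / b = 5 * Num.sqrt A / b * 4 by ring.
  by rewrite ler_wpM2r.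
have tau0 : tau K @[K --> \oo] --> (0 : R).
  have h : 20 * Num.sqrt A * (K.+1%:R^-1 ^+ 6) @[K --> \oo] --> 20 * Num.sqrt A * 0 ^+ 6.
    have h6 := cvg_comp _ _ (@cvg_harmonic R) (@exprn_continuous R 6 0).
    by apply: cvgM; [exact: cvg_cst|exact: h6].
  move: h; rewrite expr0n mulr0; under eq_fun do rewrite exprVn; exact.
have cS p : cvg (S n p @[n --> \oo]).
  apply: cauchy_cvg; apply: cauchy_exP => e e0.
  have /cvgrPdist_lt /(_ e e0) [K _ hK] := tau0.
  exists (S K p); exists K => // J /= KJ.
  by rewrite /ball/= distrC; apply: le_lt_trans (dS _ _ _ KJ) (le_lt_trans (ler_norm _) _); rewrite -normrN -sub0r; exact: (hK K (leqnn K)).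
pose g p := lim (S n p @[n --> \oo]).
have gS K p : `|g p - S K p| <= tau K.
  have h : `|S n p - S K p| @[n --> \oo] --> `|g p - S K p|.
    by apply: cvg_norm; apply: cvgB; [exact: cS|exact: cvg_cst].
  apply: (cvgr_to_le h); exists K => // J /= KJ; exact: dS.
have Lb i := L2on_bas L0 i.1 i.2; have fS := leb2_square_fin L0.
have Lc k : L2on mu2 (square L) (fun=> k).
  by apply: (@bounded_L2on _ _ _ _ _ mS _ `|k| fS).
have LS n : L2on mu2 (square L) (S n).
  by have := @L2on_sum _ _ _ mu2 (square L) mS _ (fun i p => bas L i.1 i.2 p.1 p.2) Lb (box n) c fS.
have mg : measurable_fun (square L) g.
  by apply: (measurable_fun_cvg (fun n => (LS n).1)) => p _; exact: cS.
have S0b p : `|S 0%N p| <= `|c (0, 0)| * 4.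
  by rewrite /S big_seq1 normrM ler_wpM2l// abs_bas_le.
have Sb n p : `|S n p| <= tau 0%N + `|c (0, 0)| * 4.
  by rewrite -[S n p](subrK (S 0%N p)) (le_trans (ler_normD _ _))// lerD ?S0b ?dS.
have Lg : in_L2 L (fun x y => g (x, y)).
  apply: (@bounded_L2on _ _ _ _ _ mS _ (tau 0%N + (tau 0%N + `|c (0, 0)| * 4)) fS).
    by move: mg; apply: eq_measurable_fun => -[].
  move=> p _; rewrite -surjective_pairing -[g p](subrK (S 0%N p)) (le_trans (ler_normD _ _))// lerD ?Sb//.
have mgE m n : mode L (fun x y => g (x, y)) m n = mode L f m n.
  pose i := (m, n); rewrite /mode dotL2E /=.
  have h : ip mu2 (square L) (S k) (fun p => bas L m n p.1 p.2) @[k --> \oo] -->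
      ip mu2 (square L) g (fun p => bas L m n p.1 p.2).
    apply: (@Rdominated_cvg _ _ _ _ _ _ _ (fun=> (tau 0%N + `|c (0, 0)| * 4) * 4)) => //.
    - move=> k; apply: measurable_funM; first exact: (LS k).1.
      exact: measurable_bas.
    - by move=> p _; apply: cvgM; [exact: cS|exact: cvg_cst].
    - exact: L2on_int (Lc _).
    - by move=> k p _; rewrite normrM ler_pM ?abs_bas_le.
  have E k : (maxn `|m| `|n| <= k)%N ->
      ip mu2 (square L) (S k) (fun p => bas L m n p.1 p.2) = L ^+ 2 * c i.
    rewrite geq_max => hk; rewrite (ip_suml mS Lb _ _ fS (Lb i)).
    rewrite (bigD1_seq i) ?box_uniq ?mem_box//= big1 => [|j ji].
      by rewrite addr0 (ip_bas L0 i i) eqxx mulr1n mulrC.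
    by rewrite (ip_bas L0 j i) (negbTE ji) mulr0n mulr0.
  have {h} -> : ip mu2 (square L) (fun p => g (p.1, p.2)) (fun p => bas L m n p.1 p.2) = L ^+ 2 * c i.
    transitivity (ip mu2 (square L) g (fun p => bas L m n p.1 p.2)).
      by congr ip; apply/funext => -[].
    rewrite -(cvg_lim _ h)//; apply: lim_near_cst => //.
    by exists (maxn `|m| `|n|) => // k; exact: E.
  by rewrite mulrA mulVf ?mul1r// expf_neq0// gt_eqF.
have gf := mode_inj L0 Lg Lf mgE.
move=> K; have cSK : continuous (S K) by exact: continuous_bas_sum.
have H (k : R) : `|k| = 1 -> forall x y, k * (f x y - S K (x, y)) <= tau K.
  move=> k1; apply: (@ae_le_square (fun x y => k * (f x y - S K (x, y)))).
  - move=> p; apply: cvgM; first exact: cvg_cst.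
    by apply: cvgB; [exact: cf|rewrite /= -surjective_pairing; exact: cSK].
  - move=> x y; have [h1 h2] := pf x y; have [h3 h4] := periodic_bas_sum (box K) c x y.
    by rewrite /S /= h1 h2 h3 h4.
  apply: sub_ae gf => p h sp; rewrite -h//; apply: le_trans (ler_norm _) _.
  by rewrite normrM k1 mul1r -surjective_pairing.
move=> x y; rewrite ler_norml; apply/andP; split.
  by rewrite lerNl -mulN1r; apply: H; rewrite normrN1.
by rewrite -[X in X <= _]mul1r; apply: H; rewrite normr1.
Qed.

End Expansion.

(** Lets dominated convergence, a statement on sequences, prove continuity in a real parameter. *)
Lemma seq_cvg (R : realType) (f : R -> R) (t l : R) :
  (forall u : nat -> R, u n @[n --> \oo] --> t -> f (u n) @[n --> \oo] --> l) ->
  f x @[x --> t] --> l.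
Proof.
move=> h; apply/cvgrPdist_lt => e e0; apply: contrapT => H.
have hh (n : nat) : exists s : R, `|t - s| < n.+1%:R^-1 /\ e <= `|l - f s|.
  apply: contrapT => K; apply: H; apply/nbhs_ballP.
  exists n.+1%:R^-1 => /=; first by rewrite invr_gt0.
  by move=> s ts /=; rewrite ltNge; apply/negP => es; apply: K; exists s.
have [u hu] := choice hh.
have ut : u n @[n --> \oo] --> t.
  apply/cvgrPdist_lt => d d0; near=> n; apply: lt_trans (hu n).1 _; near: n.
  exact: (@cvgr_lt R _ _ _ _ _ (@cvg_harmonic R)).
have /cvgrPdist_lt/(_ e e0) [N _ /(_ N (leqnn N))] := h u ut.
by rewrite ltNge (hu N).2.
Unshelve. all: by end_near. Qed.

(** * The continuous representative *)

Section Clip.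
Variables (R : realType) (L T : R) (L0 : 0 < L) (T0 : 0 < T).
Notation mu := (@lebesgue_measure R).
Notation mu2 := (@leb2m R).
Variable u : R -> R -> R -> R.
Hypothesis pu : forall t, 0 <= t <= T -> periodic_fun L (slice u t).
Hypothesis cu : {within [set p : R * R * R | 0 <= p.2 <= T],
        continuous (fun p : R * R * R => u p.1.1 p.1.2 p.2)}.
Hypothesis mu_ : jointly_measurable L T u.

Let mS := @measurable_square R L.
Let mI : measurable (itv0 T : set (measurableTypeR R)). Proof. exact: measurable_itv0. Qed.

(** Freezing time outside [0, T] extends u to a function continuous on all of space-time, which
    dispenses with continuity relative to a subset. *)
Definition clip t : R := Num.max 0 (Num.min T t).

Lemma clipP t : 0 <= clip t <= T.
Proof. by rewrite /clip le_max lexx/= ge_max ltW//= ge_min lexx. Qed.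

Lemma clip_id t : 0 <= t <= T -> clip t = t.
Proof. by move=> /andP[t0 tT]; rewrite /clip min_r// max_r. Qed.

Lemma continuous_clip : continuous clip.
Proof.
by move=> t; apply: continuous_max; [exact: cvg_cst|apply: continuous_min; [exact: cvg_cst|exact: cvg_id]].
Qed.

Definition clipped : R -> R -> R -> R := fun x y t => u x y (clip t).

Lemma clippedE x y t : 0 <= t <= T -> clipped x y t = u x y t.
Proof. by move=> tT; rewrite /clipped clip_id. Qed.

Lemma periodic_clipped t : periodic_fun L (slice clipped t).
Proof. exact: (pu (clipP t)). Qed.

Lemma continuous_clipped : continuous (fun p : R * R * R => clipped p.1.1 p.1.2 p.2).
Proof.
move=> p; have /(_ (p.1, clip p.2) (clipP p.2)) := (subspace_continuousP [set q : R * R * R | 0 <= q.2 <= T] _).1 cu.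
move=> H P hP; have {}hP := H P hP.
have cg : ((q.1, clip q.2) : R * R * R) @[q --> p] --> ((p.1, clip p.2) : R * R * R).
  have h1 : q.1 @[q --> p] --> p.1 by exact: cvg_fst.
  have h2 : clip q.2 @[q --> p] --> clip p.2.
    by apply: (@continuous_comp _ _ _ snd clip); [exact: cvg_snd|exact: continuous_clip].
  exact: (cvg_pair h1 h2).
change (nbhs p (fun q : R * R * R => P (clipped q.1.1 q.1.2 q.2))).
have h2 : nbhs p (fun q : R * R * R => 0 <= clip q.2 <= T -> P (u q.1.1 q.1.2 (clip q.2))) := cg _ hP.
by apply: (@filterS _ (nbhs p) _ _ _ _ h2) => q; apply; exact: clipP.
Qed.

Lemma continuous_clipped_xy t : continuous (fun p : R * R => clipped p.1 p.2 t).
Proof.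
move=> p; apply: (@continuous_comp _ _ _ (fun q : R * R => (q, t)) (fun p : R * R * R => clipped p.1.1 p.1.2 p.2)).
  exact: (cvg_pair (@cvg_id _ (nbhs p)) (@cvg_cst _ t _ (nbhs p) _)).
exact: continuous_clipped.
Qed.

Lemma continuous_clipped_t x y : continuous (clipped x y).
Proof.
move=> t; apply: (@continuous_comp _ _ _ (fun s : R => ((x, y), s)) (fun p : R * R * R => clipped p.1.1 p.1.2 p.2)).
  exact: (cvg_pair (@cvg_cst _ (x, y) _ (nbhs t) _) (@cvg_id _ (nbhs t))).
exact: continuous_clipped.
Qed.

Lemma cvg_clipped x y (s : nat -> R) (t : R) : s n @[n --> \oo] --> t ->
  clipped x y (s n) @[n --> \oo] --> clipped x y t.
Proof. by move=> st; exact: (cvg_comp _ _ st (@continuous_clipped_t x y t)). Qed.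

Lemma bounded_clipped : exists B, forall x y t, `|clipped x y t| <= B.
Proof.
have cK : compact ((`[0, L] `*` `[0, L]) `*` `[0, T] : set (R * R * R)).
  by apply: compact_setX; [apply: compact_setX|]; exact: segment_compact.
have := compact_bounded (continuous_compact (continuous_subspaceT continuous_clipped) cK).
move=> [B [_ hB]]; exists (B + 1) => x y t.
have [m [x' [xL ->]]] := shift_itv L0 x; have [n [y' [yL ->]]] := shift_itv L0 y.
have /= := @periodic_shift _ _ (slice clipped t) m n x' y' (periodic_clipped t); rewrite /slice => ->.
apply: (hB (B + 1)); first by rewrite ltrDl.
move: xL yL (clipP t) => /andP[x0 xL] /andP[y0 yL] tT.
exists ((x', y'), clip t); first by split; [split|]; rewrite /= ?in_itv/= ?x0 ?y0 ?(ltW xL) ?(ltW yL).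
by rewrite /= /clipped (clip_id tT).
Qed.

(** Joint measurability gives measurable slices at interior times only; the slices at 0 and T are
    limits of those. *)
Lemma measurable_clipped t : measurable_fun (square L) (fun p : R * R => clipped p.1 p.2 t).
Proof.
(* A convex combination of [clip t] and T / 2, strictly inside (0, T) already for n = 0. *)
pose s n := clip t + (T / 2 - clip t) * n.+2%:R^-1.
have sT n : 0 < s n < T.
  have /andP[c0 cT] := clipP t.
  have k0 : 0 < (n.+2%:R^-1 : R) by rewrite invr_gt0.
  have k1 : (n.+2%:R^-1 : R) < 1 by rewrite invf_lt1// ltr1n.
  rewrite /s; move: (n.+2%:R^-1 : R) k0 k1 => k k0 k1.
  have k2 : 0 <= 1 - k by rewrite subr_ge0 ltW.
  have h1 := mulr_ge0 c0 k2; have h2 := mulr_gt0 T0 k0.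
  have h3 : 0 <= (T - clip t) * (1 - k) by rewrite mulr_ge0// subr_ge0.
  by apply/andP; split; lra.
have cs : s n @[n --> \oo] --> clip t.
  have h : clip t + (T / 2 - clip t) * n.+2%:R^-1 @[n --> \oo] --> clip t + (T / 2 - clip t) * 0.
    apply: cvgD; first exact: cvg_cst.
    apply: cvgM; first exact: cvg_cst.
    by have := @cvg_harmonic R; rewrite -(cvg_shiftS).
  by move: h; rewrite mulr0 addr0.
have ms n : measurable_fun (square L) (fun p : R * R => u p.1 p.2 (s n)).
  have sn : itv0 T (s n) by rewrite /itv0/= in_itv/= sT.
  exact: (measurable_sec_r mS mI mu_ sn).
apply: (measurable_fun_cvg ms) => p _.
have := @cvg_clipped p.1 p.2 _ _ cs.
rewrite /clipped (clip_id (clipP t)); apply: cvg_trans; apply: near_eq_cvg; apply: nearW => n /=.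
by rewrite clip_id//; have /andP[h1 h2] := sT n; rewrite !ltW.
Qed.

Lemma in_L2_clipped t k : in_L2 L (fun x y => clipped x y t ^+ k).
Proof.
have [B hB] := bounded_clipped.
apply: (@bounded_L2on _ _ _ _ _ mS _ (B ^+ k) (leb2_square_fin L0)).
  by apply: measurable_funX; exact: measurable_clipped.
by move=> p _; rewrite normrX lerXn2r ?nnegrE// (le_trans _ (hB p.1 p.2 t)).
Qed.

Lemma continuous_mode_clipped k m n : continuous (fun t => mode L (fun x y => clipped x y t ^+ k) m n).
Proof.
have [B hB] := bounded_clipped; have B0 : 0 <= B by apply: le_trans (hB 0 0 0).
move=> t; apply: cvgM; first exact: cvg_cst.
apply: seq_cvg => s st; rewrite /dotL2.
apply: (@Rdominated_cvg _ _ _ mu2 _ _ _ (fun=> B ^+ k * 4)) => //.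
- move=> j; apply: measurable_funM; last exact: measurable_bas.
  by apply: measurable_funX; exact: measurable_clipped.
- move=> p _; apply: cvgM; last exact: cvg_cst.
  exact: (cvg_comp _ _ (@cvg_clipped p.1 p.2 s t st) (@exprn_continuous R k _)).
- apply: (L2on_int mS (leb2_square_fin L0)).
  by apply: (@bounded_L2on _ _ _ _ _ mS _ `|B ^+ k * 4| (leb2_square_fin L0)).
- move=> j p _; rewrite normrM ler_pM ?abs_bas_le//.
  by rewrite normrX lerXn2r ?nnegrE.
Qed.

End Clip.

Lemma ae_forall_count d (T : measurableType d) (R : realType) (m : {measure set T -> \bar R})
    (I : countType) (P : I -> T -> Prop) :
  (forall i, {ae m, forall x, P i x}) -> {ae m, forall x, forall i, P i x}.
Proof.
move=> h; have H : {ae m, forall x, forall n : nat, if unpickle n is Some i then P i x else True}.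
  by apply: ae_foralln => n; case: (unpickle n) => [i|]; [exact: h|exact: aeW].
by apply: sub_ae H => x hx i; have := hx (pickle i); rewrite pickleK.
Qed.

(** * Uniqueness of weak time derivatives *)

Section WeakUnique.
Variables (R : realType) (L T : R) (L0 : 0 < L) (T0 : 0 < T).
Notation mu := (@lebesgue_measure R).
Notation mu2 := (@leb2m R).
Implicit Types (u v w : R -> R -> R -> R).

Let mS := @measurable_square R L.
Let mI : measurable (itv0 T : set (measurableTypeR R)). Proof. exact: measurable_itv0. Qed.

(** Each side says that |v| has integral 0 over the cylinder, computed in one of the two orders. *)
Lemma ae_swap v : measurable_fun (square L `*` itv0 T) (cyl v) ->
  {ae mu2, forall p, square L p -> {ae mu, forall t, 0 < t < T -> v p.1 p.2 t = 0}} ->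
  {ae mu, forall t, 0 < t < T -> {ae mu2, forall p, square L p -> v p.1 p.2 t = 0}}.
Proof.
move=> mv h; have E0 : (\int[mu2]_(p in square L) \int[mu]_(t in itv0 T) `|cyl v (p, t)|%:E = 0)%E.
  have mz : measurable_fun (square L) (fun=> 0%E : \bar R) by exact: measurable_cst.
  transitivity (\int[mu2]_(p in square L) 0)%E; last exact: integral0.
  apply: ae_eq_integral => //; first exact: measurable_tonelli_l.
  apply: sub_ae h => p hp sp; have mvp := measurable_sec_l mS mI mv sp.
  have mav : measurable_fun (itv0 T) (fun t => `|cyl v (p, t)|%:E).
    by apply/measurable_EFinP; exact: measurableT_comp.
  transitivity (\int[mu]_(t in itv0 T) 0)%E; last exact: integral0.
  apply: ae_eq_integral => //.
  apply: sub_ae (hp sp) => t; rewrite /itv0/= in_itv/= => ht tT.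
  by rewrite /cyl/= ht// normr0.
have E1 := tonelli_rect_l mu2 mu mS mI mv; have E2 := tonelli_rect_r mu2 mu mS mI mv.
rewrite E0 in E1; rewrite E1 in E2.
have mT := measurable_tonelli_r mu2 mS mI mv.
have : ae_eq mu (itv0 T) (fun t => \int[mu2]_(p in square L) `|cyl v (p, t)|%:E)%E (cst 0%E).
  apply: (ae_eq_integral_abs mu mI mT).1; rewrite [RHS]E2; apply: eq_integral => t _.
  by rewrite gee0_abs//; apply: integral_ge0 => p _; rewrite lee_fin.
apply: sub_ae => t ht tT.
have tI : itv0 T t by rewrite /itv0/= in_itv.
have mvt := measurable_sec_r mS mI mv tI.
have mvE : measurable_fun (square L) (EFin \o (fun p => cyl v (p, t))) by exact/measurable_EFinP.
have : ae_eq mu2 (square L) (EFin \o (fun p => cyl v (p, t))) (cst 0%E).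
  apply: (ae_eq_integral_abs mu2 mS mvE).1; exact: (ht tI).
by apply: sub_ae => p hp sp; have [] := hp sp.
Qed.

(** The equation and the regularity classes each come with weak derivatives of their own, which must
    be identified. In [weak_dt] the null set depends on the test; the countable family of rational
    bumps leaves a single null set, off which [fundamental_rat] applies. *)
Lemma weak_dt_unique j u v w : weak_dt L T j u v -> weak_dt L T j u w ->
  {ae mu, forall t, 0 < t < T -> {ae mu2, forall p, square L p -> v p.1 p.2 t = w p.1 p.2 t}}.
Proof.
move=> [_ mv iv hv] [_ mw iw hw].
have mh : measurable_fun (square L `*` itv0 T) (cyl (fun x y t => v x y t - w x y t)).
  exact: (@measurable_funB _ _ _ (square L `*` itv0 T) (cyl v) (cyl w) mv mw).
suff h : {ae mu2, forall p, square L p -> {ae mu, forall t, 0 < t < T -> v p.1 p.2 t - w p.1 p.2 t = 0}}.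
  apply: sub_ae (ae_swap mh h) => t ht tT; apply: sub_ae (ht tT) => p hp sp.
  by apply/eqP; rewrite -subr_eq0 hp.
have H : {ae mu2, forall p, forall i : rat * rat * nat, square L p ->
    0 < (ratr i.1.1 : R) -> ratr i.1.2 < T ->
    (\int[mu]_(t in itv0 T) (v p.1 p.2 t * bump i.2.+1%:R (ratr i.1.1) (ratr i.1.2) t))%R =
    (\int[mu]_(t in itv0 T) (w p.1 p.2 t * bump i.2.+1%:R (ratr i.1.1) (ratr i.1.2) t))%R}.
  apply: ae_forall_count => -[[q r] n] /=.
  have [q0|q0] := ltP 0 (ratr q : R); last by apply: aeW => p _.
  have [rT|rT] := ltP (ratr r) T; last by apply: aeW => p _ _.
  have tb := time_test_bump (ler0n R n.+1) q0 rT.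
  apply: sub_ae2 (hv _ tb) (hw _ tb) => p h1 h2 sp _ _.
  by have := h1 sp; rewrite h2// => /(can_inj (signrMK j)).
have iv' : {ae mu2, forall p, square L p -> mu.-integrable (itv0 T) (EFin \o v p.1 p.2) /\ mu.-integrable (itv0 T) (EFin \o w p.1 p.2)}.
  by apply: sub_ae2 iv iw => p h1 h2 sp; split; [case: (h1 sp)|case: (h2 sp)].
apply: sub_ae2 H iv' => p hp ip sp; have [i1 i2] := ip sp.
apply: (@fundamental_rat _ _ (fun t => v p.1 p.2 t - w p.1 p.2 t)); first exact: (integrableB mI i1 i2).
move=> q r n q0 rT; have cb : continuous (bump n.+1%:R (ratr q : R) (ratr r)).
  have sb : smooth (bump n.+1%:R (ratr q : R) (ratr r)) by apply: smooth_bump.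
  exact: (@smooth_continuous _ _ 0%N sb).
have bi f : mu.-integrable (itv0 T) (EFin \o f) ->
    mu.-integrable (itv0 T) (EFin \o (fun t => f t * bump n.+1%:R (ratr q) (ratr r) t)).
  move=> fi; apply: (integrable_mul_bounded (M := 1) mI fi).
    exact: continuous_measurable_itv0.
  by move=> t _; rewrite ger0_norm ?bump_ge0// bump_le1.
transitivity (\int[mu]_(t in itv0 T) (v p.1 p.2 t * bump n.+1%:R (ratr q) (ratr r) t -
    w p.1 p.2 t * bump n.+1%:R (ratr q) (ratr r) t))%R.
  by apply: eq_Rintegral => t _; rewrite mulrBl.
by rewrite RintegralB//; [rewrite (hp (q, r, n))// subrr|exact: bi|exact: bi].
Qed.

End WeakUnique.

(** * Weighted bounds on the coefficients *)

Section ModeBounds.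
Variables (R : realType) (L T : R) (L0 : 0 < L) (T0 : 0 < T).
Notation mu := (@lebesgue_measure R).
Notation mu2 := (@leb2m R).
Implicit Types (u v w : R -> R -> R -> R) (c : int * int -> R -> R).

Let mS := @measurable_square R L.
Let mI : measurable (itv0 T : set (measurableTypeR R)). Proof. exact: measurable_itv0. Qed.

Lemma in_Linft_L2t (n : R -> \bar R) : measurable_fun (itv0 T) n -> (forall t, (0 <= n t)%E) ->
  in_Linft T n -> in_L2t T n.
Proof.
move=> mn n0 [M hM]; apply: (@le_lt_trans _ _ (\int[mu]_(t in itv0 T) `|M|%:E)%E).
  apply: ae_ge0_le_integral => //; apply: sub_ae hM => t h.
  rewrite /itv0/= in_itv/= => tT; apply: le_trans (h tT) _.
  by rewrite lee_fin ler_norm.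
by rewrite integral_cst// [X in (_ * X < _)%E](leb_itv0 T0) -EFinM ltry.
Qed.

Lemma Lp_Hr_L2t p v : Lp_Hr (@in_Linft R) L T p.*2 v -> Lp_Hr (@in_L2t R) L T p.*2 v.
Proof.
move=> [mv [g [mg wg Lg]]]; split => //; exists g; split => //.
apply: in_Linft_L2t Lg.
- have mm a b : measurable_fun (itv0 T)
      (fun t => if (a + b <= p.*2)%N then sqL2 L (slice (g a b) t) else 0%E).
    by case ab : (a + b <= p.*2)%N; [exact: measurable_sqL2 (mg _ _ ab)|exact: measurable_cst].
  apply: emeasurable_sum => a; under eq_fun do rewrite big_mkcond.
  by apply: emeasurable_sum => b; apply: mm.
- by move=> t; apply: sume_ge0 => a _; apply: sume_ge0 => b _; exact: sqL2_ge0.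
Qed.

Lemma Lp_Hr_L2cyl p v : Lp_Hr (@in_L2t R) L T p.*2 v -> L2cyl L T v.
Proof.
move=> hv; have [n [Ln mn n0 hn]] := Lp_Hr_modes L0 hv; have [mv _] := hv.
split => //; apply: le_lt_trans Ln; apply: ae_ge0_le_integral => //.
- by move=> t _; exact: sqL2_ge0.
- exact: measurable_sqL2.
- by apply: sub_ae hn => t h; rewrite /itv0/= in_itv/= => /h[].
Qed.

Lemma L2on_tmode p v i : Lp_Hr (@in_L2t R) L T p.*2 v -> L2on mu (itv0 T) (tmode L v i).
Proof.
move=> hv; have Lv := Lp_Hr_L2cyl hv; have mt := measurable_int _ (tmode_int L0 T0 i Lv).
have {}mt : measurable_fun (itv0 T) (tmode L v i) by exact/measurable_EFinP.
split => //; have [_ fv] := Lv.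
apply: (@le_lt_trans _ _ (\int[mu]_(t in itv0 T) ((L ^- 2)%:E * sqL2 L (slice v t)))%E).
  have k0 : 0 <= L ^- 2 by rewrite invr_ge0 exprn_ge0// ltW.
  apply: ae_ge0_le_integral => //.
  - by move=> t _; rewrite lee_fin sqr_ge0.
  - by apply/measurable_EFinP; exact: measurable_funX.
  - by move=> t _; rewrite mule_ge0 ?lee_fin ?sqL2_ge0.
  - by apply: measurable_funeM; apply: measurable_sqL2; case: hv.
  have [n [_ _ _ hn]] := Lp_Hr_modes L0 hv.
  apply: sub_ae hn => t h; rewrite /itv0/= in_itv/= => /h[Lt _ _].
  have := @bessel2 R L L0 _ [:: i] Lt isT; rewrite big_seq1; exact.
rewrite ge0_integralZl//.
- by rewrite lte_mul_pinfty ?lee_fin ?invr_ge0 ?exprn_ge0 ?(ltW L0)//.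
- by apply: measurable_sqL2; case: hv.
- by move=> t _; exact: sqL2_ge0.
- by rewrite lee_fin invr_ge0 exprn_ge0// ltW.
Qed.

(** A finite sum of continuous functions that is bounded almost everywhere is bounded at every time,
    end points included. *)
Lemma sup_modes p v c : Lp_Hr (@in_Linft R) L T p.*2 v -> (forall i, continuous (c i)) ->
  (forall i, {ae mu, forall t, 0 < t < T -> tmode L v i t = c i t}) ->
  exists M, forall s t, uniq s -> 0 <= t <= T ->
    \sum_(i <- s) wt R i.1 i.2 ^+ p.*2 * c i t ^+ 2 <= M.
Proof.
move=> hv cc vc; have [n [[M hM] mn n0 hn]] := Lp_Hr_modes L0 hv.
exists (3 * (cwt L p * L ^- 2) * M) => s t us.
apply: (@ae_le_continuous _ T T0 (fun t => \sum_(i <- s) wt R i.1 i.2 ^+ p.*2 * c i t ^+ 2)).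
  elim: s {us} => [|i s IH].
    by under eq_fun do rewrite big_nil; exact: cst_continuous.
  under eq_fun do rewrite big_cons; move=> x; apply: cvgD; last exact: IH.
  by apply: cvgM; [exact: cvg_cst|rewrite expr2; apply: cvgM; exact: cc].
have vc' := ae_forall_count vc.
apply: sub_ae2 (sub_ae2 (fun t h1 h2 => conj h1 h2) hM hn) vc' => x [h1 h2] h3 xT.
have [_ _ /(_ s us) h4] := h2 xT; rewrite -lee_fin.
have -> : \sum_(i <- s) wt R i.1 i.2 ^+ p.*2 * c i x ^+ 2 =
    \sum_(i <- s) wt R i.1 i.2 ^+ p.*2 * tmode L v i x ^+ 2.
  by apply: eq_bigr => i _; rewrite h3.
apply: le_trans h4 _; rewrite [leRHS]EFinM; apply: lee_wpmul2l; last exact: h1.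
have k0 : 0 <= L ^- 2 by rewrite invr_ge0 exprn_ge0// ltW.
by rewrite lee_fin; exact: mulr_ge0 (ler0n R 3) (mulr_ge0 (cwt_ge0 L0 p) k0).
Qed.

Lemma int_modes p v : Lp_Hr (@in_L2t R) L T p.*2 v -> exists M, forall s, uniq s ->
  \sum_(i <- s) wt R i.1 i.2 ^+ p.*2 * (\int[mu]_(t in itv0 T) (tmode L v i t ^+ 2))%R <= M.
Proof.
move=> hv; have [n [Ln mn n0 hn]] := Lp_Hr_modes L0 hv.
have k0 : 0 <= L ^- 2 by rewrite invr_ge0 exprn_ge0// ltW.
have C0 : 0 <= 3 * (cwt L p * L ^- 2) := mulr_ge0 (ler0n R 3) (mulr_ge0 (cwt_ge0 L0 p) k0).
exists (3 * (cwt L p * L ^- 2) * fine (\int[mu]_(t in itv0 T) n t)%E) => s us.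
have Li i := L2on_tmode i hv; have ii i := L2on_sqr_int (Li i).
have w0 i : 0 <= wt R i.1 i.2 ^+ p.*2.
  by rewrite exprn_ge0// (le_trans ler01 (wt_ge1 _ _ _)).
have fn : (\int[mu]_(t in itv0 T) n t)%E \is a fin_num.
  by rewrite ge0_fin_numE// integral_ge0.
rewrite -lee_fin EFinM fineK//.
have -> : (\sum_(i <- s) wt R i.1 i.2 ^+ p.*2 * (\int[mu]_(t in itv0 T) (tmode L v i t ^+ 2))%R)%:E =
    (\int[mu]_(t in itv0 T) (\sum_(i <- s) (wt R i.1 i.2 ^+ p.*2 * tmode L v i t ^+ 2)%:E))%E.
  rewrite ge0_integral_sum//; last 2 first.
  - move=> i; apply/measurable_EFinP; apply: measurable_funM => //.
    by apply: measurable_funX; case: (Li i).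
  - by move=> i t _; rewrite lee_fin mulr_ge0 ?sqr_ge0.
  rewrite -sumEFin; apply: eq_bigr => i _.
  under eq_integral do rewrite EFinM.
  rewrite ge0_integralZl//; last 3 first.
  - by have /integrableP[] := ii i.
  - by move=> t _; rewrite lee_fin sqr_ge0.
  by rewrite lee_fin.
  by rewrite EFinM; congr (_ * _)%E; rewrite /Rintegral fineK//; exact: (integrable_fin_num mI (ii i)).
rewrite -ge0_integralZl//.
apply: ae_ge0_le_integral => //.
- by move=> t _; apply: sume_ge0 => i _; rewrite lee_fin mulr_ge0 ?sqr_ge0.
- apply: emeasurable_sum => i; apply/measurable_EFinP; apply: measurable_funM => //.
  by apply: measurable_funX; case: (Li i).
- by move=> t _; rewrite mule_ge0// lee_fin.
- exact: measurable_funeM.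
- apply: sub_ae hn => t h; rewrite /itv0/= in_itv/= => /h[_ _ /(_ s us)].
  by rewrite -sumEFin.
Qed.

Lemma tmode_ibp j u v eta i : L2cyl L T u -> L2cyl L T v -> weak_dt L T j u v -> time_test T eta ->
  (\int[mu]_(t in itv0 T) (tmode L u i t * derive1n j eta t))%R =
  (-1) ^+ j * (\int[mu]_(t in itv0 T) (tmode L v i t * eta t))%R.
Proof.
move=> Lu Lv uv te; have c0 := @time_test_continuous _ T _ 0%N te.
have cj := @time_test_continuous _ T _ j te.
have [M0 h0] := continuous_bounded01 T0 c0; have [Mj hj] := continuous_bounded01 T0 cj.
apply: (@weak_dt_tmode _ L T L0 T0 j u v eta i (Num.max M0 Mj)) => //.
- exact: continuous_measurable_itv0.
- move=> t; rewrite /itv0/= in_itv/= => /andP[t0 tT]; rewrite le_max.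
  by apply/orP; left; apply: h0; rewrite !ltW.
- exact: continuous_measurable_itv0.
- move=> t; rewrite /itv0/= in_itv/= => /andP[t0 tT]; rewrite le_max.
  by apply/orP; right; apply: hj; rewrite !ltW.
Qed.

End ModeBounds.

Lemma ae_conj d (T : measurableType d) (R : realType) (m : {measure set T -> \bar R})
    (P Q : T -> Prop) :
  {ae m, forall x, P x} -> {ae m, forall x, Q x} -> {ae m, forall x, P x /\ Q x}.
Proof. exact: sub_ae2. Qed.

(** All that the grid argument knows about Phi. [q] stands for the coefficients of the cube, [V] and
    [W] for primitives of the squares of the second and fourth time derivatives. Finite
    duplicate-free lists replace infinite series, and one constant [M] serves all bounds. The
    weights wt^8, wt^2, wt^6 and 1 come from the values in H^8, H^2, H^6 and L^2 of the four
    regularity classes. *)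
Record fourier_data (R : realType) (alpha beta L T M : R) (u : R -> R -> R -> R)
    (c : nat -> int * int -> R -> R) (q V W : int * int -> R -> R) : Prop := FourierData {
  fd_derive : forall j i t, (j < 3)%N -> 0 <= t <= T -> is_derive t 1 (c j i) (c j.+1 i t);
  fd_init : forall i, c 1%N i 0 = 0;
  fd_c0 : forall s t, uniq s -> 0 <= t <= T ->
    \sum_(i <- s) wt R i.1 i.2 ^+ 8 * c 0%N i t ^+ 2 <= M;
  fd_c2 : forall s t, uniq s -> 0 <= t <= T ->
    \sum_(i <- s) wt R i.1 i.2 ^+ 2 * c 2%N i t ^+ 2 <= M;
  fd_c3 : forall s t, uniq s -> 0 <= t <= T -> \sum_(i <- s) c 3%N i t ^+ 2 <= M;
  fd_q : forall s t, uniq s -> 0 <= t <= T ->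
    \sum_(i <- s) (lam L i.1 i.2 ^+ 2 * q i t) ^+ 2 <= M;
  fd_V : forall i r t, 0 <= r -> r <= t -> t <= T ->
    V i r <= V i t /\ (c 1%N i t - c 1%N i r) ^+ 2 <= (t - r) * (V i t - V i r);
  fd_VT : forall s, uniq s -> \sum_(i <- s) wt R i.1 i.2 ^+ 6 * (V i T - V i 0) <= M;
  fd_W : forall i r t, 0 <= r -> r <= t -> t <= T ->
    W i r <= W i t /\ (c 3%N i t - c 3%N i r) ^+ 2 <= (t - r) * (W i t - W i r);
  fd_WT : forall s, uniq s -> \sum_(i <- s) (W i T - W i 0) <= M;
  fd_pde : forall i t, 0 <= t <= T ->
    beta * c 2%N i t + c 1%N i t = - lam L i.1 i.2 *
      (q i t + alpha * c 0%N i t - 2 * lam L i.1 i.2 * c 0%N i t + lam L i.1 i.2 ^+ 2 * c 0%N i t);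
  fd_bessel : forall s p t e, uniq s -> 0 <= t <= T -> 0 <= e ->
    (forall x y, `|u x y t ^+ 3 - \sum_(i <- s) p i * bas L i.1 i.2 x y| <= e) ->
    \sum_(i <- s) (q i t - p i) ^+ 2 <= e ^+ 2;
  fd_tail : forall K x y t, 0 <= t <= T ->
    `|u x y t - \sum_(i <- box K) c 0%N i t * bas L i.1 i.2 x y| <= M / K.+1%:R ^+ 6 }.

(** * Coefficients of the solution *)

Section Assemble.
Variables (R : realType) (alpha beta L T : R) (L0 : 0 < L) (T0 : 0 < T).
Variable u : R -> R -> R -> R.
Hypothesis sol : mpfc_solution alpha beta L T u.
Hypothesis reg : mpfc_regularity L T u.
Notation mu := (@lebesgue_measure R).
Notation mu2 := (@leb2m R).

Let mS := @measurable_square R L.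
Let mI : measurable (itv0 T : set (measurableTypeR R)). Proof. exact: measurable_itv0. Qed.

Let pu : forall t, 0 <= t <= T -> periodic_fun L (slice u t). Proof. by case: sol. Qed.
Let cu : {within [set p : R * R * R | 0 <= p.2 <= T],
        continuous (fun p : R * R * R => u p.1.1 p.1.2 p.2)}. Proof. by case: sol. Qed.
Let hu : Lp_Hr (@in_L2t R) L T 0 u. Proof. by case: reg => -[]. Qed.
Let mu_ : jointly_measurable L T u. Proof. by case: hu. Qed.

Let m_ k (i : int * int) t := mode L (fun x y => clipped T u x y t ^+ k) i.1 i.2.

Let cm k i : continuous (m_ k i).
Proof. exact: (continuous_mode_clipped L0 T0 pu cu mu_). Qed.

Let m1E i t : 0 <= t <= T -> m_ 1 i t = tmode L u i t.
Proof.
move=> tT; rewrite /m_ /tmode; congr mode; apply/funext => x; apply/funext => y.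
by rewrite expr1 clippedE.
Qed.

(** One chain of classical derivatives per frequency, built from the fourth weak derivative alone;
    the lower weak derivatives are matched with it afterwards by [chain_weak]. *)
Definition is_chain (c : nat -> int * int -> R -> R) v4 :=
  [/\ Lp_Hr (@in_L2t R) L T 0 v4, forall j i, continuous (c j i),
     forall j i t, (j < 3)%N -> 0 <= t <= T -> is_derive t 1 (c j i) (c j.+1 i t),
     forall i, exists k, c 3%N i = (fun t => prim T (tmode L v4 i) t + k) &
     forall i t, 0 <= t <= T -> m_ 1 i t = c 0%N i t].

Lemma chain_exists : exists c v4, is_chain c v4.
Proof.
have [[_ /(_ 4%N isT) [v4 wd4 h4]] _ _ _] := reg.
have Lu := Lp_Hr_L2cyl L0 (p := 0) hu; have L4 := Lp_Hr_L2cyl L0 (p := 0) h4.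
have H i : exists cs : nat -> R -> R, [/\ forall j, continuous (cs j),
    forall (j : nat) (t : R), (j < 3)%N -> - 2^-1 < t -> is_derive t 1 (cs j) (cs j.+1 t),
    exists k, cs 3%N = (fun t => prim T (tmode L v4 i) t + k) & forall t, 0 <= t <= T -> m_ 1 i t = cs 0%N t].
  apply: (time_chain T0 (@cm 1%N i) (L2on_tmode L0 T0 i (p := 0) h4)).
  move=> eta te; have := tmode_ibp L0 T0 i Lu L4 wd4 te.
  have -> : (-1) ^+ 4 = 1 :> R by rewrite -signr_odd.
  rewrite mul1r => <-; apply: eq_Rintegral => t; rewrite inE /itv0/= in_itv/= => /andP[t0 tT].
  by rewrite m1E// !ltW.
have [cs hcs] := choice H.
exists (fun j i => cs i j), v4; split => //.
- by move=> j i; case: (hcs i).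
- by move=> j i t j3 /andP[t0 _]; have [_ d _ _] := hcs i; apply: d => //; lra.
- by move=> i; case: (hcs i).
- by move=> i; case: (hcs i).
Qed.

Lemma chain_weak c v4 j p v i : is_chain c v4 -> (j <= 3)%N -> weak_dt L T j u v ->
  Lp_Hr (@in_L2t R) L T p.*2 v -> {ae mu, forall t, 0 < t < T -> tmode L v i t = c j i t}.
Proof.
move=> [_ cc dc _ c0] j3 wd hv.
have Lu := Lp_Hr_L2cyl L0 (p := 0) hu; have Lv := Lp_Hr_L2cyl L0 hv.
apply: (@weak_chain _ T T0 (fun j => c j i)).
- by move=> k; exact: cc.
- by move=> k t kj tT; apply: dc => //; exact: leq_trans j3.
- exact: tmode_int.
- move=> eta te; rewrite -(tmode_ibp L0 T0 i Lu Lv wd te).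
  apply: eq_Rintegral => t; rewrite inE /itv0/= in_itv/= => /andP[t0 tT].
  by rewrite -c0 ?m1E// !ltW.
Qed.

Lemma chain_c0 c v4 : is_chain c v4 -> exists M, forall s t, uniq s -> 0 <= t <= T ->
  \sum_(i <- s) wt R i.1 i.2 ^+ 8 * c 0%N i t ^+ 2 <= M.
Proof.
move=> [_ cc _ _ c0]; have [_ [h8 _] _ _] := reg.
apply: (sup_modes L0 T0 (p := 4) h8) => [i|i]; first exact: cc.
by apply: aeW => t /andP[t0 tT]; rewrite -c0 ?m1E// !ltW.
Qed.

Lemma chain_sup j c v4 : (0 < j <= 2)%N -> is_chain c v4 -> exists M, forall s t, uniq s -> 0 <= t <= T ->
  \sum_(i <- s) wt R i.1 i.2 ^+ 2 * c j i t ^+ 2 <= M.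
Proof.
move=> /andP[j0 j2] ch; have [_ _ [_ hj] _] := reg.
have [|v wd hv] := hj j; first by rewrite j0.
apply: (sup_modes L0 T0 (p := 1) hv) => [i|i]; first by case: ch => _ h _ _ _; exact: h.
by apply: (@chain_weak _ v4 _ 1%N) => //; [exact: ltnW|exact: Lp_Hr_L2t].
Qed.

Lemma ae_Rintegral_sq (f g : R -> R) : {ae mu, forall t, 0 < t < T -> f t = g t} ->
  measurable_fun (itv0 T) f -> measurable_fun (itv0 T) g ->
  (\int[mu]_(t in itv0 T) (f t ^+ 2))%R = (\int[mu]_(t in itv0 T) (g t ^+ 2))%R.
Proof.
move=> fg mf mg; congr fine; apply: ae_eq_integral => //.
- by apply/measurable_EFinP; exact: measurable_funX.
- by apply/measurable_EFinP; exact: measurable_funX.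
by apply: sub_ae fg => t h; rewrite /itv0/= in_itv/= => tT; rewrite h.
Qed.

Lemma chain_int j p r c v4 : is_chain c v4 -> (0 < j <= r)%N -> (j <= 3)%N ->
  Wmp_Hr (@in_L2t R) L T r p.*2 u -> exists M, forall s, uniq s ->
  \sum_(i <- s) wt R i.1 i.2 ^+ p.*2 * (\int[mu]_(t in itv0 T) (c j i t ^+ 2))%R <= M.
Proof.
move=> ch jr j3 [_ /(_ j jr) [v wd hv]]; have [M hM] := int_modes L0 T0 hv.
exists M => s us; apply: le_trans (hM s us); rewrite le_eqVlt; apply/orP; left; apply/eqP.
apply: eq_bigr => i _; congr (_ * _); apply: ae_Rintegral_sq.
- by apply: sub_ae (chain_weak i ch j3 wd hv) => t h tT; rewrite h.
- by apply: continuous_measurable_itv0; case: ch => _ h _ _ _; exact: h.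
- by case: (L2on_tmode L0 T0 i hv).
Qed.

Lemma chain_c3 c v4 : is_chain c v4 -> exists M, forall s t, uniq s -> 0 <= t <= T ->
  \sum_(i <- s) c 3%N i t ^+ 2 <= M.
Proof.
move=> ch; have [h4 cc _ c3 _] := ch; have [hW _ _ _] := reg.
have [M3 hM3] := @chain_int 3 0 4 c v4 ch isT isT hW.
have [M4 hM4] := int_modes L0 T0 (p := 0) h4.
exists (T^-1 * (2 * M3 + 2 * T ^+ 2 * M4)) => s t us tT.
have Lv i := L2on_tmode L0 T0 i (p := 0) h4.
pose W i t := prim T (fun x => tmode L v4 i x ^+ 2) t.
have iv i := L2on_sqr_int (Lv i).
have key i r : 0 <= r <= T -> c 3%N i t ^+ 2 <= 2 * c 3%N i r ^+ 2 + 2 * T * (W i T).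
  move=> rT; have {}key a b : 0 <= a -> a <= b -> b <= T -> (c 3%N i b - c 3%N i a) ^+ 2 <= T * W i T.
    move=> a0 ab bT; have [k ->] := c3 i.
    have -> : prim T (tmode L v4 i) b + k - (prim T (tmode L v4 i) a + k) = prim T (tmode L v4 i) b - prim T (tmode L v4 i) a by ring.
    apply: le_trans (prim_holder T0 (Lv i) ab) _; rewrite -/(W i b) -/(W i a).
    have Wb : W i b <= W i T by apply: prim_mono => // x; exact: sqr_ge0.
    have Wa : 0 <= W i a by rewrite -(prim0 T (fun x => tmode L v4 i x ^+ 2)); apply: prim_mono => // x; exact: sqr_ge0.
    have Wab : W i a <= W i b by apply: prim_mono => // x; exact: sqr_ge0.
    by apply: ler_pM; lra.
  have {key} : (c 3%N i t - c 3%N i r) ^+ 2 <= T * W i T.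
    move: tT rT => /andP[t0 tT] /andP[r0 rT].
    have [rt|/ltW tr] := leP r t; first exact: key.
    by rewrite -sqrrN opprB; exact: key.
  have := sqr_ge0 (c 3%N i t - 2 * c 3%N i r).
  move: (c 3%N i t) (c 3%N i r) (W i T) => a b w; nra.
have {}key i : T * c 3%N i t ^+ 2 <= 2 * (\int[mu]_(r in itv0 T) (c 3%N i r ^+ 2))%R + 2 * T ^+ 2 * W i T.
  have ci k : mu.-integrable (itv0 T) (EFin \o (fun=> k : R)).
    by apply: continuous_integrable_itv0; exact: cst_continuous.
  have c3i : mu.-integrable (itv0 T) (EFin \o (fun r => c 3%N i r ^+ 2)).
    apply: continuous_integrable_itv0; under eq_fun do rewrite expr2.
    by move=> r; apply: cvgM; exact: cc.
  have cstE k : (\int[mu]_(r in itv0 T) k)%R = T * k.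
    by rewrite Rintegral_cst// [X in fine X](leb_itv0 T0) mulrC.
  have -> : 2 * T ^+ 2 * W i T = T * (2 * T * W i T) by ring.
  rewrite -!cstE -RintegralZl// -RintegralD//; last exact: (integrableZl mI 2 c3i).
  apply: le_Rintegral => //.
    exact: (integrableD mI (integrableZl mI 2 c3i) (ci _)).
  by move=> r; rewrite /itv0/= in_itv/= => /andP[r0 rT]; apply: key; rewrite !ltW.
rewrite -(ler_pM2l T0) mulrA mulfV ?gt_eqF// mul1r mulr_sumr.
apply: (@le_trans _ _ (\sum_(i <- s) (2 * (\int[mu]_(r in itv0 T) (c 3%N i r ^+ 2))%R + 2 * T ^+ 2 * W i T))).
  by apply: ler_sum => i _; exact: key.
rewrite big_split -!mulr_sumr/=; apply: lerD; rewrite ler_wpM2l ?mulr_ge0 ?sqr_ge0 ?(ltW T0)//.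
  apply: le_trans (hM3 s us); rewrite le_eqVlt; apply/orP; left; apply/eqP.
  by apply: eq_bigr => i _; rewrite expr0 mul1r.
apply: le_trans (hM4 s us); rewrite le_eqVlt; apply/orP; left; apply/eqP.
by apply: eq_bigr => i _; rewrite expr0 mul1r /W primT.
Qed.

Lemma clipped_in_L2 k t : in_L2 L (fun x y => clipped T u x y t ^+ k).
Proof. exact: (in_L2_clipped L0 T0 pu cu mu_). Qed.

(** The time derivatives in the equation are exchanged for those of the regularity class. This gives
    the identity for almost every t, and both sides are continuous in t. *)
Lemma chain_pde c v4 i t : is_chain c v4 -> 0 <= t <= T ->
  beta * c 2%N i t + c 1%N i t = - lam L i.1 i.2 *
    (m_ 3 i t + alpha * c 0%N i t - 2 * lam L i.1 i.2 * c 0%N i t + lam L i.1 i.2 ^+ 2 * c 0%N i t).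
Proof.
move=> ch; have [_ cc _ _ c0] := ch; set l := lam L i.1 i.2.
have cl j k : continuous (fun t => k * c j i t).
  by move=> r; apply: cvgM; [exact: cvg_cst|exact: cc].
move: t; apply: (@ae_eq_continuous _ T T0 (fun t => beta * c 2%N i t + c 1%N i t)
  (fun t => - l * (m_ 3 i t + alpha * c 0%N i t - 2 * l * c 0%N i t + l ^+ 2 * c 0%N i t))).
- by move=> r; apply: cvgD; [exact: cl|exact: cc].
- move=> r; apply: cvgM; first exact: cvg_cst.
  apply: cvgD; last exact: cl.
  by apply: cvgB; [apply: cvgD; [exact: cm|exact: cl]|exact: cl].
have [_ _ _ [ut [utt [w1 w2 pde]]]] := sol.
have [[_ h4] _ _ _] := reg; have [v1 wv1 l1] := h4 1%N isT; have [v2 wv2 l2] := h4 2%N isT.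
have a1 := @chain_weak c v4 1 0 v1 i ch isT wv1 l1; have a2 := @chain_weak c v4 2 0 v2 i ch isT wv2 l2.
have [n1 [_ _ _ s1]] := Lp_Hr_modes L0 (p := 0) l1; have [n2 [_ _ _ s2]] := Lp_Hr_modes L0 (p := 0) l2.
have u1 := weak_dt_unique w1 wv1; have u2 := weak_dt_unique w2 wv2.
apply: sub_ae2 (ae_conj (ae_conj a1 a2) (ae_conj s1 s2)) (ae_conj pde (ae_conj u1 u2)) => t.
move=> [[{}a1 {}a2] [{}s1 {}s2]] [{}pde [{}u1 {}u2]] tT.
have tT' : 0 <= t <= T by move: tT => /andP[t0 t1]; rewrite !ltW.
have [S1 _ _] := s1 tT; have [S2 _ _] := s2 tT.
have [lap1 [lap2 [W1 W2 W3]]] := pde tT.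
have [Lu Ll1 _] := W1; have [_ Ll2 _] := W2; have [LF Lr _] := W3.
have E3 : in_L2 L (fun x y => u x y t ^+ 3).
  have := clipped_in_L2 3 t; congr in_L2; apply/funext => x; apply/funext => y.
  by rewrite clippedE.
have q3 : m_ 3 i t = mode L (fun x y => u x y t ^+ 3) i.1 i.2.
  rewrite /m_; congr mode; apply/funext => x; apply/funext => y.
  by rewrite clippedE.
have cE : mode L (slice u t) i.1 i.2 = c 0%N i t by rewrite -c0 ?m1E.
have Lau := L2onZ mS alpha Lu; have L2l := L2onZ mS 2 Ll1.
have Ls := L2onD mS E3 Lau; have Ls2 := L2onD mS Ls L2l.
have L12 := L2onD mS (L2onZ mS beta S2) S1.
have := mode_lap L0 i.1 i.2 W3.
have -> : mode L (fun x y => beta * utt x y t + ut x y t) i.1 i.2 = beta * c 2%N i t + c 1%N i t.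
  transitivity (mode L (fun x y => beta * slice v2 t x y + slice v1 t x y) i.1 i.2).
    apply: mode_ae => //.
    by apply: sub_ae2 (u1 tT) (u2 tT) => p h1 h2 sp; rewrite h1// h2.
  have B2 : in_L2 L (fun x y => beta * slice v2 t x y) := L2onZ mS beta S2.
  by rewrite (modeD L0 _ _ B2 S1) (modeZ L0 beta _ _ S2) -a1// -a2.
have La' : in_L2 L (fun x y => alpha * u x y t) := Lau.
have L2' : in_L2 L (fun x y => 2 * lap1 x y) := L2l.
have Ls' : in_L2 L (fun x y => u x y t ^+ 3 + alpha * u x y t) := Ls.
have Ls2' : in_L2 L (fun x y => u x y t ^+ 3 + alpha * u x y t + 2 * lap1 x y) := Ls2.
move=> ->; congr (_ * _); rewrite (modeD L0 _ _ Ls2' Ll2) (modeD L0 _ _ Ls' L2') (modeD L0 _ _ E3 La').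
rewrite (modeZ L0 alpha _ _ Lu) (modeZ L0 2 _ _ Ll1).
have M1 := mode_lap L0 i.1 i.2 W1; have M2 := mode_lap L0 i.1 i.2 W2.
rewrite M2 M1 -q3 cE -/l; ring.
Qed.

Lemma dist_le3 (a b x y e d : R) : `|a - x| <= e -> `|b - y| <= e -> `|x - y| <= d ->
  `|a - b| <= d + 2 * e.
Proof.
rewrite !ler_norml => /andP[a1 a2] /andP[b1 b2] /andP[d1 d2].
by apply/andP; split; lra.
Qed.

Lemma le_sum_norm (s : seq R) x : x \in s -> x <= \sum_(y <- s) `|y|.
Proof.
elim: s => [//|y s IH]; rewrite inE big_cons => /orP[/eqP->|/IH h].
  by rewrite -[leLHS]addr0 lerD ?ler_norm ?sumr_ge0.
by rewrite -[leLHS]add0r lerD.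
Qed.

Lemma chain_m1 c v4 i t : is_chain c v4 -> 0 <= t <= T ->
  mode L (slice (clipped T u) t) i.1 i.2 = c 0%N i t.
Proof. by move=> [_ _ _ _ c0] tT; rewrite -c0. Qed.

Lemma chain_tail c v4 : is_chain c v4 -> exists A, forall K x y t, 0 <= t <= T ->
  `|u x y t - \sum_(i <- box K) c 0%N i t * bas L i.1 i.2 x y| <= A / K.+1%:R ^+ 6.
Proof.
move=> ch; have [A hA] := chain_c0 ch; exists (20 * Num.sqrt A) => K x y t tT.
have := @mode_expansion R L L0 (slice (clipped T u) t) A.
move=> /(_ (continuous_clipped_xy T0 cu (t := t)) (periodic_clipped T0 pu t)).
move=> /(_ (clipped_in_L2 1 t)) h.
have {}h := h _ K x y; rewrite /slice clippedE// in h.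
rewrite (eq_bigr (fun i => mode L (fun x0 y0 => clipped T u x0 y0 t) i.1 i.2 * bas L i.1 i.2 x y)).
  apply: h => J; apply: le_trans (hA (box J) t (box_uniq J) tT).
  by apply: ler_sum => i _; rewrite -(chain_m1 _ ch).
by move=> i _; rewrite -(chain_m1 _ ch).
Qed.

Lemma mode_bas_sum (s : seq (int * int)) (p : int * int -> R) i : uniq s -> i \in s ->
  mode L (fun x y => \sum_(j <- s) p j * bas L j.1 j.2 x y) i.1 i.2 = p i.
Proof.
move=> us si; rewrite /mode dotL2E.
have Lb j := L2on_bas L0 j.1 j.2; have fS := leb2_square_fin L0.
rewrite (ip_suml mS (e := fun j q => bas L j.1 j.2 q.1 q.2) Lb s p fS (Lb i)).
rewrite (bigD1_seq i) //= big1 => [|j ji]; last first.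
  by rewrite (ip_bas L0 j i) (negbTE ji) mulr0n mulr0.
by rewrite addr0 (ip_bas L0 i i) eqxx mulr1n mulrCA mulVf ?mulr1// expf_neq0// gt_eqF.
Qed.

Lemma chain_bessel s (p : int * int -> R) t e : uniq s -> 0 <= t <= T -> 0 <= e ->
  (forall x y, `|u x y t ^+ 3 - \sum_(i <- s) p i * bas L i.1 i.2 x y| <= e) ->
  \sum_(i <- s) (m_ 3 i t - p i) ^+ 2 <= e ^+ 2.
Proof.
move=> us tT e0 hp; have fS := leb2_square_fin L0.
pose g x y := \sum_(i <- s) p i * bas L i.1 i.2 x y.
pose f x y := clipped T u x y t ^+ 3 - g x y.
have Lb j := L2on_bas L0 j.1 j.2.
have Lg : in_L2 L g.
  exact: (@L2on_sum _ _ _ mu2 (square L) mS _ (fun j q => bas L j.1 j.2 q.1 q.2) Lb s p fS).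
have L3 := clipped_in_L2 3 t.
have Lf : in_L2 L f := L2onB mS L3 Lg.
have := bessel2 L0 Lf us.
have fe : (sqL2 L f <= (e ^+ 2 * L ^+ 2)%:E)%E.
  rewrite sqL2E; apply: (@le_trans _ _ (\int[mu2]_(q in square L) (e ^+ 2)%:E)%E).
    apply: ge0_le_integral => //.
    - by move=> q _; rewrite lee_fin sqr_ge0.
    - by have [mf _] := Lf; apply/measurable_EFinP; apply: measurable_funX.
    - move=> q _; rewrite lee_fin -real_normK ?num_real// lerXn2r ?nnegrE//.
      by rewrite /f clippedE.
  by rewrite integral_cst// [X in (_ * X)%E](leb2_square L0) -EFinM.
move=> /le_trans /(_ (lee_wpmul2l _ fe)); rewrite lee_fin invr_ge0 exprn_ge0 ?(ltW L0)// => /(_ isT).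
rewrite -EFinM lee_fin mulrC -mulrA mulfV ?mulr1; last by rewrite expf_neq0// gt_eqF.
apply: le_trans; rewrite le_eqVlt; apply/orP; left; apply/eqP; apply: eq_big_seq => i si.
congr (_ ^+ 2); rewrite -[X in _ - X](mode_bas_sum p us si) /m_ -mulN1r -modeZ// -modeD//; last first.
  exact: (L2onZ mS (-1) Lg).
by congr mode; apply/funext => x; apply/funext => y; rewrite /f mulN1r.
Qed.

Lemma Rderive_sum (I : Type) (s : seq I) (f df : I -> R -> R) (t : R) :
  (forall i, is_derive t 1 (f i) (df i t)) ->
  is_derive t 1 (fun x => \sum_(i <- s) f i x) (\sum_(i <- s) df i t).
Proof.
move=> h; elim: s => [|i s IH].
  by under eq_fun do rewrite big_nil; rewrite big_nil; exact: Rderive_cst.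
by under eq_fun do rewrite big_cons; rewrite big_cons; exact: RderiveD.
Qed.

(** The initial velocity is given pointwise only; this bound on difference quotients, uniform in
    space, lets dominated convergence carry it to the coefficients. It is proved on partial sums, by
    the mean value theorem and the absolute summability of [c 1], and the tail error disappears as K
    grows. *)
Lemma chain_lipschitz c v4 : is_chain c v4 -> exists D, forall x y t, 0 < t <= T ->
  `|u x y t - u x y 0| <= D * t.
Proof.
move=> ch; have [A hA] := chain_tail ch; have [M hM] := @chain_sup 1 c v4 isT ch.
have [_ _ dc _ _] := ch.
have M0 : 0 <= M.
  by have := hM [::] 0 isT; rewrite lexx ltW// big_nil; apply.
exists (20 * Num.sqrt M) => x y t /andP[t0 tT].
have z0 : 0 <= (0 : R) <= T by apply/andP; split => //; exact: ltW.
have t0T : 0 <= t <= T by rewrite ltW.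
have c1le K r : 0 <= r <= T -> `|\sum_(i <- box K) c 1%N i r * bas L i.1 i.2 x y| <= 20 * Num.sqrt M.
  move=> rT; apply: le_trans (ler_norm_sum _ _ _) _.
  have w0 i : wt R i.1 i.2 != 0 by rewrite gt_eqF// (lt_le_trans ltr01 (wt_ge1 _ _ _)).
  apply: (@le_trans _ _ (\sum_(i <- box K) (wt R i.1 i.2 * `|c 1%N i r|) * (wt R i.1 i.2)^-1 * 4)).
    apply: ler_sum => i _; rewrite normrM [wt _ _ _ * _]mulrC mulfK//.
    by rewrite ler_wpM2l// abs_bas_le.
  rewrite -mulr_suml; have -> : 20 * Num.sqrt M = 5 * Num.sqrt M * 4 by ring.
  rewrite ler_wpM2r// -(@ler_pXn2r _ 2) ?nnegrE//; last first.
    apply: sumr_ge0 => i _; have wp : 0 <= wt R i.1 i.2 by rewrite (le_trans ler01 (wt_ge1 _ _ _)).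
    by rewrite !mulr_ge0// invr_ge0.
  apply: le_trans (sum_cauchy_schwarz _ _ _ _) _.
  have -> : (5 * Num.sqrt M) ^+ 2 = M * 25 by rewrite exprMn sqr_sqrtr//; ring.
  apply: ler_pM.
  - by apply: sumr_ge0 => i _; exact: sqr_ge0.
  - by apply: sumr_ge0 => i _; exact: sqr_ge0.
  - apply: le_trans (hM (box K) r (box_uniq K) rT); apply: ler_sum => i _.
    by rewrite exprMn real_normK ?num_real.
  - by apply: le_trans (sum_box_wt R K); apply: ler_sum => i _; rewrite exprVn.
have key K : `|u x y t - u x y 0| <= 20 * Num.sqrt M * t + 2 * (A / K.+1%:R ^+ 6).
  have [|r /andP[r0 rt] E] := @RMVT R (fun r => \sum_(i <- box K) c 0%N i r * bas L i.1 i.2 x y)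
    (fun r => \sum_(i <- box K) c 1%N i r * bas L i.1 i.2 x y) 0 t t0.
    move=> z /andP[z1 z2]; apply: (@Rderive_sum _ _ (fun i r => c 0%N i r * bas L i.1 i.2 x y) (fun i r => c 1%N i r * bas L i.1 i.2 x y)) => i.
    have zT : 0 <= z <= T by rewrite z1 (le_trans z2).
    apply: Rderive_eq (RderiveM (dc 0%N i z isT zT) (Rderive_cst _ z)) _; by rewrite mulr0 addr0.
  have rT : 0 <= r <= T by rewrite (ltW r0) (le_trans (ltW rt)).
  have h1 := hA K x y t t0T; have h2 := hA K x y 0 z0.
  have : `|\sum_(i <- box K) c 0%N i t * bas L i.1 i.2 x y - \sum_(i <- box K) c 0%N i 0 * bas L i.1 i.2 x y| <= 20 * Num.sqrt M * t.
    by rewrite E subr0 normrM (gtr0_norm t0) ler_wpM2r ?(ltW t0)// c1le.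
  exact: dist_le3 h1 h2.
have cv : 20 * Num.sqrt M * t + 2 * (A / K.+1%:R ^+ 6) @[K --> \oo] --> 20 * Num.sqrt M * t + 2 * (A * 0 ^+ 6).
  have h6 := cvg_comp _ _ (@cvg_harmonic R) (@exprn_continuous R 6 0).
  apply: cvgD; first exact: cvg_cst.
  apply: cvgM; first exact: cvg_cst.
  apply: cvgM; first exact: cvg_cst.
  move: h6; rewrite (_ : _ \o _ = fun K : nat => K.+1%:R ^- 6 : R)//.
  by apply/funext => K; rewrite /= /harmonic exprVn.
move: cv; rewrite expr0n !mulr0 addr0 => cv.
by apply: (cvgr_to_ge cv); apply: nearW => K.
Qed.

(** The difference quotient of [c 0] along T / (n + 1) tends to 0 by dominated convergence, and
    equals [c 1] at an intermediate time by the mean value theorem; continuity of [c 1]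
    concludes. *)
Lemma chain_init c v4 i : is_chain c v4 -> c 1%N i 0 = 0.
Proof.
move=> ch; have [_ cc dc _ c0] := ch; have [D hD] := chain_lipschitz ch.
have z0 : 0 <= (0 : R) <= T by apply/andP; split => //; exact: ltW.
pose s n : R := T * n.+1%:R^-1.
have sT n : 0 < s n <= T.
  by rewrite mulr_gt0 ?invr_gt0//= -[leRHS]mulr1 ler_wpM2l ?(ltW T0)// invf_le1// ler1n.
have cs : s n @[n --> \oo] --> (0 : R).
  have : s n @[n --> \oo] --> T * 0 by apply: cvgM; [exact: cvg_cst|exact: cvg_harmonic].
  by rewrite mulr0.
have lim0 : (c 0%N i (s n) - c 0%N i 0) / s n @[n --> \oo] --> (0 : R).
  have E n : (c 0%N i (s n) - c 0%N i 0) / s n =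
      L ^- 2 * (\int[mu2]_(p in square L) ((u p.1 p.2 (s n) - u p.1 p.2 0) / s n * bas L i.1 i.2 p.1 p.2))%R.
    have /andP[s0 s1] := sT n.
    have sT' : 0 <= s n <= T by rewrite ltW.
    have Ln : in_L2 L (fun x y => -1 * clipped T u x y 0 ^+ 1) := L2onZ mS (-1) (clipped_in_L2 1 0).
    rewrite -!c0//; have A := modeD L0 i.1 i.2 (clipped_in_L2 1 (s n)) Ln.
    have A2 := modeZ L0 (-1) i.1 i.2 (clipped_in_L2 1 0).
    have Ld : in_L2 L (fun x y => clipped T u x y (s n) ^+ 1 + -1 * clipped T u x y 0 ^+ 1).
      exact: (L2onD mS (clipped_in_L2 1 (s n)) (L2onZ mS (-1) (clipped_in_L2 1 0))).
    have A3 := modeZ L0 (s n)^-1 i.1 i.2 Ld.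
    rewrite -[_ - _]/(_ + - _) -mulN1r -[X in _ + X]A2 -[X in X / _]A mulrC -A3.
    rewrite /mode /dotL2; congr (_ * _); apply: eq_Rintegral => p _; congr (_ * _).
    by rewrite !expr1 !clippedE// mulN1r mulrC.
  under eq_fun do rewrite E.
  have Z : L ^- 2 * (\int[mu2]_(p in square L) (0 * bas L i.1 i.2 p.1 p.2))%R = 0.
    rewrite (_ : (\int[mu2]_(p in square L) _)%R = 0) ?mulr0//.
    by rewrite /Rintegral integral0_eq// => p _; rewrite mul0r.
  suff : L ^- 2 * (\int[mu2]_(p in square L) ((u p.1 p.2 (s n) - u p.1 p.2 0) / s n * bas L i.1 i.2 p.1 p.2))%R
      @[n --> \oo] --> L ^- 2 * (\int[mu2]_(p in square L) (0 * bas L i.1 i.2 p.1 p.2))%R.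
    by rewrite Z.
  apply: cvgM; first exact: cvg_cst.
  apply: (@Rdominated_cvg _ _ _ mu2 _ _ _ (fun=> `|D| * 4)) => //.
  - move=> n; apply: measurable_funM; last exact: measurable_bas.
    apply: measurable_funM; last exact: measurable_cst.
    have /andP[s0 s1] := sT n.
    have sT' : 0 <= s n <= T by rewrite ltW.
    apply: measurable_funB.
      by have [h _] := clipped_in_L2 1 (s n); move: h; under eq_fun do rewrite expr1 clippedE//.
    by have [h _] := clipped_in_L2 1 0; move: h; under eq_fun do rewrite expr1 clippedE//.
  - move=> p _; apply: cvgM; last exact: cvg_cst.
    have [_ _ vel _] := sol; have := vel p.1 p.2 => /cvg_at_rightP; apply.
    by split => // n; case/andP: (sT n).
  - apply: (L2on_int mS (leb2_square_fin L0)).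
    by apply: (@bounded_L2on _ _ _ _ _ mS _ `| `|D| * 4| (leb2_square_fin L0)).
  - move=> n p _; rewrite normrM ler_pM ?abs_bas_le// normrM normfV.
    have /andP[s0 s1] := sT n.
    rewrite (gtr0_norm s0) ler_pdivrMr//; apply: le_trans (hD _ _ _ (sT n)) _.
    by rewrite ler_wpM2r ?(ltW s0)// ler_norm.
apply/eqP; rewrite -normr_le0; apply/ler_addgt0Pr => e e0; rewrite add0r.
have e2 : 0 < e / 2 by rewrite divr_gt0.
have [d /= d0 hd] : \forall r \near (0 : R), `|c 1%N i 0 - c 1%N i r| < e / 2.
  have /cvgrPdist_lt := cc 1%N i 0; exact.
have /cvgrPdist_lt /(_ _ e2) [N1 _ h1] := lim0; have /cvgrPdist_lt /(_ _ d0) [N2 _ h2] := cs.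
pose N := maxn N1 N2; have {}h1 := h1 N (leq_maxl _ _); have {}h2 := h2 N (leq_maxr _ _).
have /andP[s0 s1] := sT N.
have [|r /andP[r0 rs] E] := @RMVT R (c 0%N i) (c 1%N i) 0 (s N) s0.
  by move=> z /andP[z1 z2]; apply: dc => //; rewrite z1 (le_trans z2).
move: h1; rewrite /= E !subr0 mulfK ?gt_eqF// sub0r normrN => h1.
have : `|c 1%N i 0 - c 1%N i r| < e / 2.
  apply: hd; move: h2; rewrite /ball/= !sub0r !normrN (gtr0_norm s0) (gtr0_norm r0).
  exact: lt_trans.
move: h1; rewrite !ltr_norml ler_norml => /andP[a1 a2] /andP[b1 b2].
by apply/andP; split; lra.
Qed.

(** The equation multiplied by lam expresses lam^2 times a coefficient of the cube through lam c'',
    lam c' and c times powers of lam up to the fourth, each covered by a known bound. *)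
Lemma chain_q c v4 : is_chain c v4 -> exists M, forall s t, uniq s -> 0 <= t <= T ->
  \sum_(i <- s) (lam L i.1 i.2 ^+ 2 * m_ 3 i t) ^+ 2 <= M.
Proof.
move=> ch; have [M0 h0] := chain_c0 ch; have [M1 h1] := @chain_sup 1 c v4 isT ch.
have [M2 h2] := @chain_sup 2 c v4 isT ch; pose o := om L ^+ 2.
pose k := `|alpha| * o ^+ 2 + 2 * o ^+ 3 + o ^+ 4.
exists (3 * (o ^+ 2 * beta ^+ 2) * M2 + 3 * o ^+ 2 * M1 + 3 * k ^+ 2 * M0) => s t us tT.
have o0 : 0 <= o by exact: sqr_ge0.
apply: (@le_trans _ _ (\sum_(i <- s) (3 * (o ^+ 2 * beta ^+ 2) * (wt R i.1 i.2 ^+ 2 * c 2%N i t ^+ 2) +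
    3 * o ^+ 2 * (wt R i.1 i.2 ^+ 2 * c 1%N i t ^+ 2) + 3 * k ^+ 2 * (wt R i.1 i.2 ^+ 8 * c 0%N i t ^+ 2)))); last first.
  rewrite !big_split -!mulr_sumr/=.
  have p3 : 0 <= (3 : R) := ler0n R 3.
  apply: lerD; [apply: lerD|]; apply: ler_wpM2l; rewrite ?h0 ?h1 ?h2//.
  - exact: mulr_ge0 p3 (mulr_ge0 (sqr_ge0 o) (sqr_ge0 beta)).
  - exact: mulr_ge0 p3 (sqr_ge0 o).
  - exact: mulr_ge0 p3 (sqr_ge0 k).
apply: ler_sum => i _; set l := lam L i.1 i.2; set w := wt R i.1 i.2.
have w1 : 1 <= w := wt_ge1 _ _ _.
have l0 : 0 <= l by rewrite /l /lam mulr_ge0 ?sqr_ge0// addr_ge0 ?sqr_ge0.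
have lw : l <= o * w.
  by rewrite /l /lam /w /wt ler_wpM2l// -addrA lerDr.
have E : l ^+ 2 * m_ 3 i t = - l * (beta * c 2%N i t) + - l * c 1%N i t +
    - (alpha * l ^+ 2 - 2 * l ^+ 3 + l ^+ 4) * c 0%N i t.
  have := chain_pde i ch tT; rewrite -/l; move: (m_ 3 i t) (c 0%N i t) (c 1%N i t) (c 2%N i t) => q a b d e.
  have -> : - l * (beta * d) + - l * b = - l * (beta * d + b) by ring.
  by rewrite e; ring.
have sq3 (a b d : R) : (a + b + d) ^+ 2 <= 3 * a ^+ 2 + 3 * b ^+ 2 + 3 * d ^+ 2.
  rewrite -subr_ge0; have -> : 3 * a ^+ 2 + 3 * b ^+ 2 + 3 * d ^+ 2 - (a + b + d) ^+ 2 =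
    (a - b) ^+ 2 + (b - d) ^+ 2 + (a - d) ^+ 2 by ring.
  by rewrite !addr_ge0 ?sqr_ge0.
clearbody l w.
have l2 : l ^+ 2 <= o ^+ 2 * w ^+ 2 
  by rewrite -exprMn; apply: lerXn2r; rewrite ?nnegrE//; exact: mulr_ge0 o0 (le_trans ler01 w1).
have kw : (alpha * l ^+ 2 - 2 * l ^+ 3 + l ^+ 4) ^+ 2 <= k ^+ 2 * w ^+ 8.
  have -> : k ^+ 2 * w ^+ 8 = (k * w ^+ 4) ^+ 2 by ring.
  have w0 : 0 <= w by exact: le_trans w1.
  have k0 : 0 <= k := addr_ge0 (addr_ge0 (mulr_ge0 (normr_ge0 alpha) (exprn_ge0 2 o0))
    (mulr_ge0 (ler0n R 2) (exprn_ge0 3 o0))) (exprn_ge0 4 o0).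
  rewrite -[leLHS]real_normK ?num_real// lerXn2r ?nnegrE ?mulr_ge0 ?exprn_ge0//.
  have wp j : (j <= 4)%N -> l ^+ j <= o ^+ j * w ^+ 4.
    move=> j4; apply: (@le_trans _ _ ((o * w) ^+ j)); first by rewrite lerXn2r ?nnegrE ?(mulr_ge0 o0 w0).
    by rewrite exprMn; apply: ler_wpM2l; [exact: exprn_ge0|exact: ler_weXn2l].
  apply: le_trans (ler_normD _ _) _; rewrite (ger0_norm (exprn_ge0 4 l0)).
  apply: (@le_trans _ _ (`|alpha| * l ^+ 2 + 2 * l ^+ 3 + l ^+ 4)).
    rewrite lerD2r; apply: le_trans (ler_normB _ _) _.
    by rewrite (normrM alpha) (normrM 2) (ger0_norm (exprn_ge0 2 l0)) (ger0_norm (exprn_ge0 3 l0)) (ger0_norm (ler0n R 2)).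
  have -> : k * w ^+ 4 = `|alpha| * (o ^+ 2 * w ^+ 4) + 2 * (o ^+ 3 * w ^+ 4) + o ^+ 4 * w ^+ 4.
    by rewrite /k; ring.
  apply: lerD; [apply: lerD|exact: wp].
    by rewrite ler_wpM2l// wp.
  by rewrite ler_wpM2l// wp.
rewrite E; apply: le_trans (sq3 _ _ _) _; apply: lerD; [apply: lerD|].
- have -> : 3 * (- l * (beta * c 2%N i t)) ^+ 2 = 3 * (l ^+ 2 * (beta ^+ 2 * c 2%N i t ^+ 2)) by ring.
  have -> : 3 * (o ^+ 2 * beta ^+ 2) * (w ^+ 2 * c 2%N i t ^+ 2) = 3 * (o ^+ 2 * w ^+ 2 * (beta ^+ 2 * c 2%N i t ^+ 2)) by ring.
  by rewrite ler_wpM2l// ler_wpM2r// mulr_ge0 ?sqr_ge0.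
- have -> : 3 * (- l * c 1%N i t) ^+ 2 = 3 * (l ^+ 2 * (c 1%N i t ^+ 2)) by ring.
  have -> : 3 * o ^+ 2 * (w ^+ 2 * c 1%N i t ^+ 2) = 3 * (o ^+ 2 * w ^+ 2 * c 1%N i t ^+ 2) by ring.
  by rewrite ler_wpM2l// ler_wpM2r// sqr_ge0.
- have -> : 3 * k ^+ 2 * (w ^+ 8 * c 0%N i t ^+ 2) = 3 * (k ^+ 2 * w ^+ 8 * c 0%N i t ^+ 2) by ring.
  by rewrite exprMn sqrrN; apply: ler_wpM2l => //; exact: (ler_wpM2r (sqr_ge0 _) kw).
Qed.

Lemma fourier_data_exists : exists M c q V W, 0 <= M /\ fourier_data alpha beta L T M u c q V W.
Proof.
have [c [v4 ch]] := chain_exists; have [h4 cc dc c3 c0] := ch.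
have [M0 H0] := chain_c0 ch; have [M2 H2] := @chain_sup 2 c v4 isT ch.
have [M3 H3] := chain_c3 ch; have [Mq Hq] := chain_q ch; have [A HA] := chain_tail ch.
have [_ _ _ r26] := reg; have [MV HV] := @chain_int 2 3 2 c v4 ch isT isT r26.
have [MW HW] := int_modes L0 T0 (p := 0) h4.
pose V i t := prim T (fun x => c 2%N i x ^+ 2) t.
pose W i t := prim T (fun x => tmode L v4 i x ^+ 2) t.
have L4 i := L2on_tmode L0 T0 i (p := 0) h4.
have Lc i : L2on mu (itv0 T) (c 2%N i).
  have [B hB] := continuous_bounded01 T0 (@cc 2%N i).
  apply: (bounded_L2on mI (itv0_fin T0) (M := B)); first by apply: continuous_measurable_itv0; exact: cc.
  by move=> x; rewrite /itv0/= in_itv/= => /andP[x0 xT]; apply: hB; rewrite !ltW.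
pose M := \sum_(x <- [:: M0; M2; M3; Mq; A; MV; MW]) `|x|.
have MM x : x \in [:: M0; M2; M3; Mq; A; MV; MW] -> x <= M := @le_sum_norm _ x.
exists M, c, (m_ 3), V, W; split; first by apply: sumr_ge0 => x _; exact: normr_ge0.
split.
- exact: dc.
- by move=> i; exact: chain_init ch.
- by move=> s t us tT; apply: le_trans (H0 s t us tT) _; apply: MM; rewrite !inE eqxx.
- by move=> s t us tT; apply: le_trans (H2 s t us tT) _; apply: MM; rewrite !inE eqxx ?orbT.
- by move=> s t us tT; apply: le_trans (H3 s t us tT) _; apply: MM; rewrite !inE eqxx ?orbT.
- by move=> s t us tT; apply: le_trans (Hq s t us tT) _; apply: MM; rewrite !inE eqxx ?orbT.
- move=> i r t r0 rt tT; split.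
    by apply: prim_mono => //; [exact: L2on_sqr_int|move=> x; exact: sqr_ge0].
  have F x : 0 <= x <= T -> c 1%N i x = c 1%N i 0 + prim T (c 2%N i) x.
    by apply: prim_ftc => // y yT; exact: dc.
  have Et : c 1%N i t = _ := F t ltac:(by rewrite (le_trans r0 rt)).
  have Er : c 1%N i r = _ := F r ltac:(by rewrite r0 (le_trans rt tT)).
  rewrite Et Er.
  have -> : c 1%N i 0 + prim T (c 2%N i) t - (c 1%N i 0 + prim T (c 2%N i) r) = prim T (c 2%N i) t - prim T (c 2%N i) r by ring.
  exact: prim_holder.
- move=> s us; apply: le_trans (le_trans _ (HV s us)) _; last by apply: MM; rewrite !inE eqxx ?orbT.
  by apply: ler_sum => i _; rewrite /V prim0 primT subr0.
- move=> i r t r0 rt tT; split.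
    by apply: prim_mono => //; [exact: L2on_sqr_int|move=> x; exact: sqr_ge0].
  have [k ->] := c3 i.
  have -> : prim T (tmode L v4 i) t + k - (prim T (tmode L v4 i) r + k) = prim T (tmode L v4 i) t - prim T (tmode L v4 i) r by ring.
  exact: prim_holder.
- move=> s us; apply: le_trans (le_trans _ (HW s us)) _; last by apply: MM; rewrite !inE eqxx ?orbT.
  by apply: ler_sum => i _; rewrite /W prim0 primT subr0 expr0 mul1r.
- by move=> i t tT; exact: chain_pde ch tT.
- by move=> s p t e; exact: chain_bessel.
- move=> K x y t tT; apply: le_trans (HA K x y t tT) _; rewrite ler_wpM2r ?invr_ge0 ?exprn_ge0//.
  by apply: MM; rewrite !inE eqxx ?orbT.
Qed.

End Assemble.

(** * Energy laws in an abstract inner product space *)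

Section Hilbert.
Variables (R : realFieldType) (V : lmodType R) (dot : V -> V -> R) (A : V -> V).
Hypothesis dotC : forall x y, dot x y = dot y x.
Hypothesis dotD : forall x y z, dot (x + y) z = dot x z + dot y z.
Hypothesis dotZ : forall k x z, dot (k *: x) z = k * dot x z.
Hypothesis dot_ge0 : forall x, 0 <= dot x x.
Hypothesis AD : forall x y, A (x + y) = A x + A y.
Hypothesis AZ : forall k x, A (k *: x) = k *: A x.
Hypothesis A_sym : forall x y, dot (A x) y = dot x (A y).
Hypothesis A_ge0 : forall x, 0 <= dot (A x) x.
Implicit Types (x y z : V) (a b s alpha beta : R).

Lemma dotDr x y z : dot x (y + z) = dot x y + dot x z.
Proof. by rewrite dotC dotD !(dotC _ x). Qed.

Lemma dotZr k x z : dot x (k *: z) = k * dot x z.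
Proof. by rewrite dotC dotZ dotC. Qed.

Lemma dotN x z : dot (- x) z = - dot x z.
Proof. by rewrite -scaleN1r dotZ mulN1r. Qed.

Lemma dotNr x z : dot x (- z) = - dot x z.
Proof. by rewrite dotC dotN dotC. Qed.

Lemma AN x : A (- x) = - A x.
Proof. by rewrite -scaleN1r AZ scaleN1r. Qed.

Definition dotE := (dotD, dotDr, dotZ, dotZr, dotN, dotNr).
Definition linE := (AD, AZ, AN).

Lemma dot_le x y : 2 * dot x y <= dot x x + dot y y.
Proof.
rewrite -subr_ge0; have := dot_ge0 (x - y).
by rewrite !dotE (dotC y x); congr (_ <= _); ring.
Qed.

Lemma dotB_le x y : dot (x + y) (x + y) <= 2 * dot x x + 2 * dot y y.
Proof.
rewrite -subr_ge0; have := dot_ge0 (x - y).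
by rewrite !dotE (dotC y x); congr (_ <= _); ring.
Qed.

(** In spectral terms t^2 <= t^3 / 4 + 4 for t >= 0, obtained by adding t (t - 3)^2 / 4 >= 0 and
    half of (t - 9/4)^2 >= 0. These are [h1] and [h2], written without a spectral decomposition. *)
Lemma interpolation x : dot (A x) (A x) <= dot (A (A x)) (A x) / 4 + 4 * dot x x.
Proof.
rewrite -subr_ge0; have h1 := A_ge0 (2^-1 *: A x - (3 / 2) *: x).
have h2 := dot_ge0 (A x - (9 / 4) *: x); have h3 := dot_ge0 x.
move: h1 h2 h3; rewrite !linE !dotE (dotC x (A x)) (A_sym (A x) x).
move: (dot (A (A x)) (A x)) (dot (A x) (A x)) (dot (A x) x) (dot x x) => g b f a h1 h2 h3.
lra.
Qed.

(** A stands for minus the discrete Laplacian, q for a potential with psi = - A q, and d for the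
    last increment of x. The quartic part is left out and enters [energy_step] through X; the term
    in d is the modification due to extrapolation. *)
Definition energy alpha beta x d q := alpha / 2 * dot x x - dot (A x) x +
  dot (A x) (A x) / 2 + beta / 2 * dot (A q) q + dot (A d) d / 2.

(** The equation for q is paired with A (q2 + q1), and mu with x2 - x1. In [hd] the extrapolated
    concave term is an exact difference up to half the change of (A d, d) and a nonnegative second
    difference, which is dissipated. *)
Lemma energy_step alpha beta s x0 x1 x2 q1 q2 X mu : 0 < s ->
  beta *: (q2 - q1) = s *: mu - (s / 2) *: (q2 + q1) ->
  x2 - x1 = - (s / 2) *: A (q2 + q1) ->
  mu = X + (alpha / 2) *: (x2 + x1) - A (3 *: x1 - x0) + 2^-1 *: A (A (x2 + x1)) ->
  dot X (x2 - x1) + energy alpha beta x2 (x2 - x1) q2 <= energy alpha beta x1 (x1 - x0) q1.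
Proof.
move=> s0 eq1 eq2 emu.
have h1 : dot (beta *: (q2 - q1)) (A (q2 + q1)) = dot (s *: mu - (s / 2) *: (q2 + q1)) (A (q2 + q1)) by rewrite eq1.
have h2 : dot mu (x2 - x1) = - (s / 2) * dot mu (A (q2 + q1)) by rewrite eq2 dotZr.
have h3 := dot_ge0 (q2 + q1); have h4 := A_ge0 (q2 + q1); have h5 := A_ge0 (x2 - 2 *: x1 + x0).
have {}h1 : beta * (dot (A q2) q2 - dot (A q1) q1) = s * dot mu (A (q2 + q1)) - s / 2 * dot (A (q2 + q1)) (q2 + q1).
  rewrite dotZ [X in _ = X]dotD dotZ dotN dotZ -(A_sym (q2 + q1)) in h1; rewrite -h1; congr (_ * _).
  by rewrite !linE !dotE -!A_sym (dotC (A q1) q2) -(A_sym q2 q1); ring.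
have hmu : dot mu (x2 - x1) = dot X (x2 - x1) + alpha / 2 * (dot x2 x2 - dot x1 x1)
    - dot (A (3 *: x1 - x0)) (x2 - x1) + 2^-1 * (dot (A x2) (A x2) - dot (A x1) (A x1)).
  rewrite emu !dotD dotN !dotZ; congr (_ + _ - _ + _).
    by congr (_ * _); rewrite !dotE (dotC x1 x2); ring.
  by congr (_ * _); rewrite A_sym !linE !dotE (dotC (A x1) (A x2)); ring.
have hd : - dot (A (3 *: x1 - x0)) (x2 - x1) = - dot (A x2) x2 + dot (A x1) x1
    + 2^-1 * dot (A (x2 - x1)) (x2 - x1) - 2^-1 * dot (A (x1 - x0)) (x1 - x0)
    + 2^-1 * dot (A (x2 - 2 *: x1 + x0)) (x2 - 2 *: x1 + x0).
  by rewrite !linE !dotE !(A_sym x2 x1) !(A_sym x1 x0) !(A_sym x2 x0) !(dotC x2) !(dotC x1 (A x0)); field.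
rewrite /energy; move: h1 h2 hmu hd h4 h5.
move: (dot (A (q2 + q1)) (q2 + q1)) (dot (A q2) q2) (dot (A q1) q1) (dot mu (A (q2 + q1))) (dot mu (x2 - x1)) => Q Q2 Q1 m1 m2.
move: (dot (A (3 *: x1 - x0)) (x2 - x1)) (dot (A (x2 - 2 *: x1 + x0)) (x2 - 2 *: x1 + x0)) => U W.
move: (dot (A (x2 - x1)) (x2 - x1)) (dot (A (x1 - x0)) (x1 - x0)) => D2 D1 h1 h2 hmu hd h4 h5.
have h6 : 0 <= s * Q by rewrite mulr_ge0// ltW.
have -> : beta / 2 * Q2 = beta / 2 * Q1 + (s * m1 - s / 2 * Q) / 2 by rewrite -h1; field.
move: (dot X _) hmu h2 => Y hmu h2.
lra.
Qed.

(** One derivative stronger than [energy], with z itself in place of its potential. The term 5 (x,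
    x) pays for the negative (A x, A x): [interpolation] consumes 4 (x, x) and half of the leading
    term, and the rest gives coercivity. *)
Definition err_energy alpha beta x d z := beta / 2 * dot z z + alpha / 2 * dot (A x) x +
  dot (A (A x)) (A x) / 2 - dot (A x) (A x) + dot (A d) (A d) / 2 + 5 * dot x x.

Lemma err_energy_ge alpha beta x d z : 0 <= alpha -> 0 <= beta ->
  beta / 2 * dot z z + dot (A (A x)) (A x) / 4 + dot x x <= err_energy alpha beta x d z.
Proof.
move=> a0 b0; have := interpolation x; have := A_ge0 x; have := dot_ge0 (A d); rewrite /err_energy.
move=> h1 h2 h3; have h4 : 0 <= alpha / 2 * dot (A x) x by rewrite mulr_ge0// divr_ge0.
move: (alpha / 2 * _) (beta / 2 * _) h4 => u v h4; lra.
Qed.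

(** The equation for z is paired with (x2 - x1) / s, which differs from the mean of z by the defect
    [sig]. Hence the term in (z2 - z1, sig), which carries no factor s. *)
Lemma error_step alpha beta s x0 x1 x2 z1 z2 sig tau X :
  x2 - x1 = s *: (2^-1 *: (z2 + z1) + sig) ->
  beta *: (z2 - z1) = s *: X - s *: A ((alpha / 2) *: (x2 + x1) - A (3 *: x1 - x0) +
      2^-1 *: A (A (x2 + x1))) - (s / 2) *: (z2 + z1) + s *: tau ->
  err_energy alpha beta x2 (x2 - x1) z2 - err_energy alpha beta x1 (x1 - x0) z1 <=
  s * dot (X + tau - 2^-1 *: (z2 + z1) + 5 *: (x2 + x1)) (2^-1 *: (z2 + z1) + sig)
  - beta * dot (z2 - z1) sig.
Proof.
move=> e1 e2; set w := 2^-1 *: (z2 + z1) + sig.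
have h1 : dot (beta *: (z2 - z1)) w = beta / 2 * (dot z2 z2 - dot z1 z1) + beta * dot (z2 - z1) sig.
  by rewrite dotZ /w dotDr mulrDr; congr (_ + _); rewrite !dotE (dotC z1 z2); field.
have h2 : s * dot (x2 + x1) w = dot x2 x2 - dot x1 x1.
  by rewrite -dotZr -e1 !dotE (dotC x1 x2); ring.
have hA y : s * dot (A y) w = dot y (A x2) - dot y (A x1).
  by rewrite -dotZr -e1 A_sym AD AN dotDr dotNr.
have h3 : s * dot (A ((alpha / 2) *: (x2 + x1) - A (3 *: x1 - x0) + 2^-1 *: A (A (x2 + x1)))) w =
   alpha / 2 * (dot (A x2) x2 - dot (A x1) x1) +
   (dot (A (A x2)) (A x2) / 2 - dot (A x2) (A x2)) - (dot (A (A x1)) (A x1) / 2 - dot (A x1) (A x1))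
   + dot (A (x2 - x1)) (A (x2 - x1)) / 2 - dot (A (x1 - x0)) (A (x1 - x0)) / 2
   + dot (A (x2 - 2 *: x1 + x0)) (A (x2 - 2 *: x1 + x0)) / 2.
  rewrite hA !linE !dotE (dotC x1 (A x2)) (A_sym x2 x1) (dotC x2 (A x2)) (dotC x1 (A x1)).
  rewrite (A_sym (A x1) (A x2)) !(dotC (A x1) (A (A x2))).
  by rewrite !(dotC (A x0) (A x2)) !(dotC (A x0) (A x1)) !(dotC (A x1) (A x2)); field.
have h4 := dot_ge0 (A (x2 - 2 *: x1 + x0)).
have h5 : dot (beta *: (z2 - z1)) w = s * dot (X + tau - 2^-1 *: (z2 + z1) + 5 *: (x2 + x1)) w
   - 5 * (s * dot (x2 + x1) w)
   - s * dot (A ((alpha / 2) *: (x2 + x1) - A (3 *: x1 - x0) + 2^-1 *: A (A (x2 + x1)))) w.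
  rewrite e2; move: (A (_ + _ *: A (A (x2 + x1)))) => Y; by rewrite !dotE; field.
move: h1 h5; rewrite h2 h3 /err_energy => -> h5; move: h5 h4.
move: (dot (X + tau - _ + _) w) => S; move: (dot (A (x2 - 2 *: x1 + x0)) _) => W; lra.
Qed.

End Hilbert.

(** The scalar part of one step of [error_estimate], with inner products replaced by letters: [vw]
    is (v, w), [tt] and [SS] are the squared residuals, [j0] and [j1] the energies. *)
Lemma step_bound (R : realFieldType)
    (CN be vw vv ww hzz x5 xs Xt Xt2 XX tt SS zz0 zz1 x0 x1 j0 j1 : R) :
  0 <= CN -> 0 <= be -> 2 * vw <= vv + ww -> hzz <= (zz1 + zz0) / 2 -> ww <= 2 * hzz + 2 * SS ->
  vv <= 2 * Xt + 2 * x5 -> Xt <= 2 * Xt2 + 2 * hzz -> Xt2 <= 2 * XX + 2 * tt ->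
  xs <= 2 * x1 + 2 * x0 -> x5 = 25 * xs -> XX <= CN * (4 * (j1 + j0)) ->
  zz0 <= 2 / be * j0 -> zz1 <= 2 / be * j1 -> x0 <= j0 -> x1 <= j1 -> 0 <= SS -> 0 <= tt ->
  0 <= j0 -> 0 <= j1 ->
  vw <= (16 * CN + 200 + 20 / be) * (j1 + j0) + (16 * CN + 200 + 20 / be) * (tt + SS).
Proof.
move=> CN0 be0 h1 h2 h3 h4 h5 h6 h7 h8 h9 h10 h11 h12 h13 S0 t0 j00 j10.
have b1 : 0 <= be^-1 by rewrite invr_ge0.
have e1 : (16 * CN + 200 + 20 / be) * (j1 + j0) + (16 * CN + 200 + 20 / be) * (tt + SS) =
    4 * (CN * (4 * (j1 + j0))) + 10 * (2 / be * j0 + 2 / be * j1) + 200 * (j0 + j1) +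
    (16 * CN + 20 * be^-1) * (tt + SS) + 200 * (tt + SS) by ring.
have c3 : 0 <= (16 * CN + 20 * be^-1) * (tt + SS) by rewrite !(mulr_ge0, addr_ge0).
rewrite e1; have z1 := lerD h10 h11.
have : vw <= 4 * XX + 3 / 2 * (zz0 + zz1) + 50 * (x0 + x1) + 4 * tt + SS.
  by rewrite h8 in h4; move: h1 h2 h3 h4 h5 h6 h7; clear; lra.
have zp : 3 / 2 * (zz0 + zz1) <= 10 * (2 / be * j0 + 2 / be * j1).
  apply: le_trans (ler_wpM2l _ z1) _ => //; rewrite ler_wpM2r//; last by lra.
  by rewrite addr_ge0 ?mulr_ge0.
move: zp h9 h12 h13 S0 t0 j00 j10 c3; move: (CN * _) (_ / be * j0 + _) ((_ + _ / be) * _) => a b c; clear => *; lra.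
Qed.

(** Of j1, 1/8 is absorbed by the smallness of s and 1/2 by the boundary term of the summation by
    parts. Dividing the three sums bounded by [sP] by the remaining 3/8 gives the factor 8. *)
Lemma main_bound (R : realFieldType) (a b d sB SJ j1 j0 sSJ sP D B T be : R) :
  a <= 2 * sB * SJ + sB * j1 -> b <= B * D + B * T * D ->
  - (be * d) <= j1 / 2 + be * D + sSJ + be * D / 2 -> j1 - j0 <= a + b - be * d ->
  sB * j1 <= 1 / 8 * j1 -> sB * SJ <= sP -> sSJ <= sP -> 0 <= (B * T + B + 2 * be) * D ->
  0 <= be * D -> 0 <= j1 -> 0 <= j0 ->
  j1 <= 8 * (j0 + (B * T + B + 2 * be) * D) + 8 * sP.
Proof. by move=> *; lra. Qed.

(** The right-hand side, not J itself, grows at most geometrically with ratio 1 + b. *)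
Lemma discrete_gronwall (R : realType) (a b : R) (J : nat -> R) n : 0 <= a -> 0 <= b ->
  (forall k, (k <= n)%N -> J k <= a + b * \sum_(i < k) J i) ->
  forall k, (k <= n)%N -> J k <= a * expR (b * k%:R).
Proof.
move=> a0 b0 hJ; have key k : (k <= n.+1)%N -> a + b * \sum_(i < k) J i <= a * (1 + b) ^+ k.
  elim: k => [|k IH] kn; first by rewrite big_ord0 mulr0 addr0 mulr1.
  rewrite big_ord_recr/= mulrDr addrA exprSr mulrA mulrDr mulr1.
  have h1 := IH (ltnW kn); have h2 := hJ k kn.
  apply: lerD => //; rewrite mulrC ler_wpM2r//; exact: le_trans h2 h1.
move=> k kn; apply: le_trans (hJ k kn) _; apply: le_trans (key k (leqW kn)) _.
rewrite ler_wpM2l// mulrC expRM_natl lerXn2r ?nnegrE ?expR_ge0 ?addr_ge0//.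
exact: expR_ge1Dx.
Qed.

(* The constants are explicit because they must not depend on the Hilbert
   space, that is, on the mesh. *)
Section EstimateConstants.
Variables (R : realType) (beta T CN : R).

Definition est_B : R := 16 * CN + 200 + 20 / beta.
Definition est_P : R := est_B + 2 * beta + 1.
Definition est_E : R :=
  8 + 8 * (est_B * T + est_B + 2 * beta + 2 * beta * T + 1).
Definition est_C : R := 4 * (est_E * expR (8 * est_P * T)).

Hypotheses (beta0 : 0 < beta) (T0 : 0 <= T) (CN0 : 0 <= CN).

Lemma est_B_gt0 : 0 < est_B.
Proof. by rewrite /est_B ltr_pwDl ?divr_ge0 ?(ltW beta0)// ltr_wpDl// mulr_ge0. Qed.

Lemma est_P_gt0 : 0 < est_P.
Proof. by have := est_B_gt0; have := beta0; rewrite /est_P; lra. Qed.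

Lemma est_E_ge0 : 0 <= est_E.
Proof.
have h1 := mulr_ge0 (ltW est_B_gt0) T0; have h2 := mulr_ge0 (ltW beta0) T0.
by have := est_B_gt0; have := beta0; rewrite /est_E; lra.
Qed.

Lemma est_C_ge0 : 0 <= est_C.
Proof. exact: (mulr_ge0 (ler0n R 4) (mulr_ge0 est_E_ge0 (expR_ge0 _))). Qed.

End EstimateConstants.

(** * Abstract error estimate *)

Section ErrorEstimate.
Variables (R : realType) (V : lmodType R) (dot : V -> V -> R) (A : V -> V).
Hypothesis dotC : forall x y, dot x y = dot y x.
Hypothesis dotD : forall x y z, dot (x + y) z = dot x z + dot y z.
Hypothesis dotZ : forall k x z, dot (k *: x) z = k * dot x z.
Hypothesis dot_ge0 : forall x, 0 <= dot x x.
Hypothesis AD : forall x y, A (x + y) = A x + A y.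
Hypothesis AZ : forall k x, A (k *: x) = k *: A x.
Hypothesis A_sym : forall x y, dot (A x) y = dot x (A y).
Hypothesis A_ge0 : forall x, 0 <= dot (A x) x.
Variables (alpha beta T : R) (alpha0 : 0 <= alpha) (beta0 : 0 < beta) (T0 : 0 <= T).

Let dotr := (dotD, dotDr dotC dotD, dotZ, dotZr dotC dotZ, dotN dotZ, dotNr dotC dotZ).

Lemma abel_sum (z sig : nat -> V) n :
  \sum_(k < n.+1) dot (z k.+1 - z k) (sig k) =
  dot (z n.+1) (sig n) - dot (z 0%N) (sig 0%N) - \sum_(k < n) dot (z k.+1) (sig k.+1 - sig k).
Proof.
elim: n => [|n IH]; first by rewrite big_ord1 big_ord0 subr0 !dotr.
by rewrite big_ord_recr/= IH [in RHS]big_ord_recr/= !dotr; ring.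
Qed.

(** The squares of the increments of [sig] add up to s D at most, which compensates the missing
    factor s: Young's inequality with weights s and 1 / s then leaves a term of Gronwall type and a
    multiple of D. The boundary term of the summation by parts is absorbed by half of the energy. *)
Lemma error_estimate (CN s D : R) (n : nat) (x z sig tau X : nat -> V) : 0 <= CN ->
  0 < s -> s <= (8 * est_P beta CN)^-1 -> n%:R * s <= T -> 0 <= D -> z 0%N = 0 ->
  (forall k, (k < n)%N ->
    [/\ x k.+1 - x k = s *: (2^-1 *: (z k.+1 + z k) + sig k),
        beta *: (z k.+1 - z k) = s *: X k - s *: A ((alpha / 2) *: (x k.+1 + x k) -
           A (3 *: x k - x k.-1) + 2^-1 *: A (A (x k.+1 + x k))) - (s / 2) *: (z k.+1 + z k) + s *: tau k &
        dot (X k) (X k) <= CN * (dot (x k.+1) (x k.+1) + dot (A (A (x k.+1))) (A (x k.+1)) +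
           dot (x k) (x k) + dot (A (A (x k))) (A (x k)))]) ->
  (forall k, (k < n)%N -> dot (sig k) (sig k) <= D) ->
  \sum_(k < n) s * dot (tau k) (tau k) <= D ->
  \sum_(k < n.-1) dot (sig k.+1 - sig k) (sig k.+1 - sig k) <= s * D ->
  forall k, (k <= n)%N -> dot (x k) (x k) + dot (A (A (x k))) (A (x k)) <=
    est_C beta T CN * (err_energy dot A alpha beta (x 0%N) 0 0 + D).
Proof.
move=> CN0; have b0 := beta0; have T1 := T0.
pose B := est_B beta CN; have B0 : 0 < B := est_B_gt0 b0 CN0.
pose P := est_P beta CN; have P0 : 0 < P := est_P_gt0 b0 CN0.
pose E := est_E beta T CN; have E0 : 0 <= E := est_E_ge0 b0 T1 CN0.
have eP : P = B + 2 * beta + 1 by [].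
have eE : E = 8 + 8 * (B * T + B + 2 * beta + 2 * beta * T + 1) by [].
move=> s0 ss0 nsT D0 z0 hk hsig htau hdsig.
pose J k := err_energy dot A alpha beta (x k) (x k - x k.-1) (z k).
have JE k : beta / 2 * dot (z k) (z k) + dot (A (A (x k))) (A (x k)) / 4 + dot (x k) (x k) <= J k.
  exact: (err_energy_ge dotC dotD dotZ dot_ge0 AD AZ A_sym A_ge0 _ _ _ alpha0 (ltW beta0)).
have zz k : 0 <= dot (z k) (z k) by exact: dot_ge0.
have gg k : 0 <= dot (A (A (x k))) (A (x k)) by exact: A_ge0.
have xx k : 0 <= dot (x k) (x k) by exact: dot_ge0.
have bz k : 0 <= beta * dot (z k) (z k) by rewrite mulr_ge0// ltW.
have J0 k : 0 <= J k by have := JE k; have := bz k; have := gg k; have := xx k; lra.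
have JE4 k : dot (x k) (x k) + dot (A (A (x k))) (A (x k)) <= 4 * J k.
  by have := JE k; have := bz k; have := gg k; have := xx k; lra.
have zJ k : dot (z k) (z k) <= 2 / beta * J k.
  by rewrite mulrAC ler_pdivlMr//; have := JE k; have := gg k; have := xx k; lra.
have dn2 a b : dot (a + b) (a + b) <= 2 * dot a a + 2 * dot b b by exact: dotB_le.
have step k : (k < n)%N -> J k.+1 - J k <= s * (B * (J k.+1 + J k)) + s * (B * (dot (tau k) (tau k) + dot (sig k) (sig k)))
    - beta * dot (z k.+1 - z k) (sig k).
  move=> kn; have [e1 e2 hX] := hk k kn.
  apply: le_trans (error_step dotC dotD dotZ dot_ge0 AD AZ A_sym e1 e2) _.
  rewrite lerD2r -mulrDr ler_wpM2l ?(ltW s0)//.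
  set w := _ + sig k; set v := (X in dot X w).
  have h1 : 2 * dot v w <= dot v v + dot w w := dot_le dotC dotD dotZ dot_ge0 v w.
  have hz : dot (2^-1 *: (z k.+1 + z k)) (2^-1 *: (z k.+1 + z k)) <= (dot (z k.+1) (z k.+1) + dot (z k) (z k)) / 2.
    by rewrite !dotr -subr_ge0; have := dot_ge0 (z k.+1 - z k); rewrite !dotr (dotC (z k) (z k.+1)); lra.
  have hw : dot w w <= 2 * dot (2^-1 *: (z k.+1 + z k)) (2^-1 *: (z k.+1 + z k)) + 2 * dot (sig k) (sig k) by exact: dn2.
  have hv : dot v v <= 2 * dot (X k + tau k - 2^-1 *: (z k.+1 + z k)) (X k + tau k - 2^-1 *: (z k.+1 + z k)) +
      2 * dot (5 *: (x k.+1 + x k)) (5 *: (x k.+1 + x k)) by exact: dn2.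
  have hv2 : dot (X k + tau k - 2^-1 *: (z k.+1 + z k)) (X k + tau k - 2^-1 *: (z k.+1 + z k)) <=
      2 * dot (X k + tau k) (X k + tau k) + 2 * dot (2^-1 *: (z k.+1 + z k)) (2^-1 *: (z k.+1 + z k)).
    by apply: le_trans (dn2 _ _) _; rewrite (dotN dotZ) (dotNr dotC dotZ) opprK.
  have hv3 := dn2 (X k) (tau k); have hx := dn2 (x k.+1) (x k).
  have hx5 : dot (5 *: (x k.+1 + x k)) (5 *: (x k.+1 + x k)) = 25 * dot (x k.+1 + x k) (x k.+1 + x k).
    by rewrite dotZ (dotZr dotC dotZ); ring.
  have hXJ : dot (X k) (X k) <= CN * (4 * (J k.+1 + J k)).
    apply: le_trans hX _; rewrite ler_wpM2l//.
    have := JE k; have := JE k.+1; have := bz k; have := bz k.+1; have := gg k; have := gg k.+1; have := xx k; have := xx k.+1; lra.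
  have zk := zJ k; have zk1 := zJ k.+1; have xk : dot (x k) (x k) <= J k.
    by have := JE k; have := bz k; have := gg k; lra.
  have xk1 : dot (x k.+1) (x k.+1) <= J k.+1.
    by have := JE k.+1; have := bz k.+1; have := gg k.+1; lra.
  have S0 := dot_ge0 (sig k); have t0 := dot_ge0 (tau k).
  exact: (step_bound CN0 (ltW b0) h1 hz hw hv hv2 hv3 hx hx5 hXJ zk zk1 xk xk1 S0 t0 (J0 k) (J0 k.+1)).
(* This is where s must be small: the energy at the new time level appears on the right with the
   factor s B. *)
have sP : s * P <= 1 / 8.
  move: ss0; rewrite invfM => /(ler_wpM2r (ltW P0)); rewrite -mulrA mulVf ?gt_eqF// mulr1; lra.
have sB : s * B <= 1 / 8 by apply: le_trans sP; rewrite ler_wpM2l ?(ltW s0)// eP; lra.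
have mT m : (m <= n)%N -> m%:R * s <= T.
  by move=> mn; apply: le_trans nsT; rewrite ler_wpM2r ?(ltW s0)// ler_nat.
have x00 : J 0%N = err_energy dot A alpha beta (x 0%N) 0 0 by rewrite /J /= subrr z0.
pose K := B * T + B + 2 * beta.
have main m : (m <= n)%N -> J m <= 8 * (J 0%N + K * D) + 8 * (s * P * \sum_(i < m) J i).
  have K0 : 0 <= K by rewrite /K; have h1 := mulr_ge0 (ltW B0) T1; lra.
  have KD := mulr_ge0 K0 D0.
  case: m => [_|m mn]; first by rewrite big_ord0 !mulr0 addr0; have := J0 0%N; lra.
  have tel : J m.+1 - J 0%N = \sum_(k < m.+1) (J k.+1 - J k).
    rewrite -(big_mkord xpredT (fun k => J k.+1 - J k)) telescope_sumr//.
  have sumle : \sum_(k < m.+1) (J k.+1 - J k) <= \sum_(k < m.+1) (s * (B * (J k.+1 + J k)) +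
      s * (B * (dot (tau k) (tau k) + dot (sig k) (sig k))) - beta * dot (z k.+1 - z k) (sig k)).
    by apply: ler_sum => k _; apply: step; apply: leq_trans mn.
  have S1 : \sum_(k < m.+1) s * (B * (J k.+1 + J k)) <= 2 * (s * B) * \sum_(k < m.+1) J k + s * B * J m.+1.
    have -> : \sum_(k < m.+1) s * (B * (J k.+1 + J k)) = s * B * \sum_(k < m.+1) J k.+1 + s * B * \sum_(k < m.+1) J k.
      by rewrite !mulr_sumr -big_split; apply: eq_bigr => k _ /=; ring.
    have -> : \sum_(k < m.+1) J k.+1 = \sum_(k < m.+1) J k + J m.+1 - J 0%N.
      by rewrite -addrA tel -big_split; apply: eq_bigr => k _ /=; rewrite addrC subrK.
    have := mulr_ge0 (mulr_ge0 (ltW s0) (ltW B0)) (J0 0%N); lra.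
  have S2 : \sum_(k < m.+1) s * (B * (dot (tau k) (tau k) + dot (sig k) (sig k))) <= B * D + B * T * D.
    have -> : \sum_(k < m.+1) s * (B * (dot (tau k) (tau k) + dot (sig k) (sig k))) =
        B * \sum_(k < m.+1) s * dot (tau k) (tau k) + B * \sum_(k < m.+1) s * dot (sig k) (sig k).
      by rewrite !mulr_sumr -big_split; apply: eq_bigr => k _ /=; ring.
    apply: lerD.
      rewrite ler_wpM2l ?(ltW B0)//; apply: le_trans htau.
      rewrite -(big_mkord xpredT (fun k => s * dot (tau k) (tau k))) -(big_mkord xpredT (fun k => s * dot (tau k) (tau k))).
      rewrite (big_cat_nat (n := m.+1) (p := n))//= lerDl; apply: sumr_ge0 => k _.
      by rewrite mulr_ge0 ?(ltW s0).
    rewrite -mulrA ler_wpM2l ?(ltW B0)//.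
    apply: (@le_trans _ _ (\sum_(k < m.+1) s * D)).
      by apply: ler_sum => k _; rewrite ler_wpM2l ?(ltW s0)// hsig// (leq_trans _ mn).
    rewrite sumr_const card_ord -[_ *+ _]mulr_natl mulrA; apply: ler_wpM2r => //; exact: mT.
  have S3 : - (beta * \sum_(k < m.+1) dot (z k.+1 - z k) (sig k)) <=
      J m.+1 / 2 + beta * D + s * \sum_(k < m.+1) J k + beta * D / 2.
    rewrite abel_sum z0; have -> : dot 0 (sig 0%N) = 0 by rewrite -(scale0r 0) dotZ mul0r.
    have A1 : - (beta * dot (z m.+1) (sig m)) <= J m.+1 / 2 + beta * D.
      (* Young's inequality with weight 1/4 on (z, z), chosen so that beta (z, z) / 4 fits in half
         of J. *)
      have := dot_ge0 (2^-1 *: z m.+1 + sig m); rewrite !dotr (dotC (sig m)) => h.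
      have h2 := hsig m mn; have h3 : beta * dot (z m.+1) (z m.+1) / 4 <= J m.+1 / 2.
        by have := JE m.+1; have := gg m.+1; have := xx m.+1; lra.
      have h4 := mulr_ge0 (ltW beta0) h; have h5 := ler_wpM2l (ltW beta0) h2; lra.
    have A2 : beta * (\sum_(k < m) dot (z k.+1) (sig k.+1 - sig k)) <= s * \sum_(k < m.+1) J k + beta * D / 2.
      apply: (@le_trans _ _ (\sum_(k < m) (s * J k.+1 + beta / (2 * s) * dot (sig k.+1 - sig k) (sig k.+1 - sig k)))).
        rewrite mulr_sumr; apply: ler_sum => k _; move: (sig k.+1 - sig k) => d.
        have := dot_ge0 (s *: z k.+1 - d); rewrite !dotr (dotC d) => h.
        have h1 := JE k.+1; have := gg k.+1; have := xx k.+1 => h2 h3.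
        have h4 : s * (beta / 2 * dot (z k.+1) (z k.+1)) <= s * J k.+1 by rewrite ler_wpM2l ?(ltW s0)//; lra.
        have h5 : beta / (2 * s) * (2 * s * dot (z k.+1) d) <= beta / (2 * s) * (s * (s * dot (z k.+1) (z k.+1)) + dot d d).
          by rewrite ler_wpM2l ?divr_ge0 ?mulr_ge0 ?(ltW s0) ?(ltW beta0)//; lra.
        move: h4 h5; move: (dot (z k.+1) d) (dot (z k.+1) _) (dot d d) => p q r h4 h5.
        have -> : beta * p = beta / (2 * s) * (2 * s * p) by field; rewrite gt_eqF.
        apply: le_trans h5 _; rewrite mulrDr lerD2r; apply: le_trans h4.
        by rewrite le_eqVlt; apply/orP; left; apply/eqP; field; rewrite gt_eqF.
      rewrite big_split/= -!mulr_sumr; apply: lerD.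
        rewrite ler_wpM2l ?(ltW s0)// [leRHS]big_ord_recl/= -[leLHS]add0r lerD//.
      have -> : beta * D / 2 = beta / (2 * s) * (s * D) by field; rewrite gt_eqF.
      rewrite ler_wpM2l ?divr_ge0 ?mulr_ge0 ?(ltW s0) ?(ltW beta0)//; apply: le_trans hdsig.
      have mn1 : (m <= n.-1)%N by case: (n) mn.
      pose f k := dot (sig k.+1 - sig k) (sig k.+1 - sig k).
      rewrite -(big_mkord xpredT f) -(big_mkord xpredT f) (big_cat_nat (n := m) (p := n.-1))//= lerDl.
      by apply: sumr_ge0 => k _; exact: dot_ge0.
    by rewrite subr0; move: A1 A2; move: (\sum_(k < m) _) (dot (z m.+1) (sig m)) => a b; lra.
  move: sumle; rewrite -tel sumrB big_split/= -[X in _ <= _ - X]mulr_sumr.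
  have jm := J0 m.+1; have SJ : 0 <= \sum_(k < m.+1) J k by apply: sumr_ge0.
  move: S1 S2 S3; move: (\sum_(k < m.+1) s * (B * (J k.+1 + J k))) => a.
  move: (\sum_(k < m.+1) s * (B * (dot (tau k) _ + _))) (\sum_(k < m.+1) dot _ _) => b d.
  move: (\sum_(k < m.+1) J k) SJ (J m.+1) jm (J 0%N) (J0 0%N) => SJ SJ0 j1 j10 j0 j00 S1 S2 S3 H.
  have h2 : 0 <= s * SJ by rewrite mulr_ge0 ?(ltW s0).
  have h3 : s * B * SJ <= s * P * SJ by rewrite ler_wpM2r// ler_wpM2l ?(ltW s0)// eP; lra.
  have h4 : s * SJ <= s * P * SJ by rewrite -mulrA ler_wpM2l ?(ltW s0)// -[leLHS]mul1r ler_wpM2r// eP; lra.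
  have h5 : 0 <= beta * D by rewrite mulr_ge0// ltW.
  have h1 : s * B * j1 <= 1 / 8 * j1 by rewrite ler_wpM2r.
  have := main_bound S1 S2 S3 H h1 h3 h4; apply => //.
move=> k kn; have JJ : J k <= E * (J 0%N + D) * expR (8 * P * s * k%:R).
  apply: discrete_gronwall (leqnn k) => [||m mk].
  - by rewrite mulr_ge0// addr_ge0.
  - by rewrite !mulr_ge0 ?(ltW P0) ?(ltW s0).
  - apply: le_trans (main m (leq_trans mk kn)) _.
    have -> : 8 * (s * P * \sum_(i < m) J i) = 8 * P * s * \sum_(i < m) J i by ring.
    rewrite lerD2r.
    have KE : 8 * K <= E.
      by rewrite eE /K; have := mulr_ge0 (ltW beta0) T0; lra.
    have E8 : 8 <= E.
      rewrite eE; have h1 := mulr_ge0 (ltW B0) T0; have h2 := mulr_ge0 (ltW beta0) T0; lra.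
    rewrite (mulrDr E) (mulrDr 8); apply: lerD; first by rewrite ler_wpM2r.
    by rewrite mulrA ler_wpM2r.
have JT : J k <= E * (J 0%N + D) * expR (8 * P * T).
  apply: le_trans JJ _; apply: ler_wpM2l; first exact: mulr_ge0 E0 (addr_ge0 (J0 0%N) D0).
  rewrite ler_expR -mulrA; apply: ler_wpM2l; first exact: mulr_ge0 (ler0n R 8) (ltW P0).
  by rewrite mulrC; exact: mT.
rewrite -x00; apply: le_trans (JE4 k) _.
have -> : est_C beta T CN * (J 0%N + D) = 4 * (E * (J 0%N + D) * expR (8 * P * T)).
  by rewrite /est_C -/E -/P; ring.
by rewrite ler_wpM2l.
Qed.

End ErrorEstimate.

(** * Sums and differences on the periodic grid *)

Section GridSum.
Variable R : realType.
Implicit Types (f g : grid R) (N : nat).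

Definition gsum N f : R :=
  \sum_(1 <= i < N.+1) \sum_(1 <= j < N.+1) f i%:Z j%:Z.

Definition gtr f : grid R := fun i j => f j i.

Definition shx (a : int) f : grid R := fun i j => f (i + a) j.
Definition dfx f : grid R := fun i j => f (i + 1) j - f i j.
Definition dfy f : grid R := fun i j => f i (j + 1) - f i j.
Definition d2x f : grid R := fun i j => f (i + 1) j + f (i - 1) j - 2 * f i j.
Definition d2y f : grid R := fun i j => f i (j + 1) + f i (j - 1) - 2 * f i j.

Lemma gsum_tr N f : gsum N (gtr f) = gsum N f.
Proof. by rewrite /gsum exchange_big. Qed.

Lemma periodic_tr N f : periodic_grid N f -> periodic_grid N (gtr f).
Proof. by move=> Hf i j; have [h1 h2] := Hf j i. Qed.

Lemma periodic_op N (F : R -> R -> R) f g : periodic_grid N f ->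
  periodic_grid N g -> periodic_grid N (fun i j => F (f i j) (g i j)).
Proof.
by move=> Hf Hg i j; have [h1 h2] := Hf i j; have [k1 k2] := Hg i j;
  rewrite h1 h2 k1 k2.
Qed.

Lemma periodic_op1 N (F : R -> R) f : periodic_grid N f ->
  periodic_grid N (fun i j => F (f i j)).
Proof. by move=> Hf; apply: (periodic_op (fun a _ => F a) Hf Hf). Qed.

Lemma periodic_shx N (a : int) f : periodic_grid N f ->
  periodic_grid N (fun i j => f (i + a) j).
Proof.
move=> Hf i j; have [h1 _] := Hf (i + a) j; have [_ h2] := Hf (i + a) j.
by rewrite h2 -{1}h1 addrAC.
Qed.

Lemma periodic_dfx N f : periodic_grid N f -> periodic_grid N (dfx f).
Proof.
by move=> Hf; apply: (periodic_op (fun a b => a - b) (periodic_shx 1 Hf) Hf).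
Qed.

Lemma periodic_dfy N f : periodic_grid N f -> periodic_grid N (dfy f).
Proof. by move=> Hf; apply/(periodic_tr (periodic_dfx (periodic_tr Hf))). Qed.

Lemma periodic_d2x N f : periodic_grid N f -> periodic_grid N (d2x f).
Proof.
move=> Hf; have H1 := periodic_shx 1 Hf; have H2 := periodic_shx (-1) Hf.
apply: (periodic_op (fun a b => a - 2 * b) _ Hf).
exact: (periodic_op +%R H1 H2).
Qed.

Lemma periodic_d2y N f : periodic_grid N f -> periodic_grid N (d2y f).
Proof. by move=> Hf; apply/(periodic_tr (periodic_d2x (periodic_tr Hf))). Qed.

Lemma eq_gsum N f g : (forall i j, f i j = g i j) -> gsum N f = gsum N g.
Proof. by move=> E; apply: eq_bigr => i _; apply: eq_bigr. Qed.

Lemma gsumD N f g :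
  gsum N (fun i j => f i j + g i j) = gsum N f + gsum N g.
Proof.
by rewrite /gsum -big_split /=; apply: eq_bigr => i _; rewrite big_split.
Qed.

Lemma gsumZ N (a : R) f : gsum N (fun i j => a * f i j) = a * gsum N f.
Proof.
by rewrite /gsum mulr_sumr; apply: eq_bigr => i _; rewrite mulr_sumr.
Qed.

Lemma gsumN N f : gsum N (fun i j => - f i j) = - gsum N f.
Proof.
by rewrite -mulN1r -gsumZ; apply: eq_gsum => i j; rewrite mulN1r.
Qed.

Lemma gsumB N f g :
  gsum N (fun i j => f i j - g i j) = gsum N f - gsum N g.
Proof. by rewrite gsumD gsumN. Qed.

Lemma le_gsum N f g : (forall i j, f i j <= g i j) -> gsum N f <= gsum N g.
Proof. by move=> E; apply: ler_sum => i _; apply: ler_sum. Qed.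

Lemma gsum_ge0 N f : (forall i j, 0 <= f i j) -> 0 <= gsum N f.
Proof. by move=> E; apply: sumr_ge0 => i _; apply: sumr_ge0. Qed.

Lemma gsum_const N (a : R) : gsum N (fun _ _ => a) = N%:R ^+ 2 * a.
Proof.
rewrite /gsum !sumr_const_nat subSS subn0 -!mulrnA -[LHS]mulr_natl natrM.
by rewrite expr2.
Qed.

Lemma sum_shift N (g : int -> R) : (forall i, g (i + N%:Z) = g i) ->
  \sum_(1 <= i < N.+1) g (i%:Z + 1) = \sum_(1 <= i < N.+1) g i%:Z.
Proof.
move=> Hg; apply/eqP; rewrite -subr_eq0 -sumrB; apply/eqP.
rewrite (eq_bigr (fun i : nat => g i.+1%:Z - g i%:Z)); last first.
  by move=> i _; rewrite -[i.+1]addn1 PoszD.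
by rewrite telescope_sumr// -[N.+1]add1n PoszD Hg subrr.
Qed.

Lemma gsum_shx N f : periodic_grid N f ->
  gsum N (fun i j => f (i + 1) j) = gsum N f.
Proof.
move=> Hf; apply: (sum_shift (g := fun i => \sum_(1 <= j < N.+1) f i j%:Z)).
by move=> i; apply: eq_bigr => j _; have [-> _] := Hf i j%:Z.
Qed.

Lemma gsum_shxN N f : periodic_grid N f ->
  gsum N (fun i j => f (i - 1) j) = gsum N f.
Proof.
move=> Hf; rewrite -(gsum_shx (periodic_shx (-1) Hf)).
by apply: eq_gsum => i j; rewrite addrK.
Qed.

Lemma gsum_shy N f : periodic_grid N f ->
  gsum N (fun i j => f i (j + 1)) = gsum N f.
Proof.
by move=> Hf; rewrite -gsum_tr -(gsum_tr N f) -(gsum_shx (periodic_tr Hf)).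
Qed.

Lemma gsum_shyN N f : periodic_grid N f ->
  gsum N (fun i j => f i (j - 1)) = gsum N f.
Proof.
by move=> Hf; rewrite -gsum_tr -(gsum_tr N f) -(gsum_shxN (periodic_tr Hf)).
Qed.

Lemma gsum_cauchy N f g : gsum N (fun i j => f i j * g i j) ^+ 2 <=
  gsum N (fun i j => f i j ^+ 2) * gsum N (fun i j => g i j ^+ 2).
Proof.
apply: quadratic_ge0 => [|t]; first by apply: gsum_ge0 => i j; exact: sqr_ge0.
have -> : gsum N (fun i j => f i j ^+ 2) -
   2 * t * gsum N (fun i j => f i j * g i j) +
   t ^+ 2 * gsum N (fun i j => g i j ^+ 2) =
  gsum N (fun i j => (f i j - t * g i j) ^+ 2).
  rewrite -!gsumZ -gsumB -gsumD; apply: eq_gsum => i j; ring.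
by apply: gsum_ge0 => i j; exact: sqr_ge0.
Qed.

Lemma gsum_l1 N f :
  gsum N (fun i j => `|f i j|) ^+ 2 <= N%:R ^+ 2 * gsum N (fun i j => f i j ^+ 2).
Proof.
have := gsum_cauchy N (fun _ _ => 1) (fun i j => `|f i j|).
rewrite (@eq_gsum N _ (fun i j => `|f i j|)); last by move=> i j; rewrite mul1r.
move/le_trans; apply; rewrite gsum_const expr1n mulr1.
rewrite (@eq_gsum N _ (fun i j => f i j ^+ 2))// => i j.
by rewrite real_normK// num_real.
Qed.

Lemma green_x N f g : periodic_grid N f -> periodic_grid N g ->
  gsum N (fun i j => d2x f i j * g i j) =
  - gsum N (fun i j => dfx f i j * dfx g i j).
Proof.
move=> Hf Hg; apply/eqP; rewrite -addr_eq0 -gsumD; apply/eqP.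
have HF := periodic_op *%R (periodic_dfx Hf) (periodic_shx 1 Hg).
rewrite (@eq_gsum N _ (fun i j => dfx f i j * g (i + 1) j -
  dfx f (i - 1) j * g (i - 1 + 1) j)); last first.
  move=> i j; rewrite /d2x /dfx subrK; ring.
by rewrite gsumB (gsum_shxN HF) subrr.
Qed.

Lemma green_y N f g : periodic_grid N f -> periodic_grid N g ->
  gsum N (fun i j => d2y f i j * g i j) =
  - gsum N (fun i j => dfy f i j * dfy g i j).
Proof.
move=> Hf Hg; rewrite -gsum_tr -[in RHS]gsum_tr.
exact: (green_x (periodic_tr Hf) (periodic_tr Hg)).
Qed.

(** Two summations by parts turn the product of the pure second differences into the square of the
    mixed one. *)
Lemma d2x_mixed N f : periodic_grid N f ->
  gsum N (fun i j => d2x f i j ^+ 2) + gsum N (fun i j => d2y f i j ^+ 2) +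
  2 * gsum N (fun i j => dfx (dfy f) i j ^+ 2) =
  gsum N (fun i j => (d2x f i j + d2y f i j) ^+ 2).
Proof.
move=> Hf.
have E : gsum N (fun i j => d2x f i j * d2y f i j) =
    gsum N (fun i j => dfx (dfy f) i j ^+ 2).
  rewrite (green_x Hf (periodic_d2y Hf)).
  rewrite (@eq_gsum N _ (fun i j => d2y (dfx f) i j * dfx f i j)); last first.
    move=> i j; rewrite /dfx /d2y; ring.
  rewrite (green_y (periodic_dfx Hf) (periodic_dfx Hf)) opprK.
  by apply: eq_gsum => i j; rewrite /dfx /dfy; ring.
rewrite -E -gsumZ -!gsumD; apply: eq_gsum => i j; ring.
Qed.

(** Young's inequality for x d times S = a^2 + a b + b^2, weighted so that S^2 <= 9/2 (a^4 + b^4)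
    leaves the coefficient 1/4. Two neighbours then make 1/2, to be absorbed in [dfx4]. *)
Lemma cube_diff_bound (x d a b M : R) : d = a - b -> x ^+ 2 <= M ->
  - (x * (a ^+ 3 - b ^+ 3)) <= (a ^+ 4 + b ^+ 4) / 4 + 9 / 2 * (M * d ^+ 2).
Proof.
move=> Hd HM.
have h1 : x ^+ 2 * d ^+ 2 <= M * d ^+ 2 by rewrite ler_wpM2r// sqr_ge0.
have h3 := sqr_ge0 (a ^+ 2 + a * b + b ^+ 2 + 9 * (x * d)).
have h7 : 0 <= 9 / 2 * (a ^+ 4 + b ^+ 4) - (a ^+ 2 + a * b + b ^+ 2) ^+ 2.
  have -> : 9 / 2 * (a ^+ 4 + b ^+ 4) - (a ^+ 2 + a * b + b ^+ 2) ^+ 2 =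
    (a - b) ^+ 2 * (7 / 2 * (a + 5 / 7 * b) ^+ 2 + 12 / 7 * b ^+ 2) by field.
  by rewrite mulr_ge0 ?sqr_ge0// addr_ge0// mulr_ge0 ?sqr_ge0.
have -> : - (x * (a ^+ 3 - b ^+ 3)) = - (x * d) * (a ^+ 2 + a * b + b ^+ 2).
  by rewrite Hd; ring.
have E3 : (a ^+ 2 + a * b + b ^+ 2 + 9 * (x * d)) ^+ 2 =
  (a ^+ 2 + a * b + b ^+ 2) ^+ 2 + 81 * (x ^+ 2 * d ^+ 2) -
  18 * (- (x * d) * (a ^+ 2 + a * b + b ^+ 2)) by ring.
move: h1 h3 h7; rewrite E3.
move: ((a ^+ 2 + a * b + b ^+ 2) ^+ 2) (- (x * d) * _) (x ^+ 2 * d ^+ 2)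
  (M * d ^+ 2) => S P Y Z; lra.
Qed.

(** Discrete Gagliardo-Nirenberg inequality: one of the four differences is moved onto the cube of
    the others, so that f itself appears, bounded by its supremum, next to second differences. *)
Lemma dfx4 N f M : periodic_grid N f -> (forall i j, f i j ^+ 2 <= M) ->
  gsum N (fun i j => dfx f i j ^+ 4) <= 9 * M * gsum N (fun i j => d2x f i j ^+ 2).
Proof.
move=> Hf HM.
pose D3 : grid R := fun i j => dfx f i j ^+ 3.
have H3 : periodic_grid N D3 := periodic_op1 (fun a => a ^+ 3) (periodic_dfx Hf).
have H4 : periodic_grid N (fun i j => dfx f i j ^+ 4) :=
  periodic_op1 (fun a => a ^+ 4) (periodic_dfx Hf).
have HF := periodic_op *%R (periodic_shx 1 Hf) H3.
have E : gsum N (fun i j => dfx f i j ^+ 4) =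
    gsum N (fun i j => - (f i j * (D3 i j - D3 (i - 1) j))).
  apply/eqP; rewrite -subr_eq0 -gsumB; apply/eqP.
  rewrite (@eq_gsum N _ (fun i j => f (i + 1) j * D3 i j -
     f (i - 1 + 1) j * D3 (i - 1) j)); last first.
    by move=> i j; rewrite /D3 /dfx !subrK; ring.
  by rewrite gsumB (gsum_shxN HF) subrr.
have Hd i j : d2x f i j = dfx f i j - dfx f (i - 1) j.
  by rewrite /d2x /dfx subrK; ring.
have := @le_gsum N _ _ (fun i j => cube_diff_bound (Hd i j) (HM i j)).
rewrite -E gsumD !gsumZ.
rewrite (@eq_gsum N (fun i j => (dfx f i j ^+ 4 + dfx f (i - 1) j ^+ 4) / 4)
  (fun i j => 4^-1 * (dfx f i j ^+ 4 + dfx f (i - 1) j ^+ 4))); last first.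
  by move=> i j; rewrite mulrC.
rewrite gsumZ gsumD (gsum_shxN H4).
move: (gsum N _) (gsum N _) => X Y h; lra.
Qed.

(** Discrete Sobolev inequality in one dimension: any two values differ by at most the total
    variation, and averaging over one of them gives the mean. *)
Lemma sum_sup N (g : int -> R) (i : nat) : (1 <= i < N.+1)%N ->
  `|g i%:Z| <= N%:R^-1 * (\sum_(1 <= j < N.+1) `|g j%:Z|) +
     \sum_(1 <= j < N.+1) `|g (j%:Z + 1) - g j%:Z|.
Proof.
move=> Hi; set S := \sum_(1 <= j < N.+1) `|g (j%:Z + 1) - g j%:Z|.
have mono (a b : nat) : (1 <= a <= b)%N -> (b < N.+1)%N -> `|g b%:Z - g a%:Z| <= S.
  move=> /andP[h1 h2] h3.
  rewrite -(telescope_sumr (fun k : nat => g k%:Z) h2).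
  apply: (le_trans (ler_norm_sum _ _ _)); rewrite /S.
  rewrite (big_cat_nat h1) /=; last by lia.
  rewrite [X in _ <= _ + X](big_cat_nat h2) /=; last by lia.
  have -> : \sum_(a <= j < b) `|g (j%:Z + 1) - g j%:Z| =
      \sum_(a <= j < b) `|g j.+1%:Z - g j%:Z|.
    by apply: eq_bigr => j _; rewrite -[j.+1]addn1 PoszD.
  have p1 : 0 <= \sum_(1 <= j < a) `|g (j%:Z + 1) - g j%:Z| by apply: sumr_ge0.
  have p2 : 0 <= \sum_(b <= j < N.+1) `|g (j%:Z + 1) - g j%:Z| by apply: sumr_ge0.
  lra.
have close (j : nat) : (1 <= j < N.+1)%N -> `|g i%:Z| <= `|g j%:Z| + S.
  move=> Hj; rewrite -lerBlDl; apply: (le_trans (lerB_dist _ _)).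
  by have [h|/ltnW h] := leqP i j; [rewrite distrC|]; apply: mono; lia.
have N0 : (0 < N%:R :> R) by rewrite ltr0n; lia.
rewrite -(ler_pM2l N0) mulrDr mulrA divff ?mul1r ?gt_eqF//.
have -> : N%:R * `|g i%:Z| = \sum_(1 <= j < N.+1) `|g i%:Z|.
  by rewrite sumr_const_nat subSS subn0 mulr_natl.
have -> : N%:R * S = \sum_(1 <= j < N.+1) S.
  by rewrite sumr_const_nat subSS subn0 mulr_natl.
rewrite -big_split /=; apply: ler_sum_nat => j Hj; exact: close.
Qed.

End GridSum.

(** * Inner product and Laplacian on grid functions *)

Section GridHilbert.
Variables (R : realType) (N : nat) (h : R).
Implicit Types (f g : int -> int -> R).

Definition gdot f g : R := h ^+ 2 * gsum N (fun i j => f i j * g i j).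

(** A shifted remainder, so that the representatives run over 1..N, the range of the grid sums. *)
Definition rep (i : int) : int := ((i - 1) %% N%:Z)%Z + 1.

Definition per f : int -> int -> R := fun i j => f (rep i) (rep j).

(* The periodization makes [gA] symmetric on all grid functions. *)
Definition gA f : int -> int -> R := fun i j => - glap h (per f) i j.

Lemma per_periodic f : periodic_grid N (per f).
Proof. by move=> i j; rewrite /per /rep !(addrAC _ N%:Z) !modzDr. Qed.

Lemma rep_id (i : nat) : (1 <= i < N.+1)%N -> rep i%:Z = i%:Z.
Proof.
move=> Hi; rewrite /rep modz_small ?subrK//; apply/andP; split; lia.
Qed.

Lemma rep_range (i : int) : (0 < N)%N ->
  exists2 k : nat, (1 <= k < N.+1)%N & rep i = k%:Z.
Proof.
move=> N0; have NZ : N%:Z != 0 by lia.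
have h1 : (0 <= (i - 1) %% N%:Z)%Z := modz_ge0 _ NZ.
have h2 : ((i - 1) %% N%:Z < N%:Z)%Z by rewrite ltz_pmod//; lia.
by exists `|rep i|%N; rewrite /rep; lia.
Qed.

Lemma periodic_mul f (q : int) i j : periodic_grid N f ->
  f (i + q * N%:Z) j = f i j /\ f i (j + q * N%:Z) = f i j.
Proof.
move=> Hf; elim/int_rec: q => [|n IH|n IH]; first by rewrite mul0r !addr0.
  have -> : n.+1%:Z * N%:Z = n%:Z * N%:Z + N%:Z by rewrite -[n.+1]addn1 PoszD mulrDl mul1r.
  rewrite !addrA; have [-> _] := Hf (i + n%:Z * N%:Z) j.
  by have [_ ->] := Hf i (j + n%:Z * N%:Z).
have E : - n%:Z * N%:Z = - n.+1%:Z * N%:Z + N%:Z.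
  by rewrite -[n.+1]addn1 PoszD opprD mulrDl mulN1r subrK.
rewrite E !addrA in IH.
have [h1 _] := Hf (i + - n.+1%:Z * N%:Z) j; have [_ h2] := Hf i (j + - n.+1%:Z * N%:Z).
by rewrite h1 h2 in IH.
Qed.

Lemma per_id f : periodic_grid N f -> per f = f.
Proof.
move=> Hf; apply/funext => i; apply/funext => j; rewrite /per.
have E (k : int) : k = rep k + ((k - 1) %/ N%:Z)%Z * N%:Z.
  by have := divz_eq (k - 1) N%:Z; rewrite /rep; lia.
rewrite {2}(E i) {2}(E j).
have [-> _] := periodic_mul ((i - 1) %/ N%:Z)%Z (rep i) (rep j + ((j - 1) %/ N%:Z)%Z * N%:Z) Hf.
by have [_ ->] := periodic_mul ((j - 1) %/ N%:Z)%Z (rep i) (rep j) Hf.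
Qed.

Lemma glapE f i j : glap h f i j = h ^- 2 * (d2x f i j + d2y f i j).
Proof. rewrite /glap /d2x /d2y mulrC; congr (_ * _); ring. Qed.

Lemma periodic_glap f : periodic_grid N f -> periodic_grid N (glap h f).
Proof.
move=> Hf; have := periodic_op (fun a b => h ^- 2 * (a + b)) (periodic_d2x Hf) (periodic_d2y Hf).
by move=> H i j; rewrite !glapE.
Qed.

Lemma gA_per f : periodic_grid N f -> gA f = fun i j => - glap h f i j.
Proof. by move=> Hf; rewrite /gA per_id. Qed.

Lemma periodic_gA f : periodic_grid N (gA f).
Proof. exact: (periodic_op1 -%R (periodic_glap (per_periodic f))). Qed.

Lemma gdotC f g : gdot f g = gdot g f.
Proof. by congr (_ * _); apply: eq_gsum => i j; rewrite mulrC. Qed.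

Lemma gdotD f g k : gdot (f + g) k = gdot f k + gdot g k.
Proof.
by rewrite /gdot -mulrDr -gsumD; congr (_ * _); apply: eq_gsum => i j; rewrite -mulrDl.
Qed.

Lemma gdotZ (a : R) f k : gdot (a *: f) k = a * gdot f k.
Proof.
rewrite /gdot [RHS]mulrCA -(gsumZ N a); congr (h ^+ 2 * _); apply: eq_gsum => i j.
by rewrite mulrA.
Qed.

Lemma gdot_ge0 f : 0 <= gdot f f.
Proof.
by apply: mulr_ge0; [exact: sqr_ge0|apply: gsum_ge0 => i j; rewrite -expr2 sqr_ge0].
Qed.

Lemma gA_D f g : gA (f + g) = gA f + gA g.
Proof.
apply/funext => i; apply/funext => j; transitivity (gA f i j + gA g i j); last by [].
rewrite /gA /glap (_ : per (f + g) = fun i j => per f i j + per g i j)//=.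
by move: (h ^+ 2)^-1 => c; ring.
Qed.

Lemma gA_Z (a : R) f : gA (a *: f) = a *: gA f.
Proof.
apply/funext => i; apply/funext => j; transitivity (a * gA f i j); last by [].
rewrite /gA /glap (_ : per (a *: f) = fun i j => a * per f i j)//=.
by move: (h ^+ 2)^-1 => c; ring.
Qed.

Lemma gdot_gA f g : h != 0 -> gdot (gA f) g =
  gsum N (fun i j => dfx (per f) i j * dfx (per g) i j) +
  gsum N (fun i j => dfy (per f) i j * dfy (per g) i j).
Proof.
move=> h0; have Pf := per_periodic f; have Pg := per_periodic g.
rewrite /gdot; have -> : gsum N (fun i j => gA f i j * g i j) =
    gsum N (fun i j => gA f i j * per g i j).
  apply: eq_big_nat => i Hi; apply: eq_big_nat => j Hj.
  by rewrite /per !rep_id.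
rewrite -gsumZ.
rewrite (@eq_gsum R N _ (fun i j => - (d2x (per f) i j * per g i j) - (d2y (per f) i j * per g i j))).
  by rewrite gsumB gsumN (green_x Pf Pg) (green_y Pf Pg) !opprK.
by move=> i j; rewrite /gA glapE; field.
Qed.

Lemma gA_sym f g : h != 0 -> gdot (gA f) g = gdot f (gA g).
Proof.
move=> h0; rewrite (gdotC f) !gdot_gA//.
by congr (_ + _); apply: eq_gsum => i j; rewrite mulrC.
Qed.

Lemma gA_ge0 f : h != 0 -> 0 <= gdot (gA f) f.
Proof.
by move=> h0; rewrite gdot_gA// addr_ge0//; apply: gsum_ge0 => i j; rewrite -expr2 sqr_ge0.
Qed.

Lemma grid_normE f : grid_norm N h f = Num.sqrt (gdot f f).
Proof.
congr (Num.sqrt (_ * _)); apply: eq_bigr => i _; apply: eq_bigr => j _.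
by rewrite real_normK ?num_real// expr2.
Qed.

Lemma grid_gradnormE f : h != 0 -> periodic_grid N f ->
  grid_gradnorm N h f = Num.sqrt (gdot (gA f) f).
Proof.
move=> h0 Hf; rewrite gdot_gA// (per_id Hf) -gsumD; congr (Num.sqrt _).
rewrite -[LHS](gsumZ N (h ^+ 2) (fun i j => _)); apply: eq_gsum => i j.
transitivity (h ^+ 2 * (`|gDx h f i j| ^+ 2 + `|gDy h f i j| ^+ 2)) => //.
by rewrite !real_normK ?num_real// /gDx /gDy /dfx /dfy; field.
Qed.

Lemma gsum_d2 f : h != 0 -> periodic_grid N f ->
  gsum N (fun i j => d2x f i j ^+ 2) + gsum N (fun i j => d2y f i j ^+ 2) +
  2 * gsum N (fun i j => dfx (dfy f) i j ^+ 2) = h ^+ 2 * gdot (gA f) (gA f).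
Proof.
move=> h0 Hf; rewrite d2x_mixed// gA_per// /gdot -!gsumZ; apply: eq_gsum => i j.
by rewrite !glapE; field.
Qed.

(** Inverse inequality. Pointwise Cauchy-Schwarz gives (a + b + c + d - 4 e)^2 <= 8 (a^2 + b^2 + c^2
    + d^2 + 4 e^2), where 8 is the sum of the weights, and by periodicity all shifted sums are
    equal. *)
Lemma gA_inverse f : h != 0 -> periodic_grid N f ->
  gdot (gA f) (gA f) <= 64 * h ^- 4 * gdot f f.
Proof.
move=> h0 Hf; rewrite gA_per//.
have h2n := periodic_op1 (fun a => a ^+ 2) Hf.
have -> : 64 * h ^- 4 * gdot f f = h ^+ 2 * (8 * h ^- 4 * (gsum N (fun i j => f (i + 1) j ^+ 2) +
  gsum N (fun i j => f (i - 1) j ^+ 2) + gsum N (fun i j => f i (j + 1) ^+ 2) +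
  gsum N (fun i j => f i (j - 1) ^+ 2) + 4 * gsum N (fun i j => f i j ^+ 2))).
  rewrite (gsum_shx h2n) (gsum_shxN h2n) (gsum_shy h2n) (gsum_shyN h2n) /gdot.
  rewrite (@eq_gsum R N (fun i j => f i j * f i j) (fun i j => f i j ^+ 2))//.
  by move: (gsum _ _) => G; ring.
rewrite /gdot ler_wpM2l ?sqr_ge0//.
rewrite -!gsumZ -!gsumD -gsumZ; apply: le_gsum => i j.
have -> : - glap h f i j * - glap h f i j = h ^- 4 *
   (f (i + 1) j + f (i - 1) j + f i (j + 1) + f i (j - 1) - 4 * f i j) ^+ 2.
  by rewrite /glap; field.
rewrite (mulrC 8) -mulrA ler_wpM2l//.
  by rewrite invr_ge0 -[4%N]/(2 * 2)%N exprM sqr_ge0.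
move: (f _ _) (f _ _) (f _ _) (f _ _) (f _ _) => e d c b a.
have h1 := sqr_ge0 (a - b); have h2 := sqr_ge0 (a - c); have h3 := sqr_ge0 (a - d).
have h4 := sqr_ge0 (b - c); have h5 := sqr_ge0 (b - d); have h6 := sqr_ge0 (c - d).
have h7 := sqr_ge0 (a + e); have h8 := sqr_ge0 (b + e); have h9 := sqr_ge0 (c + e).
have h10 := sqr_ge0 (d + e).
rewrite -subr_ge0; have -> : 8 * (a ^+ 2 + b ^+ 2 + c ^+ 2 + d ^+ 2 + 4 * e ^+ 2) - (a + b + c + d - 4 * e) ^+ 2 =
  (a - b) ^+ 2 + (a - c) ^+ 2 + (a - d) ^+ 2 + (b - c) ^+ 2 + (b - d) ^+ 2 + (c - d) ^+ 2 +
  4 * ((a + e) ^+ 2 + (b + e) ^+ 2 + (c + e) ^+ 2 + (d + e) ^+ 2) by ring.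
by rewrite !addr_ge0// mulr_ge0// !addr_ge0.
Qed.

(** Square of a discrete H^2 norm; by [gsum_d2] it controls the mixed second differences too. *)
Definition h2n f : R := gdot f f + gdot (gA f) (gA f).

Lemma P2_ge0 f : 0 <= h2n f.
Proof. by rewrite addr_ge0// gdot_ge0. Qed.

Lemma P2D f g : h2n (f + g) <= 2 * h2n f + 2 * h2n g.
Proof.
have B := dotB_le gdotC gdotD gdotZ gdot_ge0.
rewrite /h2n gA_D; have := B f g; have := B (gA f) (gA g); lra.
Qed.

Lemma P2Z a f : h2n (a *: f) = a ^+ 2 * h2n f.
Proof.
by rewrite /h2n gA_Z !gdotZ !(gdotC _ (a *: _)) !gdotZ; ring.
Qed.

Definition sobC (L : R) : R := 4 * (L ^- 2 + 1 + L ^+ 2).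

(** Applying [sum_sup] in each variable bounds a value by sums of |f|, of its first differences and
    of its mixed difference. The constant depends on the mesh through h N = L only. *)
Lemma sup_le_P2 f i j : (0 < N)%N -> 0 < h -> periodic_grid N f ->
  f i j ^+ 2 <= sobC (h * N%:R) * h2n f.
Proof.
move=> N0 h0 Hf; have hn0 : h != 0 by rewrite gt_eqF.
rewrite -(per_id Hf) {1}/per.
have [k Hk ->] := rep_range i N0; have [l Hl ->] := rep_range j N0.
rewrite per_id//; set n : R := N%:R; have n0 : 0 < n by rewrite ltr0n.
have H1 := sum_sup (fun i => f i l%:Z) Hk.
have H2 (g : grid R) : \sum_(1 <= i < N.+1) `|g i%:Z l%:Z| <=
    n^-1 * gsum N (fun i j => `|g i j|) + gsum N (fun i j => `|dfy g i j|).
  rewrite /gsum mulr_sumr -big_split /=; apply: ler_sum => i' _.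
  by apply: le_trans (sum_sup (g i'%:Z) Hl) _.
have H : `|f k%:Z l%:Z| <= n^-2 * gsum N (fun i j => `|f i j|) + n^-1 * gsum N (fun i j => `|dfy f i j|)
   + n^-1 * gsum N (fun i j => `|dfx f i j|) + gsum N (fun i j => `|dfx (dfy f) i j|).
  apply: (le_trans H1); have := H2 (dfx f); have h3 := H2 f.
  have : n^-1 * (\sum_(1 <= j0 < N.+1) `|f j0 l|) <= n^-1 * (n^-1 * gsum N (fun i j => `|f i j|) + gsum N (fun i j => `|dfy f i j|)).
    by apply: ler_wpM2l => //; rewrite invr_ge0 ltW.
  rewrite [n^-1 * (_ + _)]mulrDr [n^-1 * (n^-1 * _)]mulrA -expr2 exprVn.
  have -> : gsum N (fun i j => `|dfy (dfx f) i j|) = gsum N (fun i j => `|dfx (dfy f) i j|).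
    by apply: eq_gsum => i' j'; congr `|_|; rewrite /dfx /dfy; ring.
  rewrite /dfx; move=> h4 h5; rewrite addrC -addrA; lra.
have L1 (g : grid R) : gsum N (fun i j => `|g i j|) ^+ 2 <= n ^+ 2 * gsum N (fun i j => g i j ^+ 2) := gsum_l1 N g.
have S0 (g : grid R) : 0 <= gsum N (fun i j => `|g i j|) by apply: gsum_ge0.
have Q (a b c d : R) : (a + b + c + d) ^+ 2 <= 4 * (a ^+ 2 + b ^+ 2 + c ^+ 2 + d ^+ 2).
  have h1 := sqr_ge0 (a - b); have h2 := sqr_ge0 (a - c); have h3 := sqr_ge0 (a - d).
  have h4 := sqr_ge0 (b - c); have h5 := sqr_ge0 (b - d); have h6 := sqr_ge0 (c - d).
  lra.
have Hsq : f k%:Z l%:Z ^+ 2 <= 4 * (n ^- 2 * gsum N (fun i j => f i j ^+ 2) +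
   gsum N (fun i j => dfy f i j ^+ 2) + gsum N (fun i j => dfx f i j ^+ 2) +
   n ^+ 2 * gsum N (fun i j => dfx (dfy f) i j ^+ 2)).
  rewrite -(real_normK (num_real (f _ _))).
  apply: le_trans (_ : (_ + _ + _ + _) ^+ 2 <= _); first by apply: (lerXn2r _ _ _ H); rewrite nnegrE// !addr_ge0// mulr_ge0// invr_ge0// ?exprn_ge0// ltW.
  apply: (le_trans (Q _ _ _ _)); rewrite ler_wpM2l//.
  have e (a m : R) : 0 < a -> a ^+ 2 * (n ^+ 2 * m) = (a * n) ^+ 2 * m by move=> _; ring.
  apply: lerD; [apply: lerD; [apply: lerD|]|].
  - rewrite exprMn -[X in _ <= X * _]mul1r.
    apply: (le_trans (ler_wpM2l (sqr_ge0 _) (L1 f))); rewrite le_eqVlt; apply/orP; left; apply/eqP.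
    by field; rewrite gt_eqF.
  - rewrite exprMn; apply: (le_trans (ler_wpM2l (sqr_ge0 _) (L1 (dfy f)))); rewrite le_eqVlt; apply/orP; left; apply/eqP.
    by field; rewrite gt_eqF.
  - rewrite exprMn; apply: (le_trans (ler_wpM2l (sqr_ge0 _) (L1 (dfx f)))); rewrite le_eqVlt; apply/orP; left; apply/eqP.
    by field; rewrite gt_eqF.
  - exact: L1.
apply: (le_trans Hsq); rewrite /sobC -[in X in _ <= X]mulrA ler_wpM2l//.
have g1 := gdot_gA f f hn0; rewrite (per_id Hf) in g1.
have g2 := gsum_d2 hn0 Hf; have g3 := dot_le gdotC gdotD gdotZ gdot_ge0 (gA f) f.
have g4 : 0 <= gsum N (fun i j => d2x f i j ^+ 2) by apply: gsum_ge0 => *; exact: sqr_ge0.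
have g5 : 0 <= gsum N (fun i j => d2y f i j ^+ 2) by apply: gsum_ge0 => *; exact: sqr_ge0.
have g6 : n ^+ 2 * gsum N (fun i j => dfx (dfy f) i j ^+ 2) <= (h * n) ^+ 2 * gdot (gA f) (gA f).
  have -> : (h * n) ^+ 2 * gdot (gA f) (gA f) = n ^+ 2 * (h ^+ 2 * gdot (gA f) (gA f)) by ring.
  have g7 : 0 <= gsum N (fun i j => dfx (dfy f) i j ^+ 2) by apply: gsum_ge0 => *; exact: sqr_ge0.
  rewrite ler_wpM2l ?sqr_ge0// -g2.
  move: (gsum _ _) (gsum _ _) (gsum _ _) g4 g5 g7 => a b c; lra.
have g8 : n ^- 2 * gsum N (fun i j => f i j ^+ 2) = (h * n) ^- 2 * gdot f f.
  rewrite /gdot (@eq_gsum R N (fun i j => f i j * f i j) (fun i j => f i j ^+ 2))//.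
  by field; rewrite hn0 gt_eqF.
have g9 : gsum N (fun i j => dfx f i j ^+ 2) + gsum N (fun i j => dfy f i j ^+ 2) = gdot (gA f) f.
  by rewrite g1; congr (_ + _); apply: eq_gsum => i' j'; rewrite expr2.
have g10 := gdot_ge0 f; have g11 := gdot_ge0 (gA f).
have g12 := mulr_ge0 (sqr_ge0 (h * n)) g10.
have g13 : 0 <= (h * n) ^- 2 * gdot (gA f) (gA f) by rewrite mulr_ge0// invr_ge0 sqr_ge0.
rewrite g8 /h2n; move: g3 g6 g9 g10 g11 g12 g13.
move: (gsum _ _) (gsum _ _) (gsum _ _) (gdot f f) (gdot (gA f) (gA f)) (gdot (gA f) f) ((h * n) ^- 2) ((h * n) ^+ 2).
clear => a b c u v w x y *; nra.
Qed.

End GridHilbert.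

(** * Algebra property of the discrete H^2 norm *)

Section GridAlgebra.
Variables (R : realType) (N : nat) (h : R).
Hypotheses (N0 : (0 < N)%N) (h0 : 0 < h).
Implicit Types (f g : int -> int -> R).
Local Notation dot := (gdot N h).
Local Notation A := (gA N h).
Local Notation P2 := (h2n N h).
Local Notation CS := (sobC (h * N%:R)).

Definition gmul f g : int -> int -> R := fun i j => f i j * g i j.

Lemma periodic_mulg f g : periodic_grid N f -> periodic_grid N g ->
  periodic_grid N (gmul f g).
Proof. exact: (periodic_op *%R). Qed.

Lemma periodic_addg f g : periodic_grid N f -> periodic_grid N g ->
  periodic_grid N (f + g).
Proof. exact: (periodic_op +%R). Qed.

Lemma periodic_scaleg (a : R) f : periodic_grid N f -> periodic_grid N (a *: f).
Proof. exact: (periodic_op1 (fun u => a * u)). Qed.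

Lemma periodic_subg f g : periodic_grid N f -> periodic_grid N g ->
  periodic_grid N (f - g).
Proof. exact: (periodic_op (fun u v => u - v)). Qed.

Lemma sobC_ge0 (L : R) : 0 <= sobC L.
Proof. by rewrite /sobC mulr_ge0// !addr_ge0// ?invr_ge0 sqr_ge0. Qed.

Lemma dfx_cross f g : periodic_grid N f -> periodic_grid N g ->
  gsum N (fun i j => (dfx f i j * dfx g i j) ^+ 2) <=
  9 * CS * h ^+ 2 * (P2 f * P2 g).
Proof.
move=> Hf Hg; have c0 := sobC_ge0 (h * N%:R).
have B k : periodic_grid N k -> gsum N (fun i j => (dfx k i j ^+ 2) ^+ 2) <= 9 * CS * h ^+ 2 * P2 k ^+ 2.
  move=> Hk; have := dfx4 Hk (fun i j => sup_le_P2 i j N0 h0 Hk).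
  rewrite (@eq_gsum R N (fun i j => dfx k i j ^+ 4) (fun i j => (dfx k i j ^+ 2) ^+ 2)); last first.
    by move=> i j; rewrite -exprM.
  move/le_trans; apply.
  have -> : 9 * CS * h ^+ 2 * P2 k ^+ 2 = 9 * (CS * P2 k) * (h ^+ 2 * P2 k) by ring.
  apply: ler_wpM2l; first by rewrite mulr_ge0// mulr_ge0// P2_ge0.
  have := gsum_d2 (lt0r_neq0 h0) Hk.
  have g5 : 0 <= gsum N (fun i j => d2y k i j ^+ 2) by apply: gsum_ge0 => *; exact: sqr_ge0.
  have g6 : 0 <= gsum N (fun i j => dfx (dfy k) i j ^+ 2) by apply: gsum_ge0 => *; exact: sqr_ge0.
  have g7 := mulr_ge0 (sqr_ge0 h) (gdot_ge0 N h k).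
  rewrite /h2n mulrDr; move: g5 g6 g7.
  move: (gsum _ _) (gsum _ _) (gsum _ _) (h ^+ 2 * _) (h ^+ 2 * _) => a b c u v; lra.
have H := gsum_cauchy N (fun i j => dfx f i j ^+ 2) (fun i j => dfx g i j ^+ 2).
have E : gsum N (fun i j => (dfx f i j * dfx g i j) ^+ 2) =
   gsum N (fun i j => dfx f i j ^+ 2 * dfx g i j ^+ 2).
  by apply: eq_gsum => i j; rewrite exprMn.
rewrite E -(ler_pXn2r (n := 2)) ?nnegrE//; last 2 first.
- by apply: gsum_ge0 => i j; rewrite mulr_ge0// sqr_ge0.
- by rewrite (mulr_ge0 (mulr_ge0 (mulr_ge0 _ c0) (sqr_ge0 h)) (mulr_ge0 (P2_ge0 N h f) (P2_ge0 N h g))).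
apply: (le_trans H).
have -> : (9 * CS * h ^+ 2 * (P2 f * P2 g)) ^+ 2 = (9 * CS * h ^+ 2 * P2 f ^+ 2) * (9 * CS * h ^+ 2 * P2 g ^+ 2) by ring.
by apply: ler_pM; rewrite ?B//; apply: gsum_ge0 => i j; rewrite sqr_ge0.
Qed.

Lemma P2_tr f : periodic_grid N f -> P2 (gtr f) = P2 f.
Proof.
move=> Hf; rewrite /h2n (gA_per h Hf) (gA_per h (periodic_tr Hf)) /gdot.
congr (_ * _ + _ * _); rewrite -[RHS]gsum_tr; apply: eq_gsum => i j //.
rewrite /gtr /glap; move: (h ^+ 2)^-1 => c; ring.
Qed.

Lemma dfy_cross f g : periodic_grid N f -> periodic_grid N g ->
  gsum N (fun i j => (dfy f i j * dfy g i j) ^+ 2) <=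
  9 * CS * h ^+ 2 * (P2 f * P2 g).
Proof.
move=> Hf Hg; have := dfx_cross (periodic_tr Hf) (periodic_tr Hg).
by rewrite (P2_tr Hf) (P2_tr Hg) => H; rewrite -gsum_tr; exact: H.
Qed.

Definition algC2 : R := 229 * CS.

Lemma algC2_ge0 : 0 <= algC2.
Proof. by rewrite mulr_ge0// sobC_ge0. Qed.

Lemma sqr_sum6 (a b c d e k : R) : (a + b + c + d + e + k) ^+ 2 <=
  6 * (a ^+ 2 + b ^+ 2 + c ^+ 2 + d ^+ 2 + e ^+ 2 + k ^+ 2).
Proof.
rewrite -subr_ge0.
have -> : 6 * (a ^+ 2 + b ^+ 2 + c ^+ 2 + d ^+ 2 + e ^+ 2 + k ^+ 2) - (a + b + c + d + e + k) ^+ 2 =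
  (a - b) ^+ 2 + (a - c) ^+ 2 + (a - d) ^+ 2 + (a - e) ^+ 2 + (a - k) ^+ 2 +
  (b - c) ^+ 2 + (b - d) ^+ 2 + (b - e) ^+ 2 + (b - k) ^+ 2 + (c - d) ^+ 2 +
  (c - e) ^+ 2 + (c - k) ^+ 2 + (d - e) ^+ 2 + (d - k) ^+ 2 + (e - k) ^+ 2 by ring.
by rewrite !addr_ge0// sqr_ge0.
Qed.

(** Discrete Leibniz rule: the second differences of f g split into f times those of g, g times
    those of f, and four products of first differences. Hence six squares, and the constant 229 = 1
    + 6 (1 + 1 + 36). *)
Lemma P2_mul f g : periodic_grid N f -> periodic_grid N g ->
  P2 (gmul f g) <= algC2 * (P2 f * P2 g).
Proof.
move=> Hf Hg; have Hfg := periodic_mulg Hf Hg.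
have hn0 := lt0r_neq0 h0; have c0 := sobC_ge0 (h * N%:R).
have S k i j : periodic_grid N k -> k i j ^+ 2 <= CS * P2 k by move=> Hk; exact: sup_le_P2.
have supdot k l : periodic_grid N k -> h ^+ 2 * gsum N (fun i j => k i j ^+ 2 * l i j ^+ 2) <= CS * P2 k * dot l l.
  move=> Hk; rewrite /gdot mulrCA ler_wpM2l ?sqr_ge0// -gsumZ; apply: le_gsum => i j.
  by rewrite -expr2 ler_wpM2r ?sqr_ge0// S.
have H1 : dot (gmul f g) (gmul f g) <= CS * (P2 f * P2 g).
  have -> : dot (gmul f g) (gmul f g) = h ^+ 2 * gsum N (fun i j => f i j ^+ 2 * g i j ^+ 2).
    by congr (_ * _); apply: eq_gsum => i j; rewrite /gmul; ring.
  apply: (le_trans (supdot _ _ Hf)); rewrite mulrA ler_wpM2l//.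
    exact: (mulr_ge0 c0 (P2_ge0 N h f)).
  by rewrite /h2n lerDl gdot_ge0.
have H2 : dot (A (gmul f g)) (A (gmul f g)) <= 6 * (CS * P2 f * dot (A g) (A g) + CS * P2 g * dot (A f) (A f) +
   4 * (9 * CS * (P2 f * P2 g))).
  pose X k l : grid R := fun i j => (dfx k i j * dfx l i j) ^+ 2.
  pose Y k l : grid R := fun i j => (dfy k i j * dfy l i j) ^+ 2.
  have PX : periodic_grid N (X f g).
    exact: (periodic_op (fun a b => (a * b) ^+ 2) (periodic_dfx Hf) (periodic_dfx Hg)).
  have PY : periodic_grid N (Y f g).
    exact: (periodic_op (fun a b => (a * b) ^+ 2) (periodic_dfy Hf) (periodic_dfy Hg)).
  have hX := dfx_cross Hf Hg; have hY := dfy_cross Hf Hg.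
  have h2V : 0 <= h ^- 2 by rewrite invr_ge0 sqr_ge0.
  have K Z : Z <= 9 * CS * h ^+ 2 * (P2 f * P2 g) -> h ^- 2 * Z <= 9 * CS * (P2 f * P2 g).
    move=> HZ; apply: (le_trans (ler_wpM2l h2V HZ)); rewrite le_eqVlt; apply/orP; left; apply/eqP.
    by field.
  have {}hX := K _ hX; have {}hY := K _ hY.
  have hf := supdot f (A g) Hf; have hg := supdot g (A f) Hg.
  apply: (@le_trans _ _ (6 * (h ^+ 2 * gsum N (fun i j => f i j ^+ 2 * A g i j ^+ 2) +
    h ^+ 2 * gsum N (fun i j => g i j ^+ 2 * A f i j ^+ 2) +
    (h ^- 2 * gsum N (X f g) + h ^- 2 * gsum N (X f g) + h ^- 2 * gsum N (Y f g) + h ^- 2 * gsum N (Y f g)))));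
    last by rewrite ler_wpM2l//; move: hX hY hf hg; rewrite /X /Y; lra.
  rewrite -{2}(gsum_shxN PX) -{2}(gsum_shyN PY) /gdot.
  rewrite -!gsumZ -!gsumD -gsumZ; apply: le_gsum => i j.
  rewrite !(gA_per h)// !glapE.
  set a := f i j * (d2x g i j + d2y g i j); set b := g i j * (d2x f i j + d2y f i j).
  have := sqr_sum6 a b (dfx f i j * dfx g i j) (dfx f (i - 1) j * dfx g (i - 1) j)
    (dfy f i j * dfy g i j) (dfy f i (j - 1) * dfy g i (j - 1)).
  have -> : a + b + dfx f i j * dfx g i j + dfx f (i - 1) j * dfx g (i - 1) j +
      dfy f i j * dfy g i j + dfy f i (j - 1) * dfy g i (j - 1) =
      d2x (gmul f g) i j + d2y (gmul f g) i j.
    by rewrite /a /b /gmul /d2x /d2y /dfx /dfy !subrK; ring.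
  move=> /(ler_wpM2l h2V) Hq; rewrite /X /Y.
  have e1 : h ^+ 2 * (- (h ^- 2 * (d2x (gmul f g) i j + d2y (gmul f g) i j)) *
     - (h ^- 2 * (d2x (gmul f g) i j + d2y (gmul f g) i j))) =
     h ^- 2 * (d2x (gmul f g) i j + d2y (gmul f g) i j) ^+ 2 by field.
  rewrite e1; apply: (le_trans Hq); rewrite le_eqVlt; apply/orP; left; apply/eqP.
  by rewrite /a /b; field.
have p1 := P2_ge0 N h f; have p2 := P2_ge0 N h g; have cf := mulr_ge0 c0 p1; have cg := mulr_ge0 c0 p2.
have H3 : CS * P2 f * dot (A g) (A g) <= CS * (P2 f * P2 g).
  by rewrite mulrA ler_wpM2l// /h2n lerDr gdot_ge0.
have H4 : CS * P2 g * dot (A f) (A f) <= CS * (P2 f * P2 g).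
  by rewrite (mulrC (P2 f)) [X in _ <= X]mulrA ler_wpM2l// /h2n lerDr gdot_ge0.
rewrite [X in X <= _]/h2n /algC2.
have -> : 229 * CS * (P2 f * P2 g) = 229 * (CS * (P2 f * P2 g)) by ring.
have e2 : 4 * (9 * CS * (P2 f * P2 g)) = 36 * (CS * (P2 f * P2 g)) by ring.
rewrite e2 in H2; move: H1 H2 H3 H4; clear.
move: (dot _ _) (dot _ _) (CS * P2 f * _) (CS * P2 g * _) (CS * (P2 f * P2 g)) => a b c d e; lra.
Qed.

Lemma P2_mul_le f g (a b : R) : periodic_grid N f -> periodic_grid N g ->
  P2 f <= a -> P2 g <= b -> P2 (gmul f g) <= algC2 * (a * b).
Proof.
move=> Hf Hg fa gb; apply: (le_trans (P2_mul Hf Hg)).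
by rewrite ler_wpM2l ?algC2_ge0// ler_pM// P2_ge0.
Qed.

Lemma P2D_le f g (a b : R) : P2 f <= a -> P2 g <= b -> P2 (f + g) <= 2 * a + 2 * b.
Proof. by move=> ha hb; apply: (le_trans (P2D N h f g)); lra. Qed.

(** Changing one argument at a time factors the difference exactly as a quarter of (a - b) Q1 + (a0
    - b0) Q2 with quadratic Q1 and Q2; the algebra property then gives the Lipschitz bound. *)
Lemma gchi_diff (a a0 b b0 : int -> int -> R) B :
  periodic_grid N a -> periodic_grid N a0 -> periodic_grid N b -> periodic_grid N b0 ->
  P2 a <= B -> P2 a0 <= B -> P2 b <= B -> P2 b0 <= B ->
  P2 (gchi a a0 - gchi b b0) <= 16 * algC2 ^+ 2 * B ^+ 2 * (P2 (a - b) + P2 (a0 - b0)).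
Proof.
move=> Ha Ha0 Hb Hb0 Ba Ba0 Bb Bb0.
have M f g := @P2_mul_le f g B B.
pose Q1 : int -> int -> R := gmul a a + gmul a a0 + gmul a0 a0 + (gmul a b + gmul a0 b) + gmul b b.
pose Q2 : int -> int -> R := gmul a0 a0 + gmul a0 b + gmul a0 b0 + (gmul b b + gmul b b0) + gmul b0 b0.
have PM := periodic_mulg.
have HQ1 : periodic_grid N Q1 by rewrite /Q1; repeat first [exact: PM | apply: periodic_addg].
have HQ2 : periodic_grid N Q2 by rewrite /Q2; repeat first [exact: PM | apply: periodic_addg].
have K x1 x2 x3 x4 x5 x6 : P2 x1 <= algC2 * (B * B) -> P2 x2 <= algC2 * (B * B) -> P2 x3 <= algC2 * (B * B) ->
    P2 x4 <= algC2 * (B * B) -> P2 x5 <= algC2 * (B * B) -> P2 x6 <= algC2 * (B * B) ->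
    P2 (x1 + x2 + x3 + (x4 + x5) + x6) <= 64 * (algC2 * (B * B)).
  move=> k1 k2 k3 k4 k5 k6.
  have := P2D_le (P2D_le (P2D_le (P2D_le k1 k2) k3) (P2D_le k4 k5)) k6.
  have := le_trans (P2_ge0 N h x1) k1; move: (algC2 * _) => z z0 hz; lra.
have B1 : P2 Q1 <= 64 * (algC2 * (B * B)) by apply: K; apply: M.
have B2 : P2 Q2 <= 64 * (algC2 * (B * B)) by apply: K; apply: M.
have Hd : periodic_grid N (a - b) := periodic_op (fun u v => u - v) Ha Hb.
have Hd0 : periodic_grid N (a0 - b0) := periodic_op (fun u v => u - v) Ha0 Hb0.
have E : gchi a a0 - gchi b b0 = 4^-1 *: (gmul (a - b) Q1 + gmul (a0 - b0) Q2).
  apply/funext => i; apply/funext => j.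
  transitivity (4^-1 * ((a i j - b i j) * (a i j * a i j + a i j * a0 i j + a0 i j * a0 i j +
    (a i j * b i j + a0 i j * b i j) + b i j * b i j) + (a0 i j - b0 i j) * (a0 i j * a0 i j + a0 i j * b i j +
     a0 i j * b0 i j + (b i j * b i j + b i j * b0 i j) + b0 i j * b0 i j))); last by [].
  transitivity (gchi a a0 i j - gchi b b0 i j); first by [].
  by rewrite /gchi; field.
rewrite E P2Z.
have := P2D_le (P2_mul_le Hd HQ1 (lexx _) B1) (P2_mul_le Hd0 HQ2 (lexx _) B2).
set w := P2 (_ + _); set u := P2 (a - b); set v := P2 (a0 - b0) => Hw.
have -> : 16 * algC2 ^+ 2 * B ^+ 2 * (u + v) = 4^-1 ^+ 2 * (256 * algC2 ^+ 2 * B ^+ 2 * (u + v)) by field.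
rewrite ler_wpM2l ?sqr_ge0//; apply: (le_trans Hw).
have -> : 2 * (algC2 * (u * (64 * (algC2 * (B * B))))) + 2 * (algC2 * (v * (64 * (algC2 * (B * B))))) =
  128 * algC2 ^+ 2 * B ^+ 2 * (u + v) by ring.
have p : 0 <= algC2 ^+ 2 * B ^+ 2 * (u + v).
  exact: (mulr_ge0 (mulr_ge0 (sqr_ge0 _) (sqr_ge0 _)) (addr_ge0 (P2_ge0 N h _) (P2_ge0 N h _))).
have e1 (k : R) : k * algC2 ^+ 2 * B ^+ 2 * (u + v) = k * (algC2 ^+ 2 * B ^+ 2 * (u + v)) by ring.
rewrite !e1; move: p; move: (_ * (u + v)) => z; lra.
Qed.

End GridAlgebra.

(** * Stability of the scheme *)

Section Stability.
Variables (R : realType) (N : nat) (h : R).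
Hypotheses (N0 : (0 < N)%N) (h0 : 0 < h).
Local Notation dot := (gdot N h).
Local Notation A := (gA N h).
Local Notation P2 := (h2n N h).
Local Notation L := (h * N%:R).

Lemma gaddE (f g : int -> int -> R) i j : (f + g) i j = f i j + g i j.
Proof. by []. Qed.

Lemma goppE (f : int -> int -> R) i j : (- f) i j = - f i j.
Proof. by []. Qed.

Lemma gscaleE (a : R) (f : int -> int -> R) i j : (a *: f) i j = a * f i j.
Proof. by []. Qed.

Definition gridE := (gaddE, goppE, gscaleE).

Lemma gA_Ng (f : int -> int -> R) : periodic_grid N f -> A f = - glap h f.
Proof. by move=> Hf; rewrite gA_per. Qed.

Lemma glapZ (a : R) (f : int -> int -> R) : glap h (a *: f) = a *: glap h f.
Proof.
apply/funext => i; apply/funext => j.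
transitivity ((a * f (i + 1) j + a * f (i - 1) j + a * f i (j + 1) + a * f i (j - 1)
   - 4 * (a * f i j)) / h ^+ 2); first by [].
transitivity (a * glap h f i j); last by [].
by rewrite /glap; move: (h ^+ 2)^-1 => c; ring.
Qed.

Lemma glapN (f : int -> int -> R) : glap h (- f) = - glap h f.
Proof. by rewrite -scaleN1r glapZ scaleN1r. Qed.

Lemma gA_gA (f : int -> int -> R) : periodic_grid N f -> A (A f) = glap h (glap h f).
Proof. by move=> Hf; rewrite (gA_Ng (periodic_gA N h f)) (gA_Ng Hf) glapN opprK. Qed.

Section Step.
Variables (alpha beta s : R) (fp f g fn gn mu : int -> int -> R).
Hypothesis st : scheme_step alpha beta s h fp f g fn gn mu.
Hypotheses (Hfp : periodic_grid N fp) (Hf : periodic_grid N f)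
  (Hfn : periodic_grid N fn) (Hmu : periodic_grid N mu).

(** This and the next two lemmas restate the scheme in the module of grid functions, in the shape of
    the abstract energy laws. *)
Lemma scheme_psi : beta *: (gn - g) = - (s *: A mu) - (s / 2) *: (gn + g).
Proof.
rewrite gA_Ng// scalerN opprK; apply/funext => i; apply/funext => j.
have [e _ _] := st i j.
transitivity (beta * (gn i j - g i j)); first by [].
by rewrite e /gmid mulrA mulrAC.
Qed.

Lemma scheme_phi : fn - f = (s / 2) *: (gn + g).
Proof.
apply/funext => i; apply/funext => j; have [_ _ e] := st i j.
transitivity (fn i j - f i j); first by [].
by rewrite e /gmid mulrA mulrAC.
Qed.

Lemma scheme_mu : mu = gchi fn f + (alpha / 2) *: (fn + f) - A (3 *: f - fp) +
  2^-1 *: A (A (fn + f)).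
Proof.
have Hsum : periodic_grid N (fn + f) by exact: periodic_addg.
rewrite (gA_gA Hsum) gA_Ng; last by apply: periodic_subg => //; exact: periodic_scaleg.
rewrite opprK; apply/funext => i; apply/funext => j; have [_ e _] := st i j.
have e1 : gmid fn f = 2^-1 *: (fn + f).
  by apply/funext => i'; apply/funext => j'; rewrite /gmid mulrC.
have e2 : gextrap f fp = 2^-1 *: (3 *: f - fp).
  by apply/funext => i'; apply/funext => j'; rewrite /gextrap mulrC.
rewrite e e1 e2 !glapZ.
transitivity (gchi fn f i j + alpha * (2^-1 * (fn i j + f i j)) + 2 * (2^-1 * glap h (3 *: f - fp) i j) +
  2^-1 * glap h (glap h (fn + f)) i j); first by [].
transitivity (gchi fn f i j + (alpha / 2) * (fn i j + f i j) + glap h (3 *: f - fp) i j +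
  2^-1 * glap h (glap h (fn + f)) i j); last by [].
by field.
Qed.

End Step.

(** Since (x^2 + y^2) (x + y) (x - y) = x^4 - y^4, the averaged nonlinearity pairs with the
    increment to an exact difference of the quartic energy. *)
Lemma dot_gchi (x y : int -> int -> R) :
  dot (gchi x y) (x - y) = 4^-1 * dot (gmul x x) (gmul x x) - 4^-1 * dot (gmul y y) (gmul y y).
Proof.
rewrite /gdot (mulrCA 4^-1) [4^-1 * (h ^+ 2 * _)]mulrCA -mulrBr -!(gsumZ N 4^-1) -gsumB.
congr (_ * _); apply: eq_gsum => i j.
transitivity (gchi x y i j * (x i j - y i j)); first by [].
by rewrite /gchi /gmul; field.
Qed.

Definition stabC (alpha : R) (M : R) : R :=
  4 * (algC2 N h * M ^+ 2 + (alpha + 1) * M + 4 * L ^+ 2).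

Lemma scheme_stable (alpha beta s M : R) (phi0 : grid R) (phi psi : nat -> grid R) :
  0 <= alpha -> 0 < beta -> 0 < s ->
  scheme_sequence alpha beta s h N phi0 phi psi -> P2 (phi 0%N) <= M ->
  forall k, P2 (phi k) <= stabC alpha M.
Proof.
move=> a0 b0 s0 [_ Hpsi0 Hper Hst] HM k.
have hn0 := lt0r_neq0 h0.
have Pphi j : periodic_grid N (phi j) by have [] := Hper j.
have {Hst} /choice[mu Hmu] : forall j, exists mu, periodic_grid N mu /\ scheme_step alpha beta s h
    (phi j.-1) (phi j) (psi j) (phi j.+1) (psi j.+1) mu.
  by move=> j; have [mu h1 h2] := Hst j; exists mu.
(* The potential is not found by inverting A but by running the first equation of the scheme with A
   removed; [Hq] then checks psi = - A q. The start q 0 = 0 matches psi 0 = 0. *)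
pose q : nat -> (int -> int -> R) := fix q j := if j is j'.+1 then
   (beta + s / 2)^-1 *: ((beta - s / 2) *: q j' + s *: (mu j' : int -> int -> R)) else 0.
have bs : beta + s / 2 != 0 by rewrite gt_eqF// addr_gt0// divr_gt0.
have qS j : (beta + s / 2) *: q j.+1 = (beta - s / 2) *: q j + s *: (mu j : int -> int -> R).
  by rewrite /= scalerA mulfV// scale1r.
have dot0 := gdotC N h; have dotD := gdotD N h; have dotZ := gdotZ N h; have dotp := gdot_ge0 N h.
have AD := gA_D N h; have AZ := gA_Z N h.
have Asym x y : dot (A x) y = dot x (A y) by exact: gA_sym.
have Ap x : 0 <= dot (A x) x by exact: gA_ge0.
have Hq j : (psi j : int -> int -> R) = - A (q j).
  elim: j => [|j IH].
    rewrite [q 0%N]/= -(scale0r (0 : int -> int -> R)) AZ scale0r oppr0.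
    by apply/funext => i'; apply/funext => j'; rewrite Hpsi0.
  have [Pm st] := Hmu j; have e := scheme_psi st Pm.
  have e2 : (beta + s / 2) *: (psi j.+1 : int -> int -> R) = (beta - s / 2) *: (psi j : int -> int -> R) - s *: A (mu j).
    apply/eqP; rewrite -subr_eq0; move/eqP: e; rewrite -subr_eq0 => /eqP e; apply/eqP; rewrite -{}[RHS]e.
    by apply/funext => i'; apply/funext => j'; rewrite !gridE; move: (A (mu j) i' j') => w; ring.
  have e3 : (beta + s / 2) *: (psi j.+1 : int -> int -> R) = (beta + s / 2) *: - A (q j.+1).
    by rewrite e2 IH [RHS]scalerN -(AZ _ (q j.+1)) qS AD !AZ scalerN opprD.
  by have := congr1 (fun x => (beta + s / 2)^-1 *: x) e3; rewrite !scalerA !mulVf// !scale1r.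
pose F j := 4^-1 * dot (gmul (phi j) (phi j)) (gmul (phi j) (phi j)) +
  energy dot A alpha beta (phi j) ((phi j : int -> int -> R) - phi j.-1) (q j).
have FS j : F j.+1 <= F j.
  have [Pm st] := Hmu j.
  have e3 := scheme_phi st; have e2 := scheme_mu st (Pphi _) (Pphi _) (Pphi _).
  have g1 : beta *: (q j.+1 - q j) = s *: (mu j : int -> int -> R) - (s / 2) *: (q j.+1 + q j).
    have := qS j; rewrite scalerDl scalerBl => e.
    rewrite scalerBr scalerDr; apply/eqP; rewrite -subr_eq0; move/eqP: e; rewrite -subr_eq0 => /eqP e.
    by apply/eqP; rewrite -{}[RHS]e !opprD !opprK !addrA; apply/funext => i'; apply/funext => j'; rewrite !gridE; ring.
  have g2 : (phi j.+1 : int -> int -> R) - phi j = - (s / 2) *: A (q j.+1 + q j).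
    by rewrite e3 (Hq j.+1) (Hq j) AD -opprD scalerN scaleNr.
  have := energy_step dot0 dotD dotZ dotp AD AZ Asym Ap s0 g1 g2 e2.
  rewrite dot_gchi /F /=.
  move: (energy _ _ _ _ _ _ _) (energy _ _ _ _ _ _ _) (4^-1 * _) (4^-1 * _) => x y z w; lra.
have FM : F k <= F 0%N by elim: k => // j; apply: le_trans.
have F0 : F 0%N <= algC2 N h * M ^+ 2 + (alpha + 1) * M.
  have p0 := P2_ge0 N h (phi 0%N); have m0 := le_trans p0 HM.
  have h1 : dot (gmul (phi 0%N) (phi 0%N)) (gmul (phi 0%N) (phi 0%N)) <= algC2 N h * M ^+ 2.
    apply: le_trans (_ : P2 (gmul (phi 0%N) (phi 0%N)) <= _); first by rewrite /h2n lerDl gdot_ge0.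
    by rewrite expr2; exact: P2_mul_le.
  have Az : A 0 = 0 by have := AZ 0 0; rewrite !scale0r.
  have d0 x : dot x 0 = 0 by have := dotZ 0 0 x; rewrite scale0r mul0r dot0.
  rewrite /F /energy /= subrr !Az !d0 !mulr0 mul0r !addr0.
  have h2 := Ap (phi 0%N); have h3 := gdot_ge0 N h (phi 0%N); have h4 := gdot_ge0 N h (A (phi 0%N)).
  have h5 := gdot_ge0 N h (gmul (phi 0%N) (phi 0%N)).
  have h6 : alpha * dot (phi 0%N) (phi 0%N) <= alpha * M.
    by apply: ler_wpM2l => //; move: HM; rewrite /h2n; lra.
  have h7 := mulr_ge0 a0 h3; have h8 := mulr_ge0 a0 m0.
  move: HM h1 h2 h3 h4 h5 h6 h7 h8 m0; rewrite /h2n; clear.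
  rewrite mulrDl mul1r (mulrAC alpha 2^-1).
  move: (dot (gmul _ _) _) (dot (A (phi 0%N)) (phi 0%N)) (dot (A _) _) (dot (phi 0%N) _) (algC2 N h * _) => z u v w t.
  move: (alpha * w) (alpha * M) => x y; lra.
have key : dot (phi k) (phi k) + 4^-1 * dot (A (phi k)) (A (phi k)) <= F k + 4 * L ^+ 2.
  (* The quartic term dominates: x^4 / 4 - 2 x^2 + 4 is the square of x^2 / 2 - 2. It compensates
     the (phi, phi) lost below, when the negative term -(A phi, phi) is split; the constant 4 sums
     to 4 L^2. *)
  have h1 : dot (phi k) (phi k) <= 4^-1 * dot (gmul (phi k) (phi k)) (gmul (phi k) (phi k)) - dot (phi k) (phi k) + 4 * L ^+ 2.
    have -> : 4 * L ^+ 2 = h ^+ 2 * gsum N (fun _ _ => 4) by rewrite gsum_const; ring.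
    rewrite /gdot (mulrCA 4^-1) -mulrBr -mulrDr ler_wpM2l ?sqr_ge0// -(gsumZ N 4^-1) -gsumB -gsumD.
    apply: le_gsum => i j; rewrite /gmul; move: (phi k i j) => x.
    rewrite -subr_ge0; have -> : 4^-1 * (x * x * (x * x)) - x * x + 4 - x * x = (x ^+ 2 / 2 - 2) ^+ 2 by field.
    exact: sqr_ge0.
  have h2 := dot_le dot0 dotD dotZ dotp (2^-1 *: A (phi k)) (phi k).
  rewrite !dotZ (dot0 _ (2^-1 *: _)) dotZ in h2.
  have h3 : 0 <= alpha / 2 * dot (phi k) (phi k) by rewrite mulr_ge0// divr_ge0.
  have h4 : 0 <= beta / 2 * dot (A (q k)) (q k) by apply: mulr_ge0; [rewrite divr_ge0// ltW|exact: Ap].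
  have h5 := Ap ((phi k : int -> int -> R) - phi k.-1).
  rewrite /F /energy; move: h1 h2 h3 h4 h5; clear.
  move: (alpha / 2 * dot (phi k) (phi k)) (beta / 2 * _) (dot (A (_ - _)) _) (dot (gmul _ _) _) (dot (A (phi k)) (phi k)) (dot (A (phi k)) _) (dot (phi k) _) (L ^+ 2) => x y z u v w t r.
  lra.
have h1 := gdot_ge0 N h (phi k).
rewrite /stabC /h2n; move: key FM F0 h1; move: (F _) (F _) (dot _ _) (dot _ _) (algC2 N h * _ + _) (L ^+ 2) => x y z u v w; lra.
Qed.

End Stability.

(** * Taylor bounds for the cosine *)

Section CosBounds.
Variable R : realType.
Implicit Types (x y : R).

Lemma ge0_of_derive (f g : R -> R) :
  (forall x : R, is_derive x 1 f (g x)) -> f 0 = 0 -> (forall x, 0 <= x -> 0 <= g x) ->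
  forall x, 0 <= x -> 0 <= f x.
Proof.
move=> df f0 g0 x x0.
have cf : {within `[0, x], continuous f}.
  apply: continuous_subspaceT => z; apply: differentiable_continuous.
  by apply/derivable1_diffP; have [] := df z.
have [c] := MVT_segment x0 (fun z _ => df z) cf.
rewrite in_itv/= => /andP[c0 cx]; rewrite f0 !subr0 => ->.
by rewrite mulr_ge0// g0.
Qed.

(** A chain of functions vanishing at 0, each the derivative of the next, that starts from 1 - cos
    >= 0. *)
Lemma cos_bounds x : 0 <= x ->
  1 - x ^+ 2 / 2 <= cos x /\ cos x <= 1 - x ^+ 2 / 2 + x ^+ 4 / 24.
Proof.
have h1 y : 0 <= y -> 0 <= y - sin y.
  move: y; refine (@ge0_of_derive (fun y : R => y - sin y) (fun y => 1 - cos y) _ _ _) => [|z _].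
  - by rewrite sin0 subrr.
  - by rewrite subr_ge0 cos_le1.
have h2 y : 0 <= y -> 0 <= cos y - 1 + 2^-1 * y ^+ 2.
  move: y; refine (@ge0_of_derive _ (fun y => y - sin y) _ _ h1) => [z|].
  - by apply: is_derive_eq; rewrite /GRing.scale/=; field.
  - by rewrite cos0 subrr expr0n/= mulr0 addr0.
have h3 y : 0 <= y -> 0 <= sin y - y + 6^-1 * y ^+ 3.
  move: y; refine (@ge0_of_derive _ (fun y => cos y - 1 + 2^-1 * y ^+ 2) _ _ h2) => [z|].
  - by apply: is_derive_eq; rewrite /GRing.scale/=; field.
  - by rewrite sin0 subrr expr0n/= mulr0 addr0.
have h4 y : 0 <= y -> 0 <= 1 - cos y - 2^-1 * y ^+ 2 + 24^-1 * y ^+ 4.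
  move: y; refine (@ge0_of_derive _ (fun y => sin y - y + 6^-1 * y ^+ 3) _ _ h3) => [z|].
  - by apply: is_derive_eq; rewrite /GRing.scale/=; field.
  - by rewrite cos0 !expr0n/= !mulr0 subrr subr0 addr0.
by move=> x0; split; [have := h2 x x0|have := h4 x x0]; lra.
Qed.

(** Symbol of the second difference against that of the second derivative: its size and its
    second-order accuracy. *)
Lemma cos_symbol x : 0 <= 2 - 2 * cos x <= 4 /\
  0 <= x ^+ 2 - (2 - 2 * cos x) <= x ^+ 4 / 12.
Proof.
have := cos_geN1 x; have := cos_le1 x.
have [x0|/ltW x0] := leP 0 x.
  by have [] := cos_bounds x0; split; apply/andP; split; lra.
have := cos_bounds (_ : 0 <= - x); rewrite oppr_ge0 => /(_ x0); rewrite cosN.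
have -> : (- x) ^+ 4 = x ^+ 4 by ring.
by rewrite sqrrN; move=> [*]; split; apply/andP; split; lra.
Qed.

End CosBounds.

(** * Trigonometric polynomials on the grid *)

Section GridTrig.
Variables (R : realType) (L : R) (N : nat).
Hypotheses (L0 : 0 < L) (N0 : (0 < N)%N).
Local Notation h := (L / N%:R).
Local Notation pt := (Defs.center h).
Local Notation I := (int * int)%type.

Lemma h_gt0 : 0 < h.
Proof. by rewrite divr_gt0// ltr0n. Qed.

Lemma hN : h * N%:R = L.
Proof. by rewrite mulfVK// pnatr_eq0; lia. Qed.

Lemma pt_shift (i : int) : pt (i + 1) = pt i + h /\ pt (i - 1) = pt i - h /\ pt (i + N%:Z) = pt i + L.
Proof.
have e : (N%:Z)%:~R = N%:R :> R by rewrite pmulrn.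
rewrite /Defs.center !rmorphD rmorphN rmorph1 /= e; split; [ring|split; first ring].
by rewrite -[X in _ = _ + X]hN; ring.
Qed.

(** Multiplied by 2 sin (th / 2), the sum telescopes and closes up by periodicity; 0 < |p| < N keeps
    this factor different from 0. *)
Lemma sum_e1 (p : int) : (`|p| < N)%N ->
  \sum_(1 <= i < N.+1) e1 L p (pt i%:Z) = N%:R * (p == 0)%:R.
Proof.
move=> pN; have [->|p0] := eqVneq p 0.
  under eq_bigr do rewrite e10.
  by rewrite sumr_const_nat subSS subn0 mulr1.
rewrite mulr0; set th := om L * p%:~R * h.
have Ln0 : L != 0 by rewrite gt_eqF.
have Nn0 : N%:R != 0 :> R by rewrite pnatr_eq0; lia.
have s0 : sin (th / 2) != 0.
  have eth (q : int) : om L * q%:~R * h / 2 = pi * (q%:~R / N%:R).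
    by rewrite /om; field; rewrite Nn0 Ln0.
  have pos (q : int) : (0 < q < N%:Z)%R -> 0 < sin (om L * q%:~R * h / 2).
    move=> /andP[q0 qN]; rewrite eth; apply: sin_gt0_pi.
    have n0 : 0 < N%:R :> R by rewrite ltr0n.
    rewrite mulr_gt0 ?pi_gt0 ?divr_gt0 ?ltr0z//= gtr_pMr ?pi_gt0//.
    by rewrite ltr_pdivrMr// mul1r -[N%:R]/(N%:Z%:~R) ltr_int.
  have [q0|q0] := ltrP 0 p; first by rewrite gt_eqF// pos//; lia.
  have : 0 < sin (om L * (- p)%:~R * h / 2) by apply: pos; lia.
  rewrite rmorphN/= mulrN !mulNr sinN oppr_gt0 => hs.
  by rewrite lt_eqF.
have s2 : 2 * sin (th / 2) != 0 by rewrite mulf_neq0// pnatr_eq0.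
apply/(mulfI s2); rewrite mulr0 mulr_sumr.
(* The discrete primitive lives at the left cell edges, half a step before the cell centers. *)
pose G (i : nat) : R := - e1 L (- p) (i%:R * h - h).
rewrite (eq_bigr (fun i : nat => G i.+1 - G i)); last first.
  move=> i _; rewrite /G /e1 /Defs.center rmorphN/= mulrN !mulNr.
  have e : (i%:Z)%:~R = i%:R :> R by rewrite pmulrn.
  rewrite e -(natr1 i).
  have -> : om L * p%:~R * ((i%:R + 1) * h - h) = om L * p%:~R * ((i%:R - 2^-1) * h) + th / 2.
    by rewrite /th; field; rewrite ?Nn0 ?Ln0.
  have -> : om L * p%:~R * (i%:R * h - h) = om L * p%:~R * ((i%:R - 2^-1) * h) - th / 2.
    by rewrite /th; field; rewrite ?Nn0 ?Ln0.
  by rewrite /cas !cosN !sinN cosB sinB cosD sinD; ring.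
rewrite telescope_sumr// /G.
have -> : N.+1%:R * h - h = (1%:R * h - h) + L by rewrite -[in RHS]hN -natr1; ring.
by rewrite e1D// subrr.
Qed.

Lemma sum_e1M (J : nat) (m n : int) : (2 * J < N)%N -> (`|m| <= J)%N -> (`|n| <= J)%N ->
  \sum_(1 <= i < N.+1) e1 L m (pt i%:Z) * e1 L n (pt i%:Z) = N%:R * (m == n)%:R.
Proof.
move=> JN mJ nJ; under eq_bigr do rewrite e1_mul.
rewrite -mulr_sumr sumrB 2!big_split/= !sum_e1; try lia.
have -> : (- (m + n) == 0) = (m + n == 0) by lia.
have -> : (n - m == 0) = (m == n) by lia.
have -> : (m - n == 0) = (m == n) by lia.
by field.
Qed.

Definition tpoly (s : seq I) (c : I -> R) : int -> int -> R :=
  fun i j => \sum_(p <- s) c p * bas L p.1 p.2 (pt i) (pt j).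

Lemma periodic_tpoly s c : periodic_grid N (tpoly s c).
Proof.
move=> i j; rewrite /tpoly; have [_ [_ ei]] := pt_shift i; have [_ [_ ej]] := pt_shift j.
by split; apply: eq_bigr => p _; rewrite /bas ?ei ?ej e1D.
Qed.

Lemma gsum_sum (s : seq I) (F : I -> grid R) :
  gsum N (fun i j => \sum_(p <- s) F p i j) = \sum_(p <- s) gsum N (F p).
Proof.
rewrite /gsum; under eq_bigr do rewrite exchange_big.
by rewrite exchange_big.
Qed.

Lemma gsum_bas J (p q : I) : (2 * J < N)%N -> p \in box J -> q \in box J ->
  gsum N (fun i j => bas L p.1 p.2 (pt i) (pt j) * bas L q.1 q.2 (pt i) (pt j)) = N%:R ^+ 2 * (p == q)%:R.
Proof.
move=> JN; rewrite !mem_box => /andP[p1 p2] /andP[q1 q2].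
have -> : gsum N (fun i j => bas L p.1 p.2 (pt i) (pt j) * bas L q.1 q.2 (pt i) (pt j)) =
   (\sum_(1 <= i < N.+1) e1 L p.1 (pt i%:Z) * e1 L q.1 (pt i%:Z)) *
   (\sum_(1 <= i < N.+1) e1 L p.2 (pt i%:Z) * e1 L q.2 (pt i%:Z)).
  rewrite mulr_suml; apply: eq_bigr => i _; rewrite mulr_sumr; apply: eq_bigr => j _.
  by rewrite /bas; ring.
rewrite !(sum_e1M JN)//; case: p q {p1 p2 q1 q2} => [a b] [c d] /=.
by rewrite xpair_eqE -mulnb natrM; ring.
Qed.

(** Orthogonality survives on the grid because sums and differences of two frequencies up to J stay
    below N, so that no aliasing occurs. *)
Lemma parseval J (s : seq I) (c d : I -> R) : (2 * J < N)%N -> uniq s -> {subset s <= box J} ->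
  gdot N h (tpoly s c) (tpoly s d) = L ^+ 2 * \sum_(p <- s) c p * d p.
Proof.
move=> JN us sJ; rewrite /gdot.
rewrite (@eq_gsum R N _ (fun i j => \sum_(p <- s) c p * (bas L p.1 p.2 (pt i) (pt j) * tpoly s d i j))); last first.
  by move=> i j; rewrite {1}/tpoly mulr_suml; apply: eq_bigr => p _; rewrite mulrA.
rewrite gsum_sum; transitivity (h ^+ 2 * (N%:R ^+ 2 * \sum_(p <- s) c p * d p)); last first.
  by rewrite mulrA -exprMn hN.
congr (h ^+ 2 * _); rewrite mulr_sumr.
apply: eq_big_seq => p ps; rewrite gsumZ.
rewrite (@eq_gsum R N _ (fun i j => \sum_(q <- s) d q * (bas L p.1 p.2 (pt i) (pt j) * bas L q.1 q.2 (pt i) (pt j)))); last first.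
  by move=> i j; rewrite /tpoly mulr_sumr; apply: eq_bigr => q _; rewrite mulrCA.
rewrite gsum_sum (bigD1_seq p)//= gsumZ (gsum_bas JN)// ?sJ// eqxx mulr1.
rewrite big1_seq ?addr0; first by ring.
move=> q /andP[qp qs]; rewrite gsumZ (gsum_bas JN)// ?sJ//.
by rewrite eq_sym (negPf qp) !mulr0.
Qed.

(** Eigenvalue of [gA] on the basis function of frequency p. *)
Definition lamh (p : I) : R :=
  h ^- 2 * ((2 - 2 * cos (om L * p.1%:~R * h)) + (2 - 2 * cos (om L * p.2%:~R * h))).

Lemma gA_tpoly s c : gA N h (tpoly s c) = tpoly s (fun p => lamh p * c p).
Proof.
rewrite (gA_per h (periodic_tpoly s c)); apply/funext => i; apply/funext => j.
rewrite glapE /d2x /d2y /tpoly.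
have [e1i [e2i _]] := pt_shift i; have [e1j [e2j _]] := pt_shift j.
rewrite e1i e2i e1j e2j -!big_split/= !mulr_sumr -!sumrB -big_split/= mulr_sumr -sumrN.
apply: eq_bigr => p _; rewrite /lamh /bas.
have E (m : int) x : e1 L m (x + h) = 2 * cos (om L * m%:~R * h) * e1 L m x - e1 L m (x - h).
  by rewrite /e1 -casDB mulrDr mulrBr addrK.
by rewrite !E; move: (h ^- 2) => w; ring.
Qed.

Lemma lamh_bounds (p : I) : [/\ 0 <= lamh p, lamh p <= 8 * h ^- 2, lamh p <= lam L p.1 p.2 &
  lam L p.1 p.2 - lamh p <= h ^+ 2 * lam L p.1 p.2 ^+ 2].
Proof.
have Ln0 : L != 0 by rewrite gt_eqF.
have Nn0 : N%:R != 0 :> R by rewrite pnatr_eq0; lia.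
have h0 := h_gt0; have hV : 0 <= h ^- 2 by rewrite invr_ge0 sqr_ge0.
have [/andP[a1 a2] /andP[a3 a4]] := cos_symbol (om L * p.1%:~R * h).
have [/andP[b1 b2] /andP[b3 b4]] := cos_symbol (om L * p.2%:~R * h).
have EL : lam L p.1 p.2 = h ^- 2 * ((om L * p.1%:~R * h) ^+ 2 + (om L * p.2%:~R * h) ^+ 2).
  by rewrite /lam; field; rewrite Ln0 Nn0.
have EL2 : h ^+ 2 * lam L p.1 p.2 ^+ 2 = h ^- 2 * ((om L * p.1%:~R * h) ^+ 2 + (om L * p.2%:~R * h) ^+ 2) ^+ 2.
  by rewrite EL; field; rewrite Ln0 Nn0.
rewrite /lamh; split.
- by rewrite mulr_ge0// addr_ge0.
- by rewrite mulrC ler_wpM2r//; lra.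
- by rewrite EL ler_wpM2l//; lra.
- rewrite EL2 EL -mulrBr ler_wpM2l//.
  move: a3 a4 b3 b4; move: (om L * _ * h) (om L * _ * h) => x y *.
  have h1 := mulr_ge0 (sqr_ge0 x) (sqr_ge0 y); have h2 := sqr_ge0 (x ^+ 2); have h3 := sqr_ge0 (y ^+ 2).
  have -> : (y ^+ 2 + x ^+ 2) ^+ 2 = x ^+ 4 + y ^+ 4 + 2 * (x ^+ 2 * y ^+ 2) by ring.
  have e (z : R) : (z ^+ 2) ^+ 2 = z ^+ 4 by rewrite -exprM.
  by move: h2 h3; rewrite !e; lra.
Qed.

End GridTrig.

(** * Cubes of truncated series *)

Section BoxCube.
Variables (R : realType) (L : R).
Local Notation I := (int * int)%type.

Definition bas2 (i : I) (x : R * R) : R := bas L i.1 i.2 x.1 x.2.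
Definition deg2 (i : I) : nat := maxn `|i.1| `|i.2|.

Lemma bas2_spM i j : sp bas2 deg2 (deg2 i + deg2 j) (fun x => bas2 i x * bas2 j x).
Proof.
have [s sD sE] := @e1_spM R L i.1 j.1; have [t tD tE] := @e1_spM R L i.2 j.2.
exists [seq (a.1 * b.1, (a.2, b.2)) | a <- s, b <- t].
  apply/allP => _ /allpairsP[[a b] /= [sa tb ->]] /=.
  have /= := allP sD a sa; have /= := allP tD b tb; rewrite /deg2 /=; lia.
move=> x; rewrite big_allpairs_dep /= /bas2 /bas.
have -> : e1 L i.1 x.1 * e1 L i.2 x.2 * (e1 L j.1 x.1 * e1 L j.2 x.2) =
  (e1 L i.1 x.1 * e1 L j.1 x.1) * (e1 L i.2 x.2 * e1 L j.2 x.2) by ring.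
rewrite sE tE mulr_suml; apply: eq_bigr => a _; rewrite mulr_sumr; apply: eq_bigr => b _ /=.
by ring.
Qed.

(** An element of the span may list a frequency several times; its coefficients are collected. *)
Lemma sp_box D f : sp bas2 deg2 D f ->
  exists p : I -> R, forall x, f x = \sum_(i <- box D) p i * bas2 i x.
Proof.
move=> [s sD fE]; exists (fun i => \sum_(a <- s | a.2 == i) a.1) => x; rewrite fE.
under [RHS]eq_bigr do rewrite mulr_suml.
rewrite (exchange_big_dep predT)//=; apply: eq_big_seq => a sa.
have ha : a.2 \in box D by have := allP sD a sa; rewrite mem_box /deg2 geq_max.
rewrite big_mkcond (bigD1_seq a.2)//= ?box_uniq// eqxx big1 ?addr0// => i.
by rewrite eq_sym => /negPf ->.
Qed.

Lemma cube_box K (c : I -> R) : exists p : I -> R, forall x y,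
  (\sum_(i <- box K) c i * bas L i.1 i.2 x y) ^+ 3 = \sum_(i <- box (3 * K)) p i * bas L i.1 i.2 x y.
Proof.
have H1 : sp bas2 deg2 K (fun x => \sum_(i <- box K) c i * bas2 i x).
  exists [seq (c i, i) | i <- box K]; last by move=> x; rewrite big_map.
  by apply/allP => _ /mapP[i iK ->]; move: iK; rewrite mem_box /deg2 geq_max.
have b0 x : bas2 (0, 0) x = 1 by rewrite /bas2 /bas /= !e10 mulr1.
have [p Hp] := sp_box (spX bas2_spM 3 (i0 := (0, 0)) erefl b0 H1).
by exists p => x y; rewrite -(Hp (x, y)).
Qed.

End BoxCube.

(** * Time discretization of a single coefficient *)

Section ModeConsistency.
Variables (R : realType) (T : R) (c : nat -> R -> R) (V W : R -> R).
Hypothesis dc : forall j (t : R), (j < 3)%N -> 0 <= t <= T -> is_derive t 1 (c j) (c j.+1 t).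
Hypothesis cV : forall r t : R, 0 <= r -> r <= t -> t <= T ->
  V r <= V t /\ (c 1%N t - c 1%N r) ^+ 2 <= (t - r) * (V t - V r).
Hypothesis cW : forall r t : R, 0 <= r -> r <= t -> t <= T ->
  W r <= W t /\ (c 3%N t - c 3%N r) ^+ 2 <= (t - r) * (W t - W r).
Hypothesis c10 : c 1%N 0 = 0.

Lemma increment_bound (f g : R -> R) (a b B : R) : a <= b ->
  (forall x : R, a <= x <= b -> is_derive x 1 f (g x)) ->
  (forall x, a <= x <= b -> `|g x| <= B) -> `|f b - f a| <= (b - a) * B.
Proof.
move=> ab df gB.
have cf : {within `[a, b], continuous f}.
  apply: continuous_in_subspaceT => z; rewrite inE/= in_itv/= => zab.
  by apply: differentiable_continuous; apply/derivable1_diffP; have [] := df z zab.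
have [] := @MVT_segment R f g a b ab _ cf.
  by move=> z; rewrite in_itv/= => /andP[/ltW az /ltW zb]; apply: df; rewrite az.
move=> z; rewrite in_itv/= => zab ->.
by rewrite normrM mulrC (ger0_norm (_ : 0 <= b - a)) ?subr_ge0// ler_wpM2l ?subr_ge0// gB.
Qed.

Lemma mode_mvt j (a b : R) : (j < 3)%N -> 0 <= a -> a <= b -> b <= T ->
  exists2 z, a <= z <= b & c j b - c j a = (b - a) * c j.+1 z.
Proof.
move=> j3 a0 ab bT.
have dj (z : R) : a <= z <= b -> is_derive z 1 (c j) (c j.+1 z).
  by move=> /andP[az zb]; apply: dc => //; rewrite (le_trans a0 az) (le_trans zb bT).
have cf : {within `[a, b], continuous (c j)}.
  apply: continuous_in_subspaceT => z; rewrite inE/= in_itv/= => zab.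
  by apply: differentiable_continuous; apply/derivable1_diffP; have [] := dj z zab.
have [] := @MVT_segment R (c j) (c j.+1) a b ab _ cf.
  by move=> z; rewrite in_itv/= => /andP[/ltW az /ltW zb]; apply: dj; rewrite az.
by move=> z; rewrite in_itv/= => zab ->; exists z => //; rewrite mulrC.
Qed.

Section Step.
Variables (t s : R).
Hypotheses (t0 : 0 <= t) (s0 : 0 < s) (tsT : t + s <= T).
Local Notation t' := (t + s).
Local Notation o := (Num.sqrt (s * (W t' - W t))).

Let tt' : t <= t'. Proof. by rewrite lerDl ltW. Qed.

Let o2 : o ^+ 2 = s * (W t' - W t).
Proof. by rewrite sqr_sqrtr// mulr_ge0 ?(ltW s0)// subr_ge0; have [] := cW t0 tt' tsT. Qed.

Lemma osc_c3 (r z : R) : t <= r -> r <= z -> z <= t' -> `|c 3%N z - c 3%N r| <= o.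
Proof.
move=> tr rz zt'; have r0 := le_trans t0 tr; have zT := le_trans zt' tsT.
have rt' := le_trans rz zt'.
have [_ h] := cW r0 rz zT; have [w1 _] := cW r0 rz zT.
have [w2 _] := cW t0 tr (le_trans rz zT); have [w3 _] := cW (le_trans r0 rz) zt' tsT.
rewrite -(ler_pXn2r (n := 2)) ?nnegrE ?sqrtr_ge0// o2 real_normK ?num_real//.
apply: (le_trans h); apply: ler_pM; rewrite ?subr_ge0//; lra.
Qed.

(** E is the trapezoidal error as a function of the end point. Its derivative is a multiple of a
    difference of values of [c 3], so only the oscillation of [c 3] over the step enters, and the
    square of that is at most s times an increment of W. *)
Lemma trap_c1 : ((c 1%N t' - c 1%N t) / s - (c 2%N t' + c 2%N t) / 2) ^+ 2 <=
  s ^+ 3 * (W t' - W t).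
Proof.
pose E r := c 1%N r - (r - t) * (2^-1 * (c 2%N r + c 2%N t)).
pose E' r := c 2%N r - (2^-1 * (c 2%N r + c 2%N t) + (r - t) * (2^-1 * c 3%N r)).
have dE (r : R) : t <= r <= t' -> is_derive r 1 E (E' r).
  move=> /andP[tr rt]; have r0 : 0 <= r <= T by rewrite (le_trans t0 tr) (le_trans rt tsT).
  have d1 := dc (isT : (1 < 3)%N) r0; have d2 := dc (isT : (2 < 3)%N) r0.
  by apply: is_derive_eq; rewrite /E' /GRing.scale/=; ring.
have bE (r : R) : t <= r <= t' -> `|E' r| <= s * o.
  move=> /andP[tr rt]; have [z /andP[tz zr] e] := mode_mvt (isT : (2 < 3)%N) t0 tr (le_trans rt tsT).
  have -> : E' r = - ((r - t) / 2 * (c 3%N r - c 3%N z)).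
    have er : c 2%N r = c 2%N t + (r - t) * c 3%N z by rewrite -e; ring.
    by rewrite /E' er; field.
  rewrite normrN normrM ler_pM// ?osc_c3//.
  by rewrite ger0_norm ?divr_ge0 ?subr_ge0//; lra.
have e1 : t' - t = s by ring.
have e0 : E t = c 1%N t by rewrite /E subrr; ring.
have := increment_bound tt' dE bE; rewrite e0 /E e1 => h.
have -> : (c 1%N t' - c 1%N t) / s - (c 2%N t' + c 2%N t) / 2 =
   (c 1%N t' - s * (2^-1 * (c 2%N t' + c 2%N t)) - c 1%N t) / s by field; rewrite gt_eqF.
rewrite -(real_normK (num_real _)).
have {}h : `|(c 1%N t' - s * (2^-1 * (c 2%N t' + c 2%N t)) - c 1%N t) / s| <= s * o.
  by rewrite normrM normfV (gtr0_norm s0) ler_pdivrMr// [X in _ <= X]mulrC.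
have := lerXn2r 2 _ _ h; rewrite !nnegrE normr_ge0 mulr_ge0 ?sqrtr_ge0 ?(ltW s0)// => /(_ isT isT)/le_trans; apply.
by rewrite exprMn o2 le_eqVlt; apply/orP; left; apply/eqP; ring.
Qed.

(** Residual of the third scheme equation for one coefficient, divided by s. *)
Definition sgm : R := (c 0%N t' - c 0%N t) / s - (c 1%N t' + c 1%N t) / 2.

(** The method of [trap_c1] one order higher: the leading error -(s^2 / 12) c 3 is split off, and
    the remainder again involves only the oscillation of [c 3]. The split is what makes differences
    of consecutive defects small in [sgm_diff]. *)
Lemma trap_c0 : (sgm + s ^+ 2 / 12 * c 3%N t) ^+ 2 <= s ^+ 5 * (W t' - W t).
Proof.
pose H r := c 1%N r - (r - t) * c 2%N r + 2^-1 * c 3%N t * (r - t) ^+ 2.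
pose H' r := - (r - t) * (c 3%N r - c 3%N t).
have dH (r : R) : t <= r <= t' -> is_derive r 1 H (H' r).
  move=> /andP[tr rt]; have r0 : 0 <= r <= T by rewrite (le_trans t0 tr) (le_trans rt tsT).
  have d1 := dc (isT : (1 < 3)%N) r0; have d2 := dc (isT : (2 < 3)%N) r0.
  by apply: is_derive_eq; rewrite /H' /GRing.scale/=; field.
pose E r := c 0%N r - (r - t) * (2^-1 * (c 1%N r + c 1%N t)) + 12^-1 * c 3%N t * (r - t) ^+ 3.
pose E' r := 2^-1 * (H r - H t).
have dE (r : R) : t <= r <= t' -> is_derive r 1 E (E' r).
  move=> /andP[tr rt]; have r0 : 0 <= r <= T by rewrite (le_trans t0 tr) (le_trans rt tsT).
  have d0 := dc (isT : (0 < 3)%N) r0; have d1 := dc (isT : (1 < 3)%N) r0.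
  by apply: is_derive_eq; rewrite /E' /H /GRing.scale/=; field.
have bH (r : R) : t <= r <= t' -> `|H r - H t| <= s * (s * o).
  move=> /andP[tr rt]; apply: le_trans (increment_bound (B := s * o) tr _ _) _.
  - by move=> x /andP[tx xr]; apply: dH; rewrite tx (le_trans xr rt).
  - move=> x /andP[tx xr]; rewrite /H' normrM normrN ler_pM// ?osc_c3// ?(le_trans xr rt)//.
    by rewrite ger0_norm ?subr_ge0//; lra.
  - by rewrite ler_wpM2r ?mulr_ge0 ?sqrtr_ge0 ?(ltW s0)//; lra.
have bE (r : R) : t <= r <= t' -> `|E' r| <= s * (s * o).
  move=> /bH h; rewrite /E' normrM ger0_norm ?invr_ge0//.
  by have := normr_ge0 (H r - H t); lra.
have := increment_bound tt' dE bE.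
have e1 : t' - t = s by ring.
have e0 : E t = c 0%N t by rewrite /E subrr; ring.
rewrite e0 /E e1 => h.
have -> : sgm + s ^+ 2 / 12 * c 3%N t =
  (c 0%N t' - s * (2^-1 * (c 1%N t' + c 1%N t)) + 12^-1 * c 3%N t * s ^+ 3 - c 0%N t) / s.
  by rewrite /sgm; field; rewrite gt_eqF.
rewrite -(real_normK (num_real _)).
set w := (X in `|X / s|); have {}h : `|w / s| <= s * (s * o).
  by rewrite normrM normfV (gtr0_norm s0) ler_pdivrMr// [X in _ <= X]mulrC.
have := lerXn2r 2 _ _ h; rewrite !nnegrE normr_ge0 !mulr_ge0 ?sqrtr_ge0 ?(ltW s0)// => /(_ isT isT)/le_trans; apply.
by rewrite !exprMn o2 le_eqVlt; apply/orP; left; apply/eqP; ring.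
Qed.

Lemma sgm_bound : sgm ^+ 2 <= s ^+ 4 * c 3%N t ^+ 2 + 2 * s ^+ 5 * (W t' - W t).
Proof.
have h := trap_c0; have h2 := sqr_ge0 (sgm + s ^+ 2 / 6 * c 3%N t).
have h3 := sqr_ge0 (s ^+ 2 * c 3%N t).
have e1 : sgm ^+ 2 = 2 * (sgm + s ^+ 2 / 12 * c 3%N t) ^+ 2 - (sgm + s ^+ 2 / 6 * c 3%N t) ^+ 2 +
  (s ^+ 2 * c 3%N t) ^+ 2 / 72 by field.
have e2 : s ^+ 4 * c 3%N t ^+ 2 = (s ^+ 2 * c 3%N t) ^+ 2 by ring.
have w0 := le_trans (sqr_ge0 _) h; rewrite e1 e2 -(mulrA 2); move: h h2 h3 w0.
move: ((sgm + _) ^+ 2) ((sgm + _) ^+ 2) ((s ^+ 2 * _) ^+ 2) (s ^+ 5 * _) => x y z w; lra.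
Qed.

Lemma c0_increment : (c 0%N t' - c 0%N t) ^+ 2 <= s ^+ 2 * (T * (V T - V 0)).
Proof.
have [z /andP[tz zt] e] := mode_mvt (isT : (0 < 3)%N) t0 tt' tsT.
have z0 := le_trans t0 tz; have zT := le_trans zt tsT.
have [v1 h] := cV (lexx 0) z0 zT; have [v2 _] := cV z0 zT (lexx T).
rewrite e exprMn (_ : t' - t = s); last by ring.
rewrite ler_wpM2l ?sqr_ge0//; move: h; rewrite c10 !subr0 => /le_trans; apply.
by apply: ler_pM; rewrite ?subr_ge0//; lra.
Qed.

(** The first alternative is the step k = 0, where phi^(-1) = phi^0 turns the second difference into
    a first one; it is still small enough because [c 1] vanishes at 0. *)
Lemma c0_second (r : R) : (r = t /\ t = 0) \/ (0 <= r /\ r = t - s) ->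
  (c 0%N t' - 2 * c 0%N t + c 0%N r) ^+ 2 <= 2 * s ^+ 3 * (V t' - V r).
Proof.
have [z /andP[tz zt] e] := mode_mvt (isT : (0 < 3)%N) t0 tt' tsT.
have z0 := le_trans t0 tz; have zT := le_trans zt tsT.
have [v2 _] := cV z0 zt tsT.
rewrite (_ : t' - t = s) in e; last by ring.
move=> [[-> t00]|[r0 er]].
  have [v1 h] := cV t0 tz zT.
  have -> : c 0%N t' - 2 * c 0%N t + c 0%N t = s * (c 1%N z - c 1%N t).
    by rewrite t00 c10 subr0 -t00 -e; ring.
  have hb : (z - t) * (V z - V t) <= s * (V t' - V t) by apply: ler_pM; rewrite ?subr_ge0//; lra.
  rewrite exprMn; apply: (le_trans (ler_wpM2l (sqr_ge0 s) (le_trans h hb))).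
  have : 0 <= s ^+ 3 * (V t' - V t) by rewrite mulr_ge0 ?subr_ge0 ?exprn_ge0 ?(ltW s0)// (le_trans v1 v2).
  have -> : s ^+ 2 * (s * (V t' - V t)) = s ^+ 3 * (V t' - V t) by ring.
  by rewrite -mulrA; lra.
have rt : r <= t by rewrite er; lra.
have [y /andP[ry yt] e'] := mode_mvt (isT : (0 < 3)%N) r0 rt (le_trans tt' tsT).
have y0 := le_trans r0 ry; have yz := le_trans yt tz.
have [v3 h] := cV y0 yz zT; have [v4 _] := cV r0 ry (le_trans yz zT).
rewrite (_ : t - r = s) in e'; last by rewrite er; ring.
have -> : c 0%N t' - 2 * c 0%N t + c 0%N r = s * (c 1%N z - c 1%N y) by rewrite mulrBr -e -e'; ring.
have hb : (z - y) * (V z - V y) <= (2 * s) * (V t' - V r).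
  by apply: ler_pM; rewrite ?subr_ge0//; lra.
rewrite exprMn; apply: (le_trans (ler_wpM2l (sqr_ge0 s) (le_trans h hb))).
by rewrite le_eqVlt; apply/orP; left; apply/eqP; ring.
Qed.

End Step.

(** The leading parts differ by an increment of [c 3], which W bounds too. In the square this gains
    a factor s over [sgm_bound]. *)
Lemma sgm_diff (t s : R) : 0 <= t -> 0 < s -> t + s + s <= T ->
  (sgm (t + s) s - sgm t s) ^+ 2 <= 3 * s ^+ 5 * (2 * (W (t + s) - W t) + (W (t + s + s) - W (t + s))).
Proof.
move=> t0 s0 tT; have ts0 : 0 <= t + s by rewrite addr_ge0// ltW.
have tsT : t + s <= T by apply: le_trans tT; rewrite lerDl ltW.
have h1 := trap_c0 t0 s0 tsT; have h2 := trap_c0 ts0 s0 tT.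
have tt : t <= t + s by rewrite lerDl ltW.
have [w h3] := cW t0 tt tsT; rewrite (_ : t + s - t = s) in h3; last by ring.
set a := sgm (t + s) s + _ in h2; set b := sgm t s + _ in h1.
set d := s ^+ 2 / 12 * (c 3%N (t + s) - c 3%N t).
have h4 : d ^+ 2 <= s ^+ 5 * (W (t + s) - W t).
  rewrite /d exprMn; apply: (le_trans (ler_wpM2l (sqr_ge0 _) h3)).
  have -> : (s ^+ 2 / 12) ^+ 2 * (s * (W (t + s) - W t)) = (s ^+ 5 * (W (t + s) - W t)) / 144 by field.
  have : 0 <= s ^+ 5 * (W (t + s) - W t) by rewrite mulr_ge0 ?subr_ge0// exprn_ge0// ltW.
  lra.
have -> : sgm (t + s) s - sgm t s = a - b - d by rewrite /a /b /d; ring.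
have e1 : (a - b - d) ^+ 2 = 3 * (a ^+ 2 + b ^+ 2 + d ^+ 2) - (a + b) ^+ 2 - (a + d) ^+ 2 - (b - d) ^+ 2 by ring.
have := sqr_ge0 (a + b); have := sqr_ge0 (a + d); have := sqr_ge0 (b - d).
have -> : 3 * s ^+ 5 * (2 * (W (t + s) - W t) + (W (t + s + s) - W (t + s))) =
  3 * (2 * (s ^+ 5 * (W (t + s) - W t)) + s ^+ 5 * (W (t + s + s) - W (t + s))) by ring.
rewrite e1; move: h1 h2 h4.
move: (s ^+ 5 * _) (s ^+ 5 * _) (a ^+ 2) (b ^+ 2) (d ^+ 2) ((_ + _) ^+ 2) ((_ + _) ^+ 2) ((_ - _) ^+ 2) => *; lra.
Qed.

End ModeConsistency.

(** * Splitting of the residual *)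

Section TauCoef.
Variable R : realType.

Lemma sqr_sum7 (a b c d e f g : R) : (a + b + c + d + e + f + g) ^+ 2 <=
  7 * (a ^+ 2 + b ^+ 2 + c ^+ 2 + d ^+ 2 + e ^+ 2 + f ^+ 2 + g ^+ 2).
Proof.
rewrite -subr_ge0.
have -> : 7 * (a ^+ 2 + b ^+ 2 + c ^+ 2 + d ^+ 2 + e ^+ 2 + f ^+ 2 + g ^+ 2) - (a + b + c + d + e + f + g) ^+ 2 =
  (a - b) ^+ 2 + (a - c) ^+ 2 + (a - d) ^+ 2 + (a - e) ^+ 2 + (a - f) ^+ 2 + (a - g) ^+ 2 +
  (b - c) ^+ 2 + (b - d) ^+ 2 + (b - e) ^+ 2 + (b - f) ^+ 2 + (b - g) ^+ 2 + (c - d) ^+ 2 +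
  (c - e) ^+ 2 + (c - f) ^+ 2 + (c - g) ^+ 2 + (d - e) ^+ 2 + (d - f) ^+ 2 + (d - g) ^+ 2 +
  (e - f) ^+ 2 + (e - g) ^+ 2 + (f - g) ^+ 2 by ring.
by rewrite !addr_ge0// sqr_ge0.
Qed.

Lemma sqr_le_abs (a b : R) : 0 <= b -> `|a| <= b -> a ^+ 2 <= b ^+ 2.
Proof. by move=> b0 ab; rewrite -real_normK ?num_real// lerXn2r ?nnegrE. Qed.

(** The seven terms are the time residual, the difference of the cubes, the replacement of l by lh
    in each of the four space terms, and the extrapolation defect d. Since l - lh is at most h2 l^2,
    each replacement costs a factor h2 and one more power of l. *)
Lemma tau_coef_bound (alpha beta l lh h2 T1 P Q C d : R) :
  0 <= lh -> lh <= l -> l - lh <= h2 * l ^+ 2 ->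
  (beta * T1 - l * (Q + alpha * C - 2 * l * C + l ^+ 2 * C) +
    lh * (P + alpha * C - 2 * lh * (C - d) + lh ^+ 2 * C)) ^+ 2 <=
  7 * (beta ^+ 2 * T1 ^+ 2 + (lh * (P - Q)) ^+ 2 + h2 ^+ 2 * (l ^+ 2 * Q) ^+ 2 +
    h2 ^+ 2 * (alpha ^+ 2 * (l ^+ 2 * C) ^+ 2 + 16 * (l ^+ 3 * C) ^+ 2 + 9 * (l ^+ 4 * C) ^+ 2) +
    4 * (l ^+ 2 * d) ^+ 2).
Proof.
move=> lh0 lhl hl; have l0 := le_trans lh0 lhl; have d0 : 0 <= l - lh by rewrite subr_ge0.
have hd2 : 0 <= h2 * l ^+ 2 := le_trans d0 hl.
have -> : beta * T1 - l * (Q + alpha * C - 2 * l * C + l ^+ 2 * C) +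
    lh * (P + alpha * C - 2 * lh * (C - d) + lh ^+ 2 * C) =
  beta * T1 + lh * (P - Q) + - ((l - lh) * Q) + - (alpha * ((l - lh) * C)) +
  2 * ((l - lh) * (l + lh)) * C + 2 * (lh ^+ 2 * d) +
  - ((l - lh) * (l ^+ 2 + l * lh + lh ^+ 2) * C) by ring.
apply: (le_trans (sqr_sum7 _ _ _ _ _ _ _)); rewrite ler_wpM2l//.
have S1 (x : R) : ((l - lh) * x) ^+ 2 <= h2 ^+ 2 * (l ^+ 2 * x) ^+ 2.
  have -> : h2 ^+ 2 * (l ^+ 2 * x) ^+ 2 = (h2 * l ^+ 2) ^+ 2 * x ^+ 2 by ring.
  by rewrite exprMn ler_wpM2r ?sqr_ge0// lerXn2r ?nnegrE.
have S2 : (l - lh) * (l + lh) <= h2 * (2 * l ^+ 3).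
  have -> : h2 * (2 * l ^+ 3) = (h2 * l ^+ 2) * (2 * l) by ring.
  by apply: ler_pM => //; [rewrite addr_ge0|lra].
have S3 : (l - lh) * (l ^+ 2 + l * lh + lh ^+ 2) <= h2 * (3 * l ^+ 4).
  have -> : h2 * (3 * l ^+ 4) = (h2 * l ^+ 2) * (3 * l ^+ 2) by ring.
  have k1 : l * lh <= l ^+ 2 by rewrite expr2 ler_wpM2l.
  have k2 : lh ^+ 2 <= l ^+ 2 by rewrite lerXn2r ?nnegrE.
  by apply: ler_pM => //; [rewrite !addr_ge0 ?sqr_ge0 ?mulr_ge0|lra].
have T2 : (2 * ((l - lh) * (l + lh)) * C) ^+ 2 <= h2 ^+ 2 * (16 * (l ^+ 3 * C) ^+ 2).
  have -> : h2 ^+ 2 * (16 * (l ^+ 3 * C) ^+ 2) = (2 * (h2 * (2 * l ^+ 3))) ^+ 2 * C ^+ 2 by ring.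
  rewrite exprMn ler_wpM2r ?sqr_ge0// lerXn2r ?nnegrE ?ler_wpM2l//.
    by rewrite mulr_ge0// mulr_ge0// addr_ge0.
  by rewrite mulr_ge0// (le_trans _ S2)// mulr_ge0// addr_ge0.
have T3 : (- ((l - lh) * (l ^+ 2 + l * lh + lh ^+ 2) * C)) ^+ 2 <= h2 ^+ 2 * (9 * (l ^+ 4 * C) ^+ 2).
  have -> : h2 ^+ 2 * (9 * (l ^+ 4 * C) ^+ 2) = (h2 * (3 * l ^+ 4)) ^+ 2 * C ^+ 2 by ring.
  have p : 0 <= (l - lh) * (l ^+ 2 + l * lh + lh ^+ 2) by rewrite mulr_ge0// !addr_ge0 ?sqr_ge0 ?mulr_ge0.
  by rewrite sqrrN exprMn ler_wpM2r ?sqr_ge0// lerXn2r ?nnegrE// (le_trans p).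
have T4 : (2 * (lh ^+ 2 * d)) ^+ 2 <= 4 * (l ^+ 2 * d) ^+ 2.
  have -> : (2 * (lh ^+ 2 * d)) ^+ 2 = 4 * ((lh ^+ 2) ^+ 2 * d ^+ 2) by ring.
  by rewrite ler_wpM2l// [X in _ <= X]exprMn ler_wpM2r ?sqr_ge0// lerXn2r ?nnegrE ?sqr_ge0// lerXn2r ?nnegrE.
have T5 : (- (alpha * ((l - lh) * C))) ^+ 2 <= h2 ^+ 2 * (alpha ^+ 2 * (l ^+ 2 * C) ^+ 2).
  rewrite sqrrN exprMn; apply: (le_trans (ler_wpM2l (sqr_ge0 _) (S1 C))).
  by rewrite le_eqVlt; apply/orP; left; apply/eqP; ring.
have T6 : (- ((l - lh) * Q)) ^+ 2 <= h2 ^+ 2 * (l ^+ 2 * Q) ^+ 2 by rewrite sqrrN.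
apply: (le_trans (lerD (lerD (lerD (lerD (lerD (lerD (lexx _) (lexx _)) T6) T5) T2) T4) T3)).
by rewrite le_eqVlt; apply/orP; left; apply/eqP; ring.
Qed.

Lemma telescope_le (f : nat -> R) (m : nat) :
  \sum_(k < m) (f k.+1 - f k) = f m - f 0%N.
Proof. by rewrite -(big_mkord xpredT (fun k => f k.+1 - f k)) telescope_sumr. Qed.

Lemma sqr_half (a b : R) : (2^-1 * (a + b)) ^+ 2 <= 2^-1 * (a ^+ 2 + b ^+ 2).
Proof.
have := sqr_ge0 (a - b); have -> : (2^-1 * (a + b)) ^+ 2 = 2^-1 * (a ^+ 2 + b ^+ 2) - (a - b) ^+ 2 / 4 by field.
lra.
Qed.

Lemma half_sum_le (a b d : R) : a <= d -> b <= d -> 2^-1 * (a + b) <= d.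
Proof. lra. Qed.

Lemma sqr_sum_aux (a b x y z v : R) : 0 <= x -> 0 <= z -> 0 <= v -> b ^+ 2 <= y ->
  (a + b) ^+ 2 <= 7 * (x + a ^+ 2 + y + z + v).
Proof.
move=> x0 z0 v0 by0; have := sqr_ge0 (a - b); have := sqr_ge0 a; have := sqr_ge0 b.
have -> : (a + b) ^+ 2 = 2 * a ^+ 2 + 2 * b ^+ 2 - (a - b) ^+ 2 by ring.
move: by0; move: (a ^+ 2) (b ^+ 2) ((a - b) ^+ 2) => *; lra.
Qed.

End TauCoef.

Section TpolyLinear.
Variables (R : realType) (L : R) (N : nat) (s : seq (int * int)).
Implicit Types c d : int * int -> R.

Lemma tpolyD c d : tpoly L N s c + tpoly L N s d = tpoly L N s (fun i => c i + d i).
Proof.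
apply/funext => i; apply/funext => j; rewrite gaddE /tpoly -big_split /=.
by apply: eq_bigr => p _; rewrite mulrDl.
Qed.

Lemma tpolyZ (a : R) c : a *: tpoly L N s c = tpoly L N s (fun i => a * c i).
Proof.
apply/funext => i; apply/funext => j; rewrite gscaleE /tpoly mulr_sumr.
by apply: eq_bigr => p _; rewrite mulrA.
Qed.

Lemma tpolyN c : - tpoly L N s c = tpoly L N s (fun i => - c i).
Proof.
by rewrite -scaleN1r tpolyZ; congr tpoly; apply/funext => i; rewrite mulN1r.
Qed.

Definition tpolyE := (tpolyZ, tpolyN, tpolyD).

Lemma eq_tpoly c d : (forall i, i \in s -> c i = d i) -> tpoly L N s c = tpoly L N s d.
Proof.
move=> E; apply/funext => i; apply/funext => j; apply: eq_big_seq => p ps.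
by rewrite E.
Qed.

End TpolyLinear.

(** * Consistency of the truncated solution *)

Section Consistency.
Variables (R : realType) (alpha beta L T M : R) (u : R -> R -> R -> R).
Variables (c : nat -> int * int -> R -> R) (q V W : int * int -> R -> R).
Hypotheses (L0 : 0 < L) (T0 : 0 < T) (M0 : 0 <= M).
Hypothesis fd : fourier_data alpha beta L T M u c q V W.
Local Notation I := (int * int)%type.
Local Notation w := (fun i : I => wt R i.1 i.2).
Local Notation lm := (fun i : I => lam L i.1 i.2).

Definition kap : R := 1 + om L ^+ 2.

Lemma kap_ge1 : 1 <= kap.
Proof. by rewrite /kap lerDl sqr_ge0. Qed.

Lemma lam_ge0 (i : I) : 0 <= lm i.
Proof. by rewrite /lam mulr_ge0 ?addr_ge0 ?sqr_ge0. Qed.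

Lemma lam_le (i : I) : lm i <= kap * w i.
Proof.
rewrite /lam /wt /kap; have := sqr_ge0 (i.1%:~R : R); have := sqr_ge0 (i.2%:~R : R).
move: (_ ^+ 2) (_ ^+ 2) => a b a0 b0; have := mulr_ge0 (sqr_ge0 (om L)) (ler01 : 0 <= 1 :> R).
have -> : (1 + om L ^+ 2) * (1 + a + b) = om L ^+ 2 * (a + b) + (om L ^+ 2 * 1 + 1 + a + b) by ring.
by move=> h; rewrite lerDl; lra.
Qed.

Lemma wt_expn_le (i : I) (a b : nat) : (a <= b)%N -> w i ^+ a <= w i ^+ b.
Proof. by move=> ab; rewrite ler_weXn2l// wt_ge1. Qed.

Lemma wt_ge0 (i : I) : 0 <= w i.
Proof. exact: le_trans ler01 (wt_ge1 _ _ _). Qed.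

Lemma lam_pow_le (i : I) (j : nat) (x : R) : (j <= 4)%N ->
  (lm i ^+ j * x) ^+ 2 <= kap ^+ 8 * (w i ^+ 8 * x ^+ 2).
Proof.
move=> j4; have k0 : 0 <= kap := le_trans ler01 kap_ge1.
rewrite exprMn -exprM [X in _ <= X]mulrA ler_wpM2r ?sqr_ge0//.
apply: (@le_trans _ _ ((kap * w i) ^+ (j * 2))).
  by rewrite lerXn2r ?nnegrE ?lam_ge0 ?mulr_ge0 ?wt_ge0// lam_le.
rewrite exprMn ler_pM ?exprn_ge0 ?wt_ge0// ?wt_expn_le ?ler_weXn2l ?kap_ge1//; lia.
Qed.

(** The tail bound for K = 0 leaves only the constant mode, which [fd_c0] controls. *)
Lemma solution_bound (K : nat) (x y t : R) : 0 <= t <= T ->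
  `|u x y t| <= 6 * M + 4 /\
  `|\sum_(i <- box K) c 0%N i t * bas L i.1 i.2 x y| <= 7 * M + 4.
Proof.
move=> tT; have h0 := fd_tail fd 0 x y tT; have hK := fd_tail fd K x y tT.
have := fd_c0 fd (s := [:: (0, 0)]) isT tT; rewrite big_seq1 /wt /= expr0n /= !addr0 expr1n mul1r => hc.
have hb : box 0 = [:: (0, 0)] by [].
rewrite hb big_seq1 /= expr1n divr1 in h0.
have c1 : `|c 0%N (0, 0) t| <= 1 + M.
  rewrite -(ler_pXn2r (n := 2)) ?nnegrE ?addr_ge0// real_normK ?num_real//.
  apply: (le_trans hc); have -> : (1 + M) ^+ 2 = 1 + 2 * M + M ^+ 2 by ring.
  by have := sqr_ge0 M; have := M0; lra.
have h1 : `|c 0%N (0, 0) t * bas L 0 0 x y| <= 4 * (1 + M).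
  by rewrite normrM mulrC; apply: ler_pM => //; exact: abs_bas_le.
have h2 : M / K.+1%:R ^+ 6 <= M.
  by rewrite ler_pdivrMr ?exprn_gt0// ler_peMr// exprn_ege1// ler1n.
have h3 := ler_normD (u x y t - c 0%N (0, 0) t * bas L 0 0 x y)
  (c 0%N (0, 0) t * bas L 0 0 x y); rewrite subrK in h3.
set Y := \sum_(i <- _) _ in hK *.
have h4 := ler_normB (u x y t) (u x y t - Y); rewrite opprB addrC subrK in h4.
move: M0 h0 h1 h2 h3 hK h4; clear.
move: (`|_|) (`|_|) (`|_|) (`|_|) (`|_|) (M / _) => a1 a2 a3 a4 a5 a6 *; split; lra.
Qed.

Lemma cube_diff (a b B d : R) : `|a| <= B -> `|b| <= B -> `|a - b| <= d ->
  `|a ^+ 3 - b ^+ 3| <= 3 * B ^+ 2 * d.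
Proof.
move=> aB bB ab; have B0 := le_trans (normr_ge0 _) aB.
have -> : a ^+ 3 - b ^+ 3 = (a ^+ 2 + a * b + b ^+ 2) * (a - b) by ring.
rewrite normrM ler_pM//.
have h1 : `|a ^+ 2| <= B ^+ 2 by rewrite normrX lerXn2r ?nnegrE.
have h2 : `|b ^+ 2| <= B ^+ 2 by rewrite normrX lerXn2r ?nnegrE.
have h3 : `|a * b| <= B ^+ 2 by rewrite normrM expr2 ler_pM.
have := ler_normD (a ^+ 2 + a * b) (b ^+ 2); have := ler_normD (a ^+ 2) (a * b); lra.
Qed.

(** Both functions are bounded and uniformly close, hence so are their cubes; Bessel's inequality
    turns this into closeness of all coefficients, with no Sobolev estimate of products. *)
Lemma bessel_step (K : nat) (p : I -> R) (t : R) : 0 <= t <= T ->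
  (forall x y, (\sum_(i <- box K) c 0%N i t * bas L i.1 i.2 x y) ^+ 3 =
    \sum_(i <- box (3 * K)) p i * bas L i.1 i.2 x y) ->
  \sum_(i <- box (3 * K)) (q i t - p i) ^+ 2 <= (3 * (7 * M + 4) ^+ 2 * (M / K.+1%:R ^+ 6)) ^+ 2.
Proof.
move=> tT Hp; apply: (fd_bessel fd (box_uniq _) tT).
  exact: (mulr_ge0 (mulr_ge0 (ler0n _ 3) (sqr_ge0 _)) (divr_ge0 M0 (exprn_ge0 _ (ler0n _ _)))).
move=> x y; rewrite -Hp; have [h1 h2] := solution_bound K x y tT.
by have m := M0; apply: cube_diff => //; [lra|exact: (fd_tail fd)].
Qed.

(** Frequencies outside the cutoff exceed a fixed multiple of 1 / h, so that a factor 3 h^2 lam, at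
    least 1 there, can be inserted in terms that are not small by themselves. It rests on 12 pi^2 >=
    36. *)
Lemma lam_out (K N : nat) (i : I) : (0 < N)%N -> (N <= 6 * K.+1)%N -> i \notin box K ->
  1 <= 3 * (L / N%:R) ^+ 2 * lm i.
Proof.
move=> N0 mesh_le_cutoff; rewrite mem_box negb_and -!ltnNge => iK.
have n0 : 0 < N%:R :> R by rewrite ltr0n.
have hm : (K.+1%:R : R) ^+ 2 <= i.1%:~R ^+ 2 + i.2%:~R ^+ 2.
  have e (m : int) : (m%:~R : R) ^+ 2 = (`|m|%N)%:R ^+ 2.
    by rewrite -[in LHS](real_normK (num_real _)) -intr_norm -abszE pmulrn.
  rewrite !e; case/orP: iK => h.
    by rewrite -[X in X <= _]addr0 lerD ?sqr_ge0// lerXn2r ?nnegrE// ler_nat.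
  by rewrite -[X in X <= _]add0r lerD ?sqr_ge0// lerXn2r ?nnegrE// ler_nat.
have e1 : 3 * (L / N%:R) ^+ 2 * lm i = 12 * pi ^+ 2 * (i.1%:~R ^+ 2 + i.2%:~R ^+ 2) / N%:R ^+ 2.
  by rewrite /lam /om; field; rewrite !gt_eqF.
rewrite e1 ler_pdivlMr ?exprn_gt0// mul1r.
apply: (@le_trans _ _ ((6 * K.+1%:R) ^+ 2)).
  by rewrite lerXn2r ?nnegrE// ?mulr_ge0// -natrM ler_nat.
have p2 : 4 <= pi ^+ 2 :> R.
  have -> : 4 = 2 * 2 :> R by ring.
  by rewrite expr2 ler_pM// pi_ge2.
rewrite exprMn; apply: ler_pM => //; rewrite ?sqr_ge0//; lra.
Qed.

Section Scheme.
Variables (N : nat) (s : R).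
Hypotheses (N0 : (0 < N)%N) (s0 : 0 < s).
Local Notation h := (L / N%:R).
Local Notation A := (gA N h).
Local Notation dot := (gdot N h).

(** The largest K with 6 K < N. Conversely N <= 6 (K + 1), so powers of 1 / (K + 1) are powers of h
    up to constants. *)
Definition cutoff : nat := ((N - 1) %/ 6)%N.
Local Notation S := (box (3 * cutoff)).
Local Notation tp := (tpoly L N S).
Definition time_at (k : nat) : R := k%:R * s.

(** Zero outside the cutoff, yet used over the larger box of the cube, so that linear and cubic
    terms are sums over one list. *)
Definition trunc_mode (j k : nat) (i : I) : R := if i \in box cutoff then c j i (time_at k) else 0.
Definition proj0 (k : nat) := tp (trunc_mode 0 k).
Definition proj1 (k : nat) := tp (trunc_mode 1 k).
Definition sigma_coef (k : nat) (i : I) : R :=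
  if i \in box cutoff then sgm (fun j => c j i) (time_at k) s else 0.
Definition trunc_sigma (k : nat) := tp (sigma_coef k).

Lemma box_lt_mesh : (2 * (3 * cutoff) < N)%N.
Proof. rewrite /cutoff; lia. Qed.

Lemma mesh_le_cutoff : (N <= 6 * cutoff.+1)%N.
Proof. rewrite /cutoff; lia. Qed.

Lemma time_at_succ k : time_at k.+1 = time_at k + s.
Proof. by rewrite /time_at -natr1 mulrDl mul1r. Qed.

Lemma time_at_ge0 k : 0 <= time_at k.
Proof. by rewrite mulr_ge0// ltW. Qed.

Lemma time_at_le k n : (k <= n)%N -> time_at k <= time_at n.
Proof. by move=> kn; rewrite /time_at ler_pM2r// ler_nat. Qed.

Lemma gdot_tpoly (d : I -> R) : dot (tp d) (tp d) = L ^+ 2 * \sum_(i <- S) d i ^+ 2.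
Proof. by rewrite (parseval L0 N0 _ _ box_lt_mesh (box_uniq _)). Qed.

Lemma h2n_tpoly (d : I -> R) : h2n N h (tp d) <=
  2 * L ^+ 2 * kap ^+ 2 * \sum_(i <- S) w i ^+ 2 * d i ^+ 2.
Proof.
rewrite /h2n (gA_tpoly L0 N0) !gdot_tpoly -mulrDr -big_split /=.
have e (a : R) : 2 * L ^+ 2 * kap ^+ 2 * a = L ^+ 2 * (2 * kap ^+ 2 * a) by ring.
rewrite e ler_wpM2l ?sqr_ge0// !mulr_sumr; apply: ler_sum => i _.
have [l0 _ ll _] := lamh_bounds L0 N0 i.
have : lamh L N i ^+ 2 <= kap ^+ 2 * w i ^+ 2.
  by rewrite -exprMn lerXn2r ?nnegrE ?(le_trans l0 ll, mulr_ge0 (le_trans ler01 kap_ge1) (wt_ge0 i))// (le_trans ll (lam_le i)).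
have h1 : 1 <= kap ^+ 2 * w i ^+ 2 by rewrite mulr_ege1// exprn_ege1// ?kap_ge1// wt_ge1.
move=> h2; have h3 := sqr_ge0 (d i).
have := ler_wpM2r h3 h1; have := ler_wpM2r h3 h2; rewrite mul1r.
move=> k1 k2; have -> : 2 * kap ^+ 2 * (w i ^+ 2 * d i ^+ 2) = 2 * (kap ^+ 2 * w i ^+ 2 * d i ^+ 2) by ring.
have -> : (lamh L N i * d i) ^+ 2 = lamh L N i ^+ 2 * d i ^+ 2 by rewrite exprMn.
move: k1 k2; move: (_ * d i ^+ 2) (_ * d i ^+ 2) => a b *; lra.
Qed.

Lemma sig_eq k : proj0 k.+1 - proj0 k = s *: (2^-1 *: (proj1 k.+1 + proj1 k) + trunc_sigma k).
Proof.
rewrite /proj0 /proj1 /trunc_sigma !tpolyE; apply: eq_tpoly => i _.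
rewrite /trunc_mode /sigma_coef; case: ifP => _; last by ring.
by rewrite /sgm -time_at_succ; field; rewrite gt_eqF.
Qed.

Lemma proj0E k i j : proj0 k i j = \sum_(p <- box cutoff) c 0%N p (time_at k) * bas L p.1 p.2 (Defs.center h i) (Defs.center h j).
Proof.
rewrite /proj0 /tpoly (sum_boxB _ (_ : (cutoff <= 3 * cutoff)%N)); last by lia.
rewrite [X in _ + X]big1 ?addr0; last by move=> p /negPf pK; rewrite /trunc_mode pK mul0r.
by apply: eq_big_seq => p pK; rewrite /trunc_mode pK.
Qed.

Lemma mode_hyps i : [/\ forall j (t : R), (j < 3)%N -> 0 <= t <= T -> is_derive t 1 (c j i) (c j.+1 i t),
  forall r t : R, 0 <= r -> r <= t -> t <= T ->
  V i r <= V i t /\ (c 1%N i t - c 1%N i r) ^+ 2 <= (t - r) * (V i t - V i r),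
  forall r t : R, 0 <= r -> r <= t -> t <= T ->
  W i r <= W i t /\ (c 3%N i t - c 3%N i r) ^+ 2 <= (t - r) * (W i t - W i r) & c 1%N i 0 = 0].
Proof.
split; [by move=> j t; apply: (fd_derive fd)|exact: (fd_V fd i)|exact: (fd_W fd i)|exact: (fd_init fd)].
Qed.

Section Range.
Variable n : nat.
Hypothesis ns : time_at n <= T.

Lemma time_at_in k : (k <= n)%N -> 0 <= time_at k <= T.
Proof. by move=> kn; rewrite time_at_ge0 (le_trans (time_at_le kn) ns). Qed.

Lemma step_in k : (k < n)%N -> time_at k + s <= T.
Proof. by move=> kn; rewrite -time_at_succ; have /andP[] := time_at_in kn. Qed.

Lemma s_le_T k : (k < n)%N -> s <= T.
Proof. by move=> kn; have := step_in kn; have := time_at_ge0 k; lra. Qed.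

Lemma sum_W_le : \sum_(i <- S) (W i T - W i 0) <= M.
Proof. exact: (fd_WT fd (box_uniq _)). Qed.

Lemma W_mono i r t : 0 <= r -> r <= t -> t <= T -> W i r <= W i t.
Proof. by move=> a b d; have [] := fd_W fd i a b d. Qed.

Lemma V_mono i r t : 0 <= r -> r <= t -> t <= T -> V i r <= V i t.
Proof. by move=> a b d; have [] := fd_V fd i a b d. Qed.

Lemma sig_bound k : (k < n)%N -> dot (trunc_sigma k) (trunc_sigma k) <= L ^+ 2 * M * (1 + 2 * T) * s ^+ 4.
Proof.
move=> kn; have [tk0 tkT] := (time_at_ge0 k, step_in kn); have sT := s_le_T kn.
have e0 : L ^+ 2 * M * (1 + 2 * T) * s ^+ 4 = L ^+ 2 * (M * ((1 + 2 * T) * s ^+ 4)) by ring.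
rewrite gdot_tpoly e0 ler_wpM2l ?sqr_ge0//.
apply: (@le_trans _ _ (\sum_(i <- S) (s ^+ 4 * c 3%N i (time_at k) ^+ 2 + 2 * s ^+ 5 * (W i T - W i 0)))).
  apply: ler_sum => i _; have [dc cV cW c10] := mode_hyps i.
  have ts : time_at k <= time_at k + s by rewrite lerDl ltW.
  have tT := le_trans ts tkT.
  have g1 : 0 <= s ^+ 4 * c 3%N i (time_at k) ^+ 2 by exact: (mulr_ge0 (exprn_ge0 4 (ltW s0)) (sqr_ge0 _)).
  have g2 : 0 <= 2 * s ^+ 5 by rewrite mulr_ge0// exprn_ge0// ltW.
  have m1 := W_mono i (lexx 0) tk0 tT; have m2 := W_mono i tk0 ts tkT.
  have m3 := W_mono i (le_trans tk0 ts) tkT (lexx T).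
  rewrite /sigma_coef; case: ifP => _.
    apply: (le_trans (sgm_bound dc cW tk0 s0 tkT)).
    by rewrite lerD2l ler_wpM2l//; lra.
  by rewrite expr0n addr_ge0// mulr_ge0// subr_ge0; lra.
rewrite big_split /= -!mulr_sumr.
have c3 := fd_c3 fd (box_uniq (3 * cutoff)) (time_at_in (ltnW kn)).
have s4 : 0 <= s ^+ 4 by rewrite exprn_ge0// ltW.
have e1 := ler_wpM2l s4 c3; have e2 := ler_wpM2l (mulr_ge0 (ler0n R 2) (exprn_ge0 5 (ltW s0))) sum_W_le.
apply: (le_trans (lerD e1 e2)).
have e3 := ler_wpM2r (mulr_ge0 (mulr_ge0 (ler0n R 2) s4) M0) sT.
have -> : M * ((1 + 2 * T) * s ^+ 4) = s ^+ 4 * M + T * (2 * s ^+ 4 * M) by ring.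
have -> : 2 * s ^+ 5 * M = s * (2 * s ^+ 4 * M) by ring.
by rewrite lerD2l.
Qed.

Lemma sum_step_le (f : I -> R -> R) (m : nat) : (m <= n)%N ->
  (forall i r t, 0 <= r -> r <= t -> t <= T -> f i r <= f i t) ->
  \sum_(k < m) \sum_(i <- S) (f i (time_at k.+1) - f i (time_at k)) <= \sum_(i <- S) (f i T - f i 0).
Proof.
move=> mn fm; rewrite exchange_big /=; apply: ler_sum => i _.
rewrite (telescope_le (fun k => f i (time_at k))) /time_at mul0r lerD2r; apply: fm => //; first exact: time_at_ge0.
by have /andP[] := time_at_in mn.
Qed.

Lemma sum_step_le2 (f : I -> R -> R) (m : nat) : (m < n)%N ->
  (forall i r t, 0 <= r -> r <= t -> t <= T -> f i r <= f i t) ->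
  \sum_(k < m) \sum_(i <- S) (f i (time_at k.+2) - f i (time_at k.+1)) <= \sum_(i <- S) (f i T - f i 0).
Proof.
move=> mn fm; rewrite exchange_big /=; apply: ler_sum => i _.
rewrite (telescope_le (fun k => f i (time_at k.+1))); apply: lerB; apply: fm => //.
- exact: time_at_ge0.
- by have /andP[] := time_at_in mn.
- exact: time_at_ge0.
- by apply: le_trans (time_at_le (_ : 1 <= n)%N) ns; lia.
Qed.

Lemma sig_diff_bound : \sum_(k < n.-1) dot (trunc_sigma k.+1 - trunc_sigma k) (trunc_sigma k.+1 - trunc_sigma k) <=
  s * (9 * L ^+ 2 * M * s ^+ 4).
Proof.
have [n0|n1] := posnP n; first rewrite n0 big_ord0.
  exact: (mulr_ge0 (ltW s0) (mulr_ge0 (mulr_ge0 (mulr_ge0 (ler0n R 9) (sqr_ge0 L)) M0) (exprn_ge0 4 (ltW s0)))).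
have nn : (n.-1 < n)%N by lia.
apply: (@le_trans _ _ (\sum_(k < n.-1) L ^+ 2 * (3 * s ^+ 5 *
   (2 * \sum_(i <- S) (W i (time_at k.+1) - W i (time_at k)) + \sum_(i <- S) (W i (time_at k.+2) - W i (time_at k.+1)))))).
  apply: ler_sum => k _; rewrite /trunc_sigma !tpolyE gdot_tpoly ler_wpM2l ?sqr_ge0//.
  rewrite (mulr_sumr _ _ _ 2) -big_split /= mulr_sumr; apply: ler_sum => i _.
  have [dc cV cW c10] := mode_hyps i.
  have kn : (k.+1 < n)%N by have := ltn_ord k; lia.
  have tT := step_in kn; rewrite time_at_succ in tT.
  have p5 : 0 <= 3 * s ^+ 5 by rewrite mulr_ge0// exprn_ge0// ltW.
  rewrite /sigma_coef; case: ifP => _.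
    by rewrite !time_at_succ; apply: (sgm_diff dc cW (time_at_ge0 k) s0 tT).
  rewrite subr0 expr0n /= mulr_ge0// addr_ge0// ?mulr_ge0// subr_ge0 W_mono ?time_at_ge0 ?time_at_le//.
  - by have /andP[] := time_at_in (ltnW kn).
  - by have /andP[] := time_at_in kn.
rewrite -mulr_sumr -mulr_sumr big_split /= -mulr_sumr.
have e1 := le_trans (sum_step_le (f := W) (ltnW nn) W_mono) sum_W_le.
have e2 := le_trans (sum_step_le2 (f := W) nn W_mono) sum_W_le.
have -> : s * (9 * L ^+ 2 * M * s ^+ 4) = L ^+ 2 * (3 * s ^+ 5 * (3 * M)) by ring.
by rewrite ler_wpM2l ?sqr_ge0// ler_wpM2l ?mulr_ge0 ?exprn_ge0 ?(ltW s0)//; lra.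
Qed.

(** Residual of the first two scheme equations, combined and divided by s, for the truncated
    solution with velocity [proj1]. *)
Definition trunc_tau (k : nat) : int -> int -> R :=
  (beta / s) *: (proj1 k.+1 - proj1 k) + 2^-1 *: (proj1 k.+1 + proj1 k) +
  A (gchi (proj0 k.+1) (proj0 k) + (alpha / 2) *: (proj0 k.+1 + proj0 k) - A (3 *: proj0 k - proj0 k.-1) +
     2^-1 *: A (A (proj0 k.+1 + proj0 k))).

Definition chi_defect (k : nat) : int -> int -> R :=
  4^-1 *: gmul (proj0 k.+1 + proj0 k) (gmul (proj0 k.+1 - proj0 k) (proj0 k.+1 - proj0 k)).

(** The average of the two cubes minus a term quadratic in a - b, thus of order s^2. The cubes are
    left to Bessel's inequality and the rest to the algebra norm. *)
Lemma gchi_split (a b : int -> int -> R) : gchi a b =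
  2^-1 *: (gmul a (gmul a a) + gmul b (gmul b b)) - 4^-1 *: gmul (a + b) (gmul (a - b) (a - b)).
Proof.
apply/funext => i; apply/funext => j.
transitivity (2^-1 * (a i j * (a i j * a i j) + b i j * (b i j * b i j)) -
  4^-1 * ((a i j + b i j) * ((a i j - b i j) * (a i j - b i j)))); last by [].
by rewrite /gchi; field.
Qed.

Section Cube.
Variable p : nat -> I -> R.
Hypothesis Hp : forall k x y, (\sum_(i <- box cutoff) c 0%N i (time_at k) * bas L i.1 i.2 x y) ^+ 3 =
  \sum_(i <- S) p k i * bas L i.1 i.2 x y.

Lemma proj0_cube k : gmul (proj0 k) (gmul (proj0 k) (proj0 k)) = tp (p k).
Proof.
apply/funext => i; apply/funext => j; rewrite /gmul proj0E.
by rewrite -expr2 -exprS Hp.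
Qed.

Definition tau_coef (k : nat) (i : I) : R :=
  beta / s * (trunc_mode 1 k.+1 i - trunc_mode 1 k i) + 2^-1 * (trunc_mode 1 k.+1 i + trunc_mode 1 k i) +
  lamh L N i * (2^-1 * (p k.+1 i + p k i) + alpha / 2 * (trunc_mode 0 k.+1 i + trunc_mode 0 k i) -
    lamh L N i * (3 * trunc_mode 0 k i - trunc_mode 0 k.-1 i) +
    2^-1 * (lamh L N i * (lamh L N i * (trunc_mode 0 k.+1 i + trunc_mode 0 k i)))).

Lemma trunc_tauE k : trunc_tau k = tp (tau_coef k) - A (chi_defect k).
Proof.
have AD := gA_D N h; have AZ := gA_Z N h.
rewrite /trunc_tau gchi_split !proj0_cube -/(chi_defect k).
have -> : 2^-1 *: (tp (p k.+1) + tp (p k)) - chi_defect k + (alpha / 2) *: (proj0 k.+1 + proj0 k) -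
     A (3 *: proj0 k - proj0 k.-1) + 2^-1 *: A (A (proj0 k.+1 + proj0 k)) =
   2^-1 *: (tp (p k.+1) + tp (p k)) + (alpha / 2) *: (proj0 k.+1 + proj0 k) -
     A (3 *: proj0 k - proj0 k.-1) + 2^-1 *: A (A (proj0 k.+1 + proj0 k)) - chi_defect k.
  by apply/funext => i; apply/funext => j; rewrite !gridE; ring.
rewrite (AD _ (- chi_defect k)) (AN AZ (chi_defect k)) addrA; congr (_ - _).
rewrite /proj0 /proj1; rewrite !(tpolyE, gA_tpoly L0 N0); apply: eq_tpoly => i _.
by rewrite /tau_coef.
Qed.

Local Notation E0 := (3 * (7 * M + 4) ^+ 2 * (M / cutoff.+1%:R ^+ 6)).
Local Notation P k i := (2^-1 * (p k.+1 i + p k i)).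
Local Notation Q k i := (2^-1 * (q i (time_at k.+1) + q i (time_at k))).

Definition coef_const : R := kap ^+ 8 * (alpha ^+ 2 + 25).

(** Inside the cutoff the mean of the mode equations at both ends of the step is subtracted.
    Outside, only the nonlinear part remains, and [lam_out] supplies the factor h^4. *)
Lemma tau_coef_le k i : (k < n)%N -> tau_coef k i ^+ 2 <=
  7 * (beta ^+ 2 * s ^+ 3 * (W i (time_at k.+1) - W i (time_at k)) + (lamh L N i * (P k i - Q k i)) ^+ 2 +
   9 * h ^+ 4 * (lm i ^+ 2 * Q k i) ^+ 2 +
   h ^+ 4 * coef_const * (w i ^+ 8 * c 0%N i (time_at k.+1) ^+ 2 + w i ^+ 8 * c 0%N i (time_at k) ^+ 2) +
   2 * kap ^+ 8 * s ^+ 3 * (w i ^+ 6 * (V i (time_at k.+1) - V i (time_at k.-1)))).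
Proof.
move=> kn; have [l0 l8 ll lhh] := lamh_bounds L0 N0 i; have h0 := h_gt0 L0 N0.
have tkT := step_in kn; have t0 := time_at_ge0 k.
have tin := time_at_in (ltnW kn); have tin' := time_at_in kn.
have tt : time_at k <= time_at k.+1 by apply: time_at_le.
have tp' : time_at k.-1 <= time_at k.+1 by apply: time_at_le; exact: leq_trans (leq_pred k) (leqnSn k).
have [_ t1T] := andP tin'; have k0 : 0 <= kap := le_trans ler01 kap_ge1.
have g1 : 0 <= beta ^+ 2 * s ^+ 3 * (W i (time_at k.+1) - W i (time_at k)).
  by rewrite mulr_ge0 ?subr_ge0 ?W_mono// mulr_ge0 ?sqr_ge0// exprn_ge0// ltW.
have g2 := sqr_ge0 (lamh L N i * (P k i - Q k i)); have g3 := sqr_ge0 (lm i ^+ 2 * Q k i).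
have h4 : 0 <= h ^+ 4 by rewrite exprn_ge0// ltW.
have Kc0 : 0 <= coef_const by rewrite /coef_const mulr_ge0 ?exprn_ge0// addr_ge0 ?sqr_ge0.
have g4 (t : R) : 0 <= w i ^+ 8 * c 0%N i t ^+ 2 by rewrite (mulr_ge0 (exprn_ge0 8 (wt_ge0 i)) (sqr_ge0 _)).
have dV : 0 <= V i (time_at k.+1) - V i (time_at k.-1) by rewrite subr_ge0 V_mono// time_at_ge0.
have g5 : 0 <= 2 * kap ^+ 8 * s ^+ 3 * (w i ^+ 6 * (V i (time_at k.+1) - V i (time_at k.-1))).
  exact: (mulr_ge0 (mulr_ge0 (mulr_ge0 (ler0n R 2) (exprn_ge0 8 k0)) (exprn_ge0 3 (ltW s0))) (mulr_ge0 (exprn_ge0 6 (wt_ge0 i)) dV)).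
have g6 : 0 <= 9 * h ^+ 4 * (lm i ^+ 2 * Q k i) ^+ 2 by rewrite mulr_ge0// mulr_ge0.
have g7 : 0 <= h ^+ 4 * coef_const * (w i ^+ 8 * c 0%N i (time_at k.+1) ^+ 2 + w i ^+ 8 * c 0%N i (time_at k) ^+ 2).
  by rewrite mulr_ge0// ?addr_ge0// mulr_ge0.
have [dc cV cW c10] := mode_hyps i.
have [iK|iK] := boolP (i \in box cutoff); last first.
  have -> : tau_coef k i = lamh L N i * (P k i - Q k i) + lamh L N i * Q k i.
    by rewrite /tau_coef /trunc_mode (negPf iK); ring.
  have lo := lam_out N0 mesh_le_cutoff iK.
  have r1 : (lamh L N i * Q k i) ^+ 2 <= 9 * h ^+ 4 * (lm i ^+ 2 * Q k i) ^+ 2.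
    have -> : 9 * h ^+ 4 * (lm i ^+ 2 * Q k i) ^+ 2 = (3 * h ^+ 2 * lm i * (lm i)) ^+ 2 * Q k i ^+ 2 by ring.
    rewrite exprMn ler_wpM2r ?sqr_ge0// lerXn2r ?nnegrE//.
      by rewrite mulr_ge0 ?lam_ge0// (le_trans ler01 lo).
    by apply: (le_trans ll); rewrite ler_peMl ?lam_ge0.
  exact: sqr_sum_aux.
set T1 := (c 1%N i (time_at k.+1) - c 1%N i (time_at k)) / s - (c 2%N i (time_at k.+1) + c 2%N i (time_at k)) / 2.
set C := (c 0%N i (time_at k.+1) + c 0%N i (time_at k)) / 2.
set d := (c 0%N i (time_at k.+1) - 2 * c 0%N i (time_at k) + c 0%N i (time_at k.-1)) / 2.
have p1 := fd_pde fd i tin; have p2 := fd_pde fd i tin'.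
have -> : tau_coef k i = beta * T1 - lm i * (Q k i + alpha * C - 2 * lm i * C + lm i ^+ 2 * C) +
    lamh L N i * (P k i + alpha * C - 2 * lamh L N i * (C - d) + lamh L N i ^+ 2 * C).
  have -> : lm i * (Q k i + alpha * C - 2 * lm i * C + lm i ^+ 2 * C) =
      - (2^-1 * (beta * c 2%N i (time_at k.+1) + c 1%N i (time_at k.+1)) + 2^-1 * (beta * c 2%N i (time_at k) + c 1%N i (time_at k))).
    by rewrite p1 p2 /C; field.
  by rewrite /tau_coef /trunc_mode iK /T1 /C /d; field; rewrite gt_eqF.
apply: (le_trans (tau_coef_bound alpha beta T1 (P k i) (Q k i) C d l0 ll lhh)); rewrite ler_wpM2l//.
have b1 : beta ^+ 2 * T1 ^+ 2 <= beta ^+ 2 * s ^+ 3 * (W i (time_at k.+1) - W i (time_at k)).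
  by rewrite -mulrA ler_wpM2l ?sqr_ge0// /T1 !time_at_succ; exact: (trap_c1 dc cW t0 s0 tkT).
have hh : (h ^+ 2) ^+ 2 = h ^+ 4 by rewrite -exprM.
have b3 : (h ^+ 2) ^+ 2 * (lm i ^+ 2 * Q k i) ^+ 2 <= 9 * h ^+ 4 * (lm i ^+ 2 * Q k i) ^+ 2.
  by rewrite hh ler_wpM2r// ler_peMl// ler1n.
have C2 : w i ^+ 8 * C ^+ 2 <= w i ^+ 8 * c 0%N i (time_at k.+1) ^+ 2 + w i ^+ 8 * c 0%N i (time_at k) ^+ 2.
  rewrite -mulrDr; apply: (ler_wpM2l (exprn_ge0 8 (wt_ge0 i))); rewrite /C mulrC.
  apply: (le_trans (sqr_half _ _)); rewrite ler_piMl ?addr_ge0 ?sqr_ge0//.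
  by rewrite invf_le1// ler1n.
have b4 : (h ^+ 2) ^+ 2 * (alpha ^+ 2 * (lm i ^+ 2 * C) ^+ 2 + 16 * (lm i ^+ 3 * C) ^+ 2 + 9 * (lm i ^+ 4 * C) ^+ 2) <=
    h ^+ 4 * coef_const * (w i ^+ 8 * c 0%N i (time_at k.+1) ^+ 2 + w i ^+ 8 * c 0%N i (time_at k) ^+ 2).
  rewrite hh -mulrA ler_wpM2l//; apply: (@le_trans _ _ (coef_const * (w i ^+ 8 * C ^+ 2))); last by rewrite ler_wpM2l.
  have u2 := lam_pow_le i C (isT : (2 <= 4)%N); have u3 := lam_pow_le i C (isT : (3 <= 4)%N).
  have u4 := lam_pow_le i C (isT : (4 <= 4)%N).
  have -> : coef_const * (w i ^+ 8 * C ^+ 2) = alpha ^+ 2 * (kap ^+ 8 * (w i ^+ 8 * C ^+ 2)) + 16 * (kap ^+ 8 * (w i ^+ 8 * C ^+ 2)) +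
    9 * (kap ^+ 8 * (w i ^+ 8 * C ^+ 2)) by rewrite /coef_const; ring.
  apply: lerD; [apply: lerD|]; apply: ler_wpM2l => //; exact: sqr_ge0.
have b5 : 4 * (lm i ^+ 2 * d) ^+ 2 <= 2 * kap ^+ 8 * s ^+ 3 * (w i ^+ 6 * (V i (time_at k.+1) - V i (time_at k.-1))).
  have d2 : 4 * d ^+ 2 <= 2 * s ^+ 3 * (V i (time_at k.+1) - V i (time_at k.-1)).
    have -> : 4 * d ^+ 2 = (c 0%N i (time_at k.+1) - 2 * c 0%N i (time_at k) + c 0%N i (time_at k.-1)) ^+ 2 by rewrite /d; field.
    rewrite time_at_succ; apply: (c0_second dc cV c10 t0 s0 tkT).
    case: (k) => [|k'] /=; first by left; rewrite /time_at mul0r.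
    by right; rewrite time_at_ge0 time_at_succ addrK.
  have lk : (lm i ^+ 2) ^+ 2 <= kap ^+ 8 * w i ^+ 6.
    rewrite -exprM; apply: (@le_trans _ _ ((kap * w i) ^+ (2 * 2))).
      by rewrite lerXn2r ?nnegrE ?lam_ge0 ?mulr_ge0 ?wt_ge0// lam_le.
    by rewrite exprMn ler_pM ?exprn_ge0 ?wt_ge0// ?wt_expn_le// ler_weXn2l// kap_ge1.
  have -> : 4 * (lm i ^+ 2 * d) ^+ 2 = (lm i ^+ 2) ^+ 2 * (4 * d ^+ 2) by ring.
  have -> : 2 * kap ^+ 8 * s ^+ 3 * (w i ^+ 6 * (V i (time_at k.+1) - V i (time_at k.-1))) =
    kap ^+ 8 * w i ^+ 6 * (2 * s ^+ 3 * (V i (time_at k.+1) - V i (time_at k.-1))) by ring.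
  by apply: ler_pM => //; [exact: sqr_ge0|exact: (mulr_ge0 (ler0n R 4) (sqr_ge0 d))].
exact: (lerD (lerD (lerD (lerD b1 (lexx _)) b3) b4) b5).
Qed.

Lemma sum_tau_coef_le k : (k < n)%N -> \sum_(i <- S) tau_coef k i ^+ 2 <=
  7 * (beta ^+ 2 * s ^+ 3 * \sum_(i <- S) (W i (time_at k.+1) - W i (time_at k)) + 64 * h ^- 4 * E0 ^+ 2 +
   9 * h ^+ 4 * M + h ^+ 4 * coef_const * (2 * M) +
   2 * kap ^+ 8 * s ^+ 3 * \sum_(i <- S) (w i ^+ 6 * (V i (time_at k.+1) - V i (time_at k.-1)))).
Proof.
move=> kn; have tin := time_at_in (ltnW kn); have tin' := time_at_in kn; have h0 := h_gt0 L0 N0.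
have uS := box_uniq (3 * cutoff).
have a2 : \sum_(i <- S) (lamh L N i * (P k i - Q k i)) ^+ 2 <= 64 * h ^- 4 * E0 ^+ 2.
  have b1 := bessel_step tin (Hp k); have b2 := bessel_step tin' (Hp k.+1).
  apply: (@le_trans _ _ (\sum_(i <- S) 64 * h ^- 4 * (2^-1 * ((q i (time_at k.+1) - p k.+1 i) ^+ 2 + (q i (time_at k) - p k i) ^+ 2)))).
    apply: ler_sum => i _; have [l0 l8 _ _] := lamh_bounds L0 N0 i.
    rewrite exprMn; apply: ler_pM; rewrite ?sqr_ge0//.
      have -> : 64 * h ^- 4 = (8 * h ^- 2) ^+ 2 by field; rewrite !gt_eqF// ltr0n.
      by rewrite lerXn2r ?nnegrE// (le_trans l0 l8).
    apply: le_trans (sqr_half _ _); rewrite le_eqVlt; apply/orP; left; apply/eqP; ring.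
  have hV4 : 0 <= h ^- 4 by rewrite invr_ge0 exprn_ge0// ltW.
  rewrite -mulr_sumr; apply: ler_wpM2l; first exact: (mulr_ge0 (ler0n R 64) hV4).
  by rewrite -mulr_sumr big_split /=; exact: half_sum_le.
have a3 : \sum_(i <- S) 9 * h ^+ 4 * (lm i ^+ 2 * Q k i) ^+ 2 <= 9 * h ^+ 4 * M.
  rewrite -mulr_sumr; apply: ler_wpM2l; first exact: (mulr_ge0 (ler0n R 9) (exprn_ge0 4 (ltW h0))).
  apply: (@le_trans _ _ (\sum_(i <- S) 2^-1 * ((lm i ^+ 2 * q i (time_at k.+1)) ^+ 2 + (lm i ^+ 2 * q i (time_at k)) ^+ 2))).
    by apply: ler_sum => i _; apply: le_trans (sqr_half _ _); rewrite mulrCA mulrDr.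
  rewrite -mulr_sumr big_split /=; apply: half_sum_le; exact: (fd_q fd uS).
have a4 : \sum_(i <- S) h ^+ 4 * coef_const * (w i ^+ 8 * c 0%N i (time_at k.+1) ^+ 2 + w i ^+ 8 * c 0%N i (time_at k) ^+ 2) <= h ^+ 4 * coef_const * (2 * M).
  have k0 : 0 <= kap := le_trans ler01 kap_ge1.
  have Kc0 : 0 <= h ^+ 4 * coef_const by exact: (mulr_ge0 (exprn_ge0 4 (ltW h0)) (mulr_ge0 (exprn_ge0 8 k0) (addr_ge0 (sqr_ge0 alpha) (ler0n R 25)))).
  rewrite -mulr_sumr ler_wpM2l// big_split /= (_ : 2 * M = M + M); last by ring.
  by apply: lerD; exact: (fd_c0 fd uS).
apply: le_trans; first by apply: ler_sum => i _; exact: (tau_coef_le i kn).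
rewrite -mulr_sumr ler_wpM2l// 4!big_split /=.
by apply: lerD; [apply: lerD; [apply: lerD; [apply: lerD|]|]|]; rewrite // -mulr_sumr.
Qed.

Definition bessel_const : R := 3 * (7 * M + 4) ^+ 2 * M * (6 / L) ^+ 6.

Lemma inv_cutoff_le : cutoff.+1%:R ^- 6 <= (6 / L * h) ^+ 6.
Proof.
have h0 := h_gt0 L0 N0; have n0 : 0 < N%:R :> R by rewrite ltr0n.
have k0 : 0 < cutoff.+1%:R :> R by rewrite ltr0n.
rewrite -exprVn lerXn2r ?nnegrE ?invr_ge0 ?(ltW k0)//.
  by rewrite mulr_ge0 ?(ltW h0)// divr_ge0// ltW.
have -> : 6 / L * h = 6 / N%:R by field; rewrite !gt_eqF.
rewrite ler_pdivlMr// mulrC ler_pdivrMr// -natrM ler_nat.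
exact: mesh_le_cutoff.
Qed.

(** The squared symbol of the discrete Laplacian costs h^(-4), while the cubes differ by order h^6:
    h^8 is left, of which h^4 is traded for L^4. *)
Lemma cube_error_le : h ^- 4 * E0 ^+ 2 <= bessel_const ^+ 2 * L ^+ 4 * h ^+ 4.
Proof.
have h0 := h_gt0 L0 N0; have n0 : 0 < N%:R :> R by rewrite ltr0n.
have n1 : 1 <= N%:R :> R by rewrite ler1n.
have hL : h <= L by rewrite ler_pdivrMr// ler_peMr// ltW.
have k0 : 0 < cutoff.+1%:R :> R by rewrite ltr0n.
have m0 : 0 <= 3 * (7 * M + 4) ^+ 2 * M := mulr_ge0 (mulr_ge0 (ler0n R 3) (sqr_ge0 _)) M0.
have kh := inv_cutoff_le.
have e0 : E0 <= bessel_const * h ^+ 6.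
  have -> : bessel_const * h ^+ 6 = 3 * (7 * M + 4) ^+ 2 * M * (6 / L * h) ^+ 6 by rewrite /bessel_const; ring.
  have -> : E0 = 3 * (7 * M + 4) ^+ 2 * M * cutoff.+1%:R ^- 6 by ring.
  by rewrite ler_wpM2l.
have E00 : 0 <= E0.
  have -> : E0 = 3 * (7 * M + 4) ^+ 2 * M * cutoff.+1%:R ^- 6 by ring.
  by apply: (mulr_ge0 m0); rewrite invr_ge0 exprn_ge0.
have hV4 : 0 <= h ^- 4 by rewrite invr_ge0 exprn_ge0// ltW.
apply: (@le_trans _ _ (h ^- 4 * (bessel_const * h ^+ 6) ^+ 2)).
  by rewrite ler_wpM2l// lerXn2r ?nnegrE// (le_trans E00).
have -> : h ^- 4 * (bessel_const * h ^+ 6) ^+ 2 = bessel_const ^+ 2 * h ^+ 4 * h ^+ 4.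
  by field; rewrite !gt_eqF.
rewrite ler_wpM2r ?exprn_ge0 ?(ltW h0)// ler_wpM2l ?sqr_ge0//.
by rewrite lerXn2r ?nnegrE ?(ltW h0) ?(ltW L0).
Qed.

Definition proj_const : R := 2 * L ^+ 2 * kap ^+ 2 * M.

Lemma proj_const_ge0 : 0 <= proj_const.
Proof. exact: (mulr_ge0 (mulr_ge0 (mulr_ge0 (ler0n R 2) (sqr_ge0 L)) (sqr_ge0 kap)) M0). Qed.

Lemma P2_scale (x : R) : 0 <= x -> 0 <= 2 * L ^+ 2 * kap ^+ 2 * x.
Proof. by move=> x0; exact: (mulr_ge0 (mulr_ge0 (mulr_ge0 (ler0n R 2) (sqr_ge0 L)) (sqr_ge0 kap)) x0). Qed.

Lemma h2n_proj0 k : (k <= n)%N -> h2n N h (proj0 k) <= proj_const.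
Proof.
move=> kn; have tin := time_at_in kn; apply: (le_trans (h2n_tpoly _)).
have p0 : 0 <= 2 * L ^+ 2 * kap ^+ 2 by have := P2_scale ler01; rewrite mulr1.
rewrite ler_wpM2l//; apply: le_trans (fd_c0 fd (box_uniq (3 * cutoff)) tin).
apply: ler_sum => i _; rewrite /trunc_mode; case: ifP => _.
  by rewrite ler_wpM2r ?sqr_ge0// wt_expn_le.
by rewrite expr0n mulr0 (mulr_ge0 (exprn_ge0 8 (wt_ge0 i)) (sqr_ge0 _)).
Qed.

Lemma h2n_proj0_diff k : (k < n)%N -> h2n N h (proj0 k.+1 - proj0 k) <= proj_const * T * s ^+ 2.
Proof.
move=> kn; rewrite /proj0 !tpolyE; apply: (le_trans (h2n_tpoly _)).
have -> : proj_const * T * s ^+ 2 = 2 * L ^+ 2 * kap ^+ 2 * (s ^+ 2 * T * M) by rewrite /proj_const; ring.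
have p0 : 0 <= 2 * L ^+ 2 * kap ^+ 2 by have := P2_scale ler01; rewrite mulr1.
rewrite ler_wpM2l//.
have sT0 : 0 <= s ^+ 2 * T := mulr_ge0 (sqr_ge0 s) (ltW T0).
apply: le_trans (ler_wpM2l sT0 (fd_VT fd (box_uniq (3 * cutoff)))).
rewrite mulr_sumr; apply: ler_sum => i _; have [dc cV cW c10] := mode_hyps i.
have dV : 0 <= V i T - V i 0 by rewrite subr_ge0 V_mono// ltW.
have -> : s ^+ 2 * T * (w i ^+ 6 * (V i T - V i 0)) = w i ^+ 6 * (s ^+ 2 * (T * (V i T - V i 0))) by ring.
rewrite /trunc_mode; case: ifP => _.
  apply: ler_pM; [exact: (exprn_ge0 2 (wt_ge0 i))|exact: sqr_ge0|exact: wt_expn_le|].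
  by rewrite time_at_succ; exact: (c0_increment dc cV c10 (time_at_ge0 k) s0 (step_in kn)).
rewrite subr0 expr0n mulr0.
exact: (mulr_ge0 (exprn_ge0 6 (wt_ge0 i)) (mulr_ge0 (sqr_ge0 s) (mulr_ge0 (ltW T0) dV))).
Qed.

Definition alg_const : R := 229 * sobC L.

Lemma algC2E : algC2 N h = alg_const.
Proof. by rewrite /algC2 hN. Qed.

Lemma periodic_proj0 k : periodic_grid N (proj0 k).
Proof. exact: periodic_tpoly. Qed.

Lemma chi_defect_bound k : (k < n)%N -> dot (A (chi_defect k)) (A (chi_defect k)) <= alg_const ^+ 2 * proj_const * (proj_const * T) ^+ 2 * s ^+ 4.
Proof.
move=> kn; have h0 := h_gt0 L0 N0.
have Pd : periodic_grid N (proj0 k.+1 - proj0 k) := periodic_subg (periodic_proj0 _) (periodic_proj0 _).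
have Ps : periodic_grid N (proj0 k.+1 + proj0 k) := periodic_addg (periodic_proj0 _) (periodic_proj0 _).
have b1 := P2_mul_le N0 h0 Pd Pd (h2n_proj0_diff kn) (h2n_proj0_diff kn).
have b2 := P2D_le (h2n_proj0 kn) (h2n_proj0 (ltnW kn)).
have b3 := P2_mul_le N0 h0 Ps (periodic_mulg Pd Pd) b2 b1.
apply: (@le_trans _ _ (h2n N h (chi_defect k))); first by rewrite /h2n lerDr gdot_ge0.
rewrite /chi_defect P2Z; apply: (le_trans (ler_wpM2l (sqr_ge0 4^-1) b3)); rewrite algC2E.
have z : 0 <= alg_const ^+ 2 * proj_const * (proj_const * T) ^+ 2 * s ^+ 4.
  exact: (mulr_ge0 (mulr_ge0 (mulr_ge0 (sqr_ge0 alg_const) proj_const_ge0) (sqr_ge0 _)) (exprn_ge0 4 (ltW s0))).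
have -> : 4^-1 ^+ 2 * (alg_const * ((2 * proj_const + 2 * proj_const) * (alg_const * (proj_const * T * s ^+ 2 * (proj_const * T * s ^+ 2))))) =
  (alg_const ^+ 2 * proj_const * (proj_const * T) ^+ 2 * s ^+ 4) / 4 by field.
by rewrite ler_piMr// invf_le1// ler1n.
Qed.

(** The increments span two steps each, so they cover the time interval twice. *)
Lemma sum_V_le : \sum_(k < n) \sum_(i <- S) (w i ^+ 6 * (V i (time_at k.+1) - V i (time_at k.-1))) <= 2 * M.
Proof.
pose f i t := w i ^+ 6 * V i t.
have fm i r t : 0 <= r -> r <= t -> t <= T -> f i r <= f i t.
  by move=> a b d; rewrite /f; apply: ler_wpM2l; [exact: (exprn_ge0 6 (wt_ge0 i))|exact: V_mono].
have fT : \sum_(i <- S) (f i T - f i 0) <= M.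
  by apply: le_trans (fd_VT fd (box_uniq (3 * cutoff))); apply: ler_sum => i _; rewrite /f -mulrBr.
have e (k : nat) : \sum_(i <- S) (w i ^+ 6 * (V i (time_at k.+1) - V i (time_at k.-1))) =
    \sum_(i <- S) (f i (time_at k.+1) - f i (time_at k)) + \sum_(i <- S) (f i (time_at k) - f i (time_at k.-1)).
  by rewrite -big_split /=; apply: eq_bigr => i _; rewrite /f; ring.
under eq_bigr do rewrite e.
rewrite big_split /= (_ : 2 * M = M + M); last by ring.
apply: lerD; first exact: le_trans (sum_step_le (leqnn n) fm) fT.
apply: le_trans fT; rewrite exchange_big /=; apply: ler_sum => i _.
rewrite (telescope_le (fun k => f i (time_at k.-1))) /= /time_at mul0r lerD2r; apply: fm => //; first exact: time_at_ge0.
by have /andP[] := time_at_in (leq_pred n).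
Qed.

Definition tau_const : R := 14 * L ^+ 2 * (beta ^+ 2 * M + T * (64 * (bessel_const ^+ 2 * L ^+ 4) + 9 * M + coef_const * (2 * M)) +
   4 * kap ^+ 8 * M) + 2 * T * (alg_const ^+ 2 * proj_const * (proj_const * T) ^+ 2).

(** Terms without increments add up to T times their size; those with increments of W or V have s^3
    in front, s^4 after the factor s, and telescope. *)
Lemma tau_total : \sum_(k < n) s * dot (trunc_tau k) (trunc_tau k) <= tau_const * (s ^+ 4 + h ^+ 4).
Proof.
have h0 := h_gt0 L0 N0; have hn4 : 0 <= h ^+ 4 := exprn_ge0 4 (ltW h0).
have s4 : 0 <= s ^+ 4 := exprn_ge0 4 (ltW s0).
set Bh := 64 * (bessel_const ^+ 2 * L ^+ 4) + 9 * M + coef_const * (2 * M).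
set BG := alg_const ^+ 2 * proj_const * (proj_const * T) ^+ 2.
have Bh0 : 0 <= Bh.
  have kk := exprn_ge0 8 (le_trans ler01 kap_ge1).
  apply: addr_ge0; [apply: addr_ge0|].
  - exact: (mulr_ge0 (ler0n R 64) (mulr_ge0 (sqr_ge0 bessel_const) (exprn_ge0 4 (ltW L0)))).
  - exact: (mulr_ge0 (ler0n R 9) M0).
  - exact: (mulr_ge0 (mulr_ge0 kk (addr_ge0 (sqr_ge0 alpha) (ler0n R 25))) (mulr_ge0 (ler0n R 2) M0)).
have BG0 : 0 <= BG := mulr_ge0 (mulr_ge0 (sqr_ge0 alg_const) proj_const_ge0) (sqr_ge0 _).
pose om_ k := \sum_(i <- S) (W i (time_at k.+1) - W i (time_at k)).
pose nu_ k := \sum_(i <- S) (w i ^+ 6 * (V i (time_at k.+1) - V i (time_at k.-1))).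
have step (k : 'I_n) : s * dot (trunc_tau k) (trunc_tau k) <= 14 * L ^+ 2 * beta ^+ 2 * s ^+ 4 * om_ k +
    28 * L ^+ 2 * kap ^+ 8 * s ^+ 4 * nu_ k + s * (14 * L ^+ 2 * Bh * h ^+ 4 + 2 * BG * s ^+ 4).
  have kn := ltn_ord k; rewrite (trunc_tauE k).
  have d1 := dotB_le (gdotC N h) (gdotD N h) (gdotZ N h) (gdot_ge0 N h) (tp (tau_coef k)) (- A (chi_defect k)).
  have nn (y : int -> int -> R) : dot (- y) (- y) = dot y y.
    by rewrite (dotN (gdotZ N h)) (dotNr (gdotC N h) (gdotZ N h)) opprK.
  rewrite nn gdot_tpoly in d1.
  have d2 := ler_wpM2l (mulr_ge0 (ler0n R 2) (sqr_ge0 L)) (sum_tau_coef_le kn).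
  have d3 := ler_wpM2l (ler0n R 2) (chi_defect_bound kn).
  have d4 := ler_wpM2l (mulr_ge0 (mulr_ge0 (ler0n R 14) (sqr_ge0 L)) (ler0n R 64)) cube_error_le.
  apply: (@le_trans _ _ (s * (14 * L ^+ 2 * beta ^+ 2 * s ^+ 3 * om_ k + 28 * L ^+ 2 * kap ^+ 8 * s ^+ 3 * nu_ k +
     (14 * L ^+ 2 * Bh * h ^+ 4 + 2 * BG * s ^+ 4)))); last first.
    by rewrite le_eqVlt; apply/orP; left; apply/eqP; ring.
  rewrite ler_wpM2l ?(ltW s0)//; apply: (le_trans d1).
  rewrite (mulrA 2 (L ^+ 2)); apply: (le_trans (lerD d2 d3)); rewrite -/(om_ k) -/(nu_ k).
  have -> : 14 * L ^+ 2 * beta ^+ 2 * s ^+ 3 * om_ k + 28 * L ^+ 2 * kap ^+ 8 * s ^+ 3 * nu_ k +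
      (14 * L ^+ 2 * Bh * h ^+ 4 + 2 * BG * s ^+ 4) =
    14 * L ^+ 2 * beta ^+ 2 * s ^+ 3 * om_ k + 28 * L ^+ 2 * kap ^+ 8 * s ^+ 3 * nu_ k +
      14 * L ^+ 2 * Bh * h ^+ 4 + 2 * (alg_const ^+ 2 * proj_const * (proj_const * T) ^+ 2 * s ^+ 4) by rewrite /BG; ring.
  rewrite lerD2r.
  apply: (@le_trans _ _ (14 * L ^+ 2 * beta ^+ 2 * s ^+ 3 * om_ k + 28 * L ^+ 2 * kap ^+ 8 * s ^+ 3 * nu_ k +
    (14 * L ^+ 2 * 64 * (h ^- 4 * E0 ^+ 2) + 14 * L ^+ 2 * (9 * M + coef_const * (2 * M)) * h ^+ 4))).
    by rewrite le_eqVlt; apply/orP; left; apply/eqP; ring.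
  rewrite lerD2l; apply: (le_trans (lerD d4 (lexx _))).
  by rewrite le_eqVlt; apply/orP; left; apply/eqP; rewrite /Bh; ring.
apply: (le_trans (ler_sum _ (fun k _ => step k))).
rewrite 2!big_split /= -[X in X + _ + _]mulr_sumr -[X in _ + X + _]mulr_sumr.
have o1 : \sum_(k < n) om_ k <= M := le_trans (sum_step_le (leqnn n) W_mono) sum_W_le.
have o2 : \sum_(k < n) nu_ k <= 2 * M := sum_V_le.
have o3 : \sum_(k < n) s * (14 * L ^+ 2 * Bh * h ^+ 4 + 2 * BG * s ^+ 4) <= T * (14 * L ^+ 2 * Bh * h ^+ 4 + 2 * BG * s ^+ 4).
  rewrite sumr_const card_ord -[X in X <= _]mulr_natl mulrA; apply: ler_wpM2r; last exact: ns.
  apply: addr_ge0; first exact: (mulr_ge0 (mulr_ge0 (mulr_ge0 (ler0n R 14) (sqr_ge0 L)) Bh0) hn4).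
  exact: (mulr_ge0 (mulr_ge0 (ler0n R 2) BG0) s4).
have z1 : 0 <= 14 * L ^+ 2 * beta ^+ 2 * s ^+ 4 := mulr_ge0 (mulr_ge0 (mulr_ge0 (ler0n R 14) (sqr_ge0 L)) (sqr_ge0 beta)) s4.
have k8 := exprn_ge0 8 (le_trans ler01 kap_ge1).
have z2 : 0 <= 28 * L ^+ 2 * kap ^+ 8 * s ^+ 4 := mulr_ge0 (mulr_ge0 (mulr_ge0 (ler0n R 28) (sqr_ge0 L)) k8) s4.
apply: (le_trans (lerD (lerD (ler_wpM2l z1 o1) (ler_wpM2l z2 o2)) o3)).
have r1 : 0 <= 14 * L ^+ 2 * (beta ^+ 2 * M + 4 * kap ^+ 8 * M) * h ^+ 4.
  apply: mulr_ge0 hn4; apply: (mulr_ge0 (mulr_ge0 (ler0n R 14) (sqr_ge0 L))).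
  exact: (addr_ge0 (mulr_ge0 (sqr_ge0 beta) M0) (mulr_ge0 (mulr_ge0 (ler0n R 4) k8) M0)).
have r2 : 0 <= 14 * L ^+ 2 * (T * Bh) * s ^+ 4.
  exact: (mulr_ge0 (mulr_ge0 (mulr_ge0 (ler0n R 14) (sqr_ge0 L)) (mulr_ge0 (ltW T0) Bh0)) s4).
have r3 : 0 <= 2 * T * BG * h ^+ 4 := mulr_ge0 (mulr_ge0 (mulr_ge0 (ler0n R 2) (ltW T0)) BG0) hn4.
rewrite -subr_ge0.
have -> : tau_const * (s ^+ 4 + h ^+ 4) - (14 * L ^+ 2 * beta ^+ 2 * s ^+ 4 * M + 28 * L ^+ 2 * kap ^+ 8 * s ^+ 4 * (2 * M) +
    T * (14 * L ^+ 2 * Bh * h ^+ 4 + 2 * BG * s ^+ 4)) =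
  14 * L ^+ 2 * (beta ^+ 2 * M + 4 * kap ^+ 8 * M) * h ^+ 4 + 14 * L ^+ 2 * (T * Bh) * s ^+ 4 + 2 * T * BG * h ^+ 4.
  by rewrite /tau_const -/Bh -/BG; ring.
by rewrite !addr_ge0.
Qed.

End Cube.

End Range.

End Scheme.

End Consistency.

Lemma quad_le (R : realFieldType) (V : lmodType R) (dot : V -> V -> R) (A : V -> V) :
  (forall x y, dot x y = dot y x) ->
  (forall x y z, dot (x + y) z = dot x z + dot y z) ->
  (forall k x z, dot (k *: x) z = k * dot x z) ->
  (forall x y, A (x + y) = A x + A y) -> (forall k x, A (k *: x) = k *: A x) ->
  (forall x y, dot (A x) y = dot x (A y)) -> (forall x, 0 <= dot (A x) x) ->
  forall x y, dot (A (x + y)) (x + y) <= 2 * dot (A x) x + 2 * dot (A y) y.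
Proof.
move=> dotC dotD dotZ AD AZ A_sym A_ge0 x y; rewrite -subr_ge0.
have := A_ge0 (x - y).
rewrite !(linE AD AZ) !(dotE dotC dotD dotZ) (A_sym y x) (dotC y (A x)).
by congr (_ <= _); ring.
Qed.

(** * Convergence of the scheme *)

Section Convergence.
Variables (R : realType) (alpha beta L T M : R) (u : R -> R -> R -> R).
Variables (c : nat -> int * int -> R -> R) (q V W : int * int -> R -> R).
Hypotheses (alpha0 : 0 <= alpha) (beta0 : 0 < beta) (L0 : 0 < L) (T0 : 0 < T) (M0 : 0 <= M).
Hypothesis fd : fourier_data alpha beta L T M u c q V W.
Hypothesis pu : forall t : R, 0 <= t <= T -> periodic_fun L (slice u t).

Definition tailC : R := L ^+ 2 * (M * (6 / L) ^+ 6) ^+ 2.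
Definition tail_const : R := tailC * (L ^+ 8 + 64 * L ^+ 4 + 4096).

Lemma tailC_ge0 : 0 <= tailC.
Proof. exact: (mulr_ge0 (sqr_ge0 L) (sqr_ge0 _)). Qed.

Lemma tail_const_ge0 : 0 <= tail_const.
Proof.
apply: (mulr_ge0 tailC_ge0); apply: addr_ge0 (ler0n R 4096).
exact: (addr_ge0 (exprn_ge0 8 (ltW L0)) (mulr_ge0 (ler0n R 64) (exprn_ge0 4 (ltW L0)))).
Qed.

Definition initC : R := 2 * proj_const L M + 4 * (tail_const * L ^+ 4).
(** The value of [stabC] for initial size [initC], increased so as to dominate the truncated
    solution as well: [gchi_diff] takes one bound for all four arguments. *)
Definition boundC : R :=
  4 * (alg_const L * initC ^+ 2 + (alpha + 1) * initC + 4 * L ^+ 2) + proj_const L M.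
Definition lip_const : R := 80 * alg_const L ^+ 2 * boundC ^+ 2.

Lemma lip_const_ge0 : 0 <= lip_const.
Proof. exact: (mulr_ge0 (mulr_ge0 (ler0n R 80) (sqr_ge0 _)) (sqr_ge0 _)). Qed.

Definition trunc_const : R := L ^+ 2 * M * (1 + 2 * T) + 9 * L ^+ 2 * M + tau_const alpha beta L T M.
Definition errC : R := 2 * tail_const + 2 * (est_C beta T lip_const * ((alpha + 6) * tail_const + trunc_const)).

Section Mesh.
Variables (N : nat) (s : R) (n : nat).
Hypotheses (N0 : (0 < N)%N) (s0 : 0 < s) (ns : time_at s n <= T).
Local Notation h := (L / N%:R).
Local Notation A := (gA N h).
Local Notation dot := (gdot N h).
Local Notation P2 := (h2n N h).
Local Notation X := (proj0 L c N s).
Local Notation Z := (proj1 L c N s).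

Let h0 : 0 < h. Proof. exact: h_gt0. Qed.
Let hL : h <= L.
Proof. by rewrite ler_pdivrMr ?ltr0n// ler_peMr ?(ltW L0)// ler1n. Qed.
Let hn0 : h != 0. Proof. by rewrite gt_eqF. Qed.

(** What the truncation misses at the cell centers; the error of the scheme is [tail] plus [err]. *)
Definition tail (k : nat) : int -> int -> R := (sample h u (time_at s k) : int -> int -> R) - X k.

Lemma periodic_sample t : 0 <= t <= T -> periodic_grid N (sample h u t).
Proof.
move=> tT i j; rewrite /sample.
have [_ [_ ->]] := pt_shift L0 N0 i; have [_ [_ ->]] := pt_shift L0 N0 j.
by have [h1 h2] := pu tT (Defs.center h i) (Defs.center h j).
Qed.

Lemma periodic_tail k : (k <= n)%N -> periodic_grid N (tail k).
Proof.
by move=> kn; apply: periodic_subg; [exact: periodic_sample (time_at_in s0 ns kn)|exact: periodic_tpoly].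
Qed.

Lemma tail_sup k i j : (k <= n)%N -> tail k i j ^+ 2 <= (M * (6 / L) ^+ 6 * h ^+ 6) ^+ 2.
Proof.
move=> kn; apply: sqr_le_abs.
  apply: mulr_ge0 (exprn_ge0 6 (ltW h0)); apply: (mulr_ge0 M0).
  exact: (exprn_ge0 6 (divr_ge0 (ler0n R 6) (ltW L0))).
have := fd_tail fd (cutoff N) (Defs.center h i) (Defs.center h j) (time_at_in s0 ns kn).
rewrite -(proj0E c L0 T0 M0 N0 s0) => /le_trans; apply.
rewrite -mulrA -exprMn; apply: ler_wpM2l => //.
by exact: (inv_cutoff_le L0 T0 M0 N0 s0).
Qed.

Lemma tail0 k : (k <= n)%N -> dot (tail k) (tail k) <= tailC * h ^+ 12.
Proof.
move=> kn; have -> : tailC * h ^+ 12 = h ^+ 2 * gsum N (fun _ _ => (M * (6 / L) ^+ 6 * h ^+ 6) ^+ 2).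
  rewrite gsum_const /tailC -{1}(hN L0 N0); move: (M * _) => m; ring.
rewrite /gdot ler_wpM2l ?sqr_ge0//; apply: le_gsum => i j.
by rewrite -expr2 tail_sup.
Qed.

Lemma tail1 k : (k <= n)%N -> dot (A (tail k)) (A (tail k)) <= 64 * tailC * h ^+ 8.
Proof.
move=> kn; apply: (le_trans (gA_inverse hn0 (periodic_tail kn))).
have p : 0 <= 64 * h ^- 4 by rewrite mulr_ge0// invr_ge0 exprn_ge0// ltW.
apply: (le_trans (ler_wpM2l p (tail0 kn))); rewrite le_eqVlt; apply/orP; left; apply/eqP.
by field; rewrite !gt_eqF// ltr0n.
Qed.

Lemma tail2 k : (k <= n)%N -> dot (A (A (tail k))) (A (A (tail k))) <= 4096 * tailC * h ^+ 4.
Proof.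
move=> kn; apply: (le_trans (gA_inverse hn0 (periodic_gA N h _))).
have p : 0 <= 64 * h ^- 4 by rewrite mulr_ge0// invr_ge0 exprn_ge0// ltW.
apply: (le_trans (ler_wpM2l p (tail1 kn))); rewrite le_eqVlt; apply/orP; left; apply/eqP.
by field; rewrite !gt_eqF// ltr0n.
Qed.

(** The surplus powers of h left by the inverse inequality are bounded by powers of L, as h <= L. *)
Lemma tail_bounds k : (k <= n)%N -> [/\ dot (tail k) (tail k) <= tail_const * h ^+ 4,
  dot (A (tail k)) (A (tail k)) <= tail_const * h ^+ 4 &
  dot (A (A (tail k))) (A (A (tail k))) <= tail_const * h ^+ 4].
Proof.
move=> kn; have t0 := tailC_ge0; have h4 := exprn_ge0 4 (ltW h0).
have e8 : h ^+ 8 <= L ^+ 8 by rewrite lerXn2r ?nnegrE ?(ltW h0) ?(ltW L0).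
have e4 : h ^+ 4 <= L ^+ 4 by rewrite lerXn2r ?nnegrE ?(ltW h0) ?(ltW L0).
have a1 : 0 <= tailC * L ^+ 8 := mulr_ge0 t0 (exprn_ge0 8 (ltW L0)).
have a2 : 0 <= tailC * (64 * L ^+ 4) := mulr_ge0 t0 (mulr_ge0 (ler0n R 64) (exprn_ge0 4 (ltW L0))).
have a3 : 0 <= tailC * 4096 := mulr_ge0 t0 (ler0n R 4096).
have b1 := ler_wpM2l t0 e8; have b2 := ler_wpM2l t0 (ler_wpM2l (ler0n R 64) e4).
have eC : tail_const = tailC * L ^+ 8 + tailC * (64 * L ^+ 4) + tailC * 4096 by rewrite /tail_const; ring.
split.
- apply: (le_trans (tail0 kn)); have -> : tailC * h ^+ 12 = (tailC * h ^+ 8) * h ^+ 4 by ring.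
  by apply: (ler_wpM2r h4); rewrite eC; move: a2 a3 b1; lra.
- apply: (le_trans (tail1 kn)); have -> : 64 * tailC * h ^+ 8 = (tailC * (64 * h ^+ 4)) * h ^+ 4 by ring.
  by apply: (ler_wpM2r h4); rewrite eC; move: a1 a3 b2; lra.
- apply: (le_trans (tail2 kn)); rewrite (mulrC 4096).
  by apply: (ler_wpM2r h4); rewrite eC; move: a1 a2; lra.
Qed.

Section Scheme.
Variables phi psi : nat -> grid R.
Hypothesis sch : scheme_sequence alpha beta s h N (sample h u 0) phi psi.

Local Notation phi' := (phi : nat -> int -> int -> R).
Local Notation psi' := (psi : nat -> int -> int -> R).

Lemma periodic_phi k : periodic_grid N (phi k).
Proof. by have [_ _ Hp _] := sch; have [] := Hp k. Qed.

Lemma phi0_E : phi' 0%N = X 0%N + tail 0.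
Proof.
rewrite /tail addrC subrK; apply/funext => i; apply/funext => j.
by have [-> _ _ _] := sch; rewrite /time_at mul0r.
Qed.

Lemma phi_bound k : P2 (phi' k) <= boundC.
Proof.
have [t0 t1 _] := tail_bounds (leq0n n).
have h1 : P2 (phi' 0%N) <= initC.
  rewrite phi0_E; apply: (le_trans (P2D_le (h2n_proj0 L0 T0 M0 fd N0 s0 ns (leq0n n)) (lerD t0 t1))).
  have e4 : tail_const * h ^+ 4 <= tail_const * L ^+ 4 by rewrite ler_wpM2l ?tail_const_ge0// lerXn2r ?nnegrE ?(ltW h0) ?(ltW L0).
  by rewrite /initC; move: e4; lra.
have := scheme_stable N0 h0 alpha0 beta0 s0 sch h1 k.
rewrite /stabC (algC2E L0 N0) hN// => /le_trans; apply.
by rewrite /boundC lerDl proj_const_ge0.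
Qed.

Lemma proj0_bound k : (k <= n)%N -> P2 (X k) <= boundC.
Proof.
move=> kn; apply: (le_trans (h2n_proj0 L0 T0 M0 fd N0 s0 ns kn)); rewrite /boundC lerDr.
have c0 : 0 <= alg_const L := mulr_ge0 (ler0n R 229) (sobC_ge0 L).
have i0 : 0 <= initC.
  exact: (addr_ge0 (mulr_ge0 (ler0n R 2) (proj_const_ge0 L M0)) (mulr_ge0 (ler0n R 4) (mulr_ge0 tail_const_ge0 (exprn_ge0 4 (ltW L0))))).
apply: (mulr_ge0 (ler0n R 4)); apply: addr_ge0; last exact: (mulr_ge0 (ler0n R 4) (sqr_ge0 L)).
exact: (addr_ge0 (mulr_ge0 c0 (sqr_ge0 _)) (mulr_ge0 (addr_ge0 alpha0 ler01) i0)).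
Qed.

Definition err (k : nat) : int -> int -> R := X k - phi' k.
Definition errz (k : nat) : int -> int -> R := Z k - psi' k.
Definition errX (k : nat) : int -> int -> R := - A (gchi (X k.+1) (X k) - gchi (phi' k.+1) (phi' k)).

Lemma P2_err (y : int -> int -> R) : P2 y <= 5 * (dot y y + dot (A (A y)) (A y)).
Proof.
have Asym a b : dot (A a) b = dot a (A b) by exact: gA_sym.
have Ap a : 0 <= dot (A a) a by exact: gA_ge0.
have := interpolation (gdotC N h) (gdotD N h) (gdotZ N h) (gdot_ge0 N h) (gA_D N h) (gA_Z N h) Asym Ap y.
have := gdot_ge0 N h y; have := Ap (A y); rewrite /h2n.
move: (dot (A (A y)) _) (dot (A y) _) (dot y y) => a b d; lra.
Qed.

Lemma errX_bound k : (k < n)%N -> dot (errX k) (errX k) <= lip_const * (dot (err k.+1) (err k.+1) + dot (A (A (err k.+1))) (A (err k.+1)) +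
  dot (err k) (err k) + dot (A (A (err k))) (A (err k))).
Proof.
move=> kn; have pX j : periodic_grid N (X j) by exact: periodic_tpoly.
have := gchi_diff N0 h0 (pX k.+1) (pX k) (periodic_phi k.+1) (periodic_phi k) (proj0_bound kn) (proj0_bound (ltnW kn)) (phi_bound _) (phi_bound _).
rewrite (algC2E L0 N0) -/(err k.+1) -/(err k) => hG.
have -> : dot (errX k) (errX k) = dot (A (gchi (X k.+1) (X k) - gchi (phi' k.+1) (phi' k))) (A (gchi (X k.+1) (X k) - gchi (phi' k.+1) (phi' k))).
  by rewrite /errX (dotN (gdotZ N h)) (dotNr (gdotC N h) (gdotZ N h)) opprK.
apply: le_trans (_ : _ <= P2 (gchi (X k.+1) (X k) - gchi (phi' k.+1) (phi' k))) _; first by rewrite /h2n lerDr gdot_ge0.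
apply: (le_trans hG).
have p0 : 0 <= 16 * alg_const L ^+ 2 * boundC ^+ 2 := mulr_ge0 (mulr_ge0 (ler0n R 16) (sqr_ge0 _)) (sqr_ge0 _).
apply: (le_trans (ler_wpM2l p0 (lerD (P2_err (err k.+1)) (P2_err (err k))))).
by rewrite le_eqVlt; apply/orP; left; apply/eqP; rewrite /lip_const; ring.
Qed.

Lemma err_step k : err k.+1 - err k = s *: (2^-1 *: (errz k.+1 + errz k) + trunc_sigma L c N s k).
Proof.
have [_ _ _ Hst] := sch; have [mu pm st] := Hst k.
have e1 := scheme_phi st; have e2 := sig_eq L c N s0 k.
have -> : err k.+1 - err k = (X k.+1 - X k) - (phi' k.+1 - phi' k).
  by rewrite /err; apply/funext => i; apply/funext => j; rewrite !gridE; ring.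
by rewrite e2 e1 /errz; apply/funext => i; apply/funext => j; rewrite !gridE; field.
Qed.

(** [trunc_tau] is by definition what the truncated solution leaves in the scheme, so subtracting
    the scheme is linear algebra, except for the nonlinearity, which is collected in [errX]. *)
Lemma errz_step k : beta *: (errz k.+1 - errz k) = s *: errX k -
  s *: A ((alpha / 2) *: (err k.+1 + err k) - A (3 *: err k - err k.-1) + 2^-1 *: A (A (err k.+1 + err k))) -
  (s / 2) *: (errz k.+1 + errz k) + s *: trunc_tau alpha beta L c N s k.
Proof.
have [_ _ _ Hst] := sch; have [mu pm st] := Hst k.
have e1 := scheme_psi st pm; have e2 := scheme_mu st (periodic_phi _) (periodic_phi _) (periodic_phi _).
have AB a b : A (a - b) = A a - A b by rewrite gA_D (AN (gA_Z N h)).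
pose lin (y1 y y0 : int -> int -> R) := (alpha / 2) *: (y1 + y) - A (3 *: y - y0) + 2^-1 *: A (A (y1 + y)).
have linB : lin (err k.+1) (err k) (err k.-1) = lin (X k.+1) (X k) (X k.-1) - lin (phi' k.+1) (phi' k) (phi' k.-1).
  have E1 : err k.+1 + err k = (X k.+1 + X k) - (phi' k.+1 + phi' k).
    by rewrite /err; apply/funext => i; apply/funext => j; rewrite !gridE; ring.
  have E2 : 3 *: err k - err k.-1 = (3 *: X k - X k.-1) - (3 *: phi' k - phi' k.-1).
    by rewrite /err; apply/funext => i; apply/funext => j; rewrite !gridE; ring.
  rewrite /lin E1 E2 !AB; apply/funext => i; apply/funext => j; rewrite !gridE; ring.
have sp g (y1 y y0 : int -> int -> R) : g + (alpha / 2) *: (y1 + y) - A (3 *: y - y0) + 2^-1 *: A (A (y1 + y)) =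
    g + lin y1 y y0 by rewrite /lin !addrA.
have et : s *: trunc_tau alpha beta L c N s k = beta *: (Z k.+1 - Z k) + (s / 2) *: (Z k.+1 + Z k) +
    s *: (A (gchi (X k.+1) (X k)) + A (lin (X k.+1) (X k) (X k.-1))).
  rewrite /trunc_tau sp gA_D; apply/funext => i; apply/funext => j; rewrite !gridE.
  by field; rewrite gt_eqF.
have em : A mu = A (gchi (phi' k.+1) (phi' k)) + A (lin (phi' k.+1) (phi' k) (phi' k.-1)).
  by rewrite {1}e2 sp gA_D.
rewrite -/(lin (err k.+1) (err k) (err k.-1)) linB et /errX !AB.
have ez : beta *: (errz k.+1 - errz k) = beta *: (Z k.+1 - Z k) - beta *: (psi' k.+1 - psi' k).
  by rewrite /errz; apply/funext => i; apply/funext => j; rewrite !gridE; ring.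
by rewrite ez e1 em /errz; apply/funext => i; apply/funext => j; rewrite !gridE; field.
Qed.

(** The scheme starts from nodal values and not from the truncation, so the initial error is a tail
    rather than 0. *)
Lemma err0 : err 0 = - tail 0.
Proof. by rewrite /err phi0_E opprD addrA subrr add0r. Qed.

(** The truncated velocity starts at 0 like psi, by [fd_init]. *)
Lemma errz0 : errz 0 = 0.
Proof.
apply/funext => i; apply/funext => j; have [_ p0 _ _] := sch.
transitivity (Z 0%N i j - psi 0%N i j); first by [].
rewrite p0 subr0 /proj1 /tpoly big1// => p _.
by rewrite /trunc_mode /time_at mul0r (fd_init fd) if_same mul0r.
Qed.

Lemma gA0 : A 0 = 0.
Proof. by have := gA_Z N h 0 0; rewrite !scale0r. Qed.

Lemma err_energy0 : err_energy dot A alpha beta (err 0) 0 0 <= (alpha + 6) * tail_const * h ^+ 4.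
Proof.
have [t0 t1 t2] := tail_bounds (leq0n n).
have d0 : dot 0 0 = 0 by have := gdotZ N h 0 0 0; rewrite scale0r mul0r.
have AN' (y : int -> int -> R) : A (- y) = - A y by exact: AN (gA_Z N h) _.
have dN2 (y z : int -> int -> R) : dot (- y) (- z) = dot y z.
  by rewrite (dotN (gdotZ N h)) (dotNr (gdotC N h) (gdotZ N h)) opprK.
have e0 : dot (err 0) (err 0) = dot (tail 0) (tail 0) by rewrite err0 dN2.
have e1 : dot (A (err 0)) (err 0) = dot (A (tail 0)) (tail 0) by rewrite err0 (AN' (tail 0)) dN2.
have e2 : dot (A (err 0)) (A (err 0)) = dot (A (tail 0)) (A (tail 0)) by rewrite err0 (AN' (tail 0)) dN2.
have e3 : dot (A (A (err 0))) (A (err 0)) = dot (A (A (tail 0))) (A (tail 0)).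
  by rewrite err0 (AN' (tail 0)) (AN' (A (tail 0))) dN2.
rewrite /err_energy gA0 d0 e0 e1 e2 e3 mulr0 mul0r.
have g1 := dot_le (gdotC N h) (gdotD N h) (gdotZ N h) (gdot_ge0 N h) (A (tail 0)) (tail 0).
have g2 := dot_le (gdotC N h) (gdotD N h) (gdotZ N h) (gdot_ge0 N h) (A (A (tail 0))) (A (tail 0)).
have g3 := gdot_ge0 N h (A (tail 0)).
have g4 := mulr_ge0 tail_const_ge0 (exprn_ge0 4 (ltW h0)).
rewrite -[X in _ <= X]mulrA; move: g1 g2 g3 g4 t0 t1 t2.
move: (tail_const * h ^+ 4) (dot (A (tail 0)) (tail 0)) (dot (A (A (tail 0))) (A (tail 0))) (dot (A (A (tail 0))) (A (A (tail 0)))) (dot (A (tail 0)) (A (tail 0))) (dot (tail 0) (tail 0)).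
move=> x a b d e f g1 g2 g3 g4 t0 t1 t2.
have ax : alpha / 2 * a <= alpha / 2 * x by rewrite ler_wpM2l ?divr_ge0//; lra.
have ax0 := mulr_ge0 alpha0 g4; move: ax; rewrite mulrDl (mulrAC alpha _ x); lra.
Qed.

Lemma err_bound k : s <= (8 * est_P beta lip_const)^-1 -> (k <= n)%N ->
  dot (err k) (err k) + dot (A (A (err k))) (A (err k)) <=
  est_C beta T lip_const * ((alpha + 6) * tail_const + trunc_const) * (s ^+ 4 + h ^+ 4).
Proof.
move=> ss kn; have s4 := exprn_ge0 4 (ltW s0); have h4 := exprn_ge0 4 (ltW h0).
have Asym a b : dot (A a) b = dot a (A b) by exact: gA_sym.
have Ap a : 0 <= dot (A a) a by exact: gA_ge0.
pose p j := sval (cid (cube_box L (cutoff N) (fun i => c 0%N i (time_at s j)))).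
have Hp j : forall x y, (\sum_(i <- box (cutoff N)) c 0%N i (time_at s j) * bas L i.1 i.2 x y) ^+ 3 =
   \sum_(i <- box (3 * cutoff N)) p j i * bas L i.1 i.2 x y := svalP (cid (cube_box L (cutoff N) (fun i => c 0%N i (time_at s j)))).
have b1 := @sig_bound _ _ _ _ _ _ _ _ _ _ _ L0 T0 M0 fd _ _ N0 s0 _ ns.
have b2 := sig_diff_bound L0 T0 M0 fd N0 s0 ns.
have b3 := tau_total L0 T0 M0 fd N0 s0 ns Hp.
set D1 := L ^+ 2 * M * (1 + 2 * T) in b1; set D2 := 9 * L ^+ 2 * M in b2; set S := s ^+ 4 + h ^+ 4 in b3 *.
have S0 : 0 <= S := addr_ge0 s4 h4.
have sS : s ^+ 4 <= S by rewrite /S lerDl.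
have hS : h ^+ 4 <= S by rewrite /S lerDr.
have D10 : 0 <= D1.
  exact: (mulr_ge0 (mulr_ge0 (sqr_ge0 L) M0) (addr_ge0 ler01 (mulr_ge0 (ler0n R 2) (ltW T0)))).
have D20 : 0 <= D2 := mulr_ge0 (mulr_ge0 (ler0n R 9) (sqr_ge0 L)) M0.
have D30 : 0 <= tau_const alpha beta L T M * S.
  by apply: le_trans b3; apply: sumr_ge0 => j _; rewrite mulr_ge0 ?(ltW s0) ?gdot_ge0.
have eD : trunc_const * S = D1 * S + D2 * S + tau_const alpha beta L T M * S by rewrite /trunc_const -/D1 -/D2; ring.
have D1S := mulr_ge0 D10 S0; have D2S := mulr_ge0 D20 S0.
have D1s := ler_wpM2l D10 sS; have D2s := ler_wpM2l D20 sS.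
have DS0 : 0 <= trunc_const * S by rewrite eD !addr_ge0.
have := error_estimate (gdotC N h) (gdotD N h) (gdotZ N h) (gdot_ge0 N h) (gA_D N h) (gA_Z N h) Asym Ap
  alpha0 beta0 (ltW T0) (n := n) (x := err) (z := errz) (sig := trunc_sigma L c N s) (tau := trunc_tau alpha beta L c N s) (X := errX)
  lip_const_ge0 s0 ss ns DS0 errz0 _ _ _ _ kn.
rewrite -mulrA (mulrDl _ trunc_const) => H.
apply: le_trans (H _ _ _ _) _.
- by move=> j jn; split; [exact: err_step|exact: errz_step|exact: errX_bound].
- move=> j jn; apply: (le_trans (b1 j jn)); rewrite eD; apply: (le_trans D1s).
  by rewrite -addrA lerDl addr_ge0.
- by apply: (le_trans b3); rewrite eD lerDr addr_ge0.
- apply: (le_trans b2); rewrite ler_wpM2l ?(ltW s0)// eD; apply: (le_trans D2s).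
  by rewrite -addrA (addrCA (D1 * S)) lerDl addr_ge0.
- apply: ler_wpM2l; first exact: est_C_ge0 beta0 (ltW T0) lip_const_ge0.
  rewrite lerD2r; apply: (le_trans err_energy0); apply: ler_wpM2l => //.
  exact: (mulr_ge0 (addr_ge0 alpha0 (ler0n R 6)) tail_const_ge0).
Qed.

Lemma total_bound k : s <= (8 * est_P beta lip_const)^-1 -> (k <= n)%N ->
  let e : grid R := fun i j => sample h u (time_at s k) i j - phi k i j in
  grid_norm N h e <= Num.sqrt errC * (s ^+ 2 + h ^+ 2) /\
  grid_gradnorm N h (glap h e) <= Num.sqrt errC * (s ^+ 2 + h ^+ 2).
Proof.
move=> ss kn e.
have Asym a b : dot (A a) b = dot a (A b) by exact: gA_sym.
have Ap a : 0 <= dot (A a) a by exact: gA_ge0.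
have h4 := exprn_ge0 4 (ltW h0); have s4 := exprn_ge0 4 (ltW s0).
have Ee : (e : int -> int -> R) = tail k + err k.
  by rewrite /tail /err; apply/funext => i; apply/funext => j; rewrite /e !gridE; ring.
have Pe : periodic_grid N e.
  by apply: (periodic_op (fun a b => a - b)); [exact: periodic_sample (time_at_in s0 ns kn)|exact: periodic_phi].
have [t0 t1 t2] := tail_bounds kn.
have eb := err_bound ss kn.
set B := est_C beta T lip_const * ((alpha + 6) * tail_const + trunc_const) in eb.
have eF : errC = 2 * tail_const + 2 * B by [].
have q0 := gdot_ge0 N h (err k); have q1 := Ap (A (err k)); have q2 := gdot_ge0 N h (tail k).
have CS : tail_const * h ^+ 4 <= tail_const * (s ^+ 4 + h ^+ 4) by rewrite ler_wpM2l ?tail_const_ge0// lerDr.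
have S4 : s ^+ 4 + h ^+ 4 <= (s ^+ 2 + h ^+ 2) ^+ 2.
  have -> : (s ^+ 2 + h ^+ 2) ^+ 2 = s ^+ 4 + h ^+ 4 + 2 * (s ^+ 2 * h ^+ 2) by ring.
  by rewrite lerDl (mulr_ge0 (ler0n R 2) (mulr_ge0 (sqr_ge0 s) (sqr_ge0 h))).
have S2 : 0 <= s ^+ 2 + h ^+ 2 := addr_ge0 (sqr_ge0 s) (sqr_ge0 h).
have B0 : 0 <= B.
  have SS : 0 < s ^+ 4 + h ^+ 4 by rewrite ltr_pwDl// exprn_gt0.
  by rewrite -(pmulr_lge0 _ SS); apply: le_trans eb; exact: addr_ge0.
have F0 : 0 <= errC.
  by rewrite eF; exact: (addr_ge0 (mulr_ge0 (ler0n R 2) tail_const_ge0) (mulr_ge0 (ler0n R 2) B0)).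
have conclude y : y <= errC * (s ^+ 4 + h ^+ 4) -> Num.sqrt y <= Num.sqrt errC * (s ^+ 2 + h ^+ 2).
  move=> yF; have -> : Num.sqrt errC * (s ^+ 2 + h ^+ 2) = Num.sqrt (errC * (s ^+ 2 + h ^+ 2) ^+ 2).
    by rewrite sqrtrM// sqrtr_sqr ger0_norm.
  by apply: ler_wsqrtr; apply: (le_trans yF); rewrite ler_wpM2l.
have eFS : errC * (s ^+ 4 + h ^+ 4) = 2 * (tail_const * (s ^+ 4 + h ^+ 4)) + 2 * (B * (s ^+ 4 + h ^+ 4)) by rewrite eF; ring.
split.
  rewrite grid_normE; apply: conclude; rewrite Ee.
  apply: (le_trans (dotB_le (gdotC N h) (gdotD N h) (gdotZ N h) (gdot_ge0 N h) _ _)).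
  rewrite eFS; move: t0 CS eb q1.
  move: (dot _ _) (dot _ _) (dot _ _) (tail_const * _) (tail_const * _) (B * _) => *; lra.
rewrite (grid_gradnormE hn0 (periodic_glap h Pe)); apply: conclude.
(* The squared gradient norm of the discrete Laplacian of e is (A A e, A e), a quantity that
   [err_energy] controls. *)
have -> : dot (A (glap h e)) (glap h e) = dot (A (A e)) (A e).
  have -> : glap h e = - A e by rewrite (gA_Ng h Pe) opprK.
  by rewrite (AN (gA_Z N h)) (dotN (gdotZ N h)) (dotNr (gdotC N h) (gdotZ N h)) opprK.
rewrite Ee.
have m2 := dot_le (gdotC N h) (gdotD N h) (gdotZ N h) (gdot_ge0 N h) (A (A (tail k))) (A (tail k)).
have m3 : dot (A (A (tail k + err k))) (A (tail k + err k)) <=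
    2 * dot (A (A (tail k))) (A (tail k)) + 2 * dot (A (A (err k))) (A (err k)).
  rewrite (gA_D N h (tail k) (err k)).
  exact: (quad_le (gdotC N h) (gdotD N h) (gdotZ N h) (gA_D N h) (gA_Z N h) Asym Ap).
apply: (le_trans m3); rewrite eFS; move: t1 t2 CS eb q0 m2.
move: (dot (A (A (tail k))) (A (tail k))) (dot (A (A (tail k))) _) (dot (A (tail k)) _) (dot (A (A (err k))) _) (dot (err k) _) (tail_const * _) (tail_const * _) (B * _) => *; lra.
Qed.

End Scheme.
End Mesh.
End Convergence.

Theorem corollary3p6 (R : realType) (alpha beta L T : R)
    (Phi : R -> R -> R -> R) :
  0 < alpha -> 0 < beta -> 0 < L -> 0 < T ->
  mpfc_solution alpha beta L T Phi ->
  mpfc_regularity L T Phi ->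
  exists2 C : R, 0 < C & exists2 s0 : R, 0 < s0 &
  forall (N : nat) (s : R) (phi psi : nat -> grid R),
    let h := L / N%:R in
    (0 < N)%N -> ~~ odd N -> 0 < s <= s0 ->
    scheme_sequence alpha beta s h N (sample h Phi 0) phi psi ->
    forall k : nat, (1 <= k)%N -> k%:R * s <= T ->
      let e : grid R := fun i j => sample h Phi (k%:R * s) i j - phi k i j in
      grid_norm N h e + grid_gradnorm N h (glap h e) <= C * (s ^+ 2 + h ^+ 2).
Proof.
move=> a0 b0 L0 T0 sol reg.
have [M [c [q [V [W [M0 fd]]]]]] := fourier_data_exists L0 T0 sol reg.
have pu : forall t, 0 <= t <= T -> periodic_fun L (slice Phi t) by case: sol.
(* Each of the two norms contributes the root of [errC]; the added 1 makes the constant positive. *)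
exists (2 * Num.sqrt (errC alpha beta L T M) + 1).
  by rewrite ltr_wpDl// mulr_ge0// sqrtr_ge0.
(* The threshold of [error_estimate], which does not involve h. *)
exists (8 * est_P beta (lip_const alpha L M))^-1.
  by rewrite invr_gt0 mulr_gt0// est_P_gt0// lip_const_ge0.
move=> N s phi psi h N0 _ /andP[s0 ss] sch k _ kT; cbv zeta.
have [h1 h2] := total_bound (ltW a0) b0 L0 T0 M0 fd pu N0 s0 kT sch ss (leqnn k).
have S2 : 0 <= s ^+ 2 + h ^+ 2 by rewrite addr_ge0 ?sqr_ge0.
rewrite mulrDl mul1r (_ : 2 * Num.sqrt (errC alpha beta L T M) * (s ^+ 2 + h ^+ 2) =
  Num.sqrt (errC alpha beta L T M) * (s ^+ 2 + h ^+ 2) + Num.sqrt (errC alpha beta L T M) * (s ^+ 2 + h ^+ 2)); last by ring.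
by apply: (le_trans (lerD h1 h2)); rewrite lerDl.
Qed.
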